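(* Let $\varepsilon>0$ and $q\in\mathbb{N}$. Let $f\in\mathbb{Z}[x_1,x_2,x_3]$ be absolutely irreducible and let $g\in\mathbb{Z}[x_2,x_3]$ be non-constant, with top degree homogeneous part $g_0$, and assume $$\gcd(q,g(0,0),g_0(1,0),g_0(0,1))=1.$$ Let $B\ge 2$ and put $$K=B^{\frac{1}{\sqrt{m_1+m_2+m_3}}}\,q^{-\frac{m_1}{2(m_1+m_2+m_3)^{3/2}\deg g}},$$ where $\underline{m}=(m_1,m_2,m_3)$ is as in the context. Then there exist polynomials $f_1,\dots,f_J\in\mathbb{Z}[x_1,x_2,x_3]$ and a finite set of points $Z\subset V(f)$ such that: (1) $J=O_\varepsilon(\max\{1,KB^\varepsilon\})$; (2) each $f_j$ ($j\le J$) is coprime to $f$ and has degree $O_\varepsilon(1)$; (3) $\#Z=O_\varepsilon(\max\{1,KB^\varepsilon\}^2)$; (4) for each $\underline{x}\in S_q(f,g;B)\setminus Z$ there exists $j\le J$ with $f(x_1,x_2,x_3)=f_j(x_1,x_2,x_3)=0$. Here all implied constants depend only on $\varepsilon$ and on the degrees of $f$ and $g$.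
   Context: Fix a linear total order $\prec$ on $\mathbb{Z}_{\ge0}^3$, i.e. a strict total order such that $\underline{a}\prec\underline{b}$ and $\underline{c}\prec\underline{d}$ imply $\underline{a}+\underline{c}\prec\underline{b}+\underline{d}$. Let $\underline{m}=(m_1,m_2,m_3)$ be the maximum for $\prec$ among the exponent vectors of monomials $x_1^{m_1}x_2^{m_2}x_3^{m_3}$ appearing in $f$ with non-zero coefficient; it is assumed that $\underline{m}\neq\underline{0}$. Define $S_q(f,g;B)=\{\underline{x}\in\mathbb{Z}^3: |x_1|,|x_2|,|x_3|\le B,\ f(\underline{x})=0,\ g(\underline{x})\equiv 0\bmod q\}$. $V(f)$ denotes the zero set of $f$. *)

(* Defs.v *)
From mathcomp Require Import all_boot all_order all_algebra all_field finmap.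
From mathcomp Require Import mpoly reals exp.

Set Implicit Arguments.
Unset Strict Implicit.
Unset Printing Implicit Defensive.

Import Order.TTheory GRing.Theory Num.Theory.
Local Open Scope ring_scope.

Definition ring_dvd (A : unitRingType) (d p : A) : Prop :=
  exists c, p = d * c.

Definition ring_irreducible (A : unitRingType) (p : A) : Prop :=
  [/\ p != 0, p \isn't a GRing.unit
    & forall a b : A, p = a * b ->
        a \is a GRing.unit \/ b \is a GRing.unit].

Definition ring_coprime (A : unitRingType) (p r : A) : Prop :=
  forall d : A, ring_dvd d p -> ring_dvd d r -> d \is a GRing.unit.

(* [algC] is an algebraic closure of the rationals. *)
Definition absolutely_irreducible (n : nat) (p : {mpoly int[n]}) : Prop :=
  ring_irreducible (map_mpoly intr p : {mpoly algC[n]}).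

(* Total degree; the zero polynomial gets degree 0. *)
Definition tdeg (n : nat) (A : nzRingType) (p : {mpoly A[n]}) : nat :=
  (msize p).-1.

Definition top_part (n : nat) (A : nzRingType) (p : {mpoly A[n]}) :
    {mpoly A[n]} :=
  pihomog mdeg (tdeg p) p.

(* Compatibility with addition is required in both arguments at once, and
   nothing forces the zero exponent to be minimal. *)
Record linear_total_order (n : nat) (lt : rel 'X_{1..n}) : Prop :=
  LinearTotalOrder {
    lto_irr : irreflexive lt;
    lto_trans : transitive lt;
    lto_total : forall a b, a != b -> lt a b || lt b a;
    lto_add : forall a b c d,
      lt a b -> lt c d -> lt (a + c)%MM (b + d)%MM
  }.

Definition is_max_exponent (n : nat) (lt : rel 'X_{1..n})
    (f : {mpoly int[n]}) (m : 'X_{1..n}) : Prop :=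
  m \in msupp f /\ forall m', m' \in msupp f -> m' != m -> lt m' m.

(* The variables x_1, x_2, x_3 have indices 0, 1, 2 in ['I_3]. *)
Definition point3 : choiceType := {ffun 'I_3 -> int}.

(* The two variables of [g] are x_2 and x_3, the last two coordinates. *)
Definition eval23 (g : {mpoly int[2]}) (x : point3) : int :=
  g.@[fun i : 'I_2 => x (lift ord0 i)].

Definition eval2 (g : {mpoly int[2]}) (a b : int) : int :=
  g.@[tnth [tuple a; b]].

Definition gcd_condition (q : nat) (g : {mpoly int[2]}) : Prop :=
  gcdz (gcdz (gcdz q%:Z (eval2 g 0 0)) (eval2 (top_part g) 1 0))
       (eval2 (top_part g) 0 1) = 1.

Definition in_S (R : realType) (q : nat) (f : {mpoly int[3]})
    (g : {mpoly int[2]}) (B : R) (x : point3) : Prop :=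
  [/\ forall i, `|x i|%:~R <= B, f.@[x] = 0 & (q%:Z %| eval23 g x)%Z].

Definition Kbound (R : realType) (B : R) (q : nat) (m : 'X_{1..3}) (dg : nat)
    : R :=
  let s : R := (mdeg m)%:R in
  B `^ (1 / Num.sqrt s)
  * q%:R `^ (- ((m ord0)%:R / (2 * s `^ (3 / 2) * dg%:R))).

(* Main.v *)
(** A global p-adic determinant method.  Let [lam = sqrt (m_1 + m_2 + m_3)].  The order axioms force
    every nonzero combination of monomials that are not multiples of the maximal monomial [x^m] of [f]
    to be prime to [f].  Evaluate the monomials of this kind of degree at most [D] at zeros of [f]:
    either a nonzero combination vanishes at all the given points, or some evaluation determinant is
    nonzero.  It is bounded by a power of [B], while it is divisible by a large power

    - of [q], because powers of [g] can replace monomials among the columns;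
    - of [p0], when the points are congruent modulo [p0 ^ i], because there one coordinate is a power
      series in the two others;
    - of every other prime [p] up to [D], because the points lie in at most [(1 + o(1)) p^2] smooth
      residue classes.

    The last count is proved by cutting the surface with the lines through a fixed point of a coordinate
    plane and bounding the points of the resulting plane curves by Stepanov's method in the form of
    Stoehr and Voloch: a Wronskian with a Frobenius row vanishes to high order at the rational points.
    Altogether, the points in one class modulo [p0 ^ i] lie on a surface of degree [O(K B^e / p0^i)] not
    containing [V(f)].  Eliminating the main coordinate gives a plane curve for every class; letting [i]
    grow until the degree is bounded, the factors of bounded degree of the first curve give the [f_j],
    and every other point lies on two consecutive curves without common component through it, so that
    Bezout's theorem bounds the number of these points by [O((K B^e)^2)].  If [K] is smaller than a
    negative power of [B], the power of [q] alone makes the determinant vanish.  *)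
Require Import Defs.
From mathcomp Require Import all_boot all_order all_algebra all_field finmap.
From mathcomp Require Import mpoly reals exp.
From HB Require Import structures.
From mathcomp Require Import fingroup perm boolp polyXY zify ring lra.

Set Implicit Arguments.
Unset Strict Implicit.
Unset Printing Implicit Defensive.

Import Order.TTheory GRing.Theory Num.Theory.
Local Open Scope ring_scope.

(** * Factorial rings, elimination, norms *)

(** The root of [s = m_1 + m_2 + m_3] comes from an optimization: about [N = s D^2 / 2] monomials
    are admissible, of total degree about [s D^3 / 3]. Cutting the local expansions modulo [p] at
    order [r] yields the exponent [r N - p^2 r^3 / 6], which is largest at [r = lam D / p], with
    value [(lam D)^3 / (3 p)]. Divided by [(lam D)^3 / 3], the comparison reads [kappa ln q + i ln
    p0 + sum ln p / p <= ln B / lam + small]; the sum is about [ln D] by Mertens, so [D] is at most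
    about [K B^e / p0^i]. The class count needs the leading constant 1 up to an arbitrarily small
    relative error: the error multiplies [ln D], which can be of size [ln B], so a fixed loss would
    cost a power of [B]. Uniformity is the other obstacle. The exceptional primes depend on [f], so
    its height must be at most a power of [B]; if it is not, Cramer's rule puts all points on a
    second surface of no larger degree. Likewise [ln q] must be [O(ln B)]. Finally [p0] may not
    divide the derivative of [f] at the point, so it varies with the point, and every prime has its
    own tree of residue classes. *)

Definition ring_prime (A : idomainType) (p : A) : Prop :=
  [/\ p != 0, p \isn't a GRing.unit
    & forall a b : A, ring_dvd p (a * b) -> ring_dvd p a \/ ring_dvd p b].

(** Factors are required to be prime rather than irreducible, which makes uniqueness automatic. *)
Definition factorial_ring (A : idomainType) : Prop :=
  forall a : A, a != 0 -> exists (u : A) (s : seq A),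
    [/\ u \is a GRing.unit, forall p, p \in s -> ring_prime p
      & a = u * \prod_(p <- s) p].

Lemma ring_dvdB (A : idomainType) (d a b : A) :
  ring_dvd d a -> ring_dvd d b -> ring_dvd d (a - b).
Proof. by case=> c -> [e ->]; exists (c - e); rewrite mulrBr. Qed.

Lemma ring_dvdD (A : idomainType) (d a b : A) :
  ring_dvd d a -> ring_dvd d b -> ring_dvd d (a + b).
Proof. by case=> c -> [e ->]; exists (c + e); rewrite mulrDr. Qed.

Lemma ring_dvd_trans (A : idomainType) (a b c : A) :
  ring_dvd a b -> ring_dvd b c -> ring_dvd a c.
Proof. by case=> x -> [y ->]; exists (x * y); rewrite mulrA. Qed.

Lemma ring_dvd_unit (A : idomainType) (a u : A) :
  ring_dvd a u -> u \is a GRing.unit -> a \is a GRing.unit.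
Proof. by case=> c ->; rewrite unitrM => /andP[]. Qed.

Lemma prime_irreducible (A : idomainType) (p : A) :
  ring_prime p -> ring_irreducible p.
Proof.
case=> p0 pU pP; split=> // a b pab.
have [|[c ac]|[c bc]] := pP a b; first by exists 1; rewrite mulr1.
  right; have /(mulfI p0) : p * 1 = p * (c * b).
    by rewrite mulr1 mulrA -ac -pab.
  by move=> /esym e; apply: (@ring_dvd_unit _ _ 1); [exists c; rewrite mulrC | apply: unitr1].
left; have /(mulfI p0) : p * 1 = p * (c * a).
  by rewrite mulr1 mulrA -bc {1}pab mulrC.
by move=> /esym e; apply: (@ring_dvd_unit _ _ 1); [exists c; rewrite mulrC | apply: unitr1].
Qed.

Lemma ring_prime_prod (A : idomainType) (p : A) (s : seq A) :
  ring_prime p -> ring_dvd p (\prod_(x <- s) x) ->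
  exists2 x, x \in s & ring_dvd p x.
Proof.
move=> pp; case: (pp) => p0 pU pP; elim: s => [|x s IH].
  rewrite big_nil => h; case/negP: pU; apply: (ring_dvd_unit h); exact: unitr1.
rewrite big_cons => /pP[h|/IH[y ys h]]; first by exists x; rewrite ?mem_head.
by exists y; rewrite // inE ys orbT.
Qed.

Lemma factorial_irreducible_prime (A : idomainType) (p : A) :
  factorial_ring A -> ring_irreducible p -> ring_prime p.
Proof.
move=> fA [p0 pU pI]; have [u [s [uU sP pE]]] := fA p p0.
case: s sP pE => [|x s] sP pE.
  by case/negP: pU; rewrite pE big_nil mulr1.
have xP : ring_prime x by apply: sP; rewrite mem_head.
rewrite big_cons in pE.
have e : p = x * (u * \prod_(j <- s) j) by rewrite pE mulrCA.
case: (xP) => x0 xU xPr.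
have [xu|vU] := pI _ _ e; first by rewrite xu in xU.
split=> // a b /(ring_dvd_trans (_ : ring_dvd x p)) h.
have {h}[] : ring_dvd x a \/ ring_dvd x b.
- by apply: xPr; apply: h; exists (u * \prod_(j <- s) j).
- case=> c ->; left; exists (c / (u * \prod_(j <- s) j)).
  by rewrite e -mulrA [c / _]mulrC mulVKr.
case=> c ->; right; exists (c / (u * \prod_(j <- s) j)).
by rewrite e -mulrA [c / _]mulrC mulVKr.
Qed.

Lemma field_factorial (F : fieldType) : factorial_ring F.
Proof. by move=> a a0; exists a, [::]; rewrite big_nil mulr1 unitfE. Qed.

Lemma int_factorial : factorial_ring int.
Proof.
have primeZ (p : nat) : prime p -> ring_prime (p%:Z).
  move=> pp; split.
  - by rewrite eqz_nat -lt0n prime_gt0.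
  - by move: (prime_gt1 pp); case: (p) => [|[]].
  - move=> /= a b [c abE].
    have : (p %| `|(a * b)%R|)%N by rewrite abE abszM dvdn_mulr.
    rewrite abszM Euclid_dvdM // => /orP[] h; [left|right].
      have /dvdzP[q ->] : (p%:Z %| a)%Z by rewrite dvdzE.
      by exists q; rewrite mulrC.
    have /dvdzP[q ->] : (p%:Z %| b)%Z by rewrite dvdzE.
    by exists q; rewrite mulrC.
move=> a; have [n] := ubnP `|a|%N; elim: n a => // n IH a an a0.
have [a1|a1] := boolP (`|a|%N == 1)%N.
  exists a, [::]; rewrite big_nil mulr1; split=> //.
    by have [->|->] : a = 1 \/ a = -1 by move: a1; clear; lia.
have pp : prime (pdiv `|a|) by apply: pdiv_prime; move: a1 a0; clear; lia.
have /dvdzP[b bE] : ((pdiv `|a|)%:Z %| a)%Z by rewrite dvdzE pdiv_dvd.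
have b0 : b != 0 by apply: contraNneq a0 => b0; rewrite bE b0 mul0r.
have [|u [s [uU sP sE]]] := IH b _ b0.
  apply: leq_trans (_ : `|a| <= n)%N => //; rewrite [in X in (_ < X)%N]bE abszM absz_nat.
  by rewrite ltn_Pmulr ?prime_gt1 ?absz_gt0.
exists u, ((pdiv `|a|)%:Z :: s : seq int); split=> //.
  by move=> p; rewrite inE => /orP[/eqP->|/sP //]; apply: primeZ.
by rewrite big_cons mulrCA -sE mulrC.
Qed.

Section FactorialPoly.

Variable A : idomainType.
Implicit Types (p q f g : {poly A}) (c x : A).

Lemma size_sub_lead f : f != 0 ->
  (size (f - lead_coef f *: 'X^((size f).-1))%R < size f)%N.
Proof.
move=> f0; rewrite (polySpred f0) ltnS; apply/leq_sizeP => j hj.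
rewrite coefB coefZ coefXn; case: eqP => [->|ne].
  by rewrite mulr1 lead_coefE subrr.
rewrite mulr0 subr0 nth_default // (polySpred f0) ltn_neqAle hj andbT eq_sym.
exact/eqP.
Qed.

Lemma polyC_dvd_lead x f : ring_dvd x%:P f -> ring_dvd x (lead_coef f).
Proof. by case=> g ->; exists (lead_coef g); rewrite lead_coefM lead_coefC. Qed.

(** Gauss's lemma: [x] divides one of the two leading coefficients; removing that leading term
    lowers the total size, on which the induction runs. *)
Lemma polyC_prime x : ring_prime x -> ring_prime x%:P.
Proof.
case=> x0 xU xP; split.
- by rewrite polyC_eq0.
- by rewrite poly_unitE coefC eqxx negb_and xU orbT.
suff H n f g : (size f + size g < n)%N -> ring_dvd x%:P (f * g) ->
    ring_dvd x%:P f \/ ring_dvd x%:P g.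
  by move=> f g; apply: (H (size f + size g).+1).
elim: n f g => // n IH f g hn fg.
have [->|f0] := eqVneq f 0; first by left; exists 0; rewrite mulr0.
have [->|g0] := eqVneq g 0; first by right; exists 0; rewrite mulr0.
have lt f' m : ring_dvd x%:P (f - lead_coef f *: 'X^m) -> ring_dvd x (lead_coef f) ->
    f' = f -> ring_dvd x%:P f'.
  move=> h [c hc] ->; rewrite -[f](subrK (lead_coef f *: 'X^m)); apply: ring_dvdD => //.
  by exists (c *: 'X^m); rewrite hc -scalerA mul_polyC.
have cm h c m : ring_dvd x c -> ring_dvd x%:P ((c *: 'X^m) * h).
  by case=> e ->; exists (e *: 'X^m * h); rewrite -mul_polyC rmorphM /= -!mulrA -mul_polyC -!mulrA.
have := polyC_dvd_lead fg; rewrite lead_coefM => /xP[xf|xg].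
  have [||h|h] := IH (f - lead_coef f *: 'X^((size f).-1)) g.
  - by have := size_sub_lead f0; move: hn; clear; lia.
  - by rewrite mulrBl; apply: ring_dvdB => //; apply: cm.
  - by left; apply: lt h xf erefl.
  - by right.
have [||h|h] := IH f (g - lead_coef g *: 'X^((size g).-1)).
- by have := size_sub_lead g0; move: hn; clear; lia.
- by rewrite mulrBr; apply: ring_dvdB => //; rewrite mulrC; apply: cm.
- by left.
- right; rewrite -[g](subrK (lead_coef g *: 'X^((size g).-1))); apply: ring_dvdD => //.
  by rewrite -[_ *: _]mulr1; apply: cm.
Qed.

Hypothesis fA : factorial_ring A.

(** Each prime factor of [c] divides [p] or [q] by [polyC_prime] and is cancelled there, which does
    not change sizes. *)
Lemma factorial_clear c f p q : c != 0 -> c *: f = p * q ->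
  exists p' q', [/\ f = p' * q', size p' = size p & size q' = size q].
Proof.
move=> c0; have [u [s [uU sP cE]]] := fA c0; rewrite {}cE {c0}.
have u0 : u != 0 by apply: contraTneq uU => ->; rewrite unitr0.
move=> E; have {}E : \prod_(x <- s) x *: f = (u^-1 *: p) * q.
  by rewrite -scalerAl -E scalerA mulrA mulVr // mul1r.
rewrite -(size_scale p (_ : u^-1 != 0)) ?invr_eq0 //.
move: {p}(u^-1 *: p) E => p.
elim: s p q sP => [|x s IH] p q sP.
  by rewrite big_nil scale1r => ->; exists p, q.
rewrite big_cons => E.
have xP : ring_prime x by apply: sP; rewrite mem_head.
have sP' y : y \in s -> ring_prime y by move=> ys; apply: sP; rewrite inE ys orbT.
have [x0 _ _] := xP; have [_ _ xPr] := polyC_prime xP.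
have [|[p1 pE]|[q1 qE]] := xPr p q.
- by exists (\prod_(x <- s) x *: f); rewrite -E mul_polyC scalerA.
- have {}E : \prod_(x <- s) x *: f = p1 * q.
    have x0' : x%:P != 0 by rewrite polyC_eq0.
    by apply: (mulfI x0'); rewrite mul_polyC scalerA E pE mulrA.
  have [p' [q' [fE sp sq]]] := IH _ _ sP' E.
  by exists p', q'; split=> //; rewrite sp pE mul_polyC size_scale.
have {}E : \prod_(x <- s) x *: f = p * q1.
  have x0' : x%:P != 0 by rewrite polyC_eq0.
  by apply: (mulfI x0'); rewrite mul_polyC scalerA E qE mulrCA.
have [p' [q' [fE sp sq]]] := IH _ _ sP' E.
by exists p', q'; split=> //; rewrite sq qE mul_polyC size_scale.
Qed.

Lemma primitive_dvd_clear c f p : c != 0 ->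
  (forall x, ring_prime x -> ~ ring_dvd x%:P p) -> ring_dvd p (c *: f) -> ring_dvd p f.
Proof.
move=> c0 pP; have [u [s [uU sP cE]]] := fA c0; rewrite {}cE {c0}.
case=> q E; have {q E}[q] : ring_dvd p (\prod_(x <- s) x *: f).
  by exists (u^-1 *: q); rewrite -scalerAr -E scalerA mulrA mulVr // mul1r.
elim: s q sP => [|x s IH] q sP; first by rewrite big_nil scale1r => ->; exists q.
rewrite big_cons => E.
have xP : ring_prime x by apply: sP; rewrite mem_head.
have sP' y : y \in s -> ring_prime y by move=> ys; apply: sP; rewrite inE ys orbT.
have [x0 _ _] := xP; have [_ _ xPr] := polyC_prime xP.
have [|h|[q1 qE]] := xPr p q; last 1 first.
- apply: (IH q1) => //; have x0' : x%:P != 0 by rewrite polyC_eq0.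
  by apply: (mulfI x0'); rewrite mul_polyC scalerA E qE mulrCA.
- by exists (\prod_(x <- s) x *: f); rewrite -E mul_polyC scalerA.
by case: (pP _ xP h).
Qed.

(** In the non-constant case irreducibility makes [p] primitive, so divisibility up to a scalar is
    divisibility. If [p] is not coprime to [a], [factorial_clear] turns the gcd into a true factor
    of [p]; its cofactor is a unit, so the gcd has full size and [p] divides [a] up to a scalar. *)
Lemma poly_irreducible_prime p : ring_irreducible p -> ring_prime p.
Proof.
move=> pI; have [p0 pU pM] := pI.
have [sp|sp] := leqP (size p) 1.
  have pE := size1_polyC sp; rewrite pE; apply: polyC_prime.
  apply: factorial_irreducible_prime => //; split.
  - by rewrite -polyC_eq0 -pE.
  - by move: pU; rewrite pE poly_unitE size_polyC coefC eqxx /= -polyC_eq0 -pE p0.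
  - move=> a b ab; have := pM a%:P b%:P; rewrite -polyCM -ab -pE => /(_ erefl).
    by rewrite !poly_unitE !coefC /= => -[/andP[_ ?]|/andP[_ ?]]; [left|right].
have pprim x : ring_prime x -> ~ ring_dvd x%:P p.
  move=> [x0 xU _] [q qE]; have [] := pM _ _ qE.
    by rewrite poly_unitE coefC eqxx (negPf xU) andbF.
  rewrite poly_unitE => /andP[/eqP q1 _].
  by move: sp; rewrite qE mul_polyC size_scale // q1.
have pdvd f : p %| f -> ring_dvd p f.
  case/Pdiv.Idomain.dvdpP=> -[c q] /= c0 E; apply: (primitive_dvd_clear c0 pprim).
  by exists q; rewrite E mulrC.
split=> // a b [ab abE].
have dab : p %| a * b by rewrite abE dvdp_mulIl.
have [cp|ncp] := boolP (coprimep p a).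
  by right; apply: pdvd; rewrite -(Gauss_dvdpr _ cp).
left; apply: pdvd.
have /Pdiv.Idomain.dvdpP[[c q] /= c0 E] := dvdp_gcdl p a.
have [x [y [pE sx sy]]] := factorial_clear c0 E.
have g0 : gcdp p a != 0 by rewrite gcdp_eq0 (negPf p0).
have [xU|yU] := pM _ _ pE; last first.
  by move: yU ncp; rewrite poly_unitE sy /coprimep => /andP[->].
have sz : size (gcdp p a) == size p.
  rewrite -sy {1}pE size_mul; last 2 first.
  - by apply: contraTneq xU => ->; rewrite unitr0.
  - by rewrite -size_poly_eq0 sy size_poly_eq0.
  by move: xU; rewrite poly_unitE => /andP[/eqP->].
move: sz; rewrite (dvdp_size_eqp (dvdp_gcdl p a)) => /eqp_dvdl <-.
exact: dvdp_gcdr.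
Qed.

(** Induction on the size and, inside it, on the number of primes in the leading coefficient: a
    constant prime divisor of [f] uses up one of them, and in the absence of such divisors a proper
    factorization has two factors of smaller size. *)
Lemma poly_factorial : factorial_ring {poly A}.
Proof.
pose P f := exists (u : {poly A}) (s : seq {poly A}),
    [/\ u \is a GRing.unit, forall p, p \in s -> ring_prime p
      & f = u * \prod_(p <- s) p].
have PM f g : P f -> P g -> P (f * g).
  move=> [u [s [uU sP ->]]] [v [r [vU rP ->]]].
  exists (u * v), (s ++ r); split; first by rewrite unitrM uU.
    by move=> p; rewrite mem_cat => /orP[/sP|/rP].
  by rewrite big_cat /= mulrACA.
have Ppr p : ring_prime p -> P p.
  move=> pp; exists 1, [:: p]; rewrite unitr1 big_seq1 mul1r; split=> //.
  by move=> q; rewrite inE => /eqP->.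
have PC c : c != 0 -> P c%:P.
  move=> c0; have [u [s [uU sP ->]]] := fA c0.
  exists u%:P, [seq x%:P | x <- s]; split.
  - by rewrite rmorph_unit.
  - by move=> p /mapP[x xs ->]; apply/polyC_prime/sP.
  by rewrite rmorphM /= rmorph_prod big_map.
suff H n f : (size f < n)%N -> f != 0 -> P f by move=> f; apply: H.
elim: n f => // n IHn f fn f0.
have lf0 : lead_coef f != 0 by rewrite lead_coef_eq0.
have [u [s [uU sP]]] := fA lf0.
have [m] := ubnP (size s); elim: m s u f fn f0 {lf0} uU sP => // m IHm s u f fn f0 uU sP sm lE.
have [sf|sf] := leqP (size f) 1.
  by rewrite (size1_polyC sf); apply: PC; rewrite -polyC_eq0 -size1_polyC.
have [[x [xP [g gE]]]|npr] := EM (exists x, ring_prime x /\ ring_dvd x%:P f).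
  have [x0 _ _] := xP.
  have g0 : g != 0 by apply: contraNneq f0 => g0; rewrite gE g0 mulr0.
  have sg : size g = size f by rewrite gE mul_polyC size_scale.
  have [|y ys [v yE]] := @ring_prime_prod _ x s xP.
    have : ring_dvd x (u * \prod_(x0 <- s) x0).
      by rewrite -lE gE lead_coefM lead_coefC; exists (lead_coef g).
    case=> c E; exists (u^-1 * c); rewrite mulrCA -E mulrA mulVr ?mul1r //.
  have vU : v \is a GRing.unit.
    have [_ _ /(_ _ _ yE)[xU|//]] := prime_irreducible (sP _ ys).
    by case: xP => _; rewrite xU.
  rewrite gE; apply: PM; first by apply: PC.
  apply: (IHm (rem y s) (u * v)).
  - by rewrite sg.
  - by [].
  - by rewrite unitrM uU.
  - by move=> z /mem_rem /sP.
  - by rewrite size_rem // -ltnS (leq_trans _ sm) // prednK //; case: (s) ys.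
  - apply: (mulfI x0).
    have -> : x * lead_coef g = lead_coef f by rewrite gE lead_coefM lead_coefC.
    by rewrite lE (perm_big _ (perm_to_rem ys)) big_cons yE /=; ring.
have [fI|fI] := EM (ring_irreducible f); first exact/Ppr/poly_irreducible_prime.
have fU : f \isn't a GRing.unit by rewrite poly_unitE -(negbK (_ == 1)%N) neq_ltn sf orbT.
have [[a [b [fE aU bU]]]|nex] :=
    EM (exists a b, [/\ f = a * b, a \isn't a GRing.unit & b \isn't a GRing.unit]).
  have sz a' b' : f = a' * b' -> a' \isn't a GRing.unit -> (1 < size a')%N.
    move=> E aU'; rewrite ltnNge; apply/negP => sa.
    have aE := size1_polyC sa.
    have a0 : a'`_0 != 0.
      rewrite -polyC_eq0 -aE; apply: contraNneq f0 => a0; by rewrite E a0 mul0r.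
    have [v [[|x r] [vU rP aE']]] := fA a0.
      move: aU'; rewrite aE poly_unitE size_polyC a0 coefC eqxx /=.
      by rewrite aE' big_nil mulr1 vU.
    apply: npr; exists x; split; first by apply: rP; rewrite mem_head.
    rewrite E; exists ((v * \prod_(j <- r) j)%:P * b').
    rewrite mulrA -polyCM; congr (_ * _).
    by rewrite [LHS]aE aE' big_cons mulrCA.
  have sa := sz _ _ fE aU.
  have sb : (1 < size b)%N by apply: (sz b a) => //; rewrite mulrC.
  have a0 : a != 0 by rewrite -size_poly_eq0; case: (size a) sa.
  have b0 : b != 0 by rewrite -size_poly_eq0; case: (size b) sb.
  move: fn; rewrite fE size_mul // => fn.
  by apply: PM; apply: IHn => //; move: fn sa sb; clear; lia.
case: fI; split=> // a b fE.
have [?|aU] := boolP (a \is a GRing.unit); first by left.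
have [?|bU] := boolP (b \is a GRing.unit); first by right.
by case: nex; exists a, b.
Qed.

End FactorialPoly.

(** For nonzero [p], this is coprimality of [p] and [g] over the fraction field of [B], expressed
    without that field. *)
Definition no_syzygy (B : idomainType) (p g : {poly B}) : Prop :=
  forall w a : {poly B}, w * g = a * p -> (size w < size p)%N -> w = 0.

Lemma resultant_neq0 (B : idomainType) (p g : {poly B}) :
  p != 0 -> no_syzygy p g -> resultant p g != 0.
Proof.
move=> p0 syz; rewrite resultant_eq0 -leqNgt leqNgt; apply/negP => g1.
have /Pdiv.Idomain.dvdpP[[c p'] /= c0 pE] := dvdp_gcdl p g.
have /Pdiv.Idomain.dvdpP[[k g'] /= k0 gE] := dvdp_gcdr p g.
have d0 : gcdp p g != 0 by rewrite gcdp_eq0 (negPf p0).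
have p'0 : p' != 0.
  apply: contraNneq p0 => e; have : c *: p == 0 by rewrite pE e mul0r.
  by rewrite -mul_polyC mulf_eq0 polyC_eq0 (negPf c0).
have /eqP : k *: p' = 0.
  apply: (syz _ (c *: g')); first by rewrite -scalerAl scalerAr gE -scalerAl scalerAr pE mulrCA.
  rewrite size_scale // -(size_scale p c0) pE size_mul //.
  by move: g1; case: (size (gcdp p g)) => [|[]] // n _; rewrite !addnS /= ltnS leq_addr.
by rewrite -mul_polyC mulf_eq0 polyC_eq0 (negPf k0) (negPf p'0).
Qed.

(** The last clause records which element was taken, so that its degree and height can be bounded
    later. A constant [g] is separate because the resultant is known to lie in the ideal only when
    both degrees are positive. *)
Lemma elimination (B : idomainType) (p g : {poly B}) :
  (1 < size p)%N -> no_syzygy p g ->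
  exists r a b : _, [/\ r != 0, r%:P = a * p + b * g
    & r = resultant p g \/ r = g`_0].
Proof.
move=> p1 syz; have p0 : p != 0 by rewrite -size_poly_gt0 ltnW.
have [g1|g1] := ltnP 1 (size g).
  have [[a b] /= _ E] := resultant_in_ideal p1 g1.
  by exists (resultant p g), a, b; split; rewrite ?resultant_neq0 //; left.
have gE := size1_polyC g1.
exists g`_0, 0, 1; split; [|by rewrite mul0r add0r mul1r -gE|by right].
rewrite -polyC_eq0 -gE; apply/eqP => g0.
have : (1 : {poly B}) = 0 by apply: (syz 1 0); rewrite ?g0 ?mulr0 ?mul0r ?size_poly1.
by move/eqP; rewrite oner_eq0.
Qed.

(** Abstracts an upper bound for some degree, so that one determinant estimate serves for every
    variable of an iterated polynomial. *)
Definition filtration (B : comNzRingType) (P : nat -> B -> Prop) : Prop :=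
  [/\ P 0%N 1, forall k, P k 0, forall k a b, P k a -> P k b -> P k (a + b),
      forall k a, P k a -> P k (- a)
    & forall k l a b, P k a -> P l b -> P (k + l)%N (a * b)].

Section Filtration.
Variables (B : comNzRingType) (P : nat -> B -> Prop).
Hypothesis fP : filtration P.

Lemma filtration_sum k (I : Type) (s : seq I) (Q : pred I) (F : I -> B) :
  (forall i, Q i -> P k (F i)) -> P k (\sum_(i <- s | Q i) F i).
Proof. by case: fP => _ P0 PD _ _ h; apply: big_ind => //; apply: PD. Qed.

Lemma filtration_prod (I : Type) (s : seq I) (d : I -> nat) (F : I -> B) :
  (forall i, P (d i) (F i)) -> P (\sum_(i <- s) d i)%N (\prod_(i <- s) F i).
Proof.
case: fP => P1 _ _ _ PM h; elim: s => [|i s IH]; first by rewrite !big_nil.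
by rewrite !big_cons; apply: PM.
Qed.

Lemma filtration_det n (A : 'M[B]_n) (d : 'I_n -> nat) :
  (forall i j, P (d i) (A i j)) -> P (\sum_i d i)%N (\det A).
Proof.
case: (fP) => _ _ _ PN _ h; apply: filtration_sum => s _.
have hs : P (\sum_i d i)%N (\prod_i A i (s i)) by apply: filtration_prod.
by rewrite mulr_sign; case: ifP => _ //; apply: PN.
Qed.

Lemma filtration_resultant k l (p g : {poly B}) :
  (forall i, P k p`_i) -> (forall i, P l g`_i) ->
  P ((size g).-1 * k + (size p).-1 * l)%N (resultant p g).
Proof.
case: (fP) => _ P0 _ _ _ hp hg.
have -> : ((size g).-1 * k + (size p).-1 * l = \sum_(i < (size g).-1 + (size p).-1)
   (if split i is inl _ then k else l))%N.
  rewrite big_split_ord /=; congr (_ + _)%N.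
    rewrite -[X in (X * _)%N]card_ord -sum_nat_const; apply: eq_bigr => i _.
    by rewrite -[lshift _ i]/(unsplit (inl i)) unsplitK.
  rewrite -[X in (X * _)%N]card_ord -sum_nat_const; apply: eq_bigr => i _.
  by rewrite -[rshift _ i]/(unsplit (inr i)) unsplitK.
apply: filtration_det => i j; rewrite Sylvester_mxE.
by case: (split i) => u; case: (_ <= _)%N; rewrite ?mulr1n ?mulr0n.
Qed.

End Filtration.

Lemma size_filtration (C : comNzRingType) :
  filtration (fun k (p : {poly C}) => (size p <= k.+1)%N).
Proof.
split=> [|k|k a b ha hb|k a|k l a b ha hb]; rewrite ?size_poly1 ?size_poly0 ?size_polyN //.
  by rewrite (leq_trans (size_polyD _ _)) // geq_max ha.
rewrite (leq_trans (size_polyMleq _ _)) //; move: ha hb; clear; lia.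
Qed.

Lemma coef_filtration (C : comNzRingType) (P : nat -> C -> Prop) :
  filtration P -> filtration (fun k (p : {poly C}) => forall i, P k p`_i).
Proof.
move=> fP; case: (fP) => P1 P0 PD PN PM; split=> [i|k i|k a b ha hb i|k a ha i|k l a b ha hb i].
- by rewrite coef1; case: (i == 0)%N.
- by rewrite coef0.
- by rewrite coefD; apply: PD.
- by rewrite coefN; apply: PN.
- by rewrite coefM; apply: (filtration_sum fP) => j _; apply: PM.
Qed.

Definition ring_norm (B : comNzRingType) (N : B -> nat) : Prop :=
  [/\ N 0 = 0%N, (N 1%R <= 1)%N, forall a b, (N (a + b)%R <= N a + N b)%N,
      forall a, N (- a) = N a & forall a b, (N (a * b)%R <= N a * N b)%N].

Section Norm.
Variables (B : comNzRingType) (N : B -> nat).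
Hypothesis nN : ring_norm N.

Lemma norm_sum (I : Type) (s : seq I) (Q : pred I) (F : I -> B) :
  (N (\sum_(i <- s | Q i) F i)%R <= \sum_(i <- s | Q i) N (F i))%N.
Proof.
case: nN => N0 _ ND _ _; elim/big_ind2: _ => //; first by rewrite N0.
by move=> a m b l ha hb; apply: leq_trans (ND _ _) _; apply: leq_add.
Qed.

Lemma norm_prod (I : Type) (s : seq I) (F : I -> B) :
  (N (\prod_(i <- s) F i)%R <= \prod_(i <- s) N (F i))%N.
Proof.
case: nN => _ N1 _ _ NM; elim/big_ind2: _ => //.
by move=> a m b l ha hb; apply: leq_trans (NM _ _) _; apply: leq_mul.
Qed.

Lemma norm_exp a n : (N (a ^+ n)%R <= N a ^ n)%N.
Proof.
case: nN => _ N1 _ _ NM; elim: n => // n IH; rewrite exprS expnS.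
by apply: leq_trans (NM _ _) _; rewrite leq_mul2l IH orbT.
Qed.

Lemma norm_det n (A : 'M[B]_n) h :
  (forall i j, (N (A i j) <= h)%N) -> (N (\det A) <= n`! * h ^ n)%N.
Proof.
case: (nN) => _ _ _ NN _ hA; rewrite /determinant.
apply: leq_trans (norm_sum _ _ _) _.
apply: (@leq_trans (\sum_(s : 'S_n) h ^ n)%N); last by rewrite sum_nat_const card_Sn.
apply: leq_sum => s _; rewrite mulr_sign.
have H : (N (\prod_i A i (s i))%R <= h ^ n)%N.
  apply: leq_trans (norm_prod _ _) _; rewrite -[X in (_ <= _ ^ X)%N]card_ord -prod_nat_const.
  by apply: leq_prod => i _.
by case: ifP => _; rewrite ?NN.
Qed.

Lemma norm_natmul n : (N n%:R%R <= n)%N.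
Proof.
case: (nN) => N0 N1 ND _ _; elim: n => [|n IH]; first by rewrite N0.
by rewrite -addn1 natrD; apply: leq_trans (ND _ _) _; apply: leq_add.
Qed.

(** The sum of the coefficient sizes, unlike their maximum, is submultiplicative, so the
    construction can be iterated. *)
Definition poly_norm (p : {poly B}) : nat := (\sum_(i < size p) N p`_i)%N.

Lemma poly_norm_widen n (p : {poly B}) :
  (size p <= n)%N -> poly_norm p = (\sum_(i < n) N p`_i)%N.
Proof.
case: (nN) => N0 _ _ _ _ h; rewrite /poly_norm (big_ord_widen _ (fun i => N p`_i) h) big_mkcond /=.
by apply: eq_bigr => i _; case: ltnP => // /leq_sizeP ->.
Qed.

Lemma norm_coef (p : {poly B}) i : (N p`_i <= poly_norm p)%N.
Proof.
case: (nN) => N0 _ _ _ _; have [h|h] := ltnP i (size p).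
  by rewrite /poly_norm (bigD1 (Ordinal h)) //= leq_addr.
by rewrite nth_default // N0.
Qed.

Lemma poly_normP : ring_norm poly_norm.
Proof.
case: (nN) => N0 N1 ND NN NM.
have nD (a b : {poly B}) : (poly_norm (a + b)%R <= poly_norm a + poly_norm b)%N.
  set n := maxn (size a) (size b).
  rewrite (@poly_norm_widen n a) ?leq_maxl // (@poly_norm_widen n b) ?leq_maxr //.
  rewrite (@poly_norm_widen n) ?size_polyD // -big_split /=.
  by apply: leq_sum => i _; rewrite coefD.
split.
- by rewrite /poly_norm size_poly0 big_ord0.
- by rewrite /poly_norm size_poly1 big_ord_recl big_ord0 addn0 coef1.
- exact: nD.
- by move=> a; rewrite /poly_norm size_polyN; apply: eq_bigr => i _; rewrite coefN.
- have nX m (a : {poly B}) : (poly_norm ('X^m * a)%R <= poly_norm a)%N.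
    have sX : (size ('X^m * a)%R <= m + size a)%N.
      by rewrite (leq_trans (size_polyMleq _ _)) // size_polyXn.
    rewrite (poly_norm_widen sX) big_split_ord /= big1 ?add0n => [|i _].
      by apply: leq_sum => i _; rewrite coefXnM ltnNge leq_addr /= addKn.
    by rewrite coefXnM ltn_ord N0.
  have nZ c (a : {poly B}) : (poly_norm (c *: a)%R <= N c * poly_norm a)%N.
    rewrite (poly_norm_widen (size_scale_leq c a)) big_distrr /=.
    by apply: leq_sum => i _; rewrite coefZ.
  have nS n (F : 'I_n -> {poly B}) :
      (poly_norm (\sum_(i < n) F i)%R <= \sum_(i < n) poly_norm (F i))%N.
    elim/big_ind2: _ => //; first by rewrite /poly_norm size_poly0 big_ord0.
    by move=> a m b l ha hb; apply: leq_trans (nD _ _) _; apply: leq_add.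
  move=> a b; rewrite -{1}[a]coefK poly_def mulr_suml.
  apply: leq_trans (nS _ _) _; rewrite {2}/poly_norm big_distrl /=.
  apply: leq_sum => i _; rewrite -scalerAl; apply: leq_trans (nZ _ _) _.
  by rewrite leq_mul2l nX orbT.
Qed.

Lemma poly_normC c : poly_norm c%:P = N c.
Proof.
case: (nN) => N0 _ _ _ _; rewrite /poly_norm size_polyC.
by case: eqP => [->|_]; rewrite ?big_ord0 ?N0 // big_ord_recl big_ord0 addn0 coefC.
Qed.

Lemma poly_normX : (poly_norm 'X <= 1)%N.
Proof.
case: (nN) => N0 N1 _ _ _; rewrite /poly_norm size_polyX !big_ord_recl big_ord0 addn0 !coefX /=.
by rewrite N0.
Qed.

Lemma poly_norm_deriv (p : {poly B}) : (poly_norm p^`() <= size p * poly_norm p)%N.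
Proof.
case: (nN) => N0 N1 ND NN NM.
rewrite (@poly_norm_widen (size p)); last first.
  by rewrite (leq_trans (size_poly _ _)) // leq_pred.
rewrite big_distrr /=; case sp: (size p) => [|n]; first by rewrite !big_ord0.
rewrite [X in (X <= _)%N]big_ord_recr [X in (_ <= X)%N]big_ord_recl /=.
rewrite coef_deriv [p`_n.+1]nth_default ?sp // mul0rn N0 addn0.
apply: leq_trans (leq_addl _ _); apply: leq_sum => i _; rewrite coef_deriv -mulr_natl.
apply: leq_trans (NM _ _) _; apply: leq_mul => //.
by apply: leq_trans (norm_natmul _) _; rewrite ltnS ltnW.
Qed.

End Norm.

Lemma int_norm : ring_norm (fun z : int => `|z|%N).
Proof. by split=> [||a b|a|a b]; rewrite ?absz0 ?absz1 ?abszN ?abszM //; lia. Qed.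

(** * Derivations and Wronskians *)

Definition derivation (A : comNzRingType) (D : A -> A) : Prop :=
  (forall a b, D (a + b) = D a + D b) /\ (forall a b, D (a * b) = D a * b + a * D b).

Section Derivation.

Variables (A : comNzRingType) (D : A -> A).
Hypothesis hD : derivation D.

Lemma derD a b : D (a + b) = D a + D b. Proof. by case: hD. Qed.
Lemma derM a b : D (a * b) = D a * b + a * D b. Proof. by case: hD. Qed.
Lemma der0 : D 0 = 0.
Proof. by apply: (@addrI _ (D 0)); rewrite -derD !addr0. Qed.
Lemma derN a : D (- a) = - D a.
Proof. by apply/eqP; rewrite -addr_eq0 -derD addNr der0. Qed.
Lemma der1 : D 1 = 0.
Proof. by apply: (@addrI _ (D 1)); rewrite addr0 -[in RHS](mul1r 1) derM mul1r mulr1. Qed.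
Lemma der_sum (I : Type) (s : seq I) (P : pred I) (F : I -> A) :
  D (\sum_(i <- s | P i) F i) = \sum_(i <- s | P i) D (F i).
Proof. by apply: (big_morph D derD der0). Qed.
Lemma derMn a n : D (a *+ n) = D a *+ n.
Proof. by elim: n => [|n IH]; rewrite ?mulr0n ?der0 // !mulrS derD IH. Qed.
Lemma derX a n : D (a ^+ n.+1) = a ^+ n * D a *+ n.+1.
Proof.
elim: n => [|n IH]; first by rewrite !expr1 expr0 mul1r mulr1n.
by rewrite exprS derM IH mulrnAr mulrA -exprS [in RHS]mulrS mulrC.
Qed.
Lemma der_sign b a : D ((-1) ^+ b * a) = (-1) ^+ b * D a.
Proof. by rewrite -[(-1) ^+ b]signr_odd; case: (odd b); rewrite ?expr1 ?mulN1r ?derN // !expr0 !mul1r. Qed.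

Lemma iter_der0 n : iter n D 0 = 0.
Proof. by elim: n => //= n ->; rewrite der0. Qed.
Lemma iter_derD n a b : iter n D (a + b) = iter n D a + iter n D b.
Proof. by elim: n => //= n ->; rewrite derD. Qed.
Lemma iter_der_sum n (I : Type) (s : seq I) (P : pred I) (F : I -> A) :
  iter n D (\sum_(i <- s | P i) F i) = \sum_(i <- s | P i) iter n D (F i).
Proof. by apply: (big_morph _ (iter_derD n) (iter_der0 n)). Qed.

Lemma leibniz n a b :
  iter n D (a * b) = \sum_(i < n.+1) (iter i D a * iter (n - i) D b) *+ 'C(n, i).
Proof.
elim: n => [|n IH]; first by rewrite big_ord1 bin0 mulr1n.
rewrite iterS IH der_sum.
under eq_bigr => i _ do rewrite derMn derM mulrnDl -!iterS.
rewrite big_split /= big_ord_recr [X in _ + X]big_ord_recl /=.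
rewrite [RHS]big_ord_recl big_ord_recr /= !bin0 !binn !subnn !subn0.
have reorder (s1 l f s2 s : A) : s = s1 + s2 -> s1 + l + (f + s2) = f + (s + l).
  by move=> ->; ring.
apply: reorder.
rewrite -big_split /=; apply: eq_bigr => i _.
rewrite /bump /= !add1n subSS binS mulrnDr addrC; congr (_ + _ *+ _).
by rewrite -[D (iter (n - _) D b)]iterS -subSn // subSS.
Qed.

Lemma der_prod (I : finType) (F : I -> A) :
  D (\prod_i F i) = \sum_i \prod_j (if j == i then D (F j) else F j).
Proof.
have H (s : seq I) : uniq s -> D (\prod_(i <- s) F i) =
    \sum_(i <- s) \prod_(j <- s) (if j == i then D (F j) else F j).
  elim: s => [|i s IH] /=; first by rewrite !big_nil der1.
  move=> /andP[is_ us]; rewrite big_cons derM IH // [RHS]big_cons big_cons eqxx.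
  congr (_ * _ + _).
    by rewrite big_seq [RHS]big_seq; apply: eq_bigr => j js; case: eqP is_ => // <-; rewrite js.
  rewrite mulr_sumr big_seq [RHS]big_seq; apply: eq_bigr => j js.
  by rewrite big_cons; case: eqP is_ => // ->; rewrite js.
by rewrite H ?index_enum_uniq.
Qed.

Lemma der_det n (M : 'M[A]_n) :
  D (\det M) = \sum_i \det (\matrix_(k, j) (if k == i then D (M k j) else M k j)).
Proof.
rewrite /determinant der_sum exchange_big /=; apply: eq_bigr => s _.
rewrite der_sign der_prod mulr_sumr; apply: eq_bigr => i _; congr (_ * _).
by apply: eq_bigr => j _; rewrite mxE.
Qed.

End Derivation.

Section FrobeniusWronskian.

Variables (A : comNzRingType) (D : A -> A) (hD : derivation D).
Variables (M : nat) (u v : 'I_M.+1 -> A).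
Hypothesis Dv : forall b, D (v b) = 0.

(* With [v b = u b ^+ q] in characteristic [q], the top row of [frobenius_wronskian] agrees with the
   functions [u b] at F_q-points, which makes it vanish there to order [M]. *)
Definition rows_det (a : nat -> nat) : A :=
  \det (\matrix_(i < M.+1, b < M.+1) if i == 0 :> nat then v b else iter (a i.-1) D (u b)).

Definition wronskian : A := \det (\matrix_(i < M.+1, b < M.+1) iter i D (u b)).

Definition frobenius_wronskian : A := rows_det id.

Definition has_orders (j : nat) (a : nat -> nat) : Prop :=
  forall c, (c < j)%N -> exists2 l, (l < M)%N & a l = c.

(* Determinants in which all derivatives of order below [j] occur as rows. *)
Inductive rows_span (j : nat) : A -> Prop :=
| RowsSpan0 : rows_span j 0
| RowsSpanD a x : has_orders j a -> rows_span j x -> rows_span j (rows_det a + x).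

Lemma rows_spanD j x y : rows_span j x -> rows_span j y -> rows_span j (x + y).
Proof.
elim=> [|a z ha _ IH] hy; first by rewrite add0r.
by rewrite -addrA; apply: RowsSpanD => //; apply: IH.
Qed.

Lemma rows_span_sum j (I : Type) (s : seq I) (P : pred I) (F : I -> A) :
  (forall i, P i -> rows_span j (F i)) -> rows_span j (\sum_(i <- s | P i) F i).
Proof. by move=> h; apply: big_ind => //; [exact: RowsSpan0|exact: rows_spanD]. Qed.

Lemma rows_span1 j a : has_orders j a -> rows_span j (rows_det a).
Proof. by move=> h; rewrite -[rows_det a]addr0; apply: RowsSpanD => //; exact: RowsSpan0. Qed.

Lemma rows_det_eq0 a l k : (l < M)%N -> (k < M)%N -> l != k -> a l = a k -> rows_det a = 0.
Proof.
move=> lM kM lk alk.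
apply: (@determinant_alternate _ _ _ (inord l.+1) (inord k.+1)).
  by rewrite -val_eqE /= !inordK.
by move=> b; rewrite !mxE !inordK //= alk.
Qed.

Lemma rows_det_ext a a' : (forall l, (l < M)%N -> a l = a' l) -> rows_det a = rows_det a'.
Proof.
move=> h; congr (\det _); apply/matrixP => i b; rewrite !mxE; case: eqP => // i0.
by rewrite h //; move: (ltn_ord i) i0; lia.
Qed.

Definition succ_at (a : nat -> nat) (l : nat) : nat -> nat :=
  fun k => if k == l then (a k).+1 else a k.

Lemma der_rows_det a : D (rows_det a) = \sum_(l < M) rows_det (succ_at a l).
Proof.
rewrite /rows_det (der_det hD) big_ord_recl.
rewrite [X in X + _](_ : _ = 0) ?add0r; last first.
  rewrite (expand_det_row _ ord0) big1 // => b _.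
  by rewrite !mxE /= ?eqxx Dv mul0r.
apply: eq_bigr => l _; congr (\det _); apply/matrixP => i b; rewrite !mxE.
case: (unliftP ord0 i) => [k ->|->].
  rewrite (inj_eq lift_inj) /=.
  by rewrite /succ_at /= val_eqE; case: eqP.
by rewrite eq_liftF /=.
Qed.

Lemma der_rows_span j a : has_orders j.+1 a -> rows_span j (D (rows_det a)).
Proof.
move=> ha; rewrite der_rows_det; apply: rows_span_sum => l _.
have [alj|alj] := ltnP (a l) j.
  have [k kM kE] := ha (a l).+1 alj.
  rewrite (@rows_det_eq0 _ l k) //; first exact: RowsSpan0.
    by apply: contraTneq isT => E; move: kE; rewrite -E; lia.
  rewrite /succ_at eqxx; case: eqP => [E|_]; last by rewrite kE.
  by move: kE; rewrite E; lia.
apply: rows_span1 => c cj; have [k kM kE] := ha c (ltnW cj).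
exists k => //; rewrite /succ_at; case: eqP => // E; move: alj; rewrite -E kE; lia.
Qed.

Lemma der_rows_span_gen j x : rows_span j.+1 x -> rows_span j (D x).
Proof.
elim=> [|a y ha _ IH]; first by rewrite (der0 hD); exact: RowsSpan0.
by rewrite (derD hD); apply: rows_spanD => //; apply: der_rows_span.
Qed.

(** The rows of [bump j.+1] omit the order [j.+1]; differentiating the row of order [j] makes them
    omit [j] instead. Raising any other row creates two equal rows, except for the last row, whose
    change leaves all orders up to [j] in place. *)
Lemma der_rows_bump j : (j < M)%N -> exists2 x, rows_span j.+1 x &
  D (rows_det (bump j.+1)) = rows_det (bump j) + x.
Proof.
move=> jM; rewrite der_rows_det (bigD1 (Ordinal jM)) //=.
eexists; last congr (_ + _); last first.
- apply: rows_det_ext => l lM; rewrite /succ_at /bump.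
  by case: eqP => [->|ne]; move: lM; lia.
apply: rows_span_sum => l lj; have {}lj : (l : nat) <> j.
  by move=> E; move: lj; rewrite -val_eqE /= E eqxx.
have [ll|ll] := ltnP l j.
  rewrite (@rows_det_eq0 _ l l.+1) //; first exact: RowsSpan0.
  - exact: leq_trans jM.
  - lia.
  - by rewrite /succ_at eqxx /bump; case: eqP; move: ll; lia.
have [lM|lM] := ltnP l.+1 M.
  rewrite (@rows_det_eq0 _ l l.+1) //; first exact: RowsSpan0.
  - lia.
  - by rewrite /succ_at eqxx /bump; case: eqP; move: ll lj; lia.
apply: rows_span1 => c cj; exists c; first by move: jM cj; lia.
by rewrite /succ_at /bump; case: eqP => [E|]; move: cj ll lj; lia.
Qed.

(** The main term has the rows of all orders up to [M] except [M - i]; the remainder keeps all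
    orders up to [M - i]. *)
Lemma iter_frobenius_wronskian i : (i <= M)%N -> exists2 x, rows_span (M - i).+1 x &
  iter i D frobenius_wronskian = rows_det (bump (M - i)) + x.
Proof.
elim: i => [|i IH] iM.
  exists 0; first exact: RowsSpan0.
  by rewrite addr0 subn0; apply: rows_det_ext => l lM; rewrite /bump; lia.
have [x xS xE] := IH (ltnW iM).
have E : (M - i = (M - i.+1).+1)%N by lia.
rewrite iterS xE (derD hD) E.
have [|y yS ->] := @der_rows_bump (M - i.+1); first by lia.
exists (y + D x); last by rewrite addrA.
by apply: rows_spanD => //; apply: der_rows_span_gen; rewrite -E.
Qed.

Section Evaluation.

Variables (K : fieldType) (ev : {rmorphism A -> K}).

Lemma ev_rows_det a : ev (rows_det a) =
  \det (\matrix_(i < M.+1, b < M.+1) if i == 0 :> nat then ev (v b) else ev (iter (a i.-1) D (u b))).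
Proof.
by rewrite -det_map_mx; congr (\det _); apply/matrixP => i b; rewrite !mxE; case: eqP.
Qed.

Lemma ev_rows_span j x : (forall a, has_orders j a -> ev (rows_det a) = 0) ->
  rows_span j x -> ev x = 0.
Proof.
move=> h; elim=> [|a y ha _ IH]; first exact: rmorph0.
by rewrite rmorphD /= h // IH addr0.
Qed.

(** While [i < M], every determinant in the derivative still contains the row of order 0, which
    agrees with the top row at the point. *)
Lemma frobenius_wronskian_vanish i :
  (forall b, ev (v b) = ev (u b)) -> (i < M)%N -> ev (iter i D frobenius_wronskian) = 0.
Proof.
move=> evu iM; have [x xS ->] := iter_frobenius_wronskian (ltnW iM).
have H a : has_orders 1 a -> ev (rows_det a) = 0.
  move=> /(_ 0%N isT)[l lM l0]; rewrite ev_rows_det.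
  apply: (@determinant_alternate _ _ _ ord0 (inord l.+1)).
    by rewrite -val_eqE /= inordK.
  by move=> b; rewrite !mxE /= inordK //= l0 evu.
rewrite rmorphD /= H; last by move=> c c1; exists c; [lia | rewrite /bump; lia].
rewrite add0r; apply: ev_rows_span xS => a ha; apply: H => c c1; apply: ha; lia.
Qed.

(** At the point the top row is a combination of the derivative rows; let [r] be the highest order
    that occurs in it. In the derivative of order [M - r] the main term omits exactly the row of
    order [r], so it is that nonzero coefficient times the Wronskian up to sign. The remainder
    contains all orders up to [r], on which the top row depends, and vanishes. *)
Lemma frobenius_wronskian_nonvanish :
  ev wronskian != 0 -> (exists b, ev (v b) != 0) ->
  exists2 i, (i <= M)%N & ev (iter i D frobenius_wronskian) != 0.
Proof.
move=> W0 [b0 vb0].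
pose W := \matrix_(i < M.+1, b < M.+1) ev (iter i D (u b)).
have WE : ev wronskian = \det W.
  by rewrite -det_map_mx; congr (\det _); apply/matrixP => i b; rewrite !mxE.
have WU : W \in unitmx by rewrite unitmxE -WE unitfE.
pose vv := \row_b ev (v b).
have [c vE] : exists c, vv = c *m W by exists (vv *m invmx W); rewrite mulmxKV.
have [r0 cr0] : exists r, c 0 r != 0.
  apply/rV0Pn; apply: contraNneq vb0 => c0; have := congr1 (fun X : 'rV_ _ => X 0 b0) vE.
  by rewrite c0 mul0mx !mxE => ->.
pose r := [arg max_(i > r0 | c 0 i != 0) (i : nat)].
have [cr rmax] : c 0 r != 0 /\ forall j, c 0 j != 0 -> (j <= r)%N.
  by rewrite /r; case: arg_maxnP.
have vbE b : ev (v b) = \sum_(j < M.+1 | (j <= r)%N) c 0 j * ev (iter j D (u b)).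
  have := congr1 (fun X : 'rV_ _ => X 0 b) vE; rewrite !mxE => ->.
  rewrite [RHS]big_mkcond /=; apply: eq_bigr => j _; rewrite mxE.
  case: leqP => // rj; have [->|/rmax] := eqVneq (c 0 j) 0; first by rewrite mul0r.
  by rewrite leqNgt rj.
have rM : (r <= M)%N by rewrite -ltnS ltn_ord.
exists (M - r)%N; first exact: leq_subr.
have [x xS ->] := iter_frobenius_wronskian (leq_subr r M).
have zero a : ev (rows_det a) = \sum_(j < M.+1 | (j <= r)%N) c 0 j *
   \det (\matrix_(i < M.+1, b < M.+1) if i == 0 :> nat then ev (iter j D (u b)) else ev (iter (a i.-1) D (u b))).
  rewrite ev_rows_det (expand_det_row _ ord0).
  under [RHS]eq_bigr => k _ do rewrite (expand_det_row _ ord0) mulr_sumr.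
  rewrite exchange_big /=; apply: eq_bigr => b _.
  rewrite !mxE /= vbE mulr_suml; apply: eq_bigr => k _.
  rewrite [in RHS]mxE /= [RHS]mulrA; congr (_ * _).
  rewrite /cofactor; congr (_ * \det _).
  by apply/matrixP => i' b'; rewrite !mxE.
rewrite subKn // in xS *; rewrite rmorphD /= (ev_rows_span _ xS) ?addr0; last first.
  move=> a ha; rewrite (zero a) big1 // => j jr.
  have [l lM lE] := ha j jr.
  rewrite (@determinant_alternate _ _ _ ord0 (inord l.+1)) ?mulr0 //.
    by rewrite -val_eqE /= inordK.
  by move=> b; rewrite !mxE /= inordK //= lE.
rewrite (zero _) (bigD1 r) //= big1 ?addr0; last first.
  move=> j /andP[jr ne]; have {ne jr} jr : (j < r)%N by rewrite ltn_neqAle val_eqE ne.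
  rewrite (@determinant_alternate _ _ _ ord0 (inord j.+1)) ?mulr0 //.
    by rewrite -val_eqE /= inordK //; lia.
  move=> b; rewrite !mxE /= inordK /=; last by lia.
  by rewrite /bump leqNgt jr.
rewrite mulf_neq0 //.
set N := (X in \det X).
have -> : N = row_perm (lift_perm ord0 r 1) W.
  apply/matrixP => i b; rewrite !mxE; case: (unliftP ord0 i) => [k ->|->] /=.
    by rewrite lift_perm_lift perm1.
  by rewrite lift_perm_id.
by rewrite row_permE det_mulmx det_perm mulf_neq0 ?signr_eq0 // -WE.
Qed.

End Evaluation.

End FrobeniusWronskian.

(** Cauchy-Binet summed over all choice functions; [det_rows_noninj] discards those that are not
    injective. *)
Lemma det_sum_rows (B : comNzRingType) n (T : finType) (c : 'I_n -> T -> B) (v : T -> 'I_n -> B) :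
  \det (\matrix_(i, j) \sum_(m : T) c i m * v m j) =
  \sum_(f : {ffun 'I_n -> T}) (\prod_i c i (f i)) * \det (\matrix_(i, j) v (f i) j).
Proof.
rewrite /determinant.
under [RHS]eq_bigr => f _ do rewrite mulr_sumr.
rewrite exchange_big /=; apply: eq_bigr => s _.
under eq_bigr => i _ do rewrite mxE.
rewrite bigA_distr_bigA /= mulr_sumr; apply: eq_bigr => f _.
rewrite big_split /= mulrCA; congr (_ * (_ * _)).
by apply: eq_bigr => i _; rewrite mxE.
Qed.

Lemma det_rows_noninj (B : comNzRingType) n (T : finType) (f : 'I_n -> T) (v : T -> 'I_n -> B) :
  ~~ injectiveb f -> \det (\matrix_(i, j) v (f i) j) = 0.
Proof.
case/injectivePn => i [j ij fij].
by apply: (@determinant_alternate _ _ _ i j) => // k; rewrite !mxE fij.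
Qed.

Lemma det_thin (B : comNzRingType) n r (c : 'I_n -> 'I_r -> B) (v : 'I_r -> 'I_n -> B) :
  (r < n)%N -> \det (\matrix_(i, j) \sum_(m < r) c i m * v m j) = 0.
Proof.
move=> rn; rewrite det_sum_rows big1 // => f _; rewrite det_rows_noninj ?mulr0 //.
apply/negP => /injectiveP /leq_card; rewrite !card_ord; move: rn; clear; lia.
Qed.

Section PrimeIdeal.

Variables (A : comNzRingType) (D : A -> A) (hD : derivation D) (I : A -> Prop).
Hypotheses (I0 : I 0) (ID : forall a b, I a -> I b -> I (a + b))
  (IM : forall a b, I b -> I (a * b)) (I1 : ~ I 1)
  (IP : forall a b, I (a * b) -> I a \/ I b) (Ider : forall a, I a -> I (D a)).

Let Isum (J : Type) (s : seq J) (P : pred J) (F : J -> A) :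
  (forall i, P i -> I (F i)) -> I (\sum_(i <- s | P i) F i).
Proof. by move=> h; apply: big_ind. Qed.

Lemma ideal_det n (X Y : 'M[A]_n) :
  (forall i j, I (X i j - Y i j)) -> I (\det X - \det Y).
Proof.
move=> h; rewrite /determinant -sumrB; apply: Isum => s _; rewrite -mulrBr; apply: IM.
elim/big_rec2: _ => [|i y x _ IH]; first by rewrite subrr.
have -> : X i (s i) * x - Y i (s i) * y = X i (s i) * (x - y) + y * (X i (s i) - Y i (s i)).
  by ring.
by apply: ID; apply: IM.
Qed.

Lemma ideal_prod (J : Type) (s : seq J) (F : J -> A) : I (\prod_(i <- s) F i) -> exists i, I (F i).
Proof.
elim: s => [|i s IH]; first by rewrite big_nil.
by rewrite big_cons => /IP[h|/IH //]; exists i.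
Qed.

Variables (L : nat) (u : 'I_L -> A).

(* Working modulo a [D]-stable prime ideal replaces passing to the function field of the curve. *)
Lemma wronskian_ideal (a : 'I_L -> nat) :
  I (\det (\matrix_(i < L, b < L) iter i D (u b))) ->
  I (\det (\matrix_(i < L, b < L) iter (a i) D (u b))).
Proof.
move=> hW.
(* [P r] says that the minors formed by the first [r] derivatives lie in [I]. At the least size
   [r.+1] with this property some minor of size [r] lies outside [I], and expanding the larger ones
   gives a relation of order [r] whose leading coefficient is outside [I]. *)
pose P r := `[< forall s : 'I_r -> 'I_L, I (\det (\matrix_(i < r, b < r) iter i D (u (s b)))) >].
have PL : P L.
  apply/asboolP => s; have [/injectiveP sI|/injectivePn[i [j ij sij]]] := boolP (injectiveb s).
    have -> : \matrix_(i, b) iter i D (u (s b)) = col_perm (perm sI) (\matrix_(i < L, b < L) iter i D (u b)).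
      by apply/matrixP => i b; rewrite !mxE permE.
    by rewrite col_permE det_mulmx mulrC; apply: IM.
  rewrite -det_tr (@determinant_alternate _ _ _ i j) // => k.
  by rewrite !mxE sij.
have [[|r] /asboolP Pr rmin] := ex_minnP (ex_intro P L PL).
  case: I1; suff <- : \det (\matrix_(i < 0, b < 0) iter i D (u (False_rect 'I_L (notF (ltn_ord b))))) = 1 by apply: Pr.
  exact: det_mx00.
have rL : (r < L)%N by apply: rmin.
have /asboolPn/existsNP[s hs] : ~~ P r by apply/negP => /rmin; rewrite ltnn.
pose sx b (x : 'I_r.+1) := if unlift ord_max x is Some k then s k else b.
pose Mx b := \matrix_(i < r.+1, x < r.+1) iter i D (u (sx b x)).
have b0 : 'I_L := Ordinal rL.
pose mu i := cofactor (Mx b0) i ord_max.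
have cofE b i : cofactor (Mx b) i ord_max = mu i.
  rewrite /mu /cofactor; congr (_ * _); congr (\det _).
  by apply/matrixP => k l; rewrite !mxE /sx liftK.
have muI : ~ I (mu ord_max).
  move=> h; apply: hs; have {h} := @IM ((-1) ^+ (r + r)) _ h.
  rewrite /mu /cofactor /= signrMK; congr (I (\det _)); apply/matrixP => k l.
  by rewrite !mxE /sx liftK lift_max.
have muR b : I (\sum_(i < r.+1) mu i * iter i D (u b)).
  have := Pr (sx b); rewrite -/(Mx b) (expand_det_col _ ord_max).
  congr (I _); apply: eq_bigr => i _; rewrite cofE mulrC !mxE; congr (_ * iter _ _ (u _)).
  by rewrite /sx unlift_none.
(* [Dep y]: modulo [I] and up to a denominator outside [I], the row [y] is a combination of the
   derivatives of order below [r]. Such rows are stable under [D], so all derivatives are among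
   them, and [r < L] puts the determinant into [I]. *)
pose Dep (y : 'I_L -> A) := exists2 e, ~ I e &
  exists nu : 'I_r -> A, forall b, I (e * y b + \sum_(i < r) nu i * iter i D (u b)).
have DepI y z : (forall b, I (y b - z b)) -> Dep z -> Dep y.
  move=> h [e eI [nu hnu]]; exists e => //; exists nu => b.
  rewrite -[y b](subrK (z b)) mulrDr -addrA; apply: ID => //; exact: IM.
have DepD y z : Dep y -> Dep z -> Dep (fun b => y b + z b).
  move=> [e eI [nu hnu]] [f fI [ka hka]]; exists (e * f); first by move=> /IP[].
  exists (fun i => f * nu i + e * ka i) => b.
  under eq_bigr => i _ do rewrite mulrDl -!mulrA.
  rewrite big_split /= -!mulr_sumr.
  have -> : forall p q, e * f * (y b + z b) + (f * p + e * q) = f * (e * y b + p) + e * (f * z b + q).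
    by move=> p q; ring.
  by apply: ID; apply: IM.
have DepZ c y : Dep y -> Dep (fun b => c * y b).
  move=> [e eI [nu hnu]]; exists e => //; exists (fun i => c * nu i) => b.
  under eq_bigr => i _ do rewrite -mulrA.
  by rewrite -mulr_sumr mulrCA -mulrDr; apply: IM.
have DepS e y : ~ I e -> Dep (fun b => e * y b) -> Dep y.
  move=> eI [f fI [nu hnu]]; exists (f * e); first by move=> /IP[].
  by exists nu => b; rewrite -mulrA.
have Dep_sum (n : nat) (F : 'I_n -> 'I_L -> A) : (forall i, Dep (F i)) -> Dep (fun b => \sum_(i < n) F i b).
  elim: n F => [|n IH] F hF.
    exists 1 => //; exists (fun=> 0) => b.
    by rewrite big_ord0 mulr0 add0r; apply: Isum => i _; rewrite mul0r.
  apply: (DepI _ (fun b => \sum_(i < n) F (widen_ord (leqnSn n) i) b + F ord_max b)).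
    by move=> b; rewrite big_ord_recr subrr.
  by apply: DepD => //; apply: IH.
have Dep_lt (i : 'I_r) : Dep (fun b => iter i D (u b)).
  exists 1 => //; exists (fun j => if j == i then -1 else 0) => b.
  rewrite (bigD1 i) //= eqxx big1 ?addr0 ?mul1r ?mulN1r ?subrr // => j /negPf->.
  by rewrite mul0r.
have Dep_r : Dep (fun b => iter r D (u b)).
  exists (mu ord_max) => //; exists (fun i => mu (widen_ord (leqnSn r) i)) => b.
  by have := muR b; rewrite big_ord_recr /= addrC.
have Dep_der y : Dep y -> Dep (fun b => D (y b)).
  move=> hy; have [e eI [nu hnu]] := hy; apply: (DepS e) => //.
  apply: (DepI _ (fun b => - D e * y b + (-1) * \sum_(i < r) (D (nu i) * iter i D (u b) + nu i * iter i.+1 D (u b)))).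
    move=> b; have := Ider (hnu b); rewrite (derD hD) (derM hD) (der_sum hD).
    under eq_bigr => i _ do rewrite (derM hD).
    by congr (I _); rewrite mulN1r mulNr opprD !opprK; ring.
  apply: (DepD); first exact: (DepZ).
  apply: (DepZ); apply: (Dep_sum) => i; apply: (DepD); first by apply: (DepZ).
  apply: (DepZ); have [h|h] := ltnP i.+1 r; first exact: (Dep_lt (Ordinal h)).
  by have -> : i.+1 = r by apply/eqP; rewrite eqn_leq h ltn_ord.
have Dep_all k : Dep (fun b => iter k D (u b)).
  elim: k => [|k IH]; last exact: Dep_der.
  case: (posnP r) => [r0|r0]; last exact: (Dep_lt (Ordinal r0)).
  by move: Dep_r; rewrite r0.
have /fin_all_exists2[e eI] : forall i : 'I_L, exists2 e, ~ I e &
  exists nu : 'I_r -> A, forall b, I (e * iter (a i) D (u b) + \sum_(j < r) nu j * iter j D (u b)).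
  by move=> i; apply: Dep_all.
case/fin_all_exists => nu hnu.
have H : I (\det (\matrix_(i, b) (e i * iter (a i) D (u b)))).
  rewrite -[\det _]subr0 -(@det_thin _ L r (fun i j => - nu i j) (fun j b => iter j D (u b))) //.
  apply: ideal_det => i b; rewrite !mxE; have := hnu i b; congr (I (_ + _)).
  by rewrite -sumrN; apply: eq_bigr => j _; rewrite mulNr opprK.
have : I ((\prod_i e i) * \det (\matrix_(i < L, b < L) iter (a i) D (u b))).
  move: H; congr I.
  have -> : \prod_i e i = \det (diag_mx (\row_i e i)) by rewrite det_diag; apply: eq_bigr => i _; rewrite mxE.
  rewrite -det_mulmx; congr (\det _); apply/matrixP => i b; rewrite !mxE (bigD1 i) //= big1.
    by rewrite !mxE eqxx mulr1n addr0.
  by move=> j ji; rewrite !mxE eq_sym (negPf ji) mulr0n mul0r.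
by case/IP => // /ideal_prod[i /eI].
Qed.

End PrimeIdeal.

(** A maximal non-vanishing minor is bordered by one further column. The cofactors along the added
    row give the coefficients [c]; they annihilate every row of the infinite family because all
    larger minors vanish. *)
Lemma kernel_or_det (K : idomainType) (L : nat) (rho : nat -> 'I_L -> K) :
  (exists a : 'I_L -> nat, \det (\matrix_(i, b) rho (a i) b) != 0) \/
  (exists2 c : 'I_L -> K, (exists b, c b != 0) & forall n, \sum_b c b * rho n b = 0).
Proof.
pose P r := `[< forall (a : 'I_r -> nat) (s : 'I_r -> 'I_L), \det (\matrix_(i < r, b < r) rho (a i) (s b)) = 0 >].
have [PL|/asboolPn/existsNP[a /existsNP[s]]] := boolP (P L); last first.
  move/eqP => h; left; exists a.
  have /injectiveP sI : injectiveb s.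
    apply: contraNT h => /injectivePn[i [j ij sij]]; apply/eqP.
    by rewrite -det_tr (@determinant_alternate _ _ _ i j) // => k; rewrite !mxE sij.
  apply: contraNneq h => h0.
  have -> : \matrix_(i, b) rho (a i) (s b) = col_perm (perm sI) (\matrix_(i < L, b < L) rho (a i) b).
    by apply/matrixP => i b; rewrite !mxE permE.
  by rewrite col_permE det_mulmx h0 mul0r.
right; have [[|r] /asboolP Pr rmin] := ex_minnP (ex_intro P L PL).
  have := Pr (fun=> 0%N) (fun b => False_rect 'I_L (notF (ltn_ord b))).
  by rewrite det_mx00 => /eqP; rewrite oner_eq0.
have rL : (r < L)%N by apply: rmin.
have /asboolPn/existsNP[a /existsNP[s /eqP hs]] : ~~ P r by apply/negP => /rmin; rewrite ltnn.
have [b bs] : exists b, forall k, s k != b.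
  have : ~~ [forall b, b \in codom s].
    apply/negP => /forallP h; have : (#|'I_L| <= size (codom s))%N.
      by apply: leq_trans (card_size _); apply/subset_leq_card/subsetP => x _; apply: h.
    by rewrite size_codom !card_ord leqNgt rL.
  case/forallPn => b bs; exists b => k; apply: contraNneq bs => <-; exact: codom_f.
pose sx (x : 'I_r.+1) := if unlift ord_max x is Some k then s k else b.
pose ax n (x : 'I_r.+1) := if unlift ord_max x is Some k then a k else n.
pose Mx n := \matrix_(i < r.+1, x < r.+1) rho (ax n i) (sx x).
pose mu i := cofactor (Mx 0%N) ord_max i.
have cofE n i : cofactor (Mx n) ord_max i = mu i.
  rewrite /mu /cofactor; congr (_ * _); congr (\det _).
  by apply/matrixP => k l; rewrite !mxE /ax liftK.
have mu0 : mu ord_max != 0.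
  rewrite mulf_neq0 ?signr_eq0 //; apply: contraNneq hs => <-; apply/eqP; congr (\det _).
  by apply/matrixP => k l; rewrite !mxE /sx /ax !liftK.
exists (fun c => \sum_(x | sx x == c) mu x).
  exists b; rewrite (big_pred1 ord_max) // => x; rewrite /sx.
  by case: unliftP => [k ->|->]; rewrite /= ?eqxx // (negPf (bs k)) eq_sym eq_liftF.
move=> n; have := Pr (ax n) sx; rewrite -/(Mx n) (expand_det_row _ ord_max) => E.
rewrite -[RHS]E.
under eq_bigr => c _ do rewrite mulr_suml.
rewrite (exchange_big_dep predT) //=; apply: eq_bigr => x _.
by rewrite (big_pred1 (sx x)) // cofE mxE mulrC /ax unlift_none.
Qed.

Section Flat.

Variables (A : comNzRingType) (D : A -> A) (hD : derivation D).
Variables (K : idomainType) (ev : {rmorphism A -> K}).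

(* In characteristic 0 the elements vanishing to infinite order at the point [ev] along [D] form a
   [D]-stable prime ideal. *)
Definition flat (u : A) : Prop := forall i, ev (iter i D u) = 0.

Lemma flat0 : flat 0. Proof. by move=> i; rewrite (iter_der0 hD) rmorph0. Qed.
Lemma flatD a b : flat a -> flat b -> flat (a + b).
Proof. by move=> ha hb i; rewrite (iter_derD hD) rmorphD /= ha hb addr0. Qed.
Lemma flatM a b : flat b -> flat (a * b).
Proof.
move=> hb i; rewrite (leibniz hD) rmorph_sum big1 // => j _.
by rewrite rmorphMn rmorphM /= hb mulr0 mul0rn.
Qed.
Lemma flat_der a : flat a -> flat (D a).
Proof. by move=> ha i; rewrite -iterSr. Qed.
Lemma flat1 : ~ flat 1.
Proof. by move=> /(_ 0%N) /eqP; rewrite /= rmorph1 oner_eq0. Qed.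

Lemma jet_order u : ~ flat u ->
  exists m, (forall i, (i < m)%N -> ev (iter i D u) = 0) /\ ev (iter m D u) != 0.
Proof.
move=> /existsNP[i /eqP hi]; have [m hm mmin] := ex_minnP (ex_intro (fun i => ev (iter i D u) != 0) i hi).
exists m; split=> // j jm; apply/eqP/negPn/negP => /mmin; rewrite leqNgt jm //.
Qed.

Hypothesis char0 : forall n, n.+1%:R != 0 :> K.

(** If [a] and [b] first fail to vanish at orders [m] and [n], Leibniz at order [m + n] leaves the
    single term with the factor ['C(m + n, m)], nonzero in characteristic 0. *)
Lemma flat_prime a b : flat (a * b) -> flat a \/ flat b.
Proof.
move=> hab; have [?|/jet_order[m [mlt hm]]] := EM (flat a); first by left.
have [?|/jet_order[n [nlt hn]]] := EM (flat b); first by right.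
have := hab (m + n)%N; rewrite (leibniz hD) rmorph_sum /=.
have mmn : (m < (m + n).+1)%N by rewrite ltnS leq_addr.
rewrite (bigD1 (Ordinal mmn)) //= big1 => [|i im].
  rewrite addr0 addKn rmorphMn rmorphM /= -mulr_natr => /eqP.
  rewrite !mulf_eq0 (negPf hm) (negPf hn) /=.
  have : (0 < 'C(m + n, m))%N by rewrite bin_gt0 leq_addr.
  by case: 'C(_, _) => // k _; rewrite (negPf (char0 k)).
rewrite rmorphMn rmorphM /=; have [lt|le] := ltnP i m; first by rewrite mlt // mul0r mul0rn.
rewrite (nlt (m + n - i)%N) ?mulr0 ?mul0rn //.
have : (i : nat) <> m by move=> E; move: im; rewrite -val_eqE /= E eqxx.
by move: le (ltn_ord i); lia.
Qed.

Lemma wronskian_flat (L : nat) (u : 'I_L -> A) :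
  flat (\det (\matrix_(i < L, b < L) iter i D (u b))) ->
  exists2 c : 'I_L -> K, (exists b, c b != 0) & forall n, \sum_b c b * ev (iter n D (u b)) = 0.
Proof.
move=> hW; have [[a /eqP ha]|//] := kernel_or_det (fun n b => ev (iter n D (u b))).
case: ha.
have h : flat (\det (\matrix_(i < L, b < L) iter (a i) D (u b))).
  by apply: (wronskian_ideal hD flat0 flatD flatM flat1 flat_prime flat_der).
have := h 0%N; rewrite /= -det_map_mx => <-; congr (\det _).
by apply/matrixP => i b; rewrite !mxE.
Qed.

End Flat.

Lemma horner_taylor2 (B : comNzRingType) (p : {poly B}) (x h : B) :
  exists q, p.[x + h] = p.[x] + h * p^`().[x] + h ^+ 2 * q.
Proof.
elim/poly_ind: p => [|p c [q qE]].
  by exists 0; rewrite deriv0 !horner0 !mulr0 !addr0.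
exists (p^`().[x] + (x + h) * q); rewrite derivD derivC addr0 derivM derivX !hornerE qE.
ring.
Qed.

Section Bivariate.

Variable C : comNzRingType.
Implicit Types u v p : {poly {poly C}}.

Definition diff_t u : {poly {poly C}} := map_poly (@deriv C) u.

Lemma coef_diff_t u i : (diff_t u)`_i = (u`_i)^`().
Proof. by rewrite coef_map_id0 // deriv0. Qed.

Lemma diff_tP : derivation diff_t.
Proof.
split=> a b; apply/polyP => i; rewrite !(coef_diff_t, coefD) ?derivD // !coefM.
rewrite -big_split /= raddf_sum; apply: eq_bigr => j _.
by rewrite /= derivM !coef_diff_t.
Qed.

Lemma diff_tC (c : {poly C}) : diff_t c%:P = (c^`())%:P.
Proof. by apply/polyP => i; rewrite coef_diff_t !coefC; case: (i == 0)%N; rewrite ?deriv0. Qed.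

Lemma diff_tX : diff_t 'X = 0.
Proof. by apply/polyP => i; rewrite coef_diff_t coefX coef0 -polyC_natr derivC. Qed.

(* The Hamiltonian derivation kills [p], so it acts on the functions on the curve [p = 0]. *)
Definition curve_der p u := p^`() * diff_t u - diff_t p * u^`().

Lemma curve_derP p : derivation (curve_der p).
Proof.
have [hD hM] := diff_tP; split=> a b; rewrite /curve_der ?hD ?hM !derivE; ring.
Qed.

Lemma curve_der_self p : curve_der p p = 0.
Proof. by rewrite /curve_der mulrC subrr. Qed.

Lemma curve_derC p (c : C) : curve_der p c%:P%:P = 0.
Proof. by rewrite /curve_der diff_tC !derivC polyC0 !mulr0 subrr. Qed.

Lemma curve_derCt p (r : {poly C}) : curve_der p r%:P = p^`() * (r^`())%:P.
Proof. by rewrite /curve_der diff_tC derivC mulr0 subr0. Qed.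

Lemma deriv_horner (p : {poly {poly C}}) (x : {poly C}) :
  (p.[x])^`() = (diff_t p).[x] + p^`().[x] * x^`().
Proof.
have [hD hM] := diff_tP; elim/poly_ind: p => [|p c IH].
  by rewrite horner0 deriv0 (der0 diff_tP) deriv0 !horner0 mul0r addr0.
rewrite hornerMXaddC hD hM diff_tX mulr0 addr0 diff_tC [(p * 'X + _)^`()]derivD.
rewrite derivM derivX derivC !hornerE derivD derivM IH; ring.
Qed.

(** One index [b < n * k1] runs through the monomials of outer degree below [n] and inner degree
    below [k1]; the outer bound keeps them independent modulo a polynomial of outer degree [n]. *)
Definition monom2 (k1 b : nat) : {poly {poly C}} := 'X^(b %/ k1) * ('X^(b %% k1))%:P.

Definition curve_wronskian p (k1 L : nat) : {poly {poly C}} :=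
  \det (\matrix_(i < L, b < L) iter i (curve_der p) (monom2 k1 b)).

End Bivariate.

Lemma diff_t_map (C C' : comNzRingType) (h : {rmorphism C -> C'}) (u : {poly {poly C}}) :
  map_poly (map_poly h) (diff_t u) = diff_t (map_poly (map_poly h) u).
Proof. by apply/polyP => i; rewrite !(coef_map, coef_diff_t) /= deriv_map. Qed.

Lemma curve_der_map (C C' : comNzRingType) (h : {rmorphism C -> C'}) (p u : {poly {poly C}}) :
  map_poly (map_poly h) (curve_der p u) =
  curve_der (map_poly (map_poly h) p) (map_poly (map_poly h) u).
Proof. by rewrite /curve_der rmorphB !rmorphM /= !diff_t_map !deriv_map. Qed.

Lemma monom2_map (C C' : comNzRingType) (h : {rmorphism C -> C'}) k1 b :
  map_poly (map_poly h) (monom2 C k1 b) = monom2 C' k1 b.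
Proof. by rewrite rmorphM /= map_polyXn map_polyC /= map_polyXn. Qed.

Lemma iter_curve_der_map (C C' : comNzRingType) (h : {rmorphism C -> C'}) (p u : {poly {poly C}}) i :
  map_poly (map_poly h) (iter i (curve_der p) u) =
  iter i (curve_der (map_poly (map_poly h) p)) (map_poly (map_poly h) u).
Proof. by elim: i => //= i IH; rewrite curve_der_map IH. Qed.

Lemma curve_wronskian_map (C C' : comNzRingType) (h : {rmorphism C -> C'}) (p : {poly {poly C}}) k1 L :
  map_poly (map_poly h) (curve_wronskian p k1 L) = curve_wronskian (map_poly (map_poly h) p) k1 L.
Proof.
rewrite -det_map_mx; congr (\det _); apply/matrixP => i b.
by rewrite !mxE /= iter_curve_der_map monom2_map.
Qed.

Section WronskianNonvanishing.

Variables (C : idomainType) (p : {poly {poly C}}) (n : nat) (x1 : C).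
Hypothesis char0 : forall n, n.+1%:R != 0 :> C.
Hypothesis sp : size p = n.+1.
Hypothesis irr_p : forall v w a : {poly {poly C}}, v != 0 -> w != 0 ->
  (size v <= n)%N -> (size w <= n)%N -> w * v <> a * p.
Hypotheses (px1 : (p.[x1%:P]).[0] = 0) (dpx1 : (p^`().[x1%:P]).[0] != 0).

Let ev : {rmorphism {poly {poly C}} -> C} := (horner_eval 0 \o horner_eval x1%:P)%FUN.
Let D := curve_der p.
Let hD : derivation D := curve_derP p.

(** The inner variable vanishes at the point but its derivative along the curve does not, so it is
    not flat; primality of flatness then strips the factors ['X] from [r]. *)
Lemma poly_not_flat (r : {poly C}) : r != 0 -> ~ flat D ev r%:P.
Proof.
have [m] := ubnP (size r); elim: m r => // m IH r rm r0 hr.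
have [r00|r00] := eqVneq r.[0] 0; last first.
  by have /eqP := hr 0%N; rewrite /= /horner_eval hornerC (negPf r00).
have /factor_theorem[q qE] : root r 0 by apply/rootP.
rewrite subr0 in qE.
have q0 : q != 0 by apply: contraNneq r0 => q0; rewrite qE q0 mul0r.
move: hr; rewrite qE polyCM => /(flat_prime hD char0)[|hX].
  by apply: IH => //; move: rm; rewrite qE size_mulX.
have := flat_der hX 0%N; rewrite /= /D curve_derCt derivX /horner_eval hornerM hornerC hornerM.
by rewrite hornerC mulr1 => /eqP; rewrite (negPf dpx1).
Qed.

Lemma curve_self_flat : flat D ev p.
Proof.
move=> [|i]; first by [].
by rewrite iterSr /D curve_der_self (iter_der0 hD) rmorph0.
Qed.

Let n0 : (0 < n)%N.
Proof.
case: (posnP n) => // n0; move: dpx1; have := sp; rewrite n0 => s1.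
have /size1_polyC -> : (size p <= 1)%N by rewrite s1.
by rewrite derivC horner0 horner0 eqxx.
Qed.

(** Eliminating the outer variable from [p] and [v] leaves a nonzero polynomial in the inner
    variable, which would be flat together with [v]. *)
Lemma small_not_flat (v : {poly {poly C}}) : v != 0 -> (size v <= n)%N -> ~ flat D ev v.
Proof.
move=> v0 sv hv.
have s1 : (1 < size p)%N by rewrite sp ltnS.
have syz : no_syzygy p v.
  move=> w a wva sw; apply/eqP/negPn/negP => w0.
  by apply: (irr_p v0 w0 sv _ wva); rewrite -ltnS -sp.
have [r [a [b [r0 rE _]]]] := elimination s1 syz.
apply: (poly_not_flat r0); rewrite rE; apply: (flatD hD); apply: (flatM hD) => //.
exact: curve_self_flat.
Qed.

(** A multiple of [p] is flat, so the Wronskian is flat because [w] is too small to be. Then a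
    constant combination of the monomials is flat; its outer degree is below [n], so it is zero,
    contrary to the independence of the monomials. *)
Lemma curve_wronskian_no_syzygy k1 : (0 < k1)%N ->
  no_syzygy p (curve_wronskian p k1 (n * k1)).
Proof.
move=> k0 w a E sw; apply/eqP/negPn/negP => w0.
have : flat D ev (w * curve_wronskian p k1 (n * k1)).
  by rewrite E; apply: (flatM hD); exact: curve_self_flat.
case/(flat_prime hD char0) => [|hW]; first by apply: small_not_flat => //; rewrite -ltnS -sp.
have [c [b0 cb0] hc] := wronskian_flat hD char0 hW.
pose v := \sum_b (c b)%:P%:P * monom2 C k1 b.
have coefv (b : 'I_(n * k1)) : v`_(b %/ k1)`_(b %% k1) = c b.
  rewrite !coef_sum (bigD1 b) //= big1 ?addr0 => [|b' nb].
    by rewrite coefCM coefCM /monom2 coefMC coefXn eqxx mul1r coefXn eqxx mulr1.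
  rewrite coefCM coefCM /monom2 coefMC !coefXn.
  case: eqP => [e1|_]; last by rewrite mul0r coef0 mulr0.
  rewrite mul1r coefXn; case: eqP => [e2|_]; last by rewrite mulr0.
  by case/eqP: nb; apply: val_inj; rewrite /= (divn_eq b k1) (divn_eq b' k1) e1 e2.
have sv : (size v <= n)%N.
  apply: leq_trans (size_sum _ _ _) _; apply/bigmax_leqP => b _.
  rewrite mul_polyC; apply: leq_trans (size_scale_leq _ _) _.
  rewrite /monom2 mulrC mul_polyC; apply: leq_trans (size_scale_leq _ _) _.
  by rewrite size_polyXn ltn_divLR.
apply: (small_not_flat _ sv).
  by apply: contraNneq cb0 => v0; rewrite -coefv v0 !coef0.
move=> i; rewrite /v (iter_der_sum hD) rmorph_sum -[RHS](hc i); apply: eq_bigr => b _.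
have DC j x : iter j D ((c b)%:P%:P * x) = (c b)%:P%:P * iter j D x.
  by elim: j => //= j ->; rewrite (derM hD) {1}/D curve_derC mul0r add0r.
by rewrite DC rmorphM /= /horner_eval hornerC hornerC.
Qed.

End WronskianNonvanishing.

(** * Points of a plane curve over a prime field *)

Lemma horner2_eval (C : comNzRingType) (p : {poly {poly C}}) (X : {poly C}) (t : C) :
  (p.[X]).[t] = (p.[(X.[t])%:P]).[t].
Proof. by elim/poly_ind: p => [|p c IH]; rewrite ?horner0 // !hornerE IH. Qed.

Lemma dvdp_big_sum (F : fieldType) (d : {poly F}) (I : Type) (s : seq I) (P : pred I) (f : I -> {poly F}) :
  (forall i, P i -> d %| f i) -> d %| \sum_(i <- s | P i) f i.
Proof.
by move=> h; apply: (big_ind (fun x => d %| x)) => // a b; exact: dvdp_add.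
Qed.

Lemma dvdp_big_prod (F : fieldType) (I : Type) (s : seq I) (d f : I -> {poly F}) :
  (forall i, d i %| f i) -> \prod_(i <- s) d i %| \prod_(i <- s) f i.
Proof.
by move=> h; elim/big_rec2: _ => [|i a b _ IH]; [rewrite dvdpp | apply: dvdp_mul].
Qed.

Lemma dvdp_det_cols (F : fieldType) n (X : 'M[{poly F}]_n) (w : 'I_n -> {poly F}) :
  (forall i j, w j %| X i j) -> \prod_j w j %| \det X.
Proof.
move=> h; apply: dvdp_big_sum => s _; apply: dvdp_mull.
rewrite (reindex_inj (@perm_inj _ s)) /=.
by apply: dvdp_big_prod => i; apply: h.
Qed.

Lemma dvdp_deriv_root (F : fieldType) (y : {poly F}) t0 m :
  (forall i, (0 < i <= m)%N -> i%:R != 0 :> F) ->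
  y.[t0] = 0 -> ('X - t0%:P) ^+ m %| y^`() -> ('X - t0%:P) ^+ m.+1 %| y.
Proof.
move=> charm y0; have [->|yn0] := eqVneq y 0; first by rewrite dvdp0.
have [e [q]] := multiplicity_XsubC y t0; rewrite yn0 /= => qt yE dy.
have [em|em] := ltnP m e; first by rewrite yE dvdp_mull // dvdp_exp2l.
case: e yE em => [|e] yE em.
  by move: qt; rewrite rootE; move: y0; rewrite yE expr0 mulr1 => ->; rewrite eqxx.
have dE : y^`() = (q^`() * ('X - t0%:P) + q *+ e.+1) * ('X - t0%:P) ^+ e.
  rewrite yE derivM deriv_exp derivXsubC mul1r mulrDl exprS; congr (_ + _).
    by rewrite mulrA.
  by rewrite mulrnAr mulrnAl.
have : ('X - t0%:P) ^+ e.+1 %| y^`() by apply: dvdp_trans dy; rewrite dvdp_exp2l.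
have X0 : ('X - t0%:P) ^+ e != 0 by rewrite expf_neq0 // polyXsubC_eq0.
rewrite dE exprS dvdp_mul2r // dvdp_XsubCl rootE !hornerE subrr mulr0 add0r hornerMn.
rewrite -mulr_natr mulf_eq0 (negPf (charm _ _)) ?orbF //.
by move: qt; rewrite rootE => /negPf->.
Qed.

Lemma sylvester_horner (F : fieldType) (p g : {poly {poly F}}) (X : {poly F}) i :
  \sum_j Sylvester_mx p g i j * X ^+ j =
  match split i with inl k => X ^+ k * p.[X] | inr k => X ^+ k * g.[X] end.
Proof.
have H (r : {poly {poly F}}) (k : nat) : (k + size r <= (size g).-1 + (size p).-1)%N ->
    \sum_(j < (size g).-1 + (size p).-1) (r`_(j - k) *+ (k <= j)) * X ^+ j = X ^+ k * r.[X].
  move=> hk; have -> : X ^+ k * r.[X] = ('X^k * r).[X] by rewrite hornerM hornerXn.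
  rewrite (@horner_coef_wide _ ((size g).-1 + (size p).-1)); last first.
    by rewrite (leq_trans (size_polyMleq _ _)) // size_polyXn.
  by apply: eq_bigr => j _; rewrite coefXnM ltnNge; case: (k <= j)%N; rewrite ?mulr1n ?mulr0n.
under eq_bigr => j _ do rewrite Sylvester_mxE.
have aux (a b m : nat) : (m < a.-1 -> m + b <= a.-1 + b.-1)%N by lia.
by case: (split i) => k; rewrite H //; first exact: aux; rewrite addnC [X in (_ <= X)%N]addnC addnC aux.
Qed.

Section Hensel.

Variables (F : fieldType) (p : {poly {poly F}}) (t0 x0 : F).
Hypotheses (p0 : (p.[x0%:P]).[t0] = 0) (dp0 : (p^`().[x0%:P]).[t0] != 0).
Let T := 'X - t0%:P.

(** Newton's iteration with the slope frozen at the starting point; linear convergence is enough. *)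
Lemma hensel_root N : exists2 X : {poly F}, X.[t0] = x0 & T ^+ N %| p.[X].
Proof.
case: N => [|N]; first by exists x0%:P; rewrite ?hornerC // expr0 dvd1p.
elim: N => [|N [X Xt dX]].
  by exists x0%:P; rewrite ?hornerC // expr1 dvdp_XsubCl rootE p0.
pose c := ((p^`().[x0%:P]).[t0])^-1.
exists (X + - (c%:P * p.[X])).
  rewrite !hornerE Xt horner2_eval Xt p0 mulr0 subr0 //.
have [q ->] := horner_taylor2 p X (- (c%:P * p.[X])).
rewrite sqrrN; apply: dvdp_add.
  rewrite mulNr -mulrA mulrCA -[X in X - _]mulr1 -mulrBr exprSr; apply: dvdp_mul => //.
  rewrite dvdp_XsubCl rootE !hornerE horner2_eval Xt mulVf ?subrr //.
apply: dvdp_mulr; apply: (@dvdp_trans _ ((T ^+ N.+1) ^+ 2)).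
  by rewrite -exprM dvdp_exp2l //; lia.
by apply: dvdp_exp2r; exact: dvdp_mull.
Qed.

Variable M : nat.
Hypothesis charM : forall i, (0 < i <= M)%N -> i%:R != 0 :> F.

(** By the chain rule, the derivative of [u.[X]] times [p'(X)] is [(curve_der p u).[X]] up to a
    multiple of the derivative of [p.[X]]. As [p'] is nonzero at the point, each derivation along
    the curve amounts to one order of vanishing at [t0], as long as the characteristic exceeds that
    order. *)
Lemma jet_dvd (X : {poly F}) (u : {poly {poly F}}) m :
  X.[t0] = x0 -> T ^+ M %| p.[X] -> (m <= M)%N ->
  (forall i, (i < m)%N -> ((iter i (curve_der p) u).[x0%:P]).[t0] = 0) ->
  T ^+ m %| u.[X].
Proof.
move=> Xt dX; elim: m u => [|m IH] u mM hu; first by rewrite expr0 dvd1p.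
apply: dvdp_deriv_root.
- by move=> i /andP[i0 im]; apply: charM; rewrite i0 /=; lia.
- by rewrite horner2_eval Xt; apply: (hu 0%N).
have dD : T ^+ m %| (curve_der p u).[X].
  by apply: IH; [exact: ltnW | move=> i im; rewrite -iterSr; apply: hu].
have dp' : T ^+ m %| (p.[X])^`().
  have /dvdpP[q ->] := dX; rewrite derivM deriv_exp derivXsubC mul1r.
  apply: dvdp_add; apply: dvdp_mull; first by rewrite dvdp_exp2l // ltnW.
  by rewrite -mulr_natr dvdp_mulr // dvdp_exp2l; lia.
have E : p^`().[X] * (u.[X])^`() = (curve_der p u).[X] + u^`().[X] * (p.[X])^`().
  by rewrite !deriv_horner /curve_der !hornerE; ring.
have cop : coprimep (T ^+ m) p^`().[X].
  by rewrite coprimep_expl // coprimep_sym coprimep_XsubC rootE horner2_eval Xt.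
by rewrite -(Gauss_dvdpr _ cop) E; apply: dvdp_add; rewrite // dvdp_mull.
Qed.

End Hensel.

Section RootCount.

Variables (F : fieldType) (p g : {poly {poly F}}) (n M : nat).
Hypotheses (sp : size p = n.+1) (charM : forall i, (0 < i <= M)%N -> i%:R != 0 :> F).

Definition jet_zero (P : F * F) : Prop :=
  [/\ (p.[P.1%:P]).[P.2] = 0, (p^`().[P.1%:P]).[P.2] != 0 &
    forall i, (i < M)%N -> ((iter i (curve_der p) g).[P.1%:P]).[P.2] = 0].

(* Hensel's lemma gives a branch [X j] of [p] through each point, and combining the columns of the
   Sylvester matrix with the powers of [X j] produces columns divisible by the [M]-th power. *)
Lemma resultant_fiber (t0 : F) (xs : seq F) :
  uniq xs -> (forall x, x \in xs -> jet_zero (x, t0)) ->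
  ('X - t0%:P) ^+ (M * size xs) %| resultant p g.
Proof.
move=> uxs hxs; set r := size xs.
case: (posnP r) => [->|r0]; first by rewrite muln0 expr0 dvd1p.
have rn : (r <= n)%N.
  pose pt := map_poly (horner_eval t0) p.
  have ptE x : pt.[x] = (p.[x%:P]).[t0] by rewrite /pt -[x](hornerC x t0) (horner_map (horner_eval t0)) /= hornerC.
  have dptE x : pt^`().[x] = (p^`().[x%:P]).[t0].
    by rewrite /pt deriv_map -[x](hornerC x t0) (horner_map (horner_eval t0)) /= hornerC.
  have pt0 : pt != 0.
    have := hxs (nth 0 xs 0) (mem_nth _ r0); case=> _ /= + _.
    by rewrite -dptE; apply: contraNneq => ->; rewrite deriv0 horner0.
  rewrite -ltnS; apply: leq_trans (max_poly_roots pt0 _ uxs) _.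
    by apply/allP => x /hxs[/= h _ _]; rewrite rootE ptE h.
  by rewrite -sp size_poly.
have [X Xt dX] : exists2 X : 'I_r -> {poly F}, (forall j, (X j).[t0] = nth 0 xs j) &
    (forall j, ('X - t0%:P) ^+ M %| p.[X j]).
  have : forall j : 'I_r, exists X : {poly F}, X.[t0] = nth 0 xs j /\ ('X - t0%:P) ^+ M %| p.[X].
    move=> j; have [/= h1 h2 _] := hxs _ (mem_nth 0 (ltn_ord j)).
    by have [Y] := hensel_root h1 h2 M; exists Y.
  by case/fin_all_exists => X hX; exists X => j; case: (hX j).
have dG j : ('X - t0%:P) ^+ M %| g.[X j].
  have [/= h1 h2 h3] := hxs _ (mem_nth 0 (ltn_ord j)).
  exact: (jet_dvd h2 charM (Xt j) (dX j) (leqnn M) h3).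
set dS := ((size g).-1 + (size p).-1)%N.
have rdS : (r <= dS)%N by rewrite /dS sp /= (leq_trans rn) ?leq_addl.
(* The first [r] columns hold the powers of the branches, the others are those of the identity. At
   [t0] the determinant is a Vandermonde determinant in the distinct values [xs], so multiplying by
   [U] changes nothing in the order of vanishing at [t0]. *)
pose U : 'M[{poly F}]_dS := \matrix_(i, j) if insub (j : nat) is Some k then X k ^+ i else (i == j)%:R.
have U0 : (\det U).[t0] != 0.
  rewrite -[_.[t0]]/(horner_eval t0 (\det U)) -det_map_mx; apply/det0P => -[v v0 vU].
  have vge (j : 'I_dS) : (r <= j)%N -> v 0 j = 0.
    move=> rj; have := congr1 (fun Y : 'rV_dS => Y 0 j) vU; rewrite !mxE (bigD1 j) //= big1.
      by rewrite !mxE insubF ?ltnNge ?rj //= eqxx /horner_eval hornerC mulr1 addr0.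
    by move=> i ij; rewrite !mxE insubF ?ltnNge ?rj //= (negPf ij) /horner_eval hornerC mulr0.
  pose q := \poly_(i < r) (if insub i is Some k then v 0 k else 0).
  have q0 : q = 0.
    apply/eqP/negPn/negP => q0; have := @max_poly_roots _ q xs q0 _ uxs.
    rewrite ltnNge size_poly => /(_ _)/negP; case=> //.
    apply/(all_nthP 0) => j jr; rewrite rootE horner_poly.
    have E := congr1 (fun Y : 'rV_dS => Y 0 (Ordinal (leq_trans jr rdS))) vU; rewrite !mxE in E.
    apply/eqP; rewrite -[RHS]E => {E}.
    rewrite (big_ord_widen dS (fun i => (if insub i is Some k then v 0 k else 0) * nth 0 xs j ^+ i)) //.
    rewrite big_mkcond /=; apply/eq_bigr => i _; rewrite valK !mxE.
    rewrite (insubT (fun x => (x < r)%N) jr) /= /horner_eval horner_exp Xt /=.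
    by case: ltnP => // /vge ->; rewrite mul0r.
  case/eqP: v0; apply/rowP => j; rewrite mxE; have [rj|jr] := leqP r j; first exact: vge.
  by have := coef_poly r (fun i => if insub i is Some k then v 0 k else 0) j; rewrite -/q q0 coef0 jr valK.
have : \prod_(j < dS) (if (j < r)%N then ('X - t0%:P) ^+ M else 1) %| \det (Sylvester_mx p g *m U).
  apply: dvdp_det_cols => i j; case: ifP => jr; last exact: dvd1p.
  rewrite mxE; under eq_bigr => k _ do rewrite [U _ _]mxE (insubT (fun x => (x < r)%N) jr).
  by rewrite sylvester_horner; case: (split i) => k; apply: dvdp_mull.
have -> : \prod_(j < dS) (if (j < r)%N then ('X - t0%:P) ^+ M else 1) = ('X - t0%:P) ^+ (M * r).
  by rewrite -big_mkcond /= -(big_ord_widen dS (fun=> ('X - t0%:P) ^+ M)) // prodr_const card_ord exprM.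
rewrite det_mulmx Gauss_dvdpl // coprimep_expl // coprimep_sym coprimep_XsubC rootE //.
Qed.

Lemma prod_XsubC_dvd (h : {poly F}) (ts : seq F) (e : F -> nat) :
  uniq ts -> (forall t, t \in ts -> ('X - t%:P) ^+ e t %| h) ->
  \prod_(t <- ts) ('X - t%:P) ^+ e t %| h.
Proof.
elim: ts => [|t ts IH] /=; first by rewrite big_nil dvd1p.
move=> /andP[tts uts] ht; rewrite big_cons Gauss_dvdp.
  by rewrite ht ?mem_head //= IH // => s sts; apply: ht; rewrite inE sts orbT.
apply: coprimep_expl; rewrite coprimep_sym coprimep_XsubC.
elim: ts tts {IH uts ht} => [|s ts IH]; first by rewrite big_nil root1.
rewrite inE negb_or => /andP[ts0 /IH h0]; rewrite big_cons rootM negb_or h0 andbT.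
by rewrite rootE !hornerE expf_neq0 // subr_eq0.
Qed.

Lemma root_count (S : seq (F * F)) :
  uniq S -> (forall P, P \in S -> jet_zero P) -> resultant p g != 0 ->
  (size S * M <= (size (resultant p g)).-1)%N.
Proof.
move=> uS hS r0.
pose fib t := [seq P.1 | P <- S & P.2 == t].
have fibS t : forall x, x \in fib t -> jet_zero (x, t).
  move=> x /mapP[[a b]]; rewrite mem_filter /= => /andP[/eqP-> h] ->; exact: hS.
have ufib t : uniq (fib t).
  rewrite map_inj_in_uniq ?filter_uniq // => -[a b] [c d]; rewrite !mem_filter /=.
  by move=> /andP[/eqP-> _] /andP[/eqP-> _] ->.
pose ts := undup [seq P.2 | P <- S].
have D : \prod_(t <- ts) ('X - t%:P) ^+ (M * size (fib t)) %| resultant p g.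
  by apply: prod_XsubC_dvd => [|t _]; [exact: undup_uniq | apply: resultant_fiber; [exact: ufib | exact: fibS]].
have sz : size (\prod_(t <- ts) ('X - t%:P) ^+ (M * size (fib t))) = (\sum_(t <- ts) M * size (fib t)).+1.
  elim: (ts) => [|t s IH]; first by rewrite !big_nil size_poly1.
  rewrite !big_cons size_mul ?IH ?size_exp_XsubC ?addSn ?addnS //.
    by rewrite expf_neq0 // polyXsubC_eq0.
  by rewrite -size_poly_eq0 IH.
have := dvdp_leq r0 D; rewrite sz => h; rewrite -ltnS prednK; last by rewrite size_poly_gt0.
apply: leq_trans h; rewrite ltnS mulnC -big_distrr /= leq_mul2l; apply/orP; right.
have -> : size S = (\sum_(t <- ts) count (fun P => P.2 == t) S)%N.
  under eq_bigr => t _ do rewrite -sum1_count big_mkcond.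
  rewrite exchange_big /= -sum1_size big_seq [RHS]big_seq; apply: eq_bigr => P PS.
  under eq_bigr => t _ do rewrite eq_sym.
  rewrite -big_mkcond sum1_count -[LHS](_ : count_mem P.2 ts = 1%N) //.
  by rewrite count_uniq_mem ?undup_uniq // mem_undup map_f.
by apply: leq_sum => t _; rewrite /fib size_map size_filter.
Qed.

End RootCount.

Lemma separable_of_no_common_root (K : closedFieldType) (q : {poly K}) :
  (forall x, root q x -> q^`().[x] != 0) -> separable_poly q.
Proof.
move=> h; rewrite unlock; apply/negPn/negP => /closed_rootP[x].
by rewrite root_gcd => /andP[/h] /negP nx; rewrite rootE.
Qed.

Lemma closed_root_nonroot (K : closedFieldType) (q w : {poly K}) :
  w != 0 -> (size w < size q)%N -> separable_poly q ->
  exists2 x, root q x & w.[x] != 0.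
Proof.
move=> w0 sw sq; have [r qE] := closed_field_poly_normal q.
have q0 : q != 0 by rewrite -size_poly_gt0; case: (size q) sw.
have lq : lead_coef q != 0 by rewrite lead_coef_eq0.
have ur : uniq r.
  by rewrite -separable_prod_XsubC -(eqp_separable (eqp_scale _ lq)) -qE.
have sr : size q = (size r).+1 by rewrite qE size_scale // size_prod_XsubC.
have [/allP h|/allPn[x xr hx]] := boolP (all (root w) r).
  by move: sw; rewrite sr ltnS leqNgt (max_poly_roots w0 (introT allP h) ur).
by exists x => //; rewrite qE rootZ // root_prod_XsubC.
Qed.

Lemma filtration_exp (B : comNzRingType) (P : nat -> B -> Prop) d (x : B) m :
  filtration P -> P d x -> P (m * d)%N (x ^+ m).
Proof.
move=> [P1 _ _ _ PM] hx; elim: m => [|m IH]; first by rewrite expr0.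
by rewrite exprS mulSn; apply: PM.
Qed.

Lemma filtration_natmul (B : comNzRingType) (P : nat -> B -> Prop) d (x : B) m :
  filtration P -> P d x -> P d (x *+ m).
Proof.
by move=> [_ P0 PD _ _] hx; elim: m => [|m IH]; rewrite ?mulr0n // mulrS; apply: PD.
Qed.

Lemma filtration_iter (B : comNzRingType) (D : B -> B) (P : nat -> B -> Prop) d e (f : B) i :
  P d f -> (forall l g, P l g -> P (e + l)%N (D g)) -> P (d + i * e)%N (iter i D f).
Proof.
move=> hf hD'; elim: i => [|i IH]; first by rewrite mul0n addn0.
by rewrite iterS (_ : d + i.+1 * e = e + (d + i * e))%N; [exact: hD' | lia].
Qed.

Section CurveDerivationDegrees.

Variables (C : comNzRingType) (p : {poly {poly C}}).

Lemma curve_der_size n l (g : {poly {poly C}}) :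
  (size p <= n.+1)%N -> (size g <= l.+1)%N -> (size (curve_der p g) <= (n + l).+1)%N.
Proof.
move=> sp hg; have sd : (size (diff_t g) <= l.+1)%N by rewrite (leq_trans (size_poly _ _)).
have sd' : (size (diff_t p) <= n.+1)%N by rewrite (leq_trans (size_poly _ _)).
have s1 : (size p^`() <= n)%N by rewrite (leq_trans (size_poly _ _)) //; move: sp; case: (size p).
have s2 : (size g^`() <= l)%N by rewrite (leq_trans (size_poly _ _)) //; move: hg; case: (size g).
rewrite (leq_trans (size_polyD _ _)) // size_polyN geq_max; apply/andP; split.
  by rewrite (leq_trans (size_polyMleq _ _)) // (leq_trans (leq_pred _)) // -addnS leq_add.
by rewrite (leq_trans (size_polyMleq _ _)) // (leq_trans (leq_pred _)) // -addSn leq_add.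
Qed.

Lemma curve_der_coef (P : nat -> {poly C} -> Prop) tau l (g : {poly {poly C}}) :
  filtration P -> (forall k c, P k c -> P k c^`()) ->
  (forall i, P tau p`_i) -> (forall i, P l g`_i) -> forall i, P (tau + l)%N (curve_der p g)`_i.
Proof.
move=> fP Pd hp hg i; have [_ _ fD fN fM] := coef_filtration fP.
apply: (fD (tau + l)%N) => [|{}i].
  by apply: (fM tau l) => j; rewrite ?coef_deriv ?coef_diff_t; [apply: filtration_natmul | apply: Pd].
apply: fN; apply: (fM tau l) => j; rewrite ?coef_deriv ?coef_diff_t; first exact: Pd.
exact: filtration_natmul.
Qed.

Lemma monom2_size k1 b n : (0 < k1)%N -> (b < n * k1)%N -> (size (monom2 C k1 b) <= n.+1)%N.
Proof.
move=> k0 bn; rewrite /monom2 mulrC mul_polyC.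
by apply: leq_trans (size_scale_leq _ _) _; rewrite size_polyXn ltnS ltnW // ltn_divLR.
Qed.

Lemma monom2_coef k1 b i : (0 < k1)%N -> (size ((monom2 C k1 b)`_i)%R <= k1.+1)%N.
Proof.
move=> k0; rewrite /monom2 coefMC coefXn.
by case: eqP => _; rewrite ?mul1r ?mul0r ?size_poly0 // size_polyXn ltnS ltnW // ltn_mod.
Qed.

Lemma deriv_size_filtration k (c : {poly C}) : (size c <= k.+1)%N -> (size c^`() <= k.+1)%N.
Proof. by move=> h; rewrite (leq_trans (size_poly _ _)) // (leq_trans (leq_pred _)). Qed.

End CurveDerivationDegrees.

Section FpCurve.

Variables (q : nat) (pq : prime q).
Let F := 'F_q.
Variables (p : {poly {poly F}}) (n tau k1 M : nat).
Hypotheses (n0 : (0 < n)%N) (sp : size p = n.+1) (ctau : forall i, (size (p`_i)%R <= tau.+1)%N).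
Hypotheses (k0 : (0 < k1)%N) (ML : (n * k1)%N = M.+1) (Mq : (M < q)%N).
Variables (r1 r2 : {poly F}) (a1 b1 a2 b2 : {poly {poly F}}).
Hypotheses (r1E : r1%:P = a1 * p + b1 * curve_wronskian p k1 M.+1)
  (r2E : r2%:P = a2 * p + b2 * p^`()) (r10 : r1 != 0) (r20 : r2 != 0).

Let D := curve_der p.
Let hD : derivation D := curve_derP p.
Let u (b : 'I_M.+1) : {poly {poly F}} := monom2 F k1 b.
Let v (b : 'I_M.+1) : {poly {poly F}} := u b ^+ q.
Let W := frobenius_wronskian D u v.

Let charF : q%:R = 0 :> F. Proof. exact: pchar_Fp_0. Qed.

Let Dv b : D (v b) = 0.
Proof.
have H m : (0 < m)%N -> D (u b ^+ m) = u b ^+ m.-1 * D (u b) *+ m.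
  by case: m => // m _; rewrite (derX hD).
by rewrite /v H ?prime_gt0 // -mulr_natr -!polyC_natr charF !polyC0 mulr0.
Qed.

(** Over an algebraic closure, take a fibre [t0] where [r1], [r2] and the leading coefficients do
    not vanish: it has [n] simple points, and [w], of smaller degree, is nonzero at one of them.
    There the Wronskian is nonzero, so some iterated derivative of [W] is. At the least such order
    Leibniz leaves only [w] times that derivative, although [w * W] is flat as a multiple of [p].
    The only binomial coefficient involved is 1, so the characteristic does no harm. *)
Lemma frobenius_no_syzygy : no_syzygy p W.
Proof.
have [K [iota _]] := countable_algebraic_closure ('F_q).
move=> w a wW sw; apply/eqP/negPn/negP => w0.
pose i2 : {rmorphism {poly {poly F}} -> {poly {poly K}}} := map_poly (map_poly iota).
pose mi : {rmorphism {poly F} -> {poly K}} := map_poly iota.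
pose lw := lead_coef w.
pose test : {poly K} := mi (r1 * r2 * lead_coef p * lw).
have test0 : test != 0.
  rewrite map_poly_eq0 !mulf_neq0 ?lead_coef_eq0 //.
  by rewrite -size_poly_eq0 sp.
have [t0] := closed_nonrootP _ test0.
rewrite rootE /test !rmorphM !hornerM !mulf_eq0 !negb_or -!andbA => /and4P[r1t r2t lpt lwt].
pose qt := map_poly (horner_eval t0) (i2 p).
pose wt := map_poly (horner_eval t0) (i2 w).
have evE (f : {poly {poly F}}) x : (map_poly (horner_eval t0) (i2 f)).[x] = ((i2 f).[x%:P]).[t0].
  have xe : horner_eval t0 x%:P = x by rewrite /horner_eval hornerC.
  by move: (horner_map (horner_eval t0) (i2 f) x%:P) => /=; rewrite xe.
have lead_ev (f : {poly {poly F}}) : f != 0 -> (mi (lead_coef f)).[t0] != 0 ->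
    size (map_poly (horner_eval t0) (i2 f)) = size f.
  move=> f0 h; rewrite /i2 /= -map_poly_comp size_map_poly_id0 //.
have sq : size qt = n.+1 by rewrite lead_ev // -size_poly_eq0 sp.
have sw' : size wt = size w by rewrite lead_ev.
have wt0 : wt != 0 by rewrite -size_poly_eq0 sw' size_poly_eq0.
have evr (r : {poly F}) (x : K) : ((i2 r%:P).[x%:P]).[t0] = (mi r).[t0].
  by rewrite /i2 /= map_polyC /= hornerC.
have sep : separable_poly qt.
  apply: separable_of_no_common_root => x; rewrite rootE => /eqP qx.
  apply: contraNneq r2t => qx'; rewrite -(evr r2 x) r2E rmorphD !rmorphM /= !hornerE.
  have hp : ((i2 p).[x%:P]).[t0] = 0 by rewrite -evE.
  have hp' : ((i2 p^`()).[x%:P]).[t0] = 0.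
    by rewrite -evE -[RHS]qx'; congr (_.[_]); rewrite /qt /i2 /= -!deriv_map.
  by rewrite /= in hp hp'; rewrite hp hp' !mulr0 addr0.
have [|x0 qx0 wx0] := closed_root_nonroot wt0 _ sep; first by rewrite sw' sq -sp.
pose ev : {rmorphism {poly {poly F}} -> K} := (horner_eval t0 \o horner_eval x0%:P \o i2)%FUN.
have evP f : ev f = (map_poly (horner_eval t0) (i2 f)).[x0] by rewrite evE.
have evp : ev p = 0 by rewrite evP; apply/eqP.
have evw : ev w != 0 by rewrite evP.
have evW : ev (wronskian D u) != 0.
  apply: contraNneq r1t => h; have := congr1 ev r1E.
  have h' : ev (curve_wronskian p k1 M.+1) = 0 by exact: h.
  rewrite (rmorphD ev) !(rmorphM ev) evp h' !mulr0 addr0.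
  by move=> <-; rewrite -(evr r1 x0).
have evv : exists b, ev (v b) != 0.
  exists ord0; rewrite rmorphXn expf_neq0 // /u /monom2 div0n mod0n !expr0 mul1r.
  by rewrite polyC1 rmorph1 oner_neq0.
have [i iM hi] := frobenius_wronskian_nonvanish hD Dv evW evv.
have [m hm mmin] := ex_minnP (ex_intro (fun i => ev (iter i D W) != 0) i hi).
have pflat : flat D ev p.
  by move=> [|j]; rewrite ?iterSr /D ?curve_der_self ?(iter_der0 hD) ?rmorph0.
have := flatM hD a pflat m; rewrite -wW (leibniz hD) rmorph_sum big_ord_recl big1 ?addr0.
  by rewrite subn0 bin0 mulr1n rmorphM => /eqP; rewrite mulf_eq0 (negPf evw) (negPf hm).
move=> j _; rewrite rmorphMn rmorphM.
have lt : (m - lift ord0 j < m)%N by rewrite lift0; move: (ltn_ord j); clear; lia.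
have [/mmin|] := boolP (ev (iter (m - lift ord0 j) D W) != 0); first by rewrite leqNgt lt.
by move/negPn/eqP => ->; rewrite mulr0 mul0rn.
Qed.

(** The terms in the degree bound for the resultant that do not grow with [q]. *)
Definition curve_error : nat := (M * (n + M * n) * tau + n * (M * (k1 + M * tau)))%N.

Lemma frobenius_wronskian_bound (P : nat -> {poly {poly F}} -> Prop) d e :
  filtration P -> (forall b, P d (u b)) -> (forall l g, P l g -> P (e + l)%N (D g)) ->
  (forall l m f, (l <= m)%N -> P l f -> P m f) ->
  P (q * d + M * (d + M * e))%N W.
Proof.
move=> fP hu hD' mono; pose r (i : 'I_M.+1) := if i == 0 :> nat then (q * d)%N else (d + M * e)%N.
have -> : (q * d + M * (d + M * e) = \sum_i r i)%N.
  by rewrite big_ord_recl /r /= sum_nat_const card_ord.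
apply: (filtration_det fP) => i b; rewrite mxE /r; case: eqP => i0.
  exact: filtration_exp.
apply: (mono (d + i.-1 * e)%N); last exact: filtration_iter.
by rewrite leq_add2l leq_mul2r; apply/orP; right; move: (ltn_ord i); lia.
Qed.

Lemma size_frobenius_wronskian : (size W <= (q * n + M * (n + M * n)).+1)%N.
Proof.
apply: (@frobenius_wronskian_bound (fun l (f : {poly {poly F}}) => size f <= l.+1)%N).
- exact: size_filtration.
- by move=> b; apply: monom2_size; rewrite // ML; exact: ltn_ord.
- by move=> l g hg; apply: curve_der_size; rewrite // sp.
- by move=> l m f lm h; apply: leq_trans h _; rewrite ltnS.
Qed.

Lemma coef_frobenius_wronskian i : (size (W`_i)%R <= (q * k1 + M * (k1 + M * tau)).+1)%N.
Proof.
move: i; have fP := coef_filtration (size_filtration F).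
apply: (@frobenius_wronskian_bound (fun l (f : {poly {poly F}}) => forall i, size (f`_i)%R <= l.+1)%N) => //.
- by move=> b i; apply: monom2_coef.
- move=> l g hg; apply: (curve_der_coef (size_filtration F)) => //.
  by move=> m c; apply: deriv_size_filtration.
- by move=> l m f lm h i; apply: leq_trans (h i) _; rewrite ltnS.
Qed.

(** Each point counts [M = n * k1 - 1] times, so for large [q] and [k1] there are about
    [q * (1 + tau / k1)] points: a large [k1] gives the leading constant 1, where counting fibre by
    fibre gives [n]. *)
Lemma curve_count (S : seq (F * F)) : uniq S ->
  (forall P, P \in S -> (p.[P.1%:P]).[P.2] = 0 /\ (p^`().[P.1%:P]).[P.2] != 0) ->
  (size S * M <= q * (n * (k1 + tau)) + curve_error)%N.
Proof.
move=> uS hS; have res0 : resultant p W != 0.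
  by apply: resultant_neq0; [rewrite -size_poly_eq0 sp | exact: frobenius_no_syzygy].
have charM i : (0 < i <= M)%N -> i%:R != 0 :> F.
  move=> /andP[i0 iM]; rewrite -(dvdn_pcharf (pchar_Fp pq)); apply/negP => /(dvdn_leq i0).
  by rewrite leqNgt (leq_ltn_trans iM Mq).
apply: (leq_trans (root_count sp charM uS _ res0)).
  move=> [x t] /hS[/= h1 h2]; split=> //= i iM.
  pose ev : {rmorphism {poly {poly F}} -> F} := (horner_eval t \o horner_eval x%:P)%FUN.
  apply: (frobenius_wronskian_vanish (ev := ev) hD Dv _ iM) => b.
  rewrite rmorphXn /=; have := expf_card (ev (u b) : 'F_q); rewrite card_Fp //.
have := filtration_resultant (size_filtration F) ctau coef_frobenius_wronskian.
have := size_frobenius_wronskian; rewrite sp /=.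
case: (size (resultant p W)) => //= l; rewrite ltnS => hW h.
have {}h : (l <= (size W).-1 * tau + n * (q * k1 + M * (k1 + M * tau)))%N by [].
apply: leq_trans h _; rewrite /curve_error.
have : ((size W).-1 * tau <= (q * n + M * (n + M * n)) * tau)%N.
  by rewrite leq_mul2r; apply/orP; right; move: hW; case: (size W).
clear; lia.
Qed.

End FpCurve.

(** * Smooth points of a surface modulo primes *)

Lemma exists_nat_nonroot (R : idomainType) (p : {poly R}) :
  (forall n, n.+1%:R != 0 :> R) -> p != 0 -> exists2 a : nat, (a < size p)%N & p.[a%:R] != 0.
Proof.
move=> char0 p0; pose s := [seq a%:R : R | a <- iota 0 (size p)].
have us : uniq s.
  rewrite map_inj_uniq ?iota_uniq // => a b /eqP; rewrite -subr_eq0.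
  wlog ab : a b / (a <= b)%N => [W|].
    by case: (leqP a b) => [/W//|/ltnW/W h e]; apply/esym/h; rewrite -oppr_eq0 opprB.
  rewrite -oppr_eq0 opprB -natrB //; case E: (b - a)%N => [|k]; last by rewrite (negPf (char0 k)).
  by move=> _; lia.
have [/allP h|/allPn[x /mapP[a]]] := boolP (all (root p) s).
  by have := max_poly_roots p0 (introT allP h) us; rewrite size_map size_iota ltnn.
by rewrite mem_iota add0n => /andP[_ ap] -> h; exists a.
Qed.

Section Eval2.

Variables (k R : comNzRingType) (h : {rmorphism k -> R}).

Definition ev2 (a b : R) (p : {poly {poly k}}) : R :=
  (map_poly (horner_eval b \o map_poly h) p).[a].

HB.instance Definition _ a b := GRing.RMorphism.copy (ev2 a b)
  (horner_eval a \o map_poly (horner_eval b \o map_poly h))%FUN.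

Lemma ev2CC a b (c : k) : ev2 a b c%:P%:P = h c.
Proof. by rewrite /ev2 /= map_polyC /= map_polyC /= /horner_eval !hornerC. Qed.

Lemma ev2X a b : ev2 a b 'X = a.
Proof. by rewrite /ev2 /= map_polyX /horner_eval hornerX. Qed.

Lemma ev2CX a b : ev2 a b 'X%:P = b.
Proof. by rewrite /ev2 /= map_polyC /= map_polyX /horner_eval hornerC hornerX. Qed.

End Eval2.

Arguments ev2 : simpl never.

Lemma poly2_ind (k : comNzRingType) (P : {poly {poly k}} -> Prop) :
  (forall c, P c%:P%:P) -> P 'X -> P 'X%:P -> (forall p q, P p -> P q -> P (p + q)) ->
  (forall p q, P p -> P q -> P (p * q)) -> forall p, P p.
Proof.
move=> PC PX PY PD PM; elim/poly_ind => [|p c IH]; first by have := PC 0; rewrite !polyC0.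
apply: (PD) => //; first exact: PM.
elim/poly_ind: c => [|q c IHc]; first by have := PC 0; rewrite !polyC0.
by rewrite polyCD polyCM; apply: (PD) => //; apply: PM.
Qed.

Lemma ev2_unique (k R : comNzRingType) (f g : {rmorphism {poly {poly k}} -> R}) :
  (forall c, f c%:P%:P = g c%:P%:P) -> f 'X = g 'X -> f 'X%:P = g 'X%:P -> f =1 g.
Proof.
move=> hC hX hY; elim/poly2_ind => // p q hp hq; first by rewrite !rmorphD /= hp hq.
by rewrite !rmorphM /= hp hq.
Qed.

Lemma ev2_comp (k R S : comNzRingType) (h : {rmorphism k -> R}) (g : {rmorphism R -> S}) a b p :
  g (ev2 h a b p) = ev2 (g \o h)%FUN (g a) (g b) p.
Proof.
move: p; apply: (@ev2_unique _ _ (g \o ev2 h a b)%FUN) => [c||].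
- by rewrite /= !ev2CC.
- by rewrite /= !ev2X.
- by rewrite /= !ev2CX.
Qed.

Lemma exists_nat_nonroot2 (R : idomainType) (p : {poly {poly R}}) N :
  (forall n, n.+1%:R != 0 :> R) -> p != 0 -> (size p <= N)%N -> (forall i, size (p`_i)%R <= N)%N ->
  exists a b : nat, [/\ (a < N)%N, (b < N)%N & ev2 idfun a%:R b%:R p != 0].
Proof.
move=> char0 p0 sp sc.
have char0' n : n.+1%:R != 0 :> {poly R} by rewrite -polyC_natr polyC_eq0.
have [a aN pa] := exists_nat_nonroot char0' p0.
have s1 : (size (p.[a%:R])%R <= N)%N.
  rewrite horner_coef; apply: leq_trans (size_sum _ _ _) _; apply/bigmax_leqP => i _.
  by rewrite -natrX mulrC mulr_natl -scaler_nat (leq_trans (size_scale_leq _ _)).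
have [b bN pb] := exists_nat_nonroot char0 pa.
exists a, b; split; [exact: leq_trans sp | exact: leq_trans s1 |].
apply: contraNneq pb => <-; apply/eqP.
have -> : p.[a%:R].[b%:R] = (horner_eval b%:R \o horner_eval a%:R)%FUN p by [].
apply: ev2_unique => [c||].
- by rewrite /= ev2CC /horner_eval !hornerC.
- by rewrite /= ev2X /horner_eval hornerX -polyC_natr hornerC.
- by rewrite /= ev2CX /horner_eval hornerC hornerX.
Qed.

Section Pencil.

Variables (k : comNzRingType) (y0 z0 : k).

(* [y := y0 + t], [z := z0 + l t]: the lines through [(y0, z0)], with outer variable [t] and inner
   variable the slope [l]. *)
Definition pencil (p : {poly {poly k}}) : {poly {poly k}} :=
  ev2 (polyC \o polyC)%FUN ('X + y0%:P%:P) (z0%:P%:P + 'X%:P * 'X) p.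

HB.instance Definition _ := GRing.RMorphism.copy pencil
  (ev2 (polyC \o polyC)%FUN ('X + y0%:P%:P) (z0%:P%:P + 'X%:P * 'X)).

Lemma pencilCC (c : k) : pencil c%:P%:P = c%:P%:P. Proof. by rewrite /pencil ev2CC. Qed.
Lemma pencilX : pencil 'X = 'X + y0%:P%:P. Proof. by rewrite /pencil ev2X. Qed.
Lemma pencilCX : pencil 'X%:P = z0%:P%:P + 'X%:P * 'X. Proof. by rewrite /pencil ev2CX. Qed.
Lemma pencil_sub : pencil ('X - y0%:P%:P) = 'X.
Proof. by rewrite rmorphB /= pencilX pencilCC addrK. Qed.

Lemma pencil_eval (R : comNzRingType) (h : {rmorphism k -> R}) (t l : R) (c : {poly {poly k}}) :
  ev2 h t l (pencil c) = ev2 h (t + h y0) (h z0 + l * t) c.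
Proof.
move: c; apply: (@ev2_unique _ _ (ev2 h t l \o pencil)%FUN) => [c||].
- by rewrite /= pencilCC !ev2CC.
- by rewrite /= pencilX rmorphD /= !ev2X ev2CC.
- by rewrite /= pencilCX rmorphD rmorphM /= ev2CC !ev2CX ev2X.
Qed.

(** Conversely [t = y - y0] and [l = (z - z0) / (y - y0)], so a power of [t] clears the
    denominators. *)
Lemma pencil_denominator (c : {poly {poly k}}) : exists N c', 'X ^+ N * c = pencil c'.
Proof.
elim/poly2_ind: c => [c|||p q [N [p' hp]] [N' [q' hq]]|p q [N [p' hp]] [N' [q' hq]]].
- by exists 0%N, c%:P%:P; rewrite expr0 mul1r pencilCC.
- by exists 0%N, ('X - y0%:P%:P); rewrite expr0 mul1r pencil_sub.
- exists 1%N, ('X%:P - z0%:P%:P); rewrite rmorphB /= pencilCX pencilCC.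
  by rewrite expr1 addrC addKr mulrC.
- exists (N + N')%N, (('X - y0%:P%:P) ^+ N' * p' + ('X - y0%:P%:P) ^+ N * q').
  rewrite rmorphD !rmorphM !rmorphXn /= pencil_sub -hp -hq exprD; ring.
- exists (N + N')%N, (p' * q'); rewrite rmorphM /= -hp -hq exprD; ring.
Qed.

End Pencil.

Arguments pencil : simpl never.

Section PencilField.

Variables (k : fieldType) (y0 z0 : k).
Hypothesis char0 : forall n, n.+1%:R != 0 :> k.

Lemma pencil_inj : injective (pencil y0 z0).
Proof.
apply: raddf_inj => c h; apply/eqP/negPn/negP => c0.
have e0 : c * ('X - y0%:P%:P) != 0 by rewrite mulf_neq0 // polyXsubC_eq0.
pose N := maxn (size (c * ('X - y0%:P%:P))) (\max_(i < size (c * ('X - y0%:P%:P))) size ((c * ('X - y0%:P%:P))`_i)%R).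
have [||a [b [_ _]]] := @exists_nat_nonroot2 _ _ N char0 e0; first by rewrite leq_maxl.
  move=> i; have [hi|hi] := ltnP i (size (c * ('X - y0%:P%:P))).
    by rewrite leq_max orbC (leq_bigmax (Ordinal hi)).
  by rewrite nth_default // size_poly0.
rewrite rmorphM mulf_eq0 negb_or => /andP[h1 h2].
have h3 : a%:R - y0 != 0.
  by move: h2; rewrite rmorphB /= ev2X ev2CC.
have := pencil_eval y0 z0 (idfun : {rmorphism k -> k}) (a%:R - y0) ((b%:R - z0) / (a%:R - y0)) c.
rewrite h rmorph0 /= divfK // subrK addrC subrK => /esym/eqP.
by rewrite (negPf h1).
Qed.

Lemma map_pencil_denominator (v : {poly {poly {poly k}}}) :
  exists N v', [/\ ('X ^+ N)%:P * v = map_poly (pencil y0 z0) v' & (size v' <= size v)%N].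
Proof.
elim/poly_ind: v => [|v c [N [v' [hv sv]]]].
  by exists 0%N, 0; rewrite mulr0 map_poly0 size_poly0.
have [N' [c' hc]] := pencil_denominator y0 z0 c.
exists (N + N')%N, ((('X - y0%:P%:P) ^+ N')%:P * v' * 'X + (('X - y0%:P%:P) ^+ N * c')%:P).
split.
  rewrite rmorphD !rmorphM /= map_polyX !map_polyC /= !rmorphXn /= pencil_sub -hv -hc.
  by rewrite exprD !polyCM !rmorphXn /=; ring.
have [v0|v0] := eqVneq v 0.
  move: sv; rewrite v0 size_poly0 leqn0 size_poly_eq0 => /eqP->.
  rewrite mulr0 !mul0r !add0r !size_polyC.
  have [c0|c0] := eqVneq c 0; last exact: leq_b1.
  move: hc; rewrite c0 mulr0 => hc0.
  have -> : c' = 0 by apply: pencil_inj; rewrite rmorph0 -hc0.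
  by rewrite mulr0 eqxx.
rewrite size_MXaddC (negPf v0) /=.
apply: leq_trans (size_polyD _ _) _; rewrite geq_max; apply/andP; split.
  rewrite (leq_trans (size_polyMleq _ _)) // size_polyX addn2 /= ltnS.
  by rewrite mul_polyC (leq_trans (size_scale_leq _ _)).
by rewrite (leq_trans (size_polyC_leq1 _)).
Qed.

Variables (f : {poly {poly {poly k}}}) (n : nat).
Hypotheses (sf : size f = n.+1) (n0 : (0 < n)%N) (fP : ring_prime f).

(** The substitution is birational: clearing powers of [t] carries a factorization back to the
    original coordinates, where the prime [f] divides neither a power of [y - y0] nor a nonzero
    polynomial of smaller degree in the main variable. *)
Lemma pencil_irreducible (v w a : {poly {poly {poly k}}}) :
  v != 0 -> w != 0 -> (size v <= n)%N -> (size w <= n)%N ->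
  w * v <> a * map_poly (pencil y0 z0) f.
Proof.
move=> v0 w0 sv sw E.
have [N1 [v' [hv sv']]] := map_pencil_denominator v.
have [N2 [w' [hw sw']]] := map_pencil_denominator w.
have [N3 [a' [ha _]]] := map_pencil_denominator a.
pose Y : {poly {poly k}} := 'X - y0%:P%:P.
have tE : pencil y0 z0 Y = 'X by exact: pencil_sub.
have Xn0 N : ('X ^+ N)%:P != 0 :> {poly {poly {poly k}}}.
  by rewrite polyC_eq0 expf_neq0 // polyX_eq0.
have E' : (Y ^+ N3)%:P * (w' * v') = (Y ^+ (N1 + N2))%:P * (a' * f).
  apply: (@map_inj_poly _ _ (pencil y0 z0)); [exact: pencil_inj | exact: rmorph0 |].
  rewrite !rmorphM /= !map_polyC /= !rmorphXn /= tE -hv -hw -ha exprD !rmorphXn /=.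
  have -> : forall A B C : {poly {poly {poly k}}}, C * (A * w * (B * v)) = A * B * C * (w * v) by move=> *; ring.
  by rewrite E; ring.
have nz (u u' : {poly {poly {poly k}}}) N : ('X ^+ N)%:P * u = map_poly (pencil y0 z0) u' -> u != 0 -> u' != 0.
  by move=> h u0; apply: contraNneq u0 => u'0; move/eqP: h; rewrite u'0 map_poly0 mulf_eq0 (negPf (Xn0 N)).
have small (u : {poly {poly {poly k}}}) : u != 0 -> (size u <= n)%N -> ~ ring_dvd f u.
  move=> u0 su [c cE]; move: su; rewrite cE size_mul; last 2 first.
  - by case: fP.
  - by apply: contraNneq u0 => c0; rewrite cE c0 mulr0.
  have : (0 < size c)%N by rewrite size_poly_gt0; apply: contraNneq u0 => c0; rewrite cE c0 mulr0.
  by rewrite sf; lia.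
have [_ _ fpr] := fP.
have [||/fpr[]] := fpr (Y ^+ N3)%:P (w' * v').
- by exists ((Y ^+ (N1 + N2))%:P * a'); rewrite E'; ring.
- by apply: small; rewrite ?(leq_trans (size_polyC_leq1 _)) // polyC_eq0 expf_neq0 // polyXsubC_eq0.
- by apply: small; [exact: nz hw w0 | exact: leq_trans sw' sw].
- by apply: small; [exact: nz hv v0 | exact: leq_trans sv' sv].
Qed.

Variable x1 : k.
Hypotheses (fx1 : (map_poly (ev2 idfun y0 z0) f).[x1] = 0)
  (dfx1 : (map_poly (ev2 idfun y0 z0) f)^`().[x1] != 0).

Let char0C n' : n'.+1%:R != 0 :> {poly k}. Proof. by rewrite -polyC_natr polyC_eq0. Qed.

Lemma pencil_at0 (g : {poly {poly {poly k}}}) :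
  ((map_poly (pencil y0 z0) g).[x1%:P%:P]).[0] = ((map_poly (ev2 idfun y0 z0) g).[x1])%:P.
Proof.
elim/poly_ind: g => [|g c IH]; first by rewrite !map_poly0 !horner0.
rewrite !rmorphD !rmorphM /= !map_polyX !map_polyC /= !hornerE IH polyCD polyCM; congr (_ + _).
have -> : (pencil y0 z0 c).[0] = (horner_eval 0 \o pencil y0 z0)%FUN c by [].
have -> : (ev2 idfun y0 z0 c)%:P = (polyC \o ev2 idfun y0 z0)%FUN c by [].
apply: ev2_unique => [{}c||].
- by rewrite /= pencilCC ev2CC /horner_eval hornerC.
- by rewrite /= pencilX ev2X /horner_eval !hornerE.
- by rewrite /= pencilCX ev2CX /horner_eval !hornerE.
Qed.

(** All lines of the pencil pass through [(y0, z0)], so [x1] at [t = 0] is a smooth point of the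
    generic curve of the pencil whose coordinates do not involve the slope; it serves as the base
    point for flatness over [{poly k}]. *)
Lemma pencil_wronskian_no_syzygy k1 : (0 < k1)%N ->
  no_syzygy (map_poly (pencil y0 z0) f) (curve_wronskian (map_poly (pencil y0 z0) f) k1 (n * k1)).
Proof.
apply: (@curve_wronskian_no_syzygy _ _ n x1%:P) => //.
- by rewrite size_map_inj_poly ?rmorph0 //; exact: pencil_inj.
- exact: pencil_irreducible.
- by rewrite pencil_at0 fx1 polyC0.
- by rewrite deriv_map pencil_at0 polyC_eq0 -deriv_map.
Qed.

End PencilField.

Section NormPowers.

Variables (B : comNzRingType) (N : B -> nat) (T : nat).
Hypotheses (nN : ring_norm N) (T2 : (2 <= T)%N).

Let T0 : (0 < T)%N. Proof. exact: ltnW. Qed.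

(** Heights are recorded as exponents of one base [T], taken so large that a factorial, the size of
    a polynomial or a factor 2 is absorbed by one extra factor [T]. *)
Lemma norm_pow_mono e e' x : (e <= e')%N -> (N x <= T ^ e)%N -> (N x <= T ^ e')%N.
Proof. by move=> ee h; apply: leq_trans h _; rewrite leq_pexp2l. Qed.

Lemma norm_powM e e' x y : (N x <= T ^ e -> N y <= T ^ e' -> N (x * y)%R <= T ^ (e + e'))%N.
Proof. by case: nN => _ _ _ _ NM hx hy; rewrite expnD (leq_trans (NM _ _)) // leq_mul. Qed.

Lemma norm_powB e x y : (N x <= T ^ e -> N y <= T ^ e -> N (x - y)%R <= T ^ e.+1)%N.
Proof.
case: nN => _ _ ND NN _ hx hy; rewrite (leq_trans (ND _ _)) // NN expnS.
by apply: leq_trans (leq_mul T2 (leqnn _)); rewrite mul2n -addnn leq_add.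
Qed.

Lemma norm_pow_det e n (A : 'M[B]_n) : (n`! <= T)%N -> (forall i j, N (A i j) <= T ^ e)%N ->
  (N (\det A) <= T ^ (n * e).+1)%N.
Proof.
move=> nT hA; rewrite (leq_trans (norm_det nN hA)) // expnS leq_mul //.
by rewrite -expnM mulnC.
Qed.

Lemma norm_pow_resultant e (p g : {poly B}) :
  (((size g).-1 + (size p).-1)`! <= T)%N ->
  (forall i, N p`_i <= T ^ e)%N -> (forall i, N g`_i <= T ^ e)%N ->
  (N (resultant p g) <= T ^ (((size g).-1 + (size p).-1) * e).+1)%N.
Proof.
case: (nN) => N0 _ _ _ _ hT hp hg; apply: norm_pow_det => // i j; rewrite Sylvester_mxE.
by case: (split i) => u; case: (u <= j)%N; rewrite ?mulr1n ?mulr0n ?N0 ?hp ?hg.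
Qed.

Lemma norm_pow_deriv e (p : {poly B}) : (size p <= T)%N ->
  (poly_norm N p <= T ^ e)%N -> (poly_norm N p^`() <= T ^ e.+1)%N.
Proof.
by move=> sp h; rewrite (leq_trans (poly_norm_deriv nN _)) // expnS leq_mul.
Qed.

Lemma norm_pow_diff_t e (p : {poly {poly B}}) : (forall i, size (p`_i)%R <= T)%N ->
  (poly_norm (poly_norm N) p <= T ^ e)%N -> (poly_norm (poly_norm N) (diff_t p) <= T ^ e.+1)%N.
Proof.
move=> sp h; have sd : (size (diff_t p) <= size p)%N by exact: size_poly.
rewrite (poly_norm_widen (poly_normP nN) sd) expnS (leq_trans _ (leq_mul (leqnn T) h)) //.
rewrite big_distrr /=; apply: leq_sum => i _; rewrite coef_diff_t.
by rewrite (leq_trans (poly_norm_deriv nN _)) // leq_mul.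
Qed.

End NormPowers.

Definition norm1 := poly_norm (fun z : int => `|z|%N).
Definition norm2 := poly_norm norm1.
Definition norm3 := poly_norm norm2.
Definition norm1P : ring_norm norm1 := poly_normP int_norm.
Definition norm2P : ring_norm norm2 := poly_normP norm1P.
Definition norm3P : ring_norm norm3 := poly_normP norm2P.

Lemma filtration_ev2 (k R : comNzRingType) (h : {rmorphism k -> R}) (P : nat -> R -> Prop)
    (a b : R) da db dy dz (c : {poly {poly k}}) :
  filtration P -> (forall l m x, (l <= m)%N -> P l x -> P m x) -> (forall x, P 0%N (h x)) ->
  P da a -> P db b -> (size c <= dy.+1)%N -> (forall i, size (c`_i)%R <= dz.+1)%N ->
  P (dz * db + dy * da)%N (ev2 h a b c).
Proof.
move=> fP mono hC ha hb sc sc'; rewrite /ev2 horner_coef; apply: (filtration_sum fP) => i _.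
have [_ _ _ _ fM] := fP; apply: (fM); last first.
  apply: (mono (i * da)%N); last exact: filtration_exp.
  rewrite leq_mul2r -ltnS; apply/orP; right; apply: leq_trans (ltn_ord i) _.
  by rewrite (leq_trans (size_poly _ _)).
rewrite coef_map /= /horner_eval horner_coef; apply: (filtration_sum fP) => j _.
rewrite coef_map; apply: (mono (0 + j * db)%N); last first.
  by apply: (fM 0%N (j * db)%N); [exact: hC | exact: (filtration_exp _ fP hb)].
rewrite add0n leq_mul2r -ltnS; apply/orP; right; apply: leq_trans (ltn_ord j) _.
by rewrite (leq_trans (size_poly _ _)).
Qed.

Lemma norm_ev2 (R : comNzRingType) (N : R -> nat) (h : {rmorphism int -> R}) (a b : R) T dy dz
    (c : {poly {poly int}}) :
  ring_norm N -> (0 < T)%N -> (forall x, N (h x) <= `|x|)%N -> (N a <= T)%N -> (N b <= T)%N ->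
  (size c <= dy.+1)%N -> (forall i, size (c`_i)%R <= dz.+1)%N ->
  (N (ev2 h a b c) <= norm2 c * T ^ (dz + dy))%N.
Proof.
move=> nN T0 hC ha hb sc sc'; case: (nN) => N0 N1 ND NN NM.
rewrite /ev2 horner_coef (leq_trans (norm_sum nN _ _ _)) //.
have sm : (size (map_poly (horner_eval b \o map_poly h) c) <= size c)%N by exact: size_poly.
rewrite /norm2 /poly_norm big_distrl /=.
rewrite (leq_trans _ (_ : \sum_(i < size (map_poly (horner_eval b \o map_poly h) c)) norm1 c`_i * T ^ (dz + dy) <= _)%N) //; last first.
  rewrite (big_ord_widen (size c) (fun i => norm1 c`_i * T ^ (dz + dy))%N) //.
  by rewrite [X in (_ <= X)%N](bigID (fun i : 'I_(size c) => (i < size (map_poly (horner_eval b \o map_poly h) c))%N)) /= leq_addr.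
apply: leq_sum => i _; rewrite (leq_trans (NM _ _)) // expnD mulnA leq_mul //; last first.
  rewrite (leq_trans (norm_exp nN _ _)) // (leq_trans (_ : _ <= T ^ i)%N) //.
    by case: (nat_of_ord i) => // m; rewrite leq_exp2r.
  rewrite leq_pexp2l // -ltnS; apply: leq_trans (ltn_ord i) _; exact: leq_trans sm sc.
rewrite coef_map /= /horner_eval horner_coef (leq_trans (norm_sum nN _ _ _)) //.
have sm' : (size (map_poly h (c`_i)%R) <= size (c`_i)%R)%N by exact: size_poly.
rewrite /norm1 /poly_norm big_distrl /=.
rewrite (leq_trans _ (_ : \sum_(j < size (map_poly h (c`_i)%R)) `|((c`_i)`_j)%R| * T ^ dz <= _)%N) //; last first.
  rewrite (big_ord_widen (size (c`_i)%R) (fun j => `|((c`_i)`_j)%R| * T ^ dz)%N) //.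
  by rewrite [X in (_ <= X)%N](bigID (fun j : 'I_(size (c`_i)%R) => (j < size (map_poly h (c`_i)%R))%N)) /= leq_addr.
apply: leq_sum => j _; rewrite (leq_trans (NM _ _)) // leq_mul //; first by rewrite coef_map; exact: hC.
rewrite (leq_trans (norm_exp nN _ _)) // (leq_trans (_ : _ <= T ^ j)%N) //.
  by case: (nat_of_ord j) => // m; rewrite leq_exp2r.
rewrite leq_pexp2l // -ltnS; apply: leq_trans (ltn_ord j) _; exact: leq_trans sm' _.
Qed.

Definition degrees3 (A : nzRingType) (d : nat) (f : {poly {poly {poly A}}}) : Prop :=
  [/\ (size f <= d.+1)%N, forall i, (size (f`_i)%R <= d.+1)%N
    & forall i j, (size (f`_i`_j)%R <= d.+1)%N].

Lemma prime_no_syzygy (A B : idomainType) (h : {rmorphism A -> B}) (f g : {poly A}) :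
  injective h -> ring_prime (map_poly h f) -> ~ ring_dvd (map_poly h f) (map_poly h g) ->
  no_syzygy f g.
Proof.
move=> hI [f0 fU fP] ndg w a E sw; apply/eqP/negPn/negP => w0.
have inj : injective (map_poly h) by apply: map_inj_poly => //; exact: rmorph0.
have [|[c cE]|//] := fP (map_poly h w) (map_poly h g).
  by exists (map_poly h a); rewrite -!rmorphM /= E mulrC.
have w0' : map_poly h w != 0 by rewrite -(rmorph0 (map_poly h)) (inj_eq inj).
have c0 : c != 0 by apply: contraNneq w0' => c0; rewrite cE c0 mulr0.
have : size (map_poly h w) = size (map_poly h f * c) by rewrite cE.
rewrite size_mul // !size_map_inj_poly ?rmorph0 // => e.
have : (0 < size c)%N by rewrite size_poly_gt0.
by move: sw e; move: (size w) (size f) (size c); clear; lia.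
Qed.

Lemma size_lt_not_dvd (A : idomainType) (f g : {poly A}) :
  g != 0 -> (size g < size f)%N -> ~ ring_dvd f g.
Proof.
move=> g0 sg [c cE]; have c0 : c != 0 by apply: contraNneq g0 => c0; rewrite cE c0 mulr0.
have f0 : f != 0 by rewrite -size_poly_gt0; case: (size f) sg.
move: sg; rewrite cE size_mul //; have : (0 < size c)%N by rewrite size_poly_gt0.
by move: (size f) (size c); clear; lia.
Qed.

Lemma elim_size (C : idomainType) (p g : {poly {poly C}}) (r : {poly C}) n m d :
  (size p <= n.+1)%N -> (size g <= m.+1)%N ->
  (forall i, size (p`_i)%R <= d.+1)%N -> (forall i, size (g`_i)%R <= d.+1)%N ->
  r = resultant p g \/ r = g`_0 -> (size r <= (d + (n + m) * d).+1)%N.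
Proof.
move=> sp sg hp hg [->|->]; last by apply: leq_trans (hg 0%N) _; rewrite ltnS leq_addr.
have := filtration_resultant (size_filtration C) hp hg => h.
apply: leq_trans h _; rewrite ltnS -mulnDl (leq_trans _ (leq_addl _ _)) // leq_mul2r.
by apply/orP; right; move: sp sg; case: (size p) => [|a]; case: (size g) => [|b] /=; lia.
Qed.

Lemma elim_coef (C : idomainType) (p g : {poly {poly {poly C}}}) (r : {poly {poly C}}) n m d e :
  (size p <= n.+1)%N -> (size g <= m.+1)%N ->
  (forall i j, size (p`_i`_j)%R <= d.+1)%N -> (forall i j, size (g`_i`_j)%R <= e.+1)%N ->
  r = resultant p g \/ r = g`_0 -> (forall j, size (r`_j)%R <= (e + (n + m) * (d + e)).+1)%N.
Proof.
move=> sp sg hp hg [->|->] j; last by apply: leq_trans (hg 0%N j) _; rewrite ltnS leq_addr.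
have := @filtration_resultant _ _ (coef_filtration (size_filtration C)) d e p g hp hg => h.
apply: leq_trans (h j) _; rewrite ltnS (leq_trans _ (leq_addl _ _)) //.
move: sp sg; case: (size p) => [|a]; case: (size g) => [|b] /=; clear; nia.
Qed.

Lemma elim_norm (p g : {poly {poly {poly int}}}) (r : {poly {poly int}}) n m T e :
  (2 <= T)%N -> ((n + m)`! <= T)%N -> (size p <= n.+1)%N -> (size g <= m.+1)%N ->
  (norm3 p <= T ^ e)%N -> (norm3 g <= T ^ e)%N ->
  r = resultant p g \/ r = g`_0 -> (norm2 r <= T ^ ((n + m) * e + e).+1)%N.
Proof.
move=> T2 fT sp sg hp hg; have T0 : (0 < T)%N by exact: ltnW.
have cp i : (norm2 p`_i <= T ^ e)%N by apply: leq_trans (norm_coef norm2P _ _) hp.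
have cg i : (norm2 g`_i <= T ^ e)%N by apply: leq_trans (norm_coef norm2P _ _) hg.
case=> ->; last by apply: (norm_pow_mono T2 _ (cg 0%N)); lia.
have le : ((size g).-1 + (size p).-1 <= n + m)%N.
  by move: sp sg; case: (size p) => [|a]; case: (size g) => [|b] /=; lia.
have f' : (((size g).-1 + (size p).-1)`! <= T)%N.
  by apply: leq_trans fT; apply: leq_fact.
apply: leq_trans (norm_pow_resultant norm2P f' cp cg) _.
rewrite leq_pexp2l //.
by rewrite ltnS (leq_trans _ (leq_addr _ _)) // leq_mul2r le orbT.
Qed.

Lemma no_syzygy_map (A B : idomainType) (h : {rmorphism A -> B}) (p g : {poly A}) :
  injective h -> no_syzygy (map_poly h p) (map_poly h g) -> no_syzygy p g.
Proof.
move=> hI syz w a E sw; have inj : injective (map_poly h) by apply: map_inj_poly => //; exact: rmorph0.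
apply: inj; rewrite rmorph0; apply: (syz _ (map_poly h a)); first by rewrite -!rmorphM E.
by rewrite !size_map_inj_poly ?rmorph0.
Qed.

Lemma ev2_map (k k' R : comNzRingType) (g : {rmorphism k -> k'}) (h : {rmorphism k' -> R}) a b c :
  ev2 h a b (map_poly (map_poly g) c) = ev2 (h \o g)%FUN a b c.
Proof.
move: c; apply: (@ev2_unique _ _ (ev2 h a b \o map_poly (map_poly g))%FUN) => [c||].
- by rewrite /= map_polyC /= map_polyC /= !ev2CC.
- by rewrite /= map_polyX !ev2X.
- by rewrite /= map_polyC /= map_polyX !ev2CX.
Qed.

Lemma pencil_map (k k' : comNzRingType) (g : {rmorphism k -> k'}) y0 z0 c :
  map_poly (map_poly g) (pencil y0 z0 c) = pencil (g y0) (g z0) (map_poly (map_poly g) c).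
Proof.
move: c; apply: (@ev2_unique _ _ (map_poly (map_poly g) \o pencil y0 z0)%FUN
    (pencil (g y0) (g z0) \o map_poly (map_poly g))%FUN) => [c||].
- by rewrite /= pencilCC !map_polyC /= !map_polyC /= pencilCC.
- by rewrite /= pencilX map_polyX pencilX rmorphD /= map_polyX !map_polyC /= map_polyC.
- rewrite /= pencilCX map_polyC /= map_polyX pencilCX rmorphD rmorphM /= !map_polyC /=.
  by rewrite map_polyC !map_polyX.
Qed.

Lemma curve_det_filtration (C : comNzRingType) (p : {poly {poly C}}) k1 L d e
    (P : nat -> {poly {poly C}} -> Prop) :
  filtration P -> (forall b, (b < L)%N -> P d (monom2 C k1 b)) ->
  (forall l g, P l g -> P (e + l)%N (curve_der p g)) ->
  (forall l m f, (l <= m)%N -> P l f -> P m f) ->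
  P (L * (d + L * e))%N (curve_wronskian p k1 L).
Proof.
move=> fP hu hD mono.
have -> : (L * (d + L * e) = \sum_(i < L) (d + L * e))%N by rewrite sum_nat_const card_ord.
apply: (filtration_det fP) => i b; rewrite mxE.
apply: (mono (d + i * e)%N); first by rewrite leq_add2l leq_mul2r ltnW ?orbT.
by apply: filtration_iter => //; apply: hu.
Qed.

Lemma pencil_filtration (k : comNzRingType) (y0 z0 : k) (P : nat -> {poly {poly k}} -> Prop)
    da db dy dz (c : {poly {poly k}}) :
  filtration P -> (forall l m x, (l <= m)%N -> P l x -> P m x) -> (forall x : k, P 0%N x%:P%:P) ->
  P da ('X + y0%:P%:P) -> P db (z0%:P%:P + 'X%:P * 'X) ->
  (size c <= dy.+1)%N -> (forall i, size (c`_i)%R <= dz.+1)%N ->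
  P (dz * db + dy * da)%N (pencil y0 z0 c).
Proof. move=> fP mono hC ha hb sc sc'; exact: (@filtration_ev2 _ _ (polyC \o polyC)%FUN P _ _ da db dy dz c fP mono hC ha hb sc sc'). Qed.

Lemma pencil_norm (y0 z0 : int) T dy dz (c : {poly {poly int}}) :
  (0 < T)%N -> (norm2 ('X + y0%:P%:P) <= T)%N -> (norm2 (z0%:P%:P + 'X%:P * 'X) <= T)%N ->
  (size c <= dy.+1)%N -> (forall i, size (c`_i)%R <= dz.+1)%N ->
  (norm2 (pencil y0 z0 c) <= norm2 c * T ^ (dz + dy))%N.
Proof.
move=> T0 ha hb sc sc'; apply: (norm_ev2 norm2P) => // x.
by rewrite /= /norm2 (poly_normC norm1P) /norm1 (poly_normC int_norm).
Qed.

Lemma pencil_size_t (k : comNzRingType) (y0 z0 : k) dy dz (c : {poly {poly k}}) :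
  (size c <= dy.+1)%N -> (forall i, size (c`_i)%R <= dz.+1)%N ->
  (size (pencil y0 z0 c) <= (dz + dy).+1)%N.
Proof.
move=> sc sc'; have := @pencil_filtration _ y0 z0 _ 1 1 dy dz c (size_filtration {poly k}).
rewrite !muln1; apply => //.
- by move=> l m x lm h; apply: leq_trans h _; rewrite ltnS.
- by move=> x; rewrite size_polyC_leq1.
- by rewrite size_XaddC.
- rewrite addrC size_MXaddC; case: ifP => // _; rewrite ltnS.
  by rewrite (leq_trans (size_polyC_leq1 _)).
Qed.

Lemma pencil_size_l (k : comNzRingType) (y0 z0 : k) dy dz (c : {poly {poly k}}) j :
  (size c <= dy.+1)%N -> (forall i, size (c`_i)%R <= dz.+1)%N ->
  (size ((pencil y0 z0 c)`_j)%R <= dz.+1)%N.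
Proof.
move=> sc sc'; move: j.
have := @pencil_filtration _ y0 z0 _ 0 1 dy dz c (coef_filtration (size_filtration k)).
rewrite muln1 muln0 addn0; apply => //.
- by move=> l m x lm h j; apply: leq_trans (h j) _; rewrite ltnS.
- by move=> x j; rewrite coefC; case: eqP; rewrite ?size_poly0 // size_polyC_leq1.
- by move=> j; rewrite coefD coefX coefC; case: j => [|[|j]] /=; rewrite ?add0r ?addr0 ?size_polyC_leq1 // ?size_poly0 // size_poly1.
- by move=> j; rewrite coefD coefC coefMX coefC; case: j => [|[|j]] /=; rewrite ?add0r ?addr0 ?size_polyX ?size_poly0 // (leq_trans (size_polyC_leq1 _)).
Qed.

Section PencilData.

Variables (n d k1 : nat).
Hypotheses (n0 : (0 < n)%N) (k0 : (0 < k1)%N).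

Let L := (n * k1)%N.
(** [mW] bounds the degree of the Wronskian in the main variable, [Ny] the size of the polynomial
    that the base point has to avoid, and [Bg] every size and factorial argument that [T] absorbs.
    [eW] and [ePi] are exponents of [T] for the heights of the Wronskian and of [Pi]; [lPi] bounds
    the degree of [Pi] in the slope. *)
Let mW := (L * (n + L * n))%N.
Let Ny := (2 * d + (n + n) * (d + d)).+1.
Let Bg := (n + mW + n + L + k1 + L * (2 * d) + 2 * d + d + Ny + L * n + 10)%N.
Let eW := (L * (L * (2 * d + 4))).+1.
Let e1 := (eW + 2 * d + 1)%N.
Let ePi := (((n + mW) * e1 + e1).+1 + (((n + n) * 2 + 2).+1 + ((d + (n + n) * (d + d)) + (d + (n + n) * d))) + (2 * d).+1)%N.
Let lPi := ((L * (0 + L * d) + (n + mW) * (d + L * (0 + L * d))) + (d + (n + n) * (d + d)) + d)%N.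

Variables (f : {poly {poly {poly int}}}) (H : nat).
Let T := (Bg`! * H.+1)%N.
Hypotheses (sf : size f = n.+1) (df : degrees3 d f)
  (fP : ring_prime (map_poly (map_poly (map_poly intr)) f : {poly {poly {poly algC}}}))
  (fH : (norm3 f <= H)%N).

Let BgT : (Bg <= T)%N.
Proof. by rewrite (leq_trans (fact_geq Bg)) // leq_pmulr. Qed.

Let T2 : (2 <= T)%N. Proof. by apply: leq_trans BgT; rewrite /Bg; lia. Qed.
Let T0 : (0 < T)%N. Proof. exact: ltnW. Qed.

Let factT m : (m <= Bg)%N -> (m`! <= T)%N.
Proof. by move=> h; rewrite (leq_trans (leq_fact h)) // leq_pmulr. Qed.

Let char0i m : m.+1%:R != 0 :> int. Proof. by rewrite pnatr_eq0. Qed.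
Let char0p m : m.+1%:R != 0 :> {poly {poly int}}.
Proof. by rewrite -!polyC_natr !polyC_eq0. Qed.

Let iota : {rmorphism int -> algC} := intr.
Let iota_inj : injective iota. Proof. exact: intr_inj. Qed.
Let h2 : {rmorphism {poly {poly int}} -> {poly {poly algC}}} := map_poly (map_poly iota).
Let h2_inj : injective h2.
Proof. by apply: map_inj_poly; [apply: map_inj_poly; [exact: iota_inj | exact: rmorph0] | exact: rmorph0]. Qed.

Let f0 : f != 0. Proof. by rewrite -size_poly_eq0 sf. Qed.
Let sf' : (size f^`() <= n)%N.
Proof. by rewrite (leq_trans (size_poly _ _)) // sf. Qed.

Let fx0 : f^`() != 0.
Proof.
apply/eqP => /(congr1 (fun g : {poly {poly {poly int}}} => g`_n.-1)).
rewrite coef_deriv coef0 prednK // -mulr_natr => /eqP; rewrite mulf_eq0.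
have -> : f`_n = lead_coef f by rewrite lead_coefE sf.
by rewrite lead_coef_eq0 (negPf f0) -[n]prednK // (negPf (char0p _)).
Qed.

Let syz_fx : no_syzygy f f^`().
Proof.
apply: (prime_no_syzygy h2_inj fP); apply: size_lt_not_dvd.
  by rewrite -(rmorph0 (map_poly h2)) (inj_eq (map_inj_poly h2_inj (rmorph0 _))).
by rewrite !size_map_inj_poly ?rmorph0 // sf ltnS.
Qed.

(* Modulo a prime not dividing the displayed coefficient of [Pi], the curves of the pencil satisfy the
   hypotheses of [curve_count] for all but [lPi] slopes. *)
Lemma pencil_data : exists (y0 z0 : nat) (r1 r2 : {poly {poly int}}) (a1 b1 a2 b2 : {poly {poly {poly int}}}) (i0 j0 : nat),
  let ft := map_poly (pencil y0%:Z z0%:Z) f in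
  let Pi := r1 * r2 * lead_coef ft in
  [/\ size ft = n.+1, forall i, (size (ft`_i)%R <= (2 * d).+1)%N,
      r1%:P = a1 * ft + b1 * curve_wronskian ft k1 (n * k1) /\ r2%:P = a2 * ft + b2 * ft^`(),
      Pi`_i0`_j0 != 0 /\ (`|(Pi`_i0`_j0)%R| <= T ^ ePi)%N
    & forall i, (size (Pi`_i)%R <= lPi.+1)%N].
Proof.
have [df0 df1 df2] := df.
have [|r2 [a2 [b2 [r20 r2E r2R]]]] := @elimination _ f f^`() _ syz_fx; first by rewrite sf ltnS.
have dfx i : (size ((f^`())`_i)%R <= d.+1)%N.
  by rewrite coef_deriv -mulr_natr -polyC_natr mulrC mul_polyC (leq_trans (size_scale_leq _ _)).
have dfx2 i j : (size ((f^`())`_i`_j)%R <= d.+1)%N.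
  rewrite coef_deriv coefMn; apply: (filtration_natmul _ (size_filtration _)); exact: df2.
have sfx : (size f^`() <= n.+1)%N by exact: leq_trans sf' _.
have sf1 : (size f <= n.+1)%N by rewrite sf.
have sr2 : (size r2 <= (d + (n + n) * d).+1)%N := elim_size sf1 sfx df1 dfx r2R.
have cr2 j : (size (r2`_j)%R <= (d + (n + n) * (d + d)).+1)%N := elim_coef sf1 sfx df2 dfx2 r2R j.
(* The base point must avoid [r2] and the leading coefficient: the fibre of [f] over it then has
   degree [n] and only simple points over [algC], one of which is [x1] below. *)
have q0 : r2 * lead_coef f != 0 by rewrite mulf_neq0 // lead_coef_eq0.
have [||y0 [z0 [y0N z0N evq]]] := @exists_nat_nonroot2 _ _ Ny char0i q0.
- rewrite (leq_trans (size_polyMleq _ _)) //.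
  have := df1 (size f).-1; rewrite -lead_coefE; move: sr2; rewrite /Ny.
  by move: (size r2) (size (lead_coef f)); clear; nia.
- have := (coef_filtration (size_filtration int)) => -[_ _ _ _ cM] i.
  have := cM _ _ _ _ cr2 (df2 (size f).-1) i; rewrite -lead_coefE.
  by move/leq_trans; apply; rewrite /Ny; clear; nia.
move: evq; rewrite rmorphM mulf_eq0 negb_or => /andP[evr2 evlc].
set ft := map_poly (pencil y0%:Z z0%:Z) f.
have pn0 (c : {poly {poly int}}) : ev2 idfun y0%:R z0%:R c != 0 -> pencil y0%:Z z0%:Z c != 0.
  apply: contraNneq => c0; have := pencil_eval y0%:Z z0%:Z (idfun : {rmorphism int -> int}) 0 0 c.
  by rewrite c0 rmorph0 /= add0r mul0r addr0 -!natz => <-.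
have plc : pencil y0%:Z z0%:Z (lead_coef f) != 0 := pn0 _ evlc.
have sft : size ft = n.+1 by rewrite size_map_poly_id0.
have lft : lead_coef ft = pencil y0%:Z z0%:Z (lead_coef f) by rewrite lead_coef_map_eq.
have tft i : (size (ft`_i)%R <= (2 * d).+1)%N.
  by rewrite coef_map mul2n -addnn; apply: pencil_size_t.
have cft i j : (size (ft`_i`_j)%R <= d.+1)%N by rewrite coef_map; exact: (pencil_size_l _ _ _ (df1 i)).
have evi c : ev2 iota y0%:R z0%:R c = iota (ev2 idfun y0%:R z0%:R c).
  move: c; apply: (@ev2_unique _ _ _ (iota \o ev2 idfun y0%:R z0%:R)%FUN) => [c||] /=.
  - by rewrite !ev2CC.
  - by rewrite !ev2X rmorph_nat.
  - by rewrite !ev2CX rmorph_nat.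
have evn0 c : ev2 idfun y0%:R z0%:R c != 0 -> ev2 iota y0%:R z0%:R c != 0.
  by rewrite evi -(rmorph0 iota) (inj_eq iota_inj).
have sg : size (map_poly (ev2 iota y0%:R z0%:R) f) = n.+1.
  by rewrite size_map_poly_id0 // evn0.
have [x1 rx1] : exists x, root (map_poly (ev2 iota y0%:R z0%:R) f) x.
  by apply/closed_rootP; rewrite sg eqSS -lt0n.
pose ev : {rmorphism {poly {poly {poly int}}} -> algC} := (horner_eval x1 \o map_poly (ev2 iota y0%:R z0%:R))%FUN.
have evf : ev f = 0 by exact/eqP.
have evfx : ev f^`() != 0.
  have := evn0 _ evr2; apply: contraNneq => h.
  have := congr1 ev r2E; rewrite (rmorphD ev) !(rmorphM ev) evf h !mulr0 addr0.
  by rewrite /ev /= map_polyC /= /horner_eval hornerC => ->.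
pose fA := map_poly h2 f.
have sfA : size fA = n.+1 by rewrite size_map_inj_poly ?rmorph0.
have evfA (g : {poly {poly {poly int}}}) : (map_poly (ev2 idfun y0%:R z0%:R) (map_poly h2 g)).[x1] = ev g.
  rewrite /ev /= /horner_eval -map_poly_comp; congr (_.[_]); apply: eq_map_poly => c /=.
  by rewrite ev2_map.
have ftA : map_poly h2 ft = map_poly (pencil y0%:R z0%:R) fA.
  by rewrite /ft /fA -!map_poly_comp; apply: eq_map_poly => c; rewrite /= pencil_map /= -!pmulrn.
have syzW : no_syzygy ft (curve_wronskian ft k1 (n * k1)).
  apply: (no_syzygy_map h2_inj); rewrite curve_wronskian_map ftA.
  have char0C m : m.+1%:R != 0 :> algC by rewrite pnatr_eq0.
  apply: (pencil_wronskian_no_syzygy char0C sfA n0 fP (x1 := x1)) => //.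
    by rewrite evfA evf.
  by rewrite /fA !deriv_map evfA.
have [|r1 [a1 [b1 [r10 r1E r1R]]]] := @elimination _ ft (curve_wronskian ft k1 (n * k1)) _ syzW.
  by rewrite sft ltnS.
pose Pi := r1 * pencil y0%:Z z0%:Z r2 * lead_coef ft.
have Pi0 : Pi != 0 by rewrite !mulf_neq0 ?pn0 // lft.
exists y0, z0, r1, (pencil y0%:Z z0%:Z r2), a1, b1, (map_poly (pencil y0%:Z z0%:Z) a2), (map_poly (pencil y0%:Z z0%:Z) b2).
exists (size Pi).-1, (size (lead_coef Pi)).-1.
rewrite /= -/ft -/Pi -[Pi`_ _]/(lead_coef Pi) -[(lead_coef Pi)`_ _]/(lead_coef (lead_coef Pi)).
have sW : (size (curve_wronskian ft k1 (n * k1)) <= mW.+1)%N.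
  apply: (@curve_det_filtration _ _ _ L n n (fun l (g : {poly {poly {poly int}}}) => size g <= l.+1)%N).
  - exact: size_filtration.
  - by move=> b; apply: monom2_size.
  - by move=> l g; apply: curve_der_size; rewrite sft.
  - by move=> l m g lm h; apply: leq_trans h _; rewrite ltnS.
have lW : forall i j, (size ((curve_wronskian ft k1 (n * k1))`_i`_j)%R <= (L * (0 + L * d)).+1)%N.
  have fl := coef_filtration (size_filtration int).
  apply: (@curve_det_filtration _ _ _ L 0 d (fun l (g : {poly {poly {poly int}}}) => forall i j, size (g`_i`_j)%R <= l.+1)%N).
  - exact: (coef_filtration fl).
  - move=> b _ i j; rewrite /monom2 coefMC coefXn; case: eqP => _; rewrite ?mul1r ?mul0r ?coef0 ?size_poly0 //.
    by rewrite coefXn; case: eqP => _; rewrite ?size_poly1 ?size_poly0.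
  - move=> l g hg; apply: (curve_der_coef fl) => // m c hc j.
    by rewrite coef_deriv; apply: (filtration_natmul _ (size_filtration int)).
  - by move=> l m g lm h i j; apply: leq_trans (h i j) _; rewrite ltnS.
split=> //.
- by split=> //; rewrite -map_polyC /= r2E rmorphD !rmorphM /= deriv_map.
- split; first by rewrite !lead_coef_eq0.
  apply: leq_trans (norm_coef int_norm _ _) _; apply: leq_trans (norm_coef norm1P _ _) _.
  rewrite -/norm2 /Pi.
  have nY : (norm2 ('X + (y0%:Z)%:P%:P : {poly {poly int}}) <= T)%N.
    have [_ _ ND _ _] := norm2P; apply: leq_trans (ND _ _) _.
    rewrite /norm2 (poly_normC norm1P) /norm1 (poly_normC int_norm).
    apply: leq_trans (leq_add (poly_normX norm1P) (leqnn _)) _.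
    by apply: leq_trans BgT; rewrite /Bg; move: y0N; clear; lia.
  have nZ : (norm2 ((z0%:Z)%:P%:P + 'X%:P * 'X : {poly {poly int}}) <= T)%N.
    have [_ _ ND _ NM] := norm2P; apply: leq_trans (ND _ _) _.
    have := NM 'X%:P 'X; rewrite /norm2 !(poly_normC norm1P) /norm1 (poly_normC int_norm) => h.
    apply: leq_trans (leq_add (leqnn _) h) _.
    apply: leq_trans (leq_add (leqnn _) (leq_mul (poly_normX int_norm) (poly_normX norm1P))) _.
    by apply: leq_trans BgT; rewrite /Bg; move: z0N; clear; lia.
  have nft : (norm3 ft <= T ^ (2 * d).+1)%N.
    rewrite /norm3 /poly_norm sft.
    apply: (@leq_trans (\sum_(i < n.+1) norm2 f`_i * T ^ (d + d))%N).
      by apply: leq_sum => i _; rewrite coef_map; apply: pencil_norm.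
    rewrite -big_distrl /= expnS mul2n -addnn leq_mul2r; apply/orP; right.
    have <- : norm3 f = (\sum_(i < n.+1) norm2 f`_i)%N by rewrite /norm3 /poly_norm sf.
    by rewrite (leq_trans fH) // (leq_trans (leqnSn _)) // leq_pmull // fact_gt0.
  have sDu b i : (b < L)%N -> (i <= L)%N -> (size (iter i (curve_der ft) (monom2 {poly int} k1 b) : {poly {poly {poly int}}})%R <= T)%N.
    move=> bL iL; apply: (@leq_trans (n + i * n).+1).
      apply: (@filtration_iter _ _ (fun l (g : {poly {poly {poly int}}}) => size g <= l.+1)%N).
        exact: monom2_size.
      by move=> l g; apply: curve_der_size; rewrite sft.
    apply: leq_trans BgT; have : (i * n <= L * n)%N by rewrite leq_mul2r iL orbT.
    by rewrite /Bg; move: (i * n)%N (L * n)%N => u v; clear; lia.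
  have tDu b i j : (i <= L)%N -> (size ((iter i (curve_der ft) (monom2 {poly int} k1 b))`_j)%R <= T)%N.
    move=> iL; apply: (@leq_trans (k1 + i * (2 * d)).+1).
      move: j; apply: (@filtration_iter _ _ (fun l (g : {poly {poly {poly int}}}) => forall j, size (g`_j)%R <= l.+1)%N).
        by move=> j; apply: monom2_coef.
      move=> l g hg; apply: (curve_der_coef (size_filtration {poly int})) => //.
      by move=> m c; apply: deriv_size_filtration.
    apply: leq_trans BgT; have : (i * (2 * d) <= L * (2 * d))%N by rewrite leq_mul2r iL orbT.
    by rewrite /Bg; move: (i * _)%N (L * (2 * d))%N => u v; clear; lia.
  have nDu b i : (b < L)%N -> (i <= L)%N ->
      (norm3 (iter i (curve_der ft) (monom2 {poly int} k1 b)) <= T ^ (i * (2 * d + 4)))%N.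
    move=> bL; elim: i => [|i IH] iL.
      have [_ _ _ _ NM] := norm3P; rewrite /= mul0n expn0 (leq_trans (NM _ _)) //.
      have h1 : (norm3 'X^(b %/ k1) <= 1)%N.
        rewrite (leq_trans (norm_exp norm3P _ _)) // -(exp1n (b %/ k1)).
        by case: (b %/ k1)%N => // m; rewrite leq_exp2r // (poly_normX norm2P).
      have h3 : (norm3 ('X^(b %% k1))%:P <= 1)%N.
        rewrite /norm3 (poly_normC norm2P) (leq_trans (norm_exp norm2P _ _)) // -(exp1n (b %% k1)).
        by case: (b %% k1)%N => // m; rewrite leq_exp2r // (poly_normX norm1P).
      by rewrite -[1%N]muln1 leq_mul.
    have {}IH := IH (ltnW iL); rewrite iterS.
    set g := iter i _ _ in IH *.
    have gx : (norm3 g^`() <= T ^ (i * (2 * d + 4)).+1)%N.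
      by apply: (norm_pow_deriv norm2P) => //; apply: sDu => //; exact: ltnW.
    have gt : (norm3 (diff_t g) <= T ^ (i * (2 * d + 4)).+1)%N.
      by apply: (norm_pow_diff_t norm1P) => // j; apply: tDu; exact: ltnW.
    have ftx : (norm3 ft^`() <= T ^ (2 * d).+2)%N.
      apply: (norm_pow_deriv norm2P) => //; rewrite sft.
      by apply: leq_trans BgT; rewrite /Bg; clear; lia.
    have ftt : (norm3 (diff_t ft) <= T ^ (2 * d).+2)%N.
      apply: (norm_pow_diff_t norm1P) => // j; apply: leq_trans (tft j) _.
      by apply: leq_trans BgT; rewrite /Bg; clear; lia.
    (* One application of [curve_der] multiplies by a derivative of [ft], of height at most
       [T ^ (2 * d).+2], differentiates [g] at the cost of one factor [T], and subtracts at the cost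
       of another. *)
    have -> : (i.+1 * (2 * d + 4) = ((2 * d).+2 + (i * (2 * d + 4)).+1).+1)%N.
      by rewrite mulSn; move: (i * _)%N => a; clear; lia.
    by apply: (norm_powB norm3P T2); apply: (norm_powM norm3P).
  have nW : (norm3 (curve_wronskian ft k1 (n * k1)) <= T ^ eW)%N.
    apply: (norm_pow_det norm3P) => [|i b]; first by apply: factT; rewrite /Bg; clear; lia.
    rewrite mxE; apply: leq_trans (nDu _ _ _ _) _ => //; first exact: ltnW.
    by rewrite leq_pexp2l // leq_mul2r ltnW ?orbT.
  have nr1 : (norm2 r1 <= T ^ ((n + mW) * e1 + e1).+1)%N.
    apply: (elim_norm T2 _ _ sW _ _ r1R).
    - by apply: factT; rewrite /Bg; clear; lia.
    - by rewrite sft.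
    - by apply: leq_trans nft _; rewrite leq_pexp2l // /e1; clear; lia.
    - by apply: leq_trans nW _; rewrite leq_pexp2l // /e1; clear; lia.
  have nf : (norm3 f <= T ^ 1)%N.
    by rewrite expn1 (leq_trans fH) // (leq_trans (leqnSn _)) // leq_pmull // fact_gt0.
  have nr2 : (norm2 r2 <= T ^ ((n + n) * 2 + 2).+1)%N.
    apply: (elim_norm T2 _ sf1 sfx _ _ r2R).
    - by apply: factT; rewrite /Bg; clear; lia.
    - by apply: leq_trans nf _; rewrite leq_pexp2l.
    - apply: (norm_pow_deriv norm2P) => //; rewrite sf.
      by apply: leq_trans BgT; rewrite /Bg; clear; lia.
  have nr2' : (norm2 (pencil y0%:Z z0%:Z r2) <=
      T ^ (((n + n) * 2 + 2).+1 + ((d + (n + n) * (d + d)) + (d + (n + n) * d))))%N.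
    apply: leq_trans (pencil_norm T0 nY nZ sr2 cr2) _; rewrite [X in (_ <= X)%N]expnD.
    by rewrite leq_mul2r nr2 orbT.
  apply: (norm_powM norm2P); first exact: (norm_powM norm2P).
  by apply: leq_trans nft; rewrite lead_coefE; exact: (norm_coef norm2P).
- have fl := coef_filtration (size_filtration int); have [_ _ _ _ fM] := fl.
  have cr2' : forall j, (size ((pencil y0%:Z z0%:Z r2)`_j)%R <= (d + (n + n) * (d + d)).+1)%N.
    by move=> j; exact: (pencil_size_l _ _ _ sr2).
  have cr1 := elim_coef (eq_leq sft) sW cft lW r1R.
  by apply: (fM) => [|j]; [exact: fM | rewrite lead_coefE; exact: cft].
Qed.

End PencilData.

Lemma leq_card_bigcup (T I : finType) (P : pred I) (A : I -> {set T}) :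
  (#|\bigcup_(i | P i) A i| <= \sum_(i | P i) #|A i|)%N.
Proof.
elim/big_ind2: _ => [|x a y b xa yb|//]; first by rewrite cards0.
by rewrite (leq_trans (leq_card_setU _ _)) // leq_add.
Qed.

Lemma leq_card_fibers (X T : finType) (A : {set X * T}) n :
  (forall t, #|[set x | (x, t) \in A]| <= n)%N -> (#|A| <= #|T| * n)%N.
Proof.
move=> h; apply: (@leq_trans #|\bigcup_t [set (x, t) | x in [set x | (x, t) \in A]]|).
  apply/subset_leq_card/subsetP => -[x t] xtA; apply/bigcupP; exists t => //.
  by apply/imsetP; exists x; rewrite ?inE.
rewrite (leq_trans (leq_card_bigcup _ _)) // -sum_nat_const leq_sum // => t _.
exact: leq_trans (leq_imset_card _ _) (h t).
Qed.

Section Evaluation3.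

Variables (k R : comNzRingType) (h : {rmorphism k -> R}).
Implicit Types x y z : R.

Definition ev3 x y z (p : {poly {poly {poly k}}}) : R := (map_poly (ev2 h y z) p).[x].

HB.instance Definition _ x y z := GRing.RMorphism.copy (ev3 x y z)
  (horner_eval x \o map_poly (ev2 h y z))%FUN.

Lemma ev3C x y z (c : {poly {poly k}}) : ev3 x y z c%:P = ev2 h y z c.
Proof. by rewrite /ev3 map_polyC hornerC. Qed.

Lemma ev3CCC x y z (c : k) : ev3 x y z c%:P%:P%:P = h c.
Proof. by rewrite ev3C ev2CC. Qed.

Lemma ev3X x y z : ev3 x y z 'X = x.
Proof. by rewrite /ev3 map_polyX hornerX. Qed.

Lemma ev3CX x y z : ev3 x y z 'X%:P = y.
Proof. by rewrite ev3C ev2X. Qed.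

Lemma ev3CCX x y z : ev3 x y z 'X%:P%:P = z.
Proof. by rewrite ev3C ev2CX. Qed.

Lemma ev3_horner x t l (p : {poly {poly {poly k}}}) :
  ((map_poly (map_poly (horner_eval l \o map_poly h)%FUN) p).[x%:P]).[t] = ev3 x t l p.
Proof.
have E : map_poly (horner_eval t) (map_poly (map_poly (horner_eval l \o map_poly h)%FUN) p) =
    map_poly (ev2 h t l) p.
  by rewrite -map_poly_comp; apply: eq_map_poly.
rewrite /ev3 -E -[in LHS]/(horner_eval t _) -horner_map /=.
by rewrite /horner_eval hornerC.
Qed.

Lemma ev3_pencil (y0 z0 : k) x t l (p : {poly {poly {poly k}}}) :
  ev3 x t l (map_poly (pencil y0 z0) p) = ev3 x (t + h y0) (h z0 + l * t) p.
Proof.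
rewrite /ev3 -map_poly_comp; congr (_.[_]); apply: eq_map_poly => c /=.
exact: pencil_eval.
Qed.

End Evaluation3.

Lemma card_roots (F : finFieldType) (p : {poly F}) n : p != 0 -> (size p <= n.+1)%N ->
  (#|[set x | root p x]| <= n)%N.
Proof.
move=> p0 sp; rewrite -ltnS; apply: leq_trans sp; rewrite cardE; apply: max_poly_roots => //.
  by apply/allP => x; rewrite mem_enum inE.
exact: enum_uniq.
Qed.

Lemma intr_Fp_eq0 (p : nat) (c : int) : prime p -> ((c%:~R : 'F_p) == 0) = (p %| `|c|)%N.
Proof.
move=> pp; rewrite (dvdn_pcharf (pchar_Fp pp)); case: c => m; rewrite ?NegzE ?rmorphN ?oppr_eq0 //=.
Qed.

Section SurfaceCount.

Variables (p : nat) (pp : prime p).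
Let F := 'F_p.
Let iF : {rmorphism int -> F} := intr.

(** Smooth in the direction of the main coordinate, which is what Hensel's lemma uses to solve for
    it. *)
Definition smooth_points (f : {poly {poly {poly int}}}) : {set F * (F * F)} :=
  [set u | (ev3 iF u.1 u.2.1 u.2.2 f == 0) && (ev3 iF u.1 u.2.1 u.2.2 f^`() != 0)].

Variables (n d k1 M l : nat).
Hypotheses (n0 : (0 < n)%N) (k0 : (0 < k1)%N) (ML : (n * k1)%N = M.+1) (Mp : (M < p)%N).
Variables (f : {poly {poly {poly int}}}) (y0 z0 : int).
Hypothesis sf : (size f <= n.+1)%N.
Let ft := map_poly (pencil y0 z0) f.
Variables (r1 r2 : {poly {poly int}}) (a1 b1 a2 b2 : {poly {poly {poly int}}}).
Hypotheses (sft : size ft = n.+1) (tft : forall i, (size (ft`_i)%R <= d.+1)%N).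
Hypotheses (r1E : r1%:P = a1 * ft + b1 * curve_wronskian ft k1 (n * k1))
  (r2E : r2%:P = a2 * ft + b2 * ft^`()).
Let Pi := r1 * r2 * lead_coef ft.
Hypothesis lPi : forall i, (size (Pi`_i)%R <= l.+1)%N.
Variables (i0 j0 : nat).
Hypothesis Pi0 : iF Pi`_i0`_j0 != 0.

Let S := smooth_points f.
Let good x y z := (ev3 iF x y z f == 0) && (ev3 iF x y z f^`() != 0).

Let fib y z : (#|[set x | good x y z]| <= n)%N.
Proof.
have [->|[x0]] := set_0Vmem [set x | good x y z]; first by rewrite cards0.
rewrite inE => /andP[_ fx]; pose g : {poly F} := map_poly (ev2 iF y z) f.
have g0 : g != 0.
  by apply: contraNneq fx; rewrite /ev3 -deriv_map -/g => ->; rewrite deriv0 horner0.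
apply: leq_trans (card_roots g0 (leq_trans (size_poly _ _) sf)).
by apply/subset_leq_card/subsetP => x; rewrite !inE => /andP[].
Qed.

Let line lam : {set F * F} := [set w | good w.1 (w.2 + iF y0) (iF z0 + lam * w.2)].

Let hl lam : {rmorphism {poly int} -> F} := (horner_eval lam \o map_poly iF)%FUN.

Let line_triv lam : (#|line lam| <= p * n)%N.
Proof.
rewrite -[X in (_ <= X * _)%N](card_Fp pp); apply: leq_card_fibers => t.
by apply: leq_trans (fib (t + iF y0) (iF z0 + lam * t)); apply/subset_leq_card/subsetP => x; rewrite !inE.
Qed.

Let line_count lam : map_poly (hl lam) Pi != 0 ->
  (#|line lam| * M <= p * (n * (k1 + d)) + curve_error n d k1 M)%N.
Proof.
move=> Pl; have := Pl; rewrite !rmorphM !mulf_eq0 !negb_or => /andP[/andP[r10 r20] lc0].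
pose ftl := map_poly (map_poly (hl lam)) ft.
have sftl : size ftl = n.+1 by rewrite size_map_poly_id0.
have goodE x t : good x (t + iF y0) (iF z0 + lam * t) =
    ((ftl.[x%:P]).[t] == 0) && ((ftl^`().[x%:P]).[t] != 0).
  by rewrite /good /ftl deriv_map !ev3_horner /ft deriv_map !ev3_pencil.
rewrite cardE; apply: (@curve_count p pp ftl n d k1 M _ _ _ _ _ _ (map_poly (hl lam) r1)
  (map_poly (hl lam) r2) (map_poly (map_poly (hl lam)) a1) (map_poly (map_poly (hl lam)) b1)
  (map_poly (map_poly (hl lam)) a2) (map_poly (map_poly (hl lam)) b2)) => //.
- by move=> i; rewrite coef_map (leq_trans (size_poly _ _)).
- by rewrite -ML -curve_wronskian_map -!rmorphM -rmorphD -r1E /= map_polyC.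
- by rewrite /ftl deriv_map -!rmorphM -rmorphD -r2E /= map_polyC.
- exact: enum_uniq.
- by move=> [x t]; rewrite mem_enum inE /= goodE => /andP[/eqP-> ->].
Qed.

(** A point with [y] different from [y0] lies on exactly one of the lines indexed by a slope. The
    slopes that keep [Pi] nonzero are handled by the curve count; the at most [l] others and the
    line [y = y0] make up [l.+1] lines with the trivial bound [p * n]. *)
Lemma smooth_points_count :
  (#|S| * M <= p * (p * (n * (k1 + d)) + curve_error n d k1 M) + (l.+1 * (p * n)) * M)%N.
Proof.
pose Lam := [set lam : F | map_poly (hl lam) Pi == 0].
have cL : (#|Lam| <= l)%N.
  pose c : {poly F} := map_poly iF Pi`_i0.
  have c0 : c != 0.
    by apply: contraNneq Pi0 => /(congr1 (fun q : {poly F} => q`_j0)); rewrite coef_map coef0 => ->.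
  apply: leq_trans (card_roots c0 (leq_trans (size_poly _ _) (lPi i0))).
  apply/subset_leq_card/subsetP => lam; rewrite !inE => /eqP/(congr1 (fun q : {poly F} => q`_i0)).
  by rewrite coef_map coef0 /root => /eqP.
pose S0 : {set F * F} := [set w | good w.1 (iF y0) w.2].
have c0 : (#|S0| <= p * n)%N.
  rewrite -[X in (_ <= X * _)%N](card_Fp pp); apply: leq_card_fibers => z.
  by apply: leq_trans (fib (iF y0) z); apply/subset_leq_card/subsetP => x; rewrite !inE.
have cS : (#|S| <= #|S0| + \sum_lam #|line lam|)%N.
  apply: (@leq_trans #|[set (w.1, (iF y0, w.2)) | w in S0] :|:
     \bigcup_lam [set (w.1, (w.2 + iF y0, iF z0 + lam * w.2)) | w in line lam]|).
    apply/subset_leq_card/subsetP => -[x [y z]]; rewrite inE /= -/(good x y z) => gd.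
    rewrite inE; have [yy|yy] := eqVneq y (iF y0).
      by apply/orP; left; apply/imsetP; exists (x, z); rewrite ?inE /= -?yy.
    have ty : y - iF y0 != 0 by rewrite subr_eq0.
    apply/orP; right; apply/bigcupP; exists ((z - iF z0) / (y - iF y0)) => //.
    have E : iF z0 + (z - iF z0) / (y - iF y0) * (y - iF y0) = z by rewrite divfK // addrC subrK.
    by apply/imsetP; exists (x, y - iF y0); rewrite ?inE /= E subrK.
  rewrite (leq_trans (leq_card_setU _ _)) // leq_add ?leq_imset_card //.
  by rewrite (leq_trans (leq_card_bigcup _ _)) // leq_sum // => lam _; exact: leq_imset_card.
apply: leq_trans (leq_mul cS (leqnn M)) _.
rewrite (bigID (mem Lam)) /= addnA [X in (X <= _)%N]mulnDl addnC; apply: leq_add.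
  rewrite big_distrl /=.
  apply: (@leq_trans (\sum_(lam in F) (p * (n * (k1 + d)) + curve_error n d k1 M))%N); last first.
    by rewrite sum_nat_const (card_Fp pp).
  rewrite [X in (_ <= X)%N](bigID (mem Lam)) /= (leq_trans _ (leq_addl _ _)) //.
  by apply: leq_sum => lam; rewrite inE => lg; exact: line_count.
rewrite leq_mul2r; apply/orP; right; rewrite mulSn leq_add //.
apply: (@leq_trans (\sum_(lam in Lam) (p * n))%N); first by apply: leq_sum => lam _; exact: line_triv.
by rewrite sum_nat_const leq_mul2r cL orbT.
Qed.

End SurfaceCount.

(** [k1] is so large that [n * (k1 + 2 * d) / M] stays below [1 + 1 / Dd], with room for the
    lower-order terms once [p] is large. *)
Lemma count_arith n d Dd k1 M e l S p : (0 < n)%N -> (0 < Dd)%N -> (n * k1)%N = M.+1 ->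
  k1 = (2 * Dd * (2 * d + 2))%N ->
  (S * M <= p * (p * (n * (k1 + 2 * d)) + e) + l * (p * n) * M)%N ->
  (2 * Dd * (e + l * n * M) <= p)%N -> (S * Dd * M <= Dd.+1 * p ^ 2 * M)%N.
Proof.
move=> n0 D0 e1 k1E hS pE.
have h1 : (2 * (p * (p * (n * (k1 + 2 * d)) + e) + l * (p * n) * M) * Dd <=
    (2 * (n * (k1 + 2 * d) * Dd) + 1) * p ^ 2)%N.
  have -> : (2 * (p * (p * (n * (k1 + 2 * d)) + e) + l * (p * n) * M) * Dd =
     2 * (n * (k1 + 2 * d) * Dd) * p ^ 2 + p * (2 * Dd * (e + l * n * M)))%N by ring.
  by rewrite mulnDl mul1n leq_add2l expnS expn1 leq_mul2l pE orbT.
have h2 : (2 * (n * (k1 + 2 * d) * Dd) + 1 <= 2 * Dd.+1 * M)%N.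
  have e2 : (n * k1 = 4 * (Dd * d * n) + 4 * (Dd * n))%N by rewrite k1E; ring.
  have e3 : (n * (k1 + 2 * d) * Dd = Dd * (n * k1) + 2 * (Dd * d * n))%N by ring.
  have e4 : (2 * Dd.+1 * M = 2 * (Dd * M) + 2 * M)%N by rewrite -addn1; ring.
  have e5 : (Dd * M.+1 = Dd + Dd * M)%N by rewrite mulnS.
  have e6 : (Dd <= Dd * n)%N by rewrite leq_pmulr.
  rewrite e3 e4 e1 e5; rewrite e1 in e2; move: (Dd * d * n)%N (Dd * n)%N (Dd * M)%N D0 e2 e6.
  by clear; lia.
have h4 := leq_trans h1 (leq_mul h2 (leqnn (p ^ 2))).
have h5 := leq_mul hS (leqnn (2 * Dd)%N).
have h3 : (2 * (S * Dd * M) <= 2 * (Dd.+1 * p ^ 2 * M))%N.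
  have E1 : (2 * (S * Dd * M) = S * M * (2 * Dd))%N by ring.
  have E2 : (2 * (Dd.+1 * p ^ 2 * M) = 2 * Dd.+1 * M * p ^ 2)%N by ring.
  rewrite E1 E2 (leq_trans h5) // (leq_trans _ h4) //; apply: eq_leq; ring.
by rewrite leq_pmul2l // in h3.
Qed.

(* A substitute for the Lang-Weil bound; only the upper estimate matters. *)
Lemma smooth_points_bound (n d Dd : nat) : (0 < n)%N -> (0 < Dd)%N ->
  exists C0 e0 : nat, forall (f : {poly {poly {poly int}}}) (H : nat),
    size f = n.+1 -> degrees3 d f ->
    ring_prime (map_poly (map_poly (map_poly intr)) f : {poly {poly {poly algC}}}) ->
    (norm3 f <= H)%N ->
    exists c : nat, [/\ (0 < c)%N, (c <= (C0 * H.+1) ^ e0)%N &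
      forall p, prime p -> (C0 <= p)%N -> ~~ (p %| c)%N ->
        (#|smooth_points p f| * Dd <= Dd.+1 * p ^ 2)%N].
Proof.
move=> n0 D0; pose k1 := (2 * Dd * (2 * d + 2))%N.
have k0 : (0 < k1)%N by rewrite /k1 !muln_gt0 D0 addn_gt0 orbT.
have := @pencil_data n d k1 n0 k0.
set L := (n * k1)%N; set Bg := (n + _ + _ + _ + _ + _ + _ + _ + _ + _ + _)%N.
move=> PD.
have L0 : (0 < L)%N by rewrite muln_gt0 n0.
pose M := L.-1; have ML : L = M.+1 by rewrite prednK.
(* The exponent of the height and the degree in the slope are read off from [pencil_data] by
   unification. *)
evar (ep : nat); evar (lp : nat).
pose E := (curve_error n (2 * d) k1 M + (lp.+1 * n) * M)%N.
exists (Bg`! + M.+1 + 2 * Dd * E)%N, ep => f H sf df fP fH.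
have [y0 [z0 [r1 [r2 [a1 [b1 [a2 [b2 [i0 [j0]]]]]]]]]] := PD f H sf df fP fH.
set ft := map_poly _ f => /= -[sft tft [r1E r2E] [Pi0 PiT] lPi'].
have lPi : forall i, (size ((r1 * r2 * lead_coef ft)`_i)%R <= lp.+1)%N := lPi'.
exists `|((r1 * r2 * lead_coef ft)`_i0`_j0)%R|%N; split.
- by rewrite absz_gt0.
- apply: leq_trans PiT _; apply: (@leq_trans ((Bg`! * H.+1) ^ ep)%N); first exact: leqnn.
  case: (ep) => // m; rewrite leq_exp2r // leq_mul2r -addnA leq_addr orbT //.
move=> p pp pC pd.
have Pi0' : (intr (r1 * r2 * lead_coef ft)`_i0`_j0 : 'F_p) != 0.
  by rewrite intr_Fp_eq0.
have Mp : (M < p)%N by apply: leq_trans pC; lia.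
have := smooth_points_count pp n0 k0 ML Mp (eq_leq sf) sft tft r1E r2E lPi Pi0'.
have pE : (2 * Dd * E <= p)%N by apply: leq_trans pC; lia.
set S := #|_|; rewrite -/L => hS.
have M0 : (0 < M)%N.
  rewrite -ltnS -ML /L /k1; apply: leq_trans (leq_pmull _ n0); lia.
rewrite -(leq_pmul2r M0).
exact: (count_arith n0 D0 _ _ hS pE).
Qed.

(** * Divisibility of interpolation determinants *)

(** All rows of [G] are combinations of the same vectors [c s], with coefficients divisible by
    [P ^+ wt s], up to multiples of [P ^+ r]. In the multilinear expansion different rows must use
    different [s], so the loss against [r * #|G|] is at most the sum of all [r - wt s]. *)
Lemma det_gain N (S : finType) (wt : S -> nat) (P : int) (r : nat) (A : 'M[int]_N)
    (G : {set 'I_N}) (c : S -> 'I_N -> int) :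
  (forall s, (wt s <= r)%N) ->
  (forall j, j \in G -> exists (w : S -> int) (R : 'I_N -> int),
     forall k, A j k = \sum_s P ^+ wt s * w s * c s k + P ^+ r * R k) ->
  (P ^+ (r * #|G| - \sum_s (r - wt s))%N %| \det A)%Z.
Proof.
move=> wr hA.
have /fin_all_exists[w /fin_all_exists[R hR]] : forall j, exists (w : S -> int) (R : 'I_N -> int),
    j \in G -> forall k, A j k = \sum_s P ^+ wt s * w s * c s k + P ^+ r * R k.
  move=> j; have [jG|jG] := boolP (j \in G); last by exists (fun=> 0), (fun=> 0).
  by have [w [R h]] := hA j jG; exists w, R.
pose C j (t : S + 'I_N) : int := match t with
  | inl s => if j \in G then P ^+ wt s * w j s else 0
  | inr j' => if j' == j then (if j \in G then P ^+ r else 1) else 0 end.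
pose V (t : S + 'I_N) k : int := match t with
  | inl s => c s k | inr j => if j \in G then R j k else A j k end.
have -> : A = \matrix_(i, j) \sum_(t : S + 'I_N) C i t * V t j.
  apply/matrixP => j k; rewrite mxE big_sumType /= [X in _ + X](bigD1 j) //= eqxx.
  rewrite [X in _ + (_ + X)]big1 ?addr0 => [|i /negPf->]; last by rewrite mul0r.
  case: ifP => jG; first exact: hR.
  by rewrite big1 ?add0r ?mul1r // => s _; rewrite mul0r.
rewrite det_sum_rows; apply: rpred_sum => phi _.
have [inj|ninj] := boolP (injectiveb phi); last by rewrite det_rows_noninj // mulr0 dvdz0.
apply: dvdz_mulr; pose wt' (t : S + 'I_N) := if t is inl s then wt s else r.
have h : (P ^+ (\sum_(j in G) wt' (phi j))%N %| \prod_i C i (phi i))%Z.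
  rewrite (bigID (mem G)) /= dvdz_mulr //.
  elim/big_ind2: _ => [|a x b y ha hb|j jG]; first by rewrite expr0.
    by rewrite exprD dvdz_mul.
  rewrite /C; case: (phi j) => [s|j'] /=; first by rewrite jG dvdz_mulr.
  by case: eqP => _; rewrite ?jG ?dvdz0.
apply: dvdz_trans h; rewrite dvdz_exp2l // leq_subLR.
apply: (@leq_trans (\sum_(j in G) (r - wt' (phi j)) + \sum_(j in G) wt' (phi j))).
  rewrite -big_split /= mulnC -sum_nat_const leq_sum // => j _.
  by rewrite subnK // /wt'; case: (phi j).
rewrite leq_add2r.
have -> : (\sum_s (r - wt s) = \sum_(t : S + 'I_N) (r - wt' t))%N.
  by rewrite big_sumType /= [X in (_ + X)%N]big1 ?addn0 // => j _; rewrite subnn.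
rewrite -(big_imset (fun t => r - wt' t)%N (h := phi) (A := mem G)) /=; last first.
  by move=> x y _ _; apply/injectiveP.
by rewrite [X in (_ <= X)%N](bigID (mem [set phi x | x in G])) /= leq_addr.
Qed.

(* Loss caused by the monomials of degree below [r] in the two local parameters of a residue class. *)
Definition tri (r : nat) : nat := (\sum_(s : 'I_r * 'I_r) (r - minn r (s.1 + s.2)))%N.

Lemma triE r : (6 * tri r = r * r.+1 * r.+2)%N.
Proof.
have h1 m : (m <= r -> 2 * \sum_(b < r) (m - b) = m * m.+1)%N.
  move=> mr; rewrite -(subnK mr) addnC big_split_ord /= [X in (_ + X)%N]big1 ?addn0 => [|i _]; last first.
    by rewrite subnDA subnn.
  elim: m {mr} => [|m IH]; first by rewrite big_ord0.
  rewrite big_ord_recl subn0 mulnDr; under eq_bigr do rewrite lift0 subSS.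
  rewrite IH; ring.
have h2 : (2 * tri r = \sum_(a < r) (r - a) * (r - a).+1)%N.
  rewrite /tri -(pair_bigA _ (fun a b : 'I_r => r - minn r (a + b))%N) /= big_distrr /=.
  apply: eq_bigr => a _; rewrite -h1 ?leq_subr //; congr (_ * _)%N; apply: eq_bigr => b _; lia.
have h3 : (3 * \sum_(a < r) (r - a) * (r - a).+1 = r * r.+1 * r.+2)%N.
  elim: r {h1 h2} => [|m IH]; first by rewrite big_ord0.
  rewrite big_ord_recl subn0 mulnDr; under eq_bigr do rewrite lift0 subSS.
  rewrite IH; ring.
by rewrite -h3 -h2; ring.
Qed.

Lemma dvdz_mul_sub (P a b a' b' : int) :
  (P %| a - a')%Z -> (P %| b - b')%Z -> (P %| a * b - a' * b')%Z.
Proof.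
move=> ha hb; have -> : a * b - a' * b' = (a - a') * b + a' * (b - b') by ring.
apply: rpredD; [exact: dvdz_mulr | exact: dvdz_mull].
Qed.

Lemma dvdz_ev2_sub (a b a' b' P : int) (c : {poly {poly int}}) :
  (P %| a - a')%Z -> (P %| b - b')%Z -> (P %| ev2 idfun a b c - ev2 idfun a' b' c)%Z.
Proof.
move=> ha hb; elim/poly2_ind: c => [c|||p q hp hq|p q hp hq].
- by rewrite !ev2CC subrr dvdz0.
- by rewrite !ev2X.
- by rewrite !ev2CX.
- by rewrite !rmorphD opprD addrACA rpredD.
by rewrite !rmorphM; exact: dvdz_mul_sub.
Qed.

Lemma dvdz_ev3_sub (a b c a' b' c' P : int) (f : {poly {poly {poly int}}}) :
  (P %| a - a')%Z -> (P %| b - b')%Z -> (P %| c - c')%Z ->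
  (P %| ev3 idfun a b c f - ev3 idfun a' b' c' f)%Z.
Proof.
move=> ha hb hc; elim/poly_ind: f => [|f e IH]; first by rewrite !rmorph0 subrr dvdz0.
rewrite !rmorphD !rmorphM /= !ev3X !ev3C opprD addrACA rpredD //; last exact: dvdz_ev2_sub.
exact: dvdz_mul_sub.
Qed.

Lemma ev3_eqh (k R : comNzRingType) (h h' : {rmorphism k -> R}) x y z p :
  h =1 h' -> ev3 h x y z p = ev3 h' x y z p.
Proof.
move=> hh; rewrite /ev3; congr (_.[_]); apply: eq_map_poly => c.
move: c; apply: (@ev2_unique _ _ (ev2 h y z) (ev2 h' y z)) => [u||].
- by rewrite /= !ev2CC.
- by rewrite /= !ev2X.
- by rewrite /= !ev2CX.
Qed.

Lemma ev3_comp (k R S : comNzRingType) (h : {rmorphism k -> R}) (g : {rmorphism R -> S}) x y z p :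
  g (ev3 h x y z p) = ev3 (g \o h)%FUN (g x) (g y) (g z) p.
Proof.
elim/poly_ind: p => [|p c IH]; first by rewrite !rmorph0.
by rewrite !rmorphD !rmorphM /= IH !ev3X !ev3C ev2_comp.
Qed.

Lemma ev2_truncate (P Y Z Y' Z' : int) r (g : {poly {poly int}}) : Y = P * Y' -> Z = P * Z' ->
  exists R, ev2 idfun Y Z g = \sum_(s : 'I_r * 'I_r)
     P ^+ minn r (s.1 + s.2) * (P ^+ (s.1 + s.2 - r) * Y' ^+ s.1 * Z' ^+ s.2) * g`_s.1`_s.2 + P ^+ r * R.
Proof.
move=> YE ZE.
have tr (A : comNzRingType) (x : A) (p : {poly A}) : exists q, p.[x] = \sum_(i < r) p`_i * x ^+ i + x ^+ r * q.
  exists (drop_poly r p).[x]; rewrite -[in LHS](poly_take_drop r p) hornerD hornerM hornerXn mulrC.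
  by congr (_ + _); rewrite /take_poly horner_poly.
have [q qE] := tr _ Y (map_poly (horner_eval Z \o map_poly idfun) g).
have /fin_all_exists[q' q'E] : forall a : 'I_r, exists q', (g`_a).[Z] = \sum_(i < r) g`_a`_i * Z ^+ i + Z ^+ r * q'.
  by move=> a; exact: tr.
exists (\sum_(a < r) Z' ^+ r * q' a * Y ^+ a + Y' ^+ r * q).
rewrite /ev2 qE mulrDr addrA mulrA -exprMn -YE; congr (_ + _).
rewrite mulr_sumr -(pair_bigA _ (fun a b : 'I_r => P ^+ minn r (a + b) * (P ^+ (a + b - r) * Y' ^+ a * Z' ^+ b) * g`_a`_b)) /=.
rewrite -big_split /=; apply: eq_bigr => a _.
rewrite coef_map /= map_poly_id // /horner_eval q'E mulrDl mulr_suml; congr (_ + _).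
  apply: eq_bigr => b _; rewrite YE ZE !exprMn !mulrA -exprD.
  have -> : (minn r (a + b) + (a + b - r) = a + b)%N by lia.
  by rewrite exprD; ring.
by rewrite ZE exprMn; ring.
Qed.

Lemma ev2_subCM (a b c : int) (u v : {poly {poly int}}) :
  ev2 idfun a b (u - c%:P%:P * v) = ev2 idfun a b u - c * ev2 idfun a b v.
Proof.
pose g : {rmorphism {poly {poly int}} -> int} := ev2 idfun a b.
have gC : g c%:P%:P = c by exact: ev2CC.
by rewrite -/(g _) -/(g u) -/(g v) (rmorphB g) (rmorphM g) gC.
Qed.

(* Newton's iteration: on a smooth residue class, [x] is a polynomial in [y - yt] and [z - zt] modulo
   any power of [p]. *)
Lemma hensel_series (f : {poly {poly {poly int}}}) (p P xt yt zt ct : int) (k : nat) :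
  (p %| P)%Z -> (p %| 1 - ct * ev3 idfun xt yt zt f^`())%Z ->
  exists xi : {poly {poly int}}, forall x y z : int,
    ev3 idfun x y z f = 0 -> (p %| x - xt)%Z -> (P %| y - yt)%Z -> (P %| z - zt)%Z ->
    (p ^+ k %| x - ev2 idfun (y - yt) (z - zt) xi)%Z.
Proof.
move=> pP hct; pose cst : {rmorphism int -> {poly {poly int}}} := (polyC \o polyC)%FUN.
pose F xi : {poly {poly int}} := ev3 cst xi ('X + yt%:P%:P) ('X%:P + zt%:P%:P) f.
suff [xi hxi] : exists xi : {poly {poly int}}, forall x y z : int,
    ev3 idfun x y z f = 0 -> (p %| x - xt)%Z -> (P %| y - yt)%Z -> (P %| z - zt)%Z ->
    (p ^+ k.+1 %| x - ev2 idfun (y - yt) (z - zt) xi)%Z.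
  by exists xi => x y z h0 h1 h2 h3; apply: dvdz_trans (hxi x y z h0 h1 h2 h3); rewrite dvdz_exp2l.
elim: k => [|k [xi IH]].
  by exists xt%:P%:P => x y z _ hx _ _; rewrite ev2CC expr1.
exists (xi - ct%:P%:P * F xi) => x y z f0 hx hy hz.
have := IH x y z f0 hx hy hz.
set e := ev2 idfun (y - yt) (z - zt); set X := e xi.
have -> : e (xi - ct%:P%:P * F xi) = X - ct * e (F xi).
  exact: ev2_subCM.
have -> : e (F xi) = ev3 idfun X y z f.
  rewrite /F /X /e (ev3_comp cst (ev2 idfun (y - yt) (z - zt))) !rmorphD /= ev2X ev2CX !ev2CC /= !subrK.
  by apply: ev3_eqh => u /=; rewrite ev2CC.
move=> hX; pose g := map_poly (ev2 idfun y z) f : {poly int}.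
have gx : g.[x] = 0 := f0.
have [q qE] := horner_taylor2 g x (X - x).
have -> : ev3 idfun X y z f = g.[x + (X - x)] by rewrite addrC subrK.
rewrite qE gx add0r.
have -> : x - (X - ct * ((X - x) * g^`().[x] + (X - x) ^+ 2 * q)) =
   (x - X) * (1 - ct * g^`().[x] + ct * (x - X) * q) by ring.
rewrite exprSr dvdz_mul // rpredD //; last first.
  by rewrite dvdz_mulr // dvdz_mull // (dvdz_trans _ hX) // -[X in (X %| _)%Z]expr1 dvdz_exp2l.
have -> : 1 - ct * g^`().[x] = 1 - ct * ev3 idfun xt yt zt f^`() -
   ct * (ev3 idfun x y z f^`() - ev3 idfun xt yt zt f^`()).
  by rewrite /ev3 -!deriv_map -/g; ring.
rewrite rpredB // dvdz_mull //; apply: dvdz_ev3_sub => //; exact: dvdz_trans pP _.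
Qed.

(** On the class [t] the series [xi t] expresses [x] through [y] and [z], so each row is a
    combination of the coefficient vectors of its class, weighted by total degree. Every class loses
    [tri r], and exponents are counted in powers of [p ^ i]. The main coordinate needs to be fixed
    only modulo [p]. *)
Lemma class_gain N (T : finType) (f : {poly {poly {poly int}}}) (p : int) (i r : nat)
    (g : 'I_N -> {poly {poly {poly int}}}) (x y z : 'I_N -> int) (xt yt zt ct : T -> int)
    (G : {set 'I_N}) :
  (0 < i)%N -> (forall t, p %| 1 - ct t * ev3 idfun (xt t) (yt t) (zt t) f^`())%Z ->
  (forall j, j \in G -> ev3 idfun (x j) (y j) (z j) f = 0 /\
     exists t, [/\ p %| x j - xt t, p ^+ i %| y j - yt t & p ^+ i %| z j - zt t]%Z) ->
  (p ^+ (i * (r * #|G| - #|T| * tri r)) %|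
     \det (\matrix_(j, k) ev3 idfun (x j) (y j) (z j) (g k)))%Z.
Proof.
move=> i0 hct hG; set P := p ^+ i.
have pP : (p %| P)%Z by rewrite -[X in (X %| _)%Z]expr1 dvdz_exp2l.
have /fin_all_exists[xi hxi] := fun t => hensel_series (i * r) pP (hct t).
pose cst : {rmorphism int -> {poly {poly int}}} := (polyC \o polyC)%FUN.
pose c t k : {poly {poly int}} := ev3 cst (xi t) ('X + (yt t)%:P%:P) ('X%:P + (zt t)%:P%:P) (g k).
pose S := (T * ('I_r * 'I_r))%type.
have := @det_gain N S (fun s => minn r (s.2.1 + s.2.2)) P r
  (\matrix_(j, k) ev3 idfun (x j) (y j) (z j) (g k)) G (fun s k => (c s.1 k)`_s.2.1`_s.2.2).
have -> : (\sum_(s : S) (r - minn r (s.2.1 + s.2.2)) = #|T| * tri r)%N.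
  rewrite -(pair_bigA _ (fun (t : T) (s : 'I_r * 'I_r) => r - minn r (s.1 + s.2))%N) /=.
  by rewrite -sum_nat_const.
rewrite exprM -/P => DG; apply: DG => [s|j jG]; first exact: geq_minl.
have [fj [t [hx hy hz]]] := hG j jG.
have [Y' YE] := dvdzP hy; have [Z' ZE] := dvdzP hz; rewrite mulrC in YE; rewrite mulrC in ZE.
exists (fun s : S => if s.1 == t then P ^+ (s.2.1 + s.2.2 - r) * Y' ^+ s.2.1 * Z' ^+ s.2.2 else 0).
have : forall k, exists R, ev3 idfun (x j) (y j) (z j) (g k) = \sum_(s : S)
   P ^+ minn r (s.2.1 + s.2.2) * (if s.1 == t then P ^+ (s.2.1 + s.2.2 - r) * Y' ^+ s.2.1 * Z' ^+ s.2.2 else 0)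
   * (c s.1 k)`_s.2.1`_s.2.2 + P ^+ r * R.
  move=> k.
  rewrite -(pair_bigA _ (fun (t' : T) (s : 'I_r * 'I_r) => P ^+ minn r (s.1 + s.2) * (if t' == t then
    P ^+ (s.1 + s.2 - r) * Y' ^+ s.1 * Z' ^+ s.2 else 0) * (c t' k)`_s.1`_s.2)) /=.
  have [R RE] := ev2_truncate r (c t k) YE ZE.
  have : (P ^+ r %| ev3 idfun (x j) (y j) (z j) (g k) - ev2 idfun (y j - yt t) (z j - zt t) (c t k))%Z.
    have -> : ev2 idfun (y j - yt t) (z j - zt t) (c t k) =
       ev3 idfun (ev2 idfun (y j - yt t) (z j - zt t) (xi t)) (y j) (z j) (g k).
      rewrite /c (ev3_comp cst (ev2 idfun (y j - yt t) (z j - zt t))) !rmorphD /= ev2X ev2CX !ev2CC /= !subrK.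
      by apply: ev3_eqh => u /=; rewrite ev2CC.
    by apply: dvdz_ev3_sub; rewrite ?subrr ?dvdz0 // /P -exprM; exact: hxi.
  case/dvdzP => R' R'E; exists (R' + R); rewrite (bigD1 t) //= [X in _ + X + _]big1 ?addr0; last first.
    by move=> t' /negPf tt; rewrite big1 // => s _; rewrite tt mulr0 mul0r.
  under eq_bigr do rewrite eqxx.
  rewrite mulrDr addrCA -RE [P ^+ r * R']mulrC -R'E.
  by rewrite subrK.
by move/fin_all_exists => [R hR]; exists R => k; rewrite mxE hR.
Qed.

Lemma intr_ev3 (A : comNzRingType) (h : {rmorphism int -> A}) (x y z : int) f :
  ev3 h (h x) (h y) (h z) f = h (ev3 idfun x y z f).
Proof. by rewrite (ev3_comp idfun h); apply: ev3_eqh. Qed.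

Lemma prime_gain N (f : {poly {poly {poly int}}}) (p r : nat) (g : 'I_N -> {poly {poly {poly int}}})
    (x y z : 'I_N -> int) (G : {set 'I_N}) : prime p ->
  (forall j, j \in G -> ev3 idfun (x j) (y j) (z j) f = 0 /\
     ~~ (p%:Z %| ev3 idfun (x j) (y j) (z j) f^`())%Z) ->
  (p%:Z ^+ (r * #|G| - #|smooth_points p f| * tri r) %|
     \det (\matrix_(j, k) ev3 idfun (x j) (y j) (z j) (g k)))%Z.
Proof.
move=> pp hG; pose F := 'F_p; pose iF : {rmorphism int -> F} := intr.
have p1 : (1 < p)%N by exact: prime_gt1.
have iF0 c : (iF c == 0) = (p%:Z %| c)%Z.
  by rewrite /iF intr_Fp_eq0.
pose T := {u : F * (F * F) | u \in smooth_points p f}.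
pose lift (a : F) : int := (a : nat)%:Z.
have liftK a : iF (lift a) = a by exact: (natr_Zp a).
have /fin_all_exists[ct hct] : forall t : T, exists c : int,
    (p%:Z %| 1 - c * ev3 idfun (lift (val t).1) (lift (val t).2.1) (lift (val t).2.2) f^`())%Z.
  move=> [[a [b c]] /=]; rewrite inE /= => /andP[_ h].
  exists (lift (ev3 iF a b c f^`())^-1).
  rewrite -iF0 rmorphB rmorph1 rmorphM liftK -intr_ev3 !liftK mulVf //.
  by rewrite subrr.
have -> : (r * #|G| - #|smooth_points p f| * tri r = 1 * (r * #|G| - #|{: T}| * tri r))%N.
  by rewrite mul1n card_sig.
apply: (@class_gain _ T f p%:Z 1 r g x y z (fun t => lift (val t).1) (fun t => lift (val t).2.1)
  (fun t => lift (val t).2.2) ct G) => //.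
move=> j /hG[fj fxj]; split=> //.
have sm : (iF (x j), (iF (y j), iF (z j))) \in smooth_points p f.
  by rewrite inE /= !(intr_ev3 iF) fj rmorph0 eqxx iF0.
exists (exist (fun u => is_true (u \in smooth_points p f)) _ sm) => /=; rewrite expr1.
by split; rewrite -iF0 rmorphB liftK subrr.
Qed.

(** * Polynomials in three variables as iterated univariate polynomials *)

Section Variables3.

Variables (i0 i1 i2 : 'I_3).
Hypothesis u3 : uniq [:: i0; i1; i2].

Lemma ord3_cases (i : 'I_3) : [\/ i = i0, i = i1 | i = i2].
Proof.
have [||_ /(_ i)] := @uniq_min_size _ [:: i0; i1; i2] (enum 'I_3) u3.
- by move=> j _; rewrite mem_enum.
- by rewrite size_enum_ord.
by rewrite mem_enum !inE => /or3P[] /eqP->; [constructor 1 | constructor 2 | constructor 3].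
Qed.

Let neq3 : [/\ (i1 == i0) = false, (i2 == i0) = false & (i2 == i1) = false].
Proof.
move: u3; rewrite /= !inE negb_or => /andP[/andP[/negPf h1 /negPf h2] /andP[/negPf h3 _]].
by rewrite ![i1 == _]eq_sym ![i2 == _]eq_sym h1 h2 h3.
Qed.

Section Conv.

Variable A : comNzRingType.

(* The outermost variable is [x_i0], the innermost is [x_i2]. *)
Definition nest_var (i : 'I_3) : {poly {poly {poly A}}} :=
  if i == i0 then 'X else if i == i1 then 'X%:P else 'X%:P%:P.

Definition nest : {mpoly A[3]} -> {poly {poly {poly A}}} :=
  mmap (polyC \o polyC \o polyC)%FUN nest_var.

HB.instance Definition _ := GRing.RMorphism.copy nest (mmap (polyC \o polyC \o polyC)%FUN nest_var).

Lemma nestC (c : A) : nest c%:MP = c%:P%:P%:P.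
Proof. exact: mmapC. Qed.

Lemma nestX0 : nest 'X_i0 = 'X.
Proof. by rewrite /nest mmapX mmap1U /nest_var eqxx. Qed.

Lemma nestX1 : nest 'X_i1 = 'X%:P.
Proof. by have [h _ _] := neq3; rewrite /nest mmapX mmap1U /nest_var h eqxx. Qed.

Lemma nestX2 : nest 'X_i2 = 'X%:P%:P.
Proof. by have [_ h h'] := neq3; rewrite /nest mmapX mmap1U /nest_var h h'. Qed.

Lemma mpoly3_ind (P : {mpoly A[3]} -> Prop) :
  (forall c, P c%:MP) -> P 'X_i0 -> P 'X_i1 -> P 'X_i2 ->
  (forall p q, P p -> P q -> P (p + q)) -> (forall p q, P p -> P q -> P (p * q)) ->
  forall p, P p.
Proof.
move=> hC h0 h1 h2 hD hM; apply: mpolyind; first by rewrite -[0]mpolyC0.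
move=> c m p _ _ hp; apply: (hD) => //; rewrite -mul_mpolyC; apply: (hM) => //.
rewrite mpolyXE_id; elim/big_ind: _ => // [|i _]; first by rewrite -mpolyC1.
elim: (m i) => [|k IH]; first by rewrite expr0 -mpolyC1.
by rewrite exprS; apply: (hM) => //; case: (ord3_cases i) => ->.
Qed.

Lemma mpoly3_unique (B : nzRingType) (f g : {rmorphism {mpoly A[3]} -> B}) :
  (forall c, f c%:MP = g c%:MP) -> f 'X_i0 = g 'X_i0 -> f 'X_i1 = g 'X_i1 -> f 'X_i2 = g 'X_i2 ->
  f =1 g.
Proof.
move=> hC h0 h1 h2; elim/mpoly3_ind => // p q hp hq; first by rewrite !rmorphD /= hp hq.
by rewrite !rmorphM /= hp hq.
Qed.

Definition flatten3 : {poly {poly {poly A}}} -> {mpoly A[3]} :=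
  ev3 (@mpolyC 3 A) 'X_i0 'X_i1 'X_i2.

HB.instance Definition _ := GRing.RMorphism.copy flatten3 (ev3 (@mpolyC 3 A) 'X_i0 'X_i1 'X_i2).

Lemma nestK : cancel nest flatten3.
Proof.
move=> p; move: p; apply: (@mpoly3_unique _ (flatten3 \o nest)%FUN idfun) => [c|||] /=.
- by rewrite nestC /flatten3 ev3CCC.
- by rewrite nestX0 /flatten3 ev3X.
- by rewrite nestX1 /flatten3 ev3CX.
- by rewrite nestX2 /flatten3 ev3CCX.
Qed.

Lemma flatten3K : cancel flatten3 nest.
Proof.
have h2 (c : {poly {poly A}}) : nest (ev2 (@mpolyC 3 A) 'X_i1 'X_i2 c) = c%:P.
  move: c; apply: (@ev2_unique _ _ (nest \o ev2 (@mpolyC 3 A) 'X_i1 'X_i2)%FUN polyC) => [c||] /=.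
  - by rewrite ev2CC nestC.
  - by rewrite ev2X nestX1.
  - by rewrite ev2CX nestX2.
elim/poly_ind => [|p c IH]; first by rewrite !rmorph0.
pose G : {rmorphism {poly {poly {poly A}}} -> {poly {poly {poly A}}}} := (nest \o flatten3)%FUN.
have GX : G 'X = 'X by rewrite /G /= /flatten3 ev3X nestX0.
have GC : G c%:P = c%:P by rewrite /G /= /flatten3 ev3C h2.
by have := rmorphD G (p * 'X) c%:P; rewrite rmorphM GX GC [G p]IH.
Qed.

End Conv.

Lemma nest_eval (A B : comNzRingType) (h : {rmorphism A -> B}) (u : 'I_3 -> B) (p : {mpoly A[3]}) :
  ev3 h (u i0) (u i1) (u i2) (nest p) = mmap h u p.
Proof.
move: p; apply: (@mpoly3_unique _ _ (ev3 h (u i0) (u i1) (u i2) \o @nest A)%FUN (mmap h u)) => [c|||] /=.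
- by rewrite nestC ev3CCC mmapC.
- by rewrite nestX0 ev3X mmapX mmap1U.
- by rewrite nestX1 ev3CX mmapX mmap1U.
- by rewrite nestX2 ev3CCX mmapX mmap1U.
Qed.

Lemma nest_meval (A : comNzRingType) (u : 'I_3 -> A) (p : {mpoly A[3]}) :
  ev3 idfun (u i0) (u i1) (u i2) (nest p) = p.@[u].
Proof. exact: nest_eval. Qed.

Lemma nest_map (A B : comNzRingType) (h : {rmorphism A -> B}) (p : {mpoly A[3]}) :
  nest (map_mpoly h p) = map_poly (map_poly (map_poly h)) (nest p).
Proof.
move: p; apply: (@mpoly3_unique _ _ (@nest B \o map_mpoly h)%FUN
   (map_poly (map_poly (map_poly h)) \o @nest A)%FUN) => [c|||] /=.
- by rewrite map_mpolyC nestC nestC map_polyC /= map_polyC /= map_polyC.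
- by rewrite map_mpolyX !nestX0 map_polyX.
- by rewrite map_mpolyX !nestX1 map_polyC /= map_polyX.
- by rewrite map_mpolyX !nestX2 map_polyC /= map_polyC /= map_polyX.
Qed.

End Variables3.

(** * Gain of powers of [q] in the columns *)

Lemma det_triangular_height (R : idomainType) N (h : 'I_N -> nat) (U : 'M[R]_N) :
  (forall i k, i != k -> U i k != 0 -> (h i < h k)%N) -> \det U = \prod_k U k k.
Proof.
move=> hU; rewrite /determinant (bigD1 1%g) //= odd_perm1 expr0 mul1r [X in _ + X]big1 ?addr0 => [|s s1].
  by apply: eq_bigr => i _; rewrite perm1.
apply/eqP; rewrite mulf_eq0; apply/orP; right; apply/negPn/negP => /prodf_neq0 Us.
have le i : (h i <= h (s i))%N.
  have [<-//|ne] := eqVneq i (s i); apply/ltnW/hU => //; exact: Us.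
have [i si] : exists i, s i != i.
  apply/existsP; apply: contraNT s1 => /existsPn ss; apply/eqP/permP => i.
  by rewrite perm1; apply/eqP/negPn/ss.
have : (\sum_i h i < \sum_i h (s i))%N.
  rewrite (bigD1 i) //= [X in (_ < X)%N](bigD1 i) //= -addSn leq_add //; last by apply: leq_sum.
  by apply: hU; [rewrite eq_sym | exact: Us].
by rewrite (reindex_inj (@perm_inj _ s)) /= ltnn.
Qed.

Lemma meval_support (n N : nat) (u : 'I_n -> int) (e : 'I_N -> 'X_{1..n}) (r : {mpoly int[n]}) :
  injective e -> (forall e', e' \in msupp r -> exists k, e' = e k) ->
  r.@[u] = \sum_k r@_(e k) * 'X_[e k].@[u].
Proof.
move=> inj hr; rewrite mevalE.
have -> : \sum_(m <- msupp r) r@_m * \prod_i u i ^+ m i =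
    \sum_(m <- msupp r) \sum_(k | e k == m) r@_(e k) * 'X_[e k].@[u].
  apply: eq_big_seq => m /hr[k ->]; rewrite (big_pred1 k) ?mevalX // => k'.
  by rewrite (inj_eq inj).
rewrite (exchange_big_dep predT) //=; apply: eq_bigr => k _.
have [kr|kr] := boolP (e k \in msupp r); last first.
  rewrite memN_msupp_eq0 // mul0r big1_seq // => m /andP[/eqP <-]; by rewrite (negPf kr).
rewrite -big_filter (_ : [seq m <- msupp r | e k == m] = [:: e k]) ?big_seq1 //.
have -> : [seq m <- msupp r | e k == m] = [seq m <- msupp r | m == e k].
  by apply: eq_filter => m; rewrite eq_sym.
by rewrite filter_pred1_uniq.
Qed.

(** Passing from the monomials ['X_[e k]] to the [P k] multiplies the matrix by [U], which is
    triangular for the height [h] and has a power of [c] as determinant; the new column [k] is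
    divisible by [q ^+ w k]. *)
Lemma q_gain_local (n N : nat) (u : 'I_N -> 'I_n -> int) (e : 'I_N -> 'X_{1..n})
    (w h : 'I_N -> nat) (P : 'I_N -> {mpoly int[n]}) (c q : int) :
  injective e ->
  (forall k, exists r, P k = c ^+ w k *: 'X_[e k] + r /\
     forall e', e' \in msupp r -> exists2 k', e' = e k' & (h k' < h k)%N) ->
  (forall j k, (q ^+ w k %| (P k).@[u j])%Z) ->
  (q ^+ (\sum_k w k)%N %| c ^+ (\sum_k w k)%N * \det (\matrix_(j, k) ('X_[e k] : {mpoly int[n]}).@[u j]))%Z.
Proof.
move=> inj /fin_all_exists[r hr] hq.
pose U : 'M[int]_N := \matrix_(k', k) ((k' == k)%:R * c ^+ w k + (r k)@_(e k')).
set A := \matrix_(j, k) _.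
have rsupp k e' : e' \in msupp (r k) -> exists k', e' = e k'.
  by have [_ h'] := hr k; case/h' => k' -> _; exists k'.
have r0 k k' : (r k)@_(e k') != 0 -> (h k' < h k)%N.
  by rewrite -mcoeff_msupp; have [_ h'] := hr k; case/h' => k'' /inj ->.
have AU : A *m U = \matrix_(j, k) (P k).@[u j].
  apply/matrixP => j k; rewrite !mxE; have [-> _] := hr k.
  rewrite mevalD mevalZ (meval_support _ inj (rsupp k)).
  under eq_bigr do rewrite !mxE mulrDr.
  rewrite big_split /= (bigD1 k) //= eqxx mul1r big1 ?addr0 => [|k' /negPf->]; last by rewrite mul0r mulr0.
  by rewrite [X in X + _]mulrC; congr (_ + _); apply: eq_bigr => k' _; rewrite mulrC.
have dU : \det U = c ^+ (\sum_k w k)%N.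
  rewrite (det_triangular_height (h := h)) => [|i k /negPf ik]; last first.
    by rewrite mxE ik mul0r add0r; exact: r0.
  rewrite expr_sum; apply: eq_bigr => k _; rewrite mxE eqxx mul1r.
  have [->|/r0] := eqVneq (r k)@_(e k) 0; first by rewrite addr0.
  by rewrite ltnn.
rewrite mulrC -dU -det_mulmx AU expr_sum.
rewrite /determinant; apply: rpred_sum => s _; apply: dvdz_mull.
rewrite [X in (X %| _)%Z](reindex_inj (@perm_inj _ s)) /=.
by elim/big_ind2: _ => // [a x b y|i _]; [exact: dvdz_mul | rewrite mxE].
Qed.

Lemma dvdz_gcd_mul (x a b c : int) : (x %| a * c)%Z -> (x %| b * c)%Z -> (x %| gcdz a b * c)%Z.
Proof.
move=> xa xb; have [u [v <-]] := Bezoutz a b.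
by rewrite mulrDl -!mulrA rpredD // dvdz_mull.
Qed.

Section QGain.

Variables (m0 D q dg : nat) (g : {mpoly int[3]}).
Variables (N : nat) (e : 'I_N -> 'X_{1..3}) (u : 'I_N -> 'I_3 -> int).
Hypotheses (dg0 : (0 < dg)%N) (e_inj : injective e).
Hypothesis (eD : forall k, (mdeg (e k) <= D)%N).
Hypothesis (e_full : forall e' : 'X_{1..3}, (mdeg e' <= D)%N -> (e' ord0 < m0)%N -> exists k, e' = e k).
Hypothesis (gsupp : forall e', e' \in msupp g -> e' ord0 = 0%N /\ (mdeg e' <= dg)%N).
Hypothesis (qg : forall j, (q%:Z %| g.@[u j])%Z).

Let A := \matrix_(j, k) ('X_[e k] : {mpoly int[3]}).@[u j].

Let pow_lead (c : int) (b : 'X_{1..3}) (Lt : nat -> 'X_{1..3} -> Prop) r :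
  g = c *: 'X_[b] + r -> (forall e', e' \in msupp r -> Lt 1%N e') ->
  (forall w e1 e2, Lt w e1 -> Lt 1%N e2 -> Lt w.+1 (e1 + e2)%MM) ->
  (forall w e1, Lt w e1 -> Lt w.+1 (e1 + b)%MM) ->
  (forall w e2, Lt 1%N e2 -> Lt w.+1 (b *+ w + e2)%MM) ->
  forall w, exists r', g ^+ w = c ^+ w *: 'X_[b *+ w] + r' /\ forall e', e' \in msupp r' -> Lt w e'.
Proof.
move=> gE hr LL Lb bL; elim=> [|w [r' [gw hr']]].
  by exists 0; rewrite !expr0 mulm0n scale1r mpolyX0 addr0; split=> // e'; rewrite msupp0.
exists (r' * g + c ^+ w *: 'X_[b *+ w] * r); split.
  have E : c ^+ w *: 'X_[b *+ w] * (c *: 'X_[b]) = c ^+ w.+1 *: 'X_[b *+ w.+1] :> {mpoly int[3]}.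
    by rewrite -scalerAl -scalerAr scalerA -mpolyXD -exprSr mulmSr addmC.
  have E2 : c ^+ w *: 'X_[b *+ w] * g = c ^+ w.+1 *: 'X_[b *+ w.+1] + c ^+ w *: 'X_[b *+ w] * r.
    by rewrite {1}gE mulrDr E.
  by rewrite exprSr gw mulrDl E2 -addrA [X in _ + X = _]addrC.
move=> e' /msuppD_le; rewrite mem_cat => /orP[] /msuppM_le/allpairsP[[e1 e2] /= [h1 h2 ->]].
  have L1 := hr' _ h1; move: h2; rewrite gE => /msuppD_le; rewrite mem_cat => /orP[h2|/hr]; last exact: LL.
  move: h2 => /msuppZ_le; rewrite msuppX inE => /eqP->; exact: Lb.
move: h1 => /msuppZ_le; rewrite msuppX inE => /eqP->; apply: bL; exact: hr.
Qed.

(** Only monomials with exponent of [x_1] below [m0] are replaced: [g] does not involve [x_1], so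
    multiplying by powers of [g] keeps that exponent and never leads to a multiple of the maximal
    monomial. This is how [m_1] enters the exponent of [q]. *)
Let wt (ht : 'X_{1..3} -> nat) k := if (e k ord0 < m0)%N then (ht (e k) %/ dg)%N else 0%N.

(** The monomial is multiplied by as large a power of [g] as the degree bound [D] permits. The
    constant term of [g] reproduces the monomial; all other terms have larger total degree, hence
    smaller slack. *)
Lemma q_gain_slack :
  let W := (\sum_k wt (fun e => D - mdeg e) k)%N in
  (q%:Z ^+ W %| g@_0 ^+ W * \det A)%Z.
Proof.
set ht := fun e : 'X_{1..3} => (D - mdeg e)%N; rewrite /=.
have zM w : (0 *+ w = 0 :> 'X_{1..3})%MM by apply/mnmP => i; rewrite mulmnE mnm0E.
pose Lt (w : nat) (e' : 'X_{1..3}) := [/\ (0 < mdeg e')%N, (mdeg e' <= w * dg)%N & e' ord0 = 0%N].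
have hpow : forall w, exists r', g ^+ w = g@_0 ^+ w *: 'X_[0%MM *+ w] + r' /\ forall e', e' \in msupp r' -> Lt w e'.
  apply: (@pow_lead g@_0 0%MM Lt (g - g@_0 *: 'X_[0%MM])).
  - by rewrite addrC subrK.
  - move=> e' he'; have ne : e' != 0%MM.
      apply: contraTneq he' => ->; rewrite mcoeff_msupp mcoeffB mcoeffZ mcoeffX eqxx mulr1 subrr.
      by rewrite eqxx.
    have : e' \in msupp g.
      by move: he'; rewrite !mcoeff_msupp mcoeffB mcoeffZ mcoeffX [_ == e']eq_sym (negPf ne) mulr0 subr0.
    by case/gsupp => h0 h1; split; rewrite ?mul1n // lt0n mdeg_eq0.
  - move=> w e1 e2 [a1 a2 a3] [b1 b2 b3]; split; rewrite ?mdegD ?mnmDE ?a3 ?b3 //; first by rewrite addn_gt0 a1.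
    by rewrite mulSnr leq_add // -[dg]mul1n.
  - move=> w e1 [a1 a2 a3]; rewrite addm0; split=> //; rewrite (leq_trans a2) // leq_mul2r leqnSn orbT //.
  - move=> w e2 [b1 b2 b3]; rewrite zM add0m; split=> //.
    by rewrite (leq_trans b2) // leq_mul2r orbT.
apply: (@q_gain_local _ _ u e (wt ht) (fun k => ht (e k)) (fun k => 'X_[e k] * g ^+ wt ht k)) => //.
- move=> k; have [r' [-> hr']] := hpow (wt ht k).
  exists ('X_[e k] * r'); split.
    by rewrite mulrDr -scalerAr -mpolyXD zM addm0.
  move=> e' /msuppM_le/allpairsP[[e1 e2] /= [h1 h2 ->]].
  move: h1; rewrite msuppX inE => /eqP->; have := hr' _ h2; rewrite /wt /Lt.
  case: ifP => [ek|_]; last by rewrite mul0n leqn0 lt0n => -[/negPf->].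
  move=> [a1 a2 a3].
  have le : (mdeg e2 <= ht (e k))%N := leq_trans a2 (leq_trunc_div _ _).
  have le2 : (mdeg (e k + e2)%MM <= D)%N.
    by rewrite mdegD -(subnKC (eD k)) leq_add2l.
  have [|k' k'E] := e_full le2; first by rewrite mnmDE a3 addn0.
  by exists k'; rewrite // -k'E /ht mdegD; move: a1 le (eD k); rewrite /ht; clear; lia.
- by move=> j k; rewrite mevalM rmorphXn /=; apply: dvdz_mull; apply: dvdz_exp2r.
Qed.

(** In the monomial, [x_i ^ (w * dg)] is replaced by [g ^ w]. The term [x_i ^ dg] of [g] restores
    the monomial, and every other term has a smaller exponent of [x_i]. *)
Lemma q_gain_coord (i : 'I_3) : i != ord0 ->
  let W := (\sum_k wt (fun e => e i) k)%N in
  (q%:Z ^+ W %| g@_(U_(i) *+ dg)%MM ^+ W * \det A)%Z.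
Proof.
move=> i0; set ht := fun e : 'X_{1..3} => e i; rewrite /=.
set b := (U_(i) *+ dg)%MM.
have b0 : b ord0 = 0%N by rewrite /b mulmnE mnm1E (negPf i0).
have bi : b i = dg by rewrite /b mulmnE mnm1E eqxx mul1n.
have bd : mdeg b = dg by rewrite /b mdegMn mdeg1 mul1n.
pose Lt (w : nat) (e' : 'X_{1..3}) := [/\ (e' i < w * dg)%N, (mdeg e' <= w * dg)%N & e' ord0 = 0%N].
have hpow : forall w, exists r', g ^+ w = g@_b ^+ w *: 'X_[b *+ w] + r' /\ forall e', e' \in msupp r' -> Lt w e'.
  apply: (@pow_lead g@_b b Lt (g - g@_b *: 'X_[b])).
  - by rewrite addrC subrK.
  - move=> e' he'; have ne : e' != b.
      apply: contraTneq he' => ->; rewrite mcoeff_msupp mcoeffB mcoeffZ mcoeffX eqxx mulr1 subrr.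
      by rewrite eqxx.
    have : e' \in msupp g.
      by move: he'; rewrite !mcoeff_msupp mcoeffB mcoeffZ mcoeffX [_ == e']eq_sym (negPf ne) mulr0 subr0.
    case/gsupp => h0 h1; split; rewrite ?mul1n //.
    have le : (e' i <= dg)%N by apply: leq_trans h1; rewrite mdegE (bigD1 i) //= leq_addr.
    rewrite ltn_neqAle le andbT; apply: contraNneq ne => ei; apply/eqP/mnmP => k.
    have [->|ki] := eqVneq k i; first by rewrite bi.
    rewrite /b mulmnE mnm1E eq_sym (negPf ki) mul0n.
    move: h1; rewrite mdegE (bigD1 i) //= ei -[X in (_ <= X)%N]addn0 leq_add2l leqn0 sum_nat_eq0.
    by move/forallP/(_ k); rewrite ki => /eqP.
  - move=> w e1 e2 [a1 a2 a3] [b1 b2 b3]; rewrite mul1n in b1 b2.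
    by rewrite /Lt mdegD !mnmDE a3 b3 mulSnr; split=> //; [rewrite -addSn leq_add // ltnW | rewrite leq_add].
  - by move=> w e1 [a1 a2 a3]; rewrite /Lt mdegD !mnmDE a3 b0 bi bd mulSnr; split=> //; [rewrite -addSn leq_add | rewrite leq_add].
  - move=> w e2 [b1 b2 b3]; rewrite mul1n in b1 b2.
    by rewrite /Lt mdegD mdegMn !mnmDE !(mulmnE b) b3 b0 bi bd mulSnr [(dg * w)%N]mulnC; split=> //; rewrite -?addnS leq_add2l.
have wb k : (b *+ wt ht k <= e k)%MM.
  apply/mnm_lepP => k'; have [->|ki] := eqVneq k' i.
    rewrite mulmnE bi /wt; case: ifP => _; last by rewrite muln0.
    by rewrite mulnC leq_trunc_div.
  by rewrite /b !mulmnE mnm1E eq_sym (negPf ki).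
apply: (@q_gain_local _ _ u e (wt ht) (fun k => ht (e k)) (fun k => 'X_[e k - b *+ wt ht k] * g ^+ wt ht k)) => //.
- move=> k; have [r' [-> hr']] := hpow (wt ht k).
  exists ('X_[e k - b *+ wt ht k] * r'); split.
    by rewrite mulrDr -scalerAr -mpolyXD submK.
  move=> e' /msuppM_le/allpairsP[[e1 e2] /= [h1 h2 ->]].
  move: h1; rewrite msuppX inE => /eqP->; have := hr' _ h2.
  have := wb k; rewrite /wt /Lt; case: ifP => [ek|_]; last by rewrite mul0n => _ [].
  set w := (_ %/ _)%N => wbk [a1 a2 a3].
  have eE : mdeg (e k) = (mdeg (e k - b *+ w)%MM + w * dg)%N.
    by rewrite -{1}(submK wbk) mdegD mdegMn bd mulnC.
  have eEi : ht (e k) = ((e k - b *+ w)%MM i + w * dg)%N.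
    by rewrite /ht -{1}(submK wbk) mnmDE mulmnE bi mulnC.
  have le2 : (mdeg (e k - b *+ w + e2)%MM <= D)%N.
    by rewrite mdegD (leq_trans _ (eD k)) // eE leq_add2l.
  have [|k' k'E] := e_full le2; first by rewrite mnmDE a3 addn0 mnmBE mulmnE b0 subn0.
  by exists k'; rewrite // -k'E eEi /ht mnmDE -addnS leq_add2l.
- by move=> j k; rewrite mevalM rmorphXn /=; apply: dvdz_mull; apply: dvdz_exp2r.
Qed.

(* Replacing monomials by multiples of powers of [g] with leading monomial 1, [x_2 ^+ dg] or
   [x_3 ^+ dg] gains [q ^+ G0] up to a power of the coefficient of that monomial; the three
   coefficients have no common factor with [q]. *)
Lemma q_gain (G0 : nat) (i1 i2 : 'I_3) : i1 != ord0 -> i2 != ord0 ->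
  gcdz (gcdz (gcdz q%:Z g@_0) g@_(U_(i1) *+ dg)%MM) g@_(U_(i2) *+ dg)%MM = 1 ->
  (G0 <= \sum_k wt (fun e => D - mdeg e) k)%N ->
  (G0 <= \sum_k wt (fun e => e i1) k)%N -> (G0 <= \sum_k wt (fun e => e i2) k)%N ->
  (q%:Z ^+ G0 %| \det A)%Z.
Proof.
move=> h1 h2 cop w0 w1 w2.
have lo W (c : int) : (G0 <= W)%N -> (q%:Z ^+ W %| c ^+ W * \det A)%Z -> (q%:Z ^+ G0 %| c ^+ W * \det A)%Z.
  by move=> le; apply: dvdz_trans; rewrite dvdz_exp2l.
have d0 := lo _ _ w0 q_gain_slack.
have d1 := lo _ _ w1 (q_gain_coord h1).
have d2 := lo _ _ w2 (q_gain_coord h2).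
set W0 := (\sum_k _)%N in d0; set W1 := (\sum_k _)%N in d1; set W2 := (\sum_k _)%N in d2.
set c0 := g@_0 in d0 cop; set c1 := g@_(U_(i1) *+ dg)%MM in d1 cop; set c2 := g@_(U_(i2) *+ dg)%MM in d2 cop.
pose G := gcdz (gcdz (gcdz (q%:Z ^+ G0) (c0 ^+ W0)) (c1 ^+ W1)) (c2 ^+ W2).
have G1 : G = 1.
  have : (G %| gcdz (gcdz (gcdz (q%:Z ^+ G0) (c0 ^+ W0)) (c1 ^+ W1)) (c2 ^+ W2))%Z := dvdzz G; rewrite !dvdz_gcd => /andP[/andP[/andP[e0 e1] e2] e3].
  have [k Gk] : exists k : nat, G = k%:Z by eexists.
  rewrite Gk in e0 e1 e2 e3 *; apply/eqP; rewrite eqz_nat; apply/negPn/negP => k1.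
  have [p pp pk] : exists2 p, prime p & (p %| k)%N.
    case: k k1 {Gk e0 e1 e2 e3} => [|[|k]] // _; first by exists 2%N.
    by exists (pdiv k.+2); rewrite ?pdiv_dvd // pdiv_prime.
  have pz (x : int) n : (k%:Z %| x ^+ n)%Z -> (p%:Z %| x)%Z.
    rewrite !dvdzE abszX /= => kx; have := dvdn_trans pk kx.
    by rewrite Euclid_dvdX // => /andP[].
  have : (p%:Z %| gcdz (gcdz (gcdz q%:Z c0) c1) c2)%Z.
    by rewrite !dvdz_gcd (pz _ _ e0) (pz _ _ e1) (pz _ _ e2) (pz _ _ e3).
  by rewrite cop dvdzE /= dvdn1 => /eqP p1; move: pp; rewrite p1.
have : (q%:Z ^+ G0 %| G * \det A)%Z.
  by rewrite /G; do 3?[apply: dvdz_gcd_mul] => //; exact: dvdz_mulr.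
by rewrite G1 mul1r.
Qed.

End QGain.

(** * Counting monomials and their degrees *)

Lemma sum_trunc (f g : nat -> nat) r m : f 0%N = 0%N -> g 0%N = 0%N ->
  (forall k, g k.+1 = f k.+1 + g k)%N -> (m <= r)%N -> (\sum_(b < r) f (m - b) = g m)%N.
Proof.
move=> f0 g0 gS; elim: r m => [|r IH] [|m] // mr; first by rewrite big_ord0 g0.
  by rewrite big1 // => b _; rewrite sub0n.
rewrite big_ord_recl subn0 gS; under eq_bigr do rewrite lift0 subSS.
by rewrite IH.
Qed.

Section MonomialSums.

Variable D : nat.
Let T := ('I_D.+1 * ('I_D.+1 * 'I_D.+1))%type.
Let o1 : 'I_3 := lift ord0 ord0.
Let o2 : 'I_3 := lift ord0 (lift ord0 ord0).

Lemma mdeg3 (e : 'X_{1..3}) : mdeg e = (e ord0 + (e o1 + e o2))%N.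
Proof. by rewrite mdegE !big_ord_recl big_ord0 addn0. Qed.

Lemma sum_bmnm3 (F : nat -> nat -> nat -> nat) :
  (\sum_(e : 'X_{1..3 < D.+1}) F (e ord0) (e o1) (e o2) =
   \sum_(a < D.+1) \sum_(b < D.+1) \sum_(c < D.+1 | a + (b + c) <= D) F a b c)%N.
Proof.
rewrite (pair_big_dep xpredT (fun a b => true)) /=.
rewrite (pair_big_dep xpredT (fun (p : 'I_D.+1 * 'I_D.+1) (c : 'I_D.+1) => p.1 + (p.2 + c) <= D)%N) /=.
pose h (e : 'X_{1..3 < D.+1}) : 'I_D.+1 * 'I_D.+1 * 'I_D.+1 := (inord (e ord0), inord (e o1), inord (e o2)).
have le (e : 'X_{1..3 < D.+1}) (i : 'I_3) : (e i <= D)%N.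
  have := bmdeg e; rewrite ltnS; apply: leq_trans; by rewrite mdegE (bigD1 i) //= leq_addr.
have hK (e : 'X_{1..3 < D.+1}) : [/\ (h e).1.1 = e ord0 :> nat, (h e).1.2 = e o1 :> nat & (h e).2 = e o2 :> nat].
  by split; rewrite /= inordK // ltnS.
have hinj : injective h.
  move=> e e' E; have [a1 a2 a3] := hK e; have [b1 b2 b3] := hK e'; apply/val_inj/mnmP => i.
  have : i = ord0 \/ i = o1 \/ i = o2.
    by case: i => [[|[|[|i]]] //= lt]; [left | right; left | right; right]; apply: val_inj.
  by case=> [->|[]->]; rewrite -?a1 -?a2 -?a3 E.
rewrite (eq_bigr (fun e => F (h e).1.1 (h e).1.2 (h e).2)) => [|e _]; last by have [-> -> ->] := hK e.
rewrite -(big_imset (fun t => F t.1.1 t.1.2 t.2) (h := h) (A := predT)) /=; last by move=> x y _ _; exact: hinj.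
apply: eq_bigl => -[[a b] c]; apply/imsetP/idP => /= [[e _ E]|abc].
  have [a1 a2 a3] := hK e; rewrite -E /= in a1 a2 a3; rewrite a1 a2 a3 -mdeg3 -ltnS.
  exact: bmdeg.
pose e : 'X_{1..3} := [multinom of [tuple (a : nat); (b : nat); (c : nat)]].
have ee : (mdeg e < D.+1)%N.
  by rewrite mdeg3 !multinomE /= !(tnth_nth 0%N).
exists (BMultinom ee) => //; rewrite /h /= !multinomE /= !(tnth_nth 0%N) /=.
by rewrite !inord_val.
Qed.

Lemma sum_bmnm3_slack (f g1 g2 g3 : nat -> nat) :
  f 0%N = 0%N -> g1 0%N = 0%N -> g2 0%N = 0%N -> g3 0%N = 0%N ->
  (forall k, g1 k.+1 = f k.+1 + g1 k)%N -> (forall k, g2 k.+1 = g1 k.+1 + g2 k)%N ->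
  (forall k, g3 k.+1 = g2 k.+1 + g3 k)%N ->
  (\sum_(e : 'X_{1..3 < D.+1}) f (D.+1 - mdeg e) = g3 D.+1)%N.
Proof.
move=> f0 g10 g20 g30 h1 h2 h3.
under eq_bigr do rewrite mdeg3.
rewrite (sum_bmnm3 (fun a b c => f (D.+1 - (a + (b + c)))))%N.
rewrite -(sum_trunc g20 g30 h3 (leqnn _)); apply: eq_bigr => a _.
rewrite -(sum_trunc g10 g20 h2 (leq_subr _ _) (r := D.+1)); apply: eq_bigr => b _.
rewrite -(sum_trunc f0 g10 h1 (m := (D.+1 - a - b)%N) (r := D.+1)); last by rewrite -subnDA leq_subr.
rewrite [RHS](bigID (fun c : 'I_D.+1 => a + (b + c) <= D)%N) /= [X in (_ + X)%N]big1 ?addn0 => [|c].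
  by apply: eq_bigr => c _; rewrite -!subnDA addnA.
by rewrite -ltnNge => h; rewrite -!subnDA (eqP (_ : D.+1 - (a + (b + c)) == 0)%N) // subn_eq0.
Qed.

Lemma card_bmnm3 : (6 * #|{: 'X_{1..3 < D.+1}}| = D.+1 * D.+2 * D.+3)%N.
Proof.
pose g1 (k : nat) := k; pose g2 k := (k * k.+1)./2; pose g3 k := ((k * k.+1) * k.+2 %/ 6)%N.
have e2 k : (2 * g2 k = k * k.+1)%N.
  by rewrite mul2n -[RHS]odd_double_half oddM /= andbN add0n.
have e3 k : (6 * g3 k = k * k.+1 * k.+2)%N.
  rewrite mulnC divnK //; elim: k => // k IH.
  have -> : (k.+1 * k.+2 * k.+3 = k * k.+1 * k.+2 + 3 * (k.+1 * k.+2))%N by ring.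
  by rewrite dvdn_addr // -(e2 k.+1) mulnA dvdn_mulr.
rewrite -e3; congr (6 * _)%N.
rewrite -(@sum_bmnm3_slack (fun k => (0 < k)%N : nat) g1 g2 g3) //.
- rewrite -sum1_card; apply: eq_bigr => e _; rewrite subn_gt0 bmdeg //.
- by move=> k; apply/eqP; rewrite -(eqn_pmul2l (m := 2)) // mulnDr !e2 /g1; apply/eqP; ring.
- move=> k; apply/eqP; rewrite -(eqn_pmul2l (m := 6)) // mulnDr !e3.
  have -> : (6 * g2 k.+1 = 3 * (2 * g2 k.+1))%N by ring.
  by rewrite e2; apply/eqP; ring.
Qed.

Lemma sum_mdeg_bmnm3 : (8 * \sum_(e : 'X_{1..3 < D.+1}) mdeg e = D * D.+1 * D.+2 * D.+3)%N.
Proof.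
pose g1 k := (k * k.+1)./2; pose g2 k := ((k * k.+1) * k.+2 %/ 6)%N.
pose g3 k := (\sum_(j < k.+1) g2 j)%N.
have e2 k : (2 * g1 k = k * k.+1)%N.
  by rewrite mul2n -[RHS]odd_double_half oddM /= andbN add0n.
have e3 k : (6 * g2 k = k * k.+1 * k.+2)%N.
  rewrite mulnC divnK //; elim: k => // k IH.
  have -> : (k.+1 * k.+2 * k.+3 = k * k.+1 * k.+2 + 3 * (k.+1 * k.+2))%N by ring.
  by rewrite dvdn_addr // -(e2 k.+1) mulnA dvdn_mulr.
have e4 k : (24 * g3 k = k * k.+1 * k.+2 * k.+3)%N.
  elim: k => [|k IH]; first by rewrite /g3 big_ord1.
  rewrite /g3 big_ord_recr /= mulnDr -/(g3 k) IH.
  have -> : (24 * g2 k.+1 = 4 * (6 * g2 k.+1))%N by ring.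
  by rewrite e3; ring.
have S1 : (\sum_(e : 'X_{1..3 < D.+1}) (D.+1 - mdeg e) = g3 D.+1)%N.
  apply: (@sum_bmnm3_slack id g1 g2 g3) => //; first by rewrite /g3 big_ord1.
  - by move=> k; apply/eqP; rewrite -(eqn_pmul2l (m := 2)) // mulnDr !e2; apply/eqP; ring.
  - move=> k; apply/eqP; rewrite -(eqn_pmul2l (m := 6)) // mulnDr !e3.
    have -> : (6 * g1 k.+1 = 3 * (2 * g1 k.+1))%N by ring.
    by rewrite e2; apply/eqP; ring.
  - by move=> k; rewrite /g3 big_ord_recr /= addnC.
have S2 : (\sum_(e : 'X_{1..3 < D.+1}) mdeg e + g3 D.+1 = #|{: 'X_{1..3 < D.+1}}| * D.+1)%N.
  rewrite -S1 -big_split /= -sum_nat_const; apply: eq_bigr => e _.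
  by rewrite subnKC // ltnW // bmdeg.
have := congr1 (muln 24) S2; rewrite mulnDr e4.
have -> : (24 * (#|{: 'X_{1..3 < D.+1}}| * D.+1) = 4 * (6 * #|{: 'X_{1..3 < D.+1}}|) * D.+1)%N by ring.
rewrite card_bmnm3 => h.
apply/eqP; rewrite -(eqn_pmul2l (m := 3)) // -(eqn_add2r (D.+1 * D.+2 * D.+3 * D.+4)) mulnA h.
apply/eqP; ring.
Qed.

End MonomialSums.

Section OffMultiples.

Variables (D : nat) (m : 'X_{1..3}).
Hypothesis mD : (mdeg m <= D)%N.

Lemma sum_bmnm_shift (F : 'X_{1..3} -> nat) :
  (\sum_(e : 'X_{1..3 < D.+1} | (m <= e)%MM) F e =
   \sum_(e : 'X_{1..3 < (D - mdeg m).+1}) F (e + m)%MM)%N.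
Proof.
have lt (e : 'X_{1..3 < (D - mdeg m).+1}) : (mdeg (e + m)%MM < D.+1)%N.
  by rewrite mdegD ltnS addnC -leq_subRL // -ltnS; exact: bmdeg.
pose h e := BMultinom (lt e).
rewrite -[RHS](big_imset (fun e : 'X_{1..3 < D.+1} => F e) (h := h) (A := predT)) /=; last first.
  by move=> x y _ _ /(congr1 (fun e : 'X_{1..3 < D.+1} => (e - m)%MM)) /=; rewrite !addmK => /val_inj.
apply: eq_bigl => e; apply/idP/imsetP => [me|[e' _ ->] /=]; last first.
  by apply/mnm_lepP => i; rewrite mnmDE leq_addl.
have le : (mdeg (e - m)%MM < (D - mdeg m).+1)%N.
  by have := bmdeg e; rewrite -{1}(submK me) mdegD !ltnS leq_subRL // addnC.
by exists (BMultinom le) => //; apply: val_inj; rewrite /= submK.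
Qed.

(* If [m] is the maximal exponent of [f], no nonzero combination of these monomials is a multiple
   of [f]. *)
Definition off_multiples : {set 'X_{1..3 < D.+1}} := [set e : 'X_{1..3 < D.+1} | ~~ (m <= e)%MM].

Lemma card_off_multiples :
  (6 * #|off_multiples| + (D - mdeg m).+1 * (D - mdeg m).+2 * (D - mdeg m).+3 = D.+1 * D.+2 * D.+3)%N.
Proof.
rewrite -(card_bmnm3 (D - mdeg m)) -(card_bmnm3 D) -mulnDr; congr (6 * _)%N.
have := sum_bmnm_shift (fun=> 1%N); rewrite [RHS]sum1_card => <-.
rewrite -[#|{: _}|]sum1_card [RHS](bigID (fun e : 'X_{1..3 < D.+1} => (m <= e)%MM)) /= addnC.
by rewrite -sum1_card; congr (_ + _)%N; apply: eq_bigl => e; rewrite inE.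
Qed.

End OffMultiples.

Lemma sum_mdeg_off_multiples D (m : 'X_{1..3}) : (mdeg m <= D)%N ->
  let d := (D - mdeg m)%N in
  (24 * \sum_(e in off_multiples D m) mdeg e + 3 * (d * d.+1 * d.+2 * d.+3) +
    4 * mdeg m * (d.+1 * d.+2 * d.+3) = 3 * (D * D.+1 * D.+2 * D.+3))%N.
Proof.
move=> mD d; rewrite -(sum_mdeg_bmnm3 D) -(sum_mdeg_bmnm3 d) -(card_bmnm3 d).
have := sum_bmnm_shift mD (fun e => mdeg e).
under [RHS]eq_bigr do rewrite mdegD.
rewrite big_split /= sum_nat_const => h.
rewrite [X in _ = (3 * (8 * X))%N](bigID (fun e : 'X_{1..3 < D.+1} => (m <= e)%MM)) /=.
rewrite h (_ : \sum_(e in off_multiples D m) mdeg e = \sum_(e : 'X_{1..3 < D.+1} | ~~ (m <= e)%MM) mdeg e)%N; last first.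
  by apply: eq_bigl => e; rewrite inE.
by rewrite -/d; ring.
Qed.

(* [c %/ dg] is the largest power of [g] that fits below the exponent [c]. *)
Definition q_weight m0 dg D : nat :=
  (\sum_(a < m0) \sum_(b < D.+1) \sum_(c < (D.+1 - a - b)%N) c %/ dg)%N.

Lemma q_weight_lower m0 dg D : (0 < dg)%N -> (m0 <= D)%N ->
  (m0 * (D.+1 - m0) ^ 3 <= 6 * dg * q_weight m0 dg D + 3 * dg * m0 * (D.+1 * D.+2))%N.
Proof.
move=> dg0 mD.
have s1 M : (M * M.+1 <= 2 * dg * (\sum_(c < M) c %/ dg) + 2 * dg * M)%N.
  elim: M => [|M IH]; first by rewrite big_ord0.
  rewrite big_ord_recr /=; have := ltn_ceil M dg0; rewrite -ltnS => h.
  have -> : (M.+1 * M.+2 = M * M.+1 + 2 * M.+1)%N by ring.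
  have h' : (M.+1 <= dg * (M %/ dg) + dg)%N by rewrite -mulnSr mulnC.
  have -> : (2 * dg * (\sum_(i < M) i %/ dg + M %/ dg) + 2 * dg * M.+1 =
    2 * dg * (\sum_(i < M) i %/ dg) + 2 * dg * M + 2 * (dg * (M %/ dg) + dg))%N by ring.
  by rewrite leq_add // leq_mul2l.
have s2 M : (M <= D.+1 -> M * M.+1 * M.+2 <= 6 * dg * (\sum_(b < D.+1) \sum_(c < (M - b)%N) c %/ dg) + 3 * dg * (M * M.+1))%N.
  move=> MD; pose g2 k := (\sum_(j < k.+1) j * j.+1)%N.
  have e2 k : (3 * g2 k = k * k.+1 * k.+2)%N.
    elim: k => [|k IH]; first by rewrite /g2 big_ord1.
    by rewrite /g2 big_ord_recr /= mulnDr -/(g2 k) IH; ring.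
  pose g1 k := (\sum_(j < k.+1) 2 * j)%N.
  have e1 k : (g1 k = k * k.+1)%N.
    elim: k => [|k IH]; first by rewrite /g1 big_ord1.
    by rewrite /g1 big_ord_recr /= -/(g1 k) IH; ring.
  rewrite -e2 -[g2 M](@sum_trunc (fun j => j * j.+1)%N _ D.+1) //; last 2 first.
  - by rewrite /g2 big_ord1.
  - by move=> k; rewrite /g2 big_ord_recr /= addnC.
  rewrite -e1 -[g1 M](@sum_trunc (fun j => 2 * j)%N _ D.+1) //; last first.
    by move=> k; rewrite /g1 big_ord_recr /= addnC.
  rewrite !big_distrr -big_split /= leq_sum // => b _.
  have := leq_mul (leqnn 3) (s1 (M - b)%N); move/leq_trans; apply.
  by apply: eq_leq; ring.
have -> : (m0 * (D.+1 - m0) ^ 3 = \sum_(a < m0) (D.+1 - m0) ^ 3)%N by rewrite sum_nat_const card_ord.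
have -> : (3 * dg * m0 * (D.+1 * D.+2) = \sum_(a < m0) 3 * dg * (D.+1 * D.+2))%N.
  by rewrite sum_nat_const card_ord; ring.
rewrite /q_weight big_distrr -big_split /= leq_sum // => a _.
apply: leq_trans (leq_trans (s2 (D.+1 - a)%N (leq_subr _ _)) _); last first.
  by rewrite leq_add2l leq_mul2l leq_mul ?orbT // ?ltnS leq_subr.
have le : (D.+1 - m0 <= D.+1 - a)%N by rewrite leq_sub2l // ltnW.
by rewrite !expnS expn0 muln1 mulnA !leq_mul // (leq_trans le) // ltnW.
Qed.

(** For a fixed exponent of [x_1], the slack [D - mdeg e] and the exponents of [x_2] and [x_3] are
    interchangeable, like barycentric coordinates of a simplex. So the three ways of inserting
    powers of [g] gain the same power of [q]. *)
Lemma q_weight_sums m0 dg D : (m0 <= D)%N -> forall (o1 := lift ord0 ord0 : 'I_3) (o2 := lift ord0 (lift ord0 ord0) : 'I_3),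
  let wt (ht : 'X_{1..3} -> nat) (e : 'X_{1..3}) := if (e ord0 < m0)%N then (ht e %/ dg)%N else 0%N in
  [/\ \sum_(e : 'X_{1..3 < D.+1}) wt (fun e => D - mdeg e) e = q_weight m0 dg D,
      \sum_(e : 'X_{1..3 < D.+1}) wt (fun e => e o1) e = q_weight m0 dg D &
      \sum_(e : 'X_{1..3 < D.+1}) wt (fun e => e o2) e = q_weight m0 dg D]%N.
Proof.
move=> mD o1 o2 wt.
have widen (F : nat -> nat) : (\sum_(a < D.+1) (if a < m0 then F a else 0) = \sum_(a < m0) F a)%N.
  rewrite -big_mkcond (big_ord_widen_cond D.+1 xpredT F) //=; exact: leq_trans mD _.
have tail M (F : nat -> nat) : (M <= D.+1 -> \sum_(c < D.+1 | c < M) F c = \sum_(c < M) F c)%N.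
  by move=> MD; rewrite (big_ord_widen_cond D.+1 xpredT F).
have cnd a b c : (a + (b + c) <= D)%N = (c < D.+1 - a - b)%N by apply/idP/idP; lia.
have inner a : (\sum_(b < D.+1) \sum_(c < D.+1 | a + (b + c) <= D) c %/ dg = \sum_(b < D.+1) \sum_(c < D.+1 - a - b) c %/ dg)%N.
  apply: eq_bigr => b _; under eq_bigl do rewrite cnd.
  by apply: (tail _ (fun c => c %/ dg)%N); rewrite -subnDA leq_subr.
have out (H : nat -> nat -> nat -> nat) : (forall a, \sum_(b < D.+1) \sum_(c < D.+1 | a + (b + c) <= D) H a b c =
    \sum_(b < D.+1) \sum_(c < D.+1 - a - b) c %/ dg)%N ->
  (\sum_(e : 'X_{1..3 < D.+1}) (if e ord0 < m0 then H (e ord0) (e o1) (e o2) else 0) = q_weight m0 dg D)%N.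
  move=> hH; rewrite (sum_bmnm3 D (fun a b c => if a < m0 then H a b c else 0))%N.
  rewrite /q_weight -(widen (fun a => \sum_(b < D.+1) \sum_(c < D.+1 - a - b) c %/ dg)%N); apply: eq_bigr => a _; case: ifP => _; first exact: hH.
  by rewrite big1 // => b _; rewrite big1.
split.
- under eq_bigr do rewrite /wt mdeg3.
  apply: (out (fun a b c => (D - (a + (b + c))) %/ dg)%N) => a; apply: eq_bigr => b _.
  under eq_bigl do rewrite cnd.
  rewrite (tail _ (fun c => (D - (a + (b + c))) %/ dg)%N) -?subnDA ?leq_subr //.
  rewrite (reindex_inj rev_ord_inj) /=; apply: eq_bigr => c _; congr (_ %/ _)%N.
  by have := ltn_ord c; lia.
- apply: (out (fun a b c => b %/ dg)%N) => a; rewrite -inner.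
  under eq_bigr do rewrite big_mkcond.
  rewrite exchange_big /=; apply: eq_bigr => b _; rewrite -big_mkcond /=; apply: eq_bigl => c.
  by rewrite [(b + c)%N]addnC.
- exact: (out (fun a b c => c %/ dg)%N).
Qed.

(** * Sums over primes *)

Section PrimeSums.

Variable R : realType.
Implicit Types (n p X : nat) (eta : R).

Lemma ln_nat_ge0 n : 0 <= ln n%:R :> R.
Proof. by case: n => [|n]; [rewrite ln0 | rewrite ln_ge0 // ler1n]. Qed.

Lemma ln_sum_logn n X : (0 < n)%N -> (forall p, prime p -> (p %| n)%N -> (p < X)%N) ->
  ln n%:R = \sum_(p < X) (logn p n)%:R * ln p%:R :> R.
Proof.
move=> n0 nX.
have ext Y Z (F : nat -> nat) : (Y <= Z)%N -> (forall p, (Y <= p)%N -> logn p n = 0%N) ->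
    \sum_(p < Y) (logn p n)%:R * ln p%:R = \sum_(p < Z) (logn p n)%:R * ln p%:R :> R.
  move=> YZ h; rewrite (big_ord_widen Z (fun p => (logn p n)%:R * ln p%:R : R) YZ) big_mkcond.
  by apply: eq_bigr => p _; case: ltnP => // /h ->; rewrite mul0r.
have L p : (X <= p)%N -> logn p n = 0%N.
  move=> Xp; apply/eqP; rewrite -leqn0 leqNgt; apply/negP; rewrite logn_gt0 mem_primes => /and3P[pp _ /nX].
  by rewrite pp => /(_ isT); rewrite ltnNge Xp.
have L' p : (n.+1 <= p)%N -> logn p n = 0%N.
  move=> np; apply/eqP; rewrite -leqn0 leqNgt; apply/negP; rewrite logn_gt0 mem_primes => /and3P[_ _ /dvdn_leq].
  by rewrite n0 => /(_ isT); rewrite leqNgt np.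
have E : ln n%:R = \sum_(p < n.+1) (logn p n)%:R * ln p%:R :> R.
  rewrite -[X in ln X%:R](partnT n0) /partn big_mkord natr_prod.
  suff [] : 0 < \prod_(i < n.+1) (i ^ logn i n)%:R :> R /\
    ln (\prod_(i < n.+1) (i ^ logn i n)%:R) = \sum_(p < n.+1) (logn p n)%:R * ln p%:R :> R by [].
  elim/big_ind2: _ => [|x a y b [x0 <-] [y0 <-]|p _]; first by rewrite ln1.
    by rewrite mulr_gt0 // lnM.
  have [->|pn] := posnP (logn p n); first by rewrite mul0r expn0 ln1.
  have p0 : (0 < p)%N by move: pn; rewrite logn_gt0 mem_primes => /and3P[/prime_gt0].
  by rewrite natrX exprn_gt0 ?ltr0n // lnXn ?ltr0n // mulr_natl.
rewrite E; case: (leqP n.+1 X) => [h|/ltnW h]; first exact: ext.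
by rewrite -(ext X n.+1).
Qed.

Lemma sum_ln_dvd n X : (0 < n)%N -> \sum_(p < X | prime p && (p %| n)%N) ln p%:R <= ln n%:R :> R.
Proof.
move=> n0; pose Y := maxn X n.+1.
rewrite (ln_sum_logn n0 (X := Y)); last first.
  by move=> p pp /(dvdn_leq n0) pn; rewrite leq_max orbC ltnS pn.
rewrite (big_ord_widen_cond Y (fun p => prime p && (p %| n)%N) (fun p => ln p%:R : R)) ?leq_maxl //.
rewrite big_mkcond; apply: ler_sum => p _; case: ifP => [/andP[/andP[pp pn] _]|_]; last first.
  by rewrite mulr_ge0 // ln_nat_ge0.
by rewrite ler_peMl ?ln_nat_ge0 // ler1n logn_gt0 mem_primes pp n0.
Qed.

(** Beyond [1 / eta] the factor [1 / p] is at most [eta], and the [ln p] over the primes dividing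
    [n] sum to at most [ln n]; the finitely many smaller primes go into [C]. Divisors of numbers
    polynomial in [B] thus cost an arbitrarily small multiple of [ln B]. *)
Lemma sum_ln_div_dvd eta : 0 < eta -> exists C : R, 0 <= C /\ forall n X, (0 < n)%N ->
  \sum_(p < X | prime p && (p %| n)%N) ln p%:R / p%:R <= eta * ln n%:R + C :> R.
Proof.
move=> e0; pose P0 := Num.bound eta^-1.
exists (\sum_(p < P0) ln p%:R); split=> [|n X n0]; first by apply: sumr_ge0 => p _; exact: ln_nat_ge0.
apply: (@le_trans _ _ (\sum_(p < X | prime p && (p %| n)%N) (eta * ln p%:R + (if (p < P0)%N then ln p%:R else 0)))).
  apply: ler_sum => p /andP[pp _].
  have p0 : 0 < p%:R :> R by rewrite ltr0n prime_gt0.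
  case: ltnP => pP.
    rewrite -[leLHS]add0r; apply: lerD; first by rewrite mulr_ge0 ?ln_nat_ge0 // ltW.
    by rewrite ler_pdivrMr // ler_peMr ?ln_nat_ge0 // ler1n prime_gt0.
  rewrite addr0 mulrC ler_wpM2r ?ln_nat_ge0 // invf_ple //.
  have := archi_boundP (ltW (x := 0) (y := eta^-1) _); rewrite invr_gt0 e0 => /(_ isT) h.
  by rewrite (le_trans (ltW h)) // ler_nat.
rewrite big_split /= lerD //.
  by rewrite -mulr_sumr ler_wpM2l ?sum_ln_dvd // ltW.
pose Y := maxn X P0.
rewrite (big_ord_widen_cond Y (fun p => prime p && (p %| n)%N) (fun p => if (p < P0)%N then ln p%:R else 0 : R)) ?leq_maxl //.
rewrite (big_ord_widen Y (fun p => ln p%:R : R)) ?leq_maxr //.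
rewrite big_mkcond [leRHS]big_mkcond; apply: ler_sum => p _.
by case: ifP => _; case: ifP => _ //; exact: ln_nat_ge0.
Qed.

Let ln_step n : (0 < n)%N -> ln n.+1%:R <= ln n%:R + n%:R^-1 :> R.
Proof.
move=> n0; have n0' : 0 < n%:R :> R by rewrite ltr0n.
have -> : n.+1%:R = n%:R * (1 + n%:R^-1) :> R by rewrite mulrDr mulr1 divff ?gt_eqF // -natr1.
rewrite lnM ?posrE // ?addr_gt0 ?invr_gt0 // lerD2l.
by apply: le_ln1Dx; rewrite (lt_trans (y := 0)) ?invr_gt0 // ltrN10.
Qed.

Lemma ln_fact_lower n : (0 < n)%N -> n%:R * ln n%:R - n%:R <= ln n`!%:R :> R.
Proof.
case: n => // n _; elim: n => [|n IH]; first by rewrite (_ : 1`! = 1)%N // !ln1 mulr0 subr_le0.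
rewrite factS natrM lnM ?posrE ?ltr0n ?fact_gt0 //.
apply: le_trans (lerD (lexx _) IH).
have n0 : 0 < n.+1%:R :> R by rewrite ltr0n.
have h := ln_step (ltn0Sn n).
have h' : n.+1%:R * ln n.+2%:R <= n.+1%:R * ln n.+1%:R + 1 :> R.
  by have := ler_wpM2l (ltW n0) h; rewrite mulrDr divff ?gt_eqF.
have -> : n.+2%:R = n.+1%:R + 1 :> R by rewrite natr1.
rewrite -[n.+2%:R]natr1 in h'; lra.
Qed.

Lemma logn_fact_le p n : prime p -> (p.-1 * logn p n`! <= n)%N.
Proof.
move=> pp; rewrite logn_fact // big_distrr /=.
have h k : (\sum_(1 <= i < k.+1) p.-1 * (n %/ p ^ i) + n %/ p ^ k <= n)%N.
  elim: k => [|k IH]; first by rewrite big_geq // expn0 divn1.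
  rewrite big_nat_recr //= -addnA; apply: leq_trans IH; rewrite leq_add2l.
  have -> : (p.-1 * (n %/ p ^ k.+1) + n %/ p ^ k.+1 = p * (n %/ p ^ k.+1))%N.
    by rewrite -mulSnr prednK // prime_gt0.
  by rewrite expnSr divnMA mulnC leq_trunc_div.
by apply: leq_trans (h n); rewrite leq_addr.
Qed.

(* The correction [(ln n + 2) / n] makes the bound provable by induction on [n]. *)
Lemma sum_ln_div_square n : (0 < n)%N ->
  \sum_(p < n.+1) ln p%:R / (p%:R * p.-1%:R) <= 2 - (ln n%:R + 2) / n%:R :> R.
Proof.
case: n => // n _; elim: n => [|n IH].
  by rewrite !big_ord_recl big_ord0 /= ln0 // ln1 !mul0r !add0r divr1 subrr.
rewrite big_ord_recr /=; apply: le_trans (lerD IH (lexx _)) _.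
set a : R := n.+1%:R; have a0 : 0 < a by rewrite ltr0n.
have -> : n.+2%:R = a + 1 :> R by rewrite /a natr1.
have h := ln_step (ltn0Sn n); rewrite -/a -[n.+2%:R]natr1 -/a in h.
have h1 : 0 < a + 1 by rewrite addr_gt0.
have h2 : (a + 1) * ln (a + 1) <= (a + 1) * ln a + (a + 1) / a.
  by rewrite -mulrDr ler_wpM2l // ltW.
have h3 : (a + 1) / a <= 2.
  by rewrite ler_pdivrMr //; have : 1 <= a; [rewrite ler1n | lra].
clearbody a.
have -> : 2 - (ln a + 2) / a + ln (a + 1) / ((a + 1) * a) =
  2 - ((a + 1) * (ln a + 2) - ln (a + 1)) / (a * (a + 1)).
  field; apply/andP; split; exact: lt0r_neq0.
have -> : 2 - (ln (a + 1) + 2) / (a + 1) = 2 - (a * (ln (a + 1) + 2)) / (a * (a + 1)).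
  field; apply/andP; split; exact: lt0r_neq0.
rewrite lerD2l lerN2 ler_wpM2r ?invr_ge0 ?mulr_ge0 ?(ltW a0) ?(ltW h1) //.
lra.
Qed.

(** Stirling's lower bound for [ln n!] against Legendre's formula; the constant 3 is 1 from Stirling
    plus 2 from [sum_ln_div_square]. *)
Lemma mertens_lower n : (0 < n)%N -> ln n%:R - 3 <= \sum_(p < n.+1 | prime p) ln p%:R / p%:R :> R.
Proof.
move=> n0; have n0' : 0 < n%:R :> R by rewrite ltr0n.
have h1 := ln_fact_lower n0.
have h2 : ln n`!%:R = \sum_(p < n.+1) (logn p n`!)%:R * ln p%:R :> R.
  apply: ln_sum_logn; first exact: fact_gt0.
  move=> p pp; rewrite ltnS leqNgt => pn; apply/negP => np.
  have : (0 < logn p n`!)%N by rewrite logn_gt0 mem_primes pp fact_gt0.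
  rewrite logn_fact // big_nat big1 // => i /andP[i1 _]; apply: divn_small.
  by apply: leq_trans np _; rewrite -{1}(expn1 p) leq_pexp2l // prime_gt0.
have h3 : ln n`!%:R <= n%:R * (\sum_(p < n.+1 | prime p) ln p%:R / p%:R +
   \sum_(p < n.+1) ln p%:R / (p%:R * p.-1%:R)) :> R.
  rewrite h2 [X in _ * (X + _)]big_mkcond -big_split /= mulr_sumr; apply: ler_sum => p _.
  case: ifP => pp; last first.
    rewrite lognE pp mul0r mulr_ge0 ?(ltW n0') // add0r mulr_ge0 ?ln_nat_ge0 //.
    by rewrite invr_ge0 mulr_ge0.
  have p1 : 0 < p.-1%:R :> R by rewrite ltr0n -ltnS prednK ?prime_gt1 ?prime_gt0.
  have p0 : 0 < p%:R :> R by rewrite ltr0n prime_gt0.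
  have pE : p%:R = p.-1%:R + 1 :> R by rewrite natr1 prednK // prime_gt0.
  have -> : ln p%:R / p%:R + ln p%:R / (p%:R * p.-1%:R) = p.-1%:R^-1 * ln p%:R :> R.
    by rewrite pE; field; rewrite -pE !gt_eqF.
  rewrite mulrA ler_wpM2r ?ln_nat_ge0 // ler_pdivlMr // -natrM ler_nat mulnC.
  exact: logn_fact_le.
have h4 := sum_ln_div_square n0.
have h5 : 0 <= (ln n%:R + 2) / n%:R :> R by rewrite divr_ge0 // addr_ge0 // ln_nat_ge0.
have : n%:R * (ln n%:R - 1) <= n%:R * (\sum_(p < n.+1 | prime p) ln p%:R / p%:R + 2) :> R.
  rewrite mulrBr mulr1; apply: le_trans (le_trans h1 h3) _.
  by rewrite ler_wpM2l ?(ltW n0') //; lra.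
by rewrite ler_pM2l //; lra.
Qed.

End PrimeSums.

(** * Comparison of the bounds for the determinant *)

Lemma prime_inverse (p : nat) (a : int) : prime p -> ~~ (p%:Z %| a)%Z ->
  exists c : int, (p%:Z %| 1 - c * a)%Z.
Proof.
move=> pp pa; have [u [v uv]] := Bezoutz p%:Z a; exists v.
have g1 : gcdz p%:Z a = 1.
  have : coprimez p%:Z a by rewrite coprimezE /= prime_coprime.
  by rewrite /coprimez => /eqP.
by rewrite -g1 -uv addrK dvdz_mull.
Qed.

Lemma absz_det_le N (c : 'I_N -> nat) (A : 'M[int]_N) :
  (forall j k, (`|(A j k)%R| <= c k)%N) -> (`|(\det A)%R| <= N`! * \prod_k c k)%N.
Proof.
move=> hA; have h (s : 'S_N) : (`|((-1) ^+ s * \prod_i A i (s i))%R| <= \prod_k c k)%N.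
  rewrite abszMsign [X in (_ <= X)%N](reindex_inj (@perm_inj _ s)) /=.
  by rewrite (big_morph absz abszM (erefl _)); apply: leq_prod => i _; exact: hA.
apply: (@leq_trans (\sum_(s : 'S_N) \prod_k c k)%N); last by rewrite sum_nat_const card_Sn.
rewrite /determinant; apply: (big_ind2 (fun (x : int) (a : nat) => `|x|%N <= a)%N) => // x a y b xa yb.
have [_ _ nD _ _] := int_norm; by apply: leq_trans (nD _ _) _; rewrite leq_add.
Qed.

Section OffMultiplesMatrix.

Variables (D : nat) (m : 'X_{1..3}).
Let N := #|off_multiples D m|.

Definition off_mon (k : 'I_N) : 'X_{1..3} := bmnm (enum_val k).

Definition off_matrix (u : 'I_N -> 'I_3 -> int) : 'M[int]_N :=
  \matrix_(j, k) ('X_[off_mon k] : {mpoly int[3]}).@[u j].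

Lemma off_mon_inj : injective off_mon.
Proof. by move=> k k' /val_inj/enum_val_inj. Qed.

Lemma off_monP k : (mdeg (off_mon k) <= D)%N /\ ~~ (m <= off_mon k)%MM.
Proof.
by have := enum_valP k; rewrite /off_mon inE => ->; rewrite -ltnS bmdeg.
Qed.

Lemma off_mon_full e : (mdeg e <= D)%N -> ~~ (m <= e)%MM -> exists k, e = off_mon k.
Proof.
move=> eD em; have eD' : (mdeg e < D.+1)%N by [].
have eo : BMultinom eD' \in off_multiples D m by rewrite inE.
by exists (enum_rank_in eo (BMultinom eD')); rewrite /off_mon enum_rankK_in.
Qed.

Lemma sum_off_mon (F : 'X_{1..3} -> nat) :
  (\sum_k F (off_mon k) = \sum_(e in off_multiples D m) F e)%N.
Proof. by rewrite [RHS]big_enum_val. Qed.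

Lemma vanishing_or_det (u : nat -> 'I_3 -> int) :
  (exists a : 'I_N -> nat, \det (off_matrix (u \o a)) != 0) \/
  (exists G : {mpoly int[3]}, [/\ G != 0,
     forall e, e \in msupp G -> (mdeg e <= D)%N /\ ~~ (m <= e)%MM & forall n, G.@[u n] = 0]).
Proof.
have [[a ha]|[c [b cb] hc]] := kernel_or_det (fun n (k : 'I_N) => ('X_[off_mon k] : {mpoly int[3]}).@[u n]).
  by left; exists a.
right; pose G : {mpoly int[3]} := \sum_k c k *: 'X_[off_mon k].
have Gc k : G@_(off_mon k) = c k.
  rewrite /G raddf_sum /= (bigD1 k) //= mcoeffZ mcoeffX eqxx mulr1 big1 ?addr0 // => k' kk.
  by rewrite mcoeffZ mcoeffX (inj_eq off_mon_inj) (negPf kk) mulr0.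
exists G; split=> [|e|n].
- by apply: contraNneq cb => G0; rewrite -Gc G0 mcoeff0.
- rewrite mcoeff_msupp /G raddf_sum /= => h.
  have [k /eqP ->|ne] := pickP (fun k => e == off_mon k); first exact: off_monP.
  case/eqP: h; apply: big1 => k _; rewrite mcoeffZ mcoeffX eq_sym.
  by have := ne k; rewrite /= => ->; rewrite mulr0.
- rewrite /G raddf_sum /= -[RHS](hc n); apply: eq_bigr => k _.
  by rewrite mevalZ.
Qed.

Section LogDet.

Variable R : realType.
Variables (u : 'I_N -> 'I_3 -> int) (Bn : nat).
Hypotheses (uB : forall j i, (`|u j i| <= Bn)%N) (B0 : (0 < Bn)%N).
Hypothesis det0 : \det (off_matrix u) != 0.
Variables (q dg : nat) (g : {mpoly int[3]}).
Let o1 : 'I_3 := lift ord0 ord0.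
Let o2 : 'I_3 := lift ord0 (lift ord0 ord0).
Hypotheses (q0 : (0 < q)%N) (dg0 : (0 < dg)%N) (mD : (m ord0 <= D)%N).
Hypothesis (gsupp : forall e', e' \in msupp g -> e' ord0 = 0%N /\ (mdeg e' <= dg)%N).
Hypothesis (qg : forall j, (q%:Z %| g.@[u j])%Z).
Hypothesis (cop : gcdz (gcdz (gcdz q%:Z g@_0) g@_(U_(o1) *+ dg)%MM) g@_(U_(o2) *+ dg)%MM = 1).
Variables (i0 i1 i2 : 'I_3) (f : {poly {poly {poly int}}}).
Hypothesis u3 : uniq [:: i0; i1; i2].
Hypothesis uf : forall j, ev3 idfun (u j i0) (u j i1) (u j i2) f = 0.
Variables (p0 i r : nat) (xt yt zt : int).
Hypothesis (pp0 : prime p0).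
Hypothesis (class0 : (0 < i)%N -> [/\ ~~ (p0 %| q)%N, ~~ (p0%:Z %| ev3 idfun xt yt zt f^`())%Z &
  forall j, [/\ p0%:Z %| u j i0 - xt, p0%:Z ^+ i %| u j i1 - yt & p0%:Z ^+ i %| u j i2 - zt]%Z]).
Variables (X : nat) (Gd : pred nat) (rp : nat -> nat).
Hypothesis (GdP : forall p, Gd p -> p != p0 /\ ~~ (p %| q)%N).

Let bad p := #|[set j | (p%:Z %| ev3 idfun (u j i0) (u j i1) (u j i2) f^`())%Z]|.

(** The logarithms of the gains can be added because they concern disjoint sets of primes: the prime
    factors of [q], the prime [p0] if [i > 0], and the set [Gd]. *)
Lemma log_det_bound :
  (q_weight (m ord0) dg D)%:R * ln q%:R + (i * (r * N - tri r))%:R * ln p0%:R +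
  \sum_(p < X.+1 | prime p && Gd p) (rp p * (N - bad p) - #|smooth_points p f| * tri (rp p))%:R * ln p%:R
  <= ln (N`!)%:R + (\sum_(e in off_multiples D m) mdeg e)%:R * ln Bn%:R :> R.
Proof.
set d := `|\det (off_matrix u)|%N.
have d0 : (0 < d)%N by rewrite absz_gt0.
have upper : ln d%:R <= ln (N`!)%:R + (\sum_(e in off_multiples D m) mdeg e)%:R * ln Bn%:R :> R.
  have : (d <= N`! * \prod_k Bn ^ mdeg (off_mon k))%N.
    apply: absz_det_le => j k; rewrite mxE mevalX mdegE expn_sum.
    elim/big_ind2: _ => // [x a y b xa yb|l _]; first by rewrite abszM leq_mul.
    by rewrite abszX; case: (off_mon k l) => // n; rewrite leq_exp2r.
  rewrite -expn_sum (sum_off_mon (fun e => mdeg e)) => dle.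
  have h0 : (0 < N`! * Bn ^ (\sum_(e in off_multiples D m) mdeg e))%N.
    by rewrite muln_gt0 fact_gt0 expn_gt0 B0.
  have : ln d%:R <= ln (N`! * Bn ^ (\sum_(e in off_multiples D m) mdeg e))%:R :> R.
    by rewrite ler_ln ?posrE ?ltr0n // ler_nat.
  by rewrite natrM natrX lnM ?posrE ?exprn_gt0 ?ltr0n ?fact_gt0 // lnXn ?ltr0n // mulr_natl.
apply: le_trans upper; pose Y := (maxn X.+1 (maxn d.+1 (maxn q.+1 p0.+1))).
have qgain : (q%:Z ^+ q_weight (m ord0) dg D %| \det (off_matrix u))%Z.
  have [s0 s1 s2] := q_weight_sums dg mD.
  have off (F : 'X_{1..3} -> nat) :
     (\sum_(k : 'I_N) (if off_mon k ord0 < m ord0 then F (off_mon k) else 0) =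
      \sum_(e : 'X_{1..3 < D.+1}) (if e ord0 < m ord0 then F e else 0))%N.
    rewrite (sum_off_mon (fun e => if e ord0 < m ord0 then F e else 0))%N.
    rewrite big_mkcond; apply: eq_bigr => e _; rewrite inE; case: ifP => // /negbFE/mnm_lepP/(_ ord0).
    by rewrite leqNgt => /negPf->.
  apply: (q_gain off_mon_inj (D := D) (m0 := m ord0) _ _ gsupp qg (i1 := o1) (i2 := o2) _ _ cop) => //.
  - by move=> k; case: (off_monP k).
  - move=> e' e'D e'm; apply: off_mon_full => //; apply/negP => /mnm_lepP/(_ ord0).
    by rewrite leqNgt e'm.
  - by rewrite -s0 -(off (fun e => (D - mdeg e) %/ dg)%N).
  - by rewrite -s1 -(off (fun e => e o1 %/ dg)%N).
  - by rewrite -s2 -(off (fun e => e o2 %/ dg)%N).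
have matE : off_matrix u = \matrix_(j, k) ev3 idfun (u j i0) (u j i1) (u j i2) (nest i0 i1 'X_[off_mon k]).
  by apply/matrixP => j k; rewrite !mxE nest_meval.
have p0gain : (p0 ^ (i * (r * N - tri r)) %| d)%N.
  have [->|i_gt0] := posnP i; first by rewrite mul0n expn0 dvd1n.
  have [_ fx hcl] := class0 i_gt0; have [ct hct] := prime_inverse pp0 fx.
  have := @class_gain N unit f p0%:Z i r (fun k => nest i0 i1 'X_[off_mon k]) (fun j => u j i0)
    (fun j => u j i1) (fun j => u j i2) (fun=> xt) (fun=> yt) (fun=> zt) (fun=> ct) setT i_gt0 (fun=> hct).
  rewrite cardsT card_ord card_unit mul1n -matE => H.
  by have := H (fun j _ => conj (uf j) (ex_intro _ tt (hcl j))); rewrite dvdzE abszX.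
have pgain p : prime p -> (p ^ (rp p * (N - bad p) - #|smooth_points p f| * tri (rp p)) %| d)%N.
  move=> pp; pose G := [set j | ~~ (p%:Z %| ev3 idfun (u j i0) (u j i1) (u j i2) f^`())%Z].
  have := @prime_gain N f p (rp p) (fun k => nest i0 i1 'X_[off_mon k]) (fun j => u j i0)
    (fun j => u j i1) (fun j => u j i2) G pp.
  have -> : #|G| = (N - bad p)%N.
    rewrite -[N in RHS]card_ord -(cardsC [set j | (p%:Z %| ev3 idfun (u j i0) (u j i1) (u j i2) f^`())%Z]) addKn.
    by apply: eq_card => j; rewrite !inE.
  rewrite -matE => H; have HG j : j \in G -> ev3 idfun (u j i0) (u j i1) (u j i2) f = 0 /\
      ~~ (p%:Z %| ev3 idfun (u j i0) (u j i1) (u j i2) f^`())%Z.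
    by rewrite inE => ?; split.
  by have := H HG; rewrite dvdzE abszX.
rewrite (ln_sum_logn R d0 (X := Y)); last first.
  by move=> p _ /(dvdn_leq d0) pd; rewrite /Y !leq_max !ltnS pd !orbT.
have -> : ln q%:R = \sum_(p < Y) (logn p q)%:R * ln p%:R :> R.
  by apply: ln_sum_logn => // p _ /(dvdn_leq q0) pq; rewrite /Y !leq_max !ltnS pq !orbT.
have -> : (i * (r * N - tri r))%:R * ln p0%:R =
   \sum_(p < Y) (if p == p0 :> nat then (i * (r * N - tri r))%N else 0%N)%:R * ln p%:R :> R.
  have p0Y : (p0 < Y)%N by rewrite /Y !leq_max !ltnS leqnn !orbT.
  rewrite (bigD1 (Ordinal p0Y)) //= eqxx big1 ?addr0 // => p pne.
  by rewrite (_ : (p == p0 :> nat) = false) ?mul0r //; apply: negPf.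
rewrite (big_ord_widen_cond Y (fun p => prime p && Gd p)
  (fun p => (rp p * (N - bad p) - #|smooth_points p f| * tri (rp p))%:R * ln p%:R : R)) ?leq_maxl //.
rewrite [X in _ + _ + X]big_mkcond mulr_sumr -!big_split /=; apply: ler_sum => p _.
set E0 := (i * _)%N; set E1 := (_ - _ * _)%N.
have := ln_nat_ge0 R p; have [|l0 _] := eqVneq (ln p%:R : R) 0.
  by move=> -> _; rewrite !mulr0; case: ifP; rewrite !addr0.
have -> : (if (prime p && Gd p) && (p < X.+1)%N then E1%:R * ln p%:R else 0) =
   (if (prime p && Gd p) && (p < X.+1)%N then E1 else 0)%:R * ln p%:R :> R.
  by case: ifP; rewrite ?mul0r.
rewrite mulrA -!mulrDl ler_wpM2r ?ln_nat_ge0 // -natrM -!natrD ler_nat.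
have [pp|npp] := boolP (prime p); last first.
  rewrite (_ : logn p q = 0%N); last by rewrite lognE (negPf npp).
  rewrite muln0 add0n addn0; case: eqP => // pE.
  by move: npp; rewrite pE pp0.
have qg' : (q_weight (m ord0) dg D * logn p q <= logn p d)%N.
  by rewrite -lognX dvdn_leq_log // /d; move: qgain; rewrite dvdzE abszX.
have p0g : p = p0 :> nat -> (E0 <= logn p d)%N by move=> pE; rewrite -pfactor_dvdn // pE.
have pg : (E1 <= logn p d)%N by rewrite -pfactor_dvdn //; exact: pgain.
have [pq|pq] := boolP (p %| q)%N.
  have -> : (if p == p0 :> nat then E0 else 0%N) = 0%N.
    case: eqP => // pE; rewrite /E0; have [->|/class0[]] := posnP i; first by rewrite mul0n.
    by rewrite -pE pq.
  case: ifP => [/andP[/andP[_ /GdP[_]]]|_]; first by rewrite pq.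
  by rewrite !addn0.
rewrite (_ : logn p q = 0%N) ?muln0 ?add0n; last by rewrite lognE pp q0 (negPf pq).
case: eqP => [pE|_]; last by rewrite add0n; case: ifP.
case: ifP => [/andP[/andP[_ /GdP[]]]|_]; first by rewrite pE eqxx.
by rewrite addn0; exact: p0g.
Qed.

End LogDet.

End OffMultiplesMatrix.

Section MasterInequality.

Variable R : realType.

Lemma tri_real r : 6 * (tri r)%:R = r%:R * (r%:R + 1) * (r%:R + 2) :> R.
Proof.
have := congr1 (fun n => n%:R : R) (triE r); rewrite !natrM => ->.
by rewrite -[r.+2%:R]natr1 -[r.+1%:R]natr1 -addrA.
Qed.

Lemma card_off_real D (m : 'X_{1..3}) (s : R) : (mdeg m)%:R = s -> 1 <= s -> s <= D%:R ->
  s * D%:R ^+ 2 / 2 - 6 * s ^+ 3 * D%:R <= (#|off_multiples D m|)%:R <= 7 * s ^+ 3 * D%:R ^+ 2.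
Proof.
move=> sE s1 sD; set N : R := (#|off_multiples D m|)%:R; set x : R := D%:R.
have mD : (mdeg m <= D)%N by rewrite -(ler_nat R) sE.
have := congr1 (fun n => n%:R : R) (card_off_multiples mD).
rewrite natrD !natrM -/N -[D.+3%:R]natr1 -[D.+2%:R]natr1 -[D.+1%:R]natr1.
rewrite -[(D - _).+3%:R]natr1 -[(D - _).+2%:R]natr1 -[(D - _).+1%:R]natr1 natrB // sE -/x => h.
have E : N = s * x ^+ 2 / 2 + ((12 * s - 3 * s ^+ 2) * x + s ^+ 3 - 6 * s ^+ 2 + 11 * s) / 6 by lra.
have x1 : 1 <= x by exact: le_trans sD.
have s2 : s <= s ^+ 2 by rewrite expr2 ler_peMl // (le_trans ler01).
have s3 : s ^+ 2 <= s ^+ 3 by rewrite [X in _ <= X]exprS ler_peMl ?sqr_ge0.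
have s0 : 0 <= s by exact: le_trans s1.
have a1 : s ^+ 3 <= s ^+ 3 * x by rewrite ler_peMr // exprn_ge0.
have a2 : s ^+ 2 * x <= s ^+ 3 * x by rewrite ler_wpM2r // (le_trans ler01).
have a3 : s * x <= s ^+ 2 * x by rewrite ler_wpM2r // (le_trans ler01).
have a4 : 0 <= s * x by rewrite mulr_ge0 // (le_trans ler01).
have a5 : s ^+ 3 * x <= s ^+ 3 * x ^+ 2.
  by rewrite ler_wpM2l ?exprn_ge0 // expr2 ler_peMr // (le_trans ler01).
have a6 : s * x ^+ 2 <= s ^+ 3 * x ^+ 2 by rewrite ler_wpM2r ?sqr_ge0 // (le_trans s2).
by rewrite E; apply/andP; split; lra.
Qed.

Lemma sum_mdeg_real D (m : 'X_{1..3}) (s : R) : (mdeg m)%:R = s -> 1 <= s -> s <= D%:R ->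
  (\sum_(e in off_multiples D m) mdeg e)%:R <= s * D%:R ^+ 3 / 3 + 20 * s ^+ 4 * D%:R ^+ 2 :> R.
Proof.
move=> sE s1 sD; set W : R := (\sum_(e in off_multiples D m) mdeg e)%:R; set x : R := D%:R.
have mD : (mdeg m <= D)%N by rewrite -(ler_nat R) sE.
have := congr1 (fun n => n%:R : R) (sum_mdeg_off_multiples mD) => /=.
rewrite !natrD !natrM -/W -[D.+3%:R]natr1 -[D.+2%:R]natr1 -[D.+1%:R]natr1.
rewrite -[(D - _).+3%:R]natr1 -[(D - _).+2%:R]natr1 -[(D - _).+1%:R]natr1 natrB // sE -/x => h.
have x1 : 1 <= x by exact: le_trans sD.
have x0 : 0 <= x by exact: le_trans x1.
have s0 : 0 <= s by exact: le_trans s1.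
have s2 : s <= s ^+ 2 by rewrite expr2 ler_peMl.
have s3 : s ^+ 2 <= s ^+ 3 by rewrite [X in _ <= X]exprS ler_peMl ?sqr_ge0.
have s4 : s ^+ 3 <= s ^+ 4 by rewrite [X in _ <= X]exprS ler_peMl ?exprn_ge0.
have m1 k : s ^+ k.+1 * x <= s ^+ k.+1 * x ^+ 2.
  by rewrite ler_wpM2l ?exprn_ge0 // expr2 ler_peMr.
have m0 k : s ^+ k.+1 <= s ^+ k.+1 * x by rewrite ler_peMr // exprn_ge0.
have := m1 0%N; have := m1 1%N; have := m1 2; have := m1 3.
have := m0 0%N; have := m0 1%N; have := m0 2; have := m0 3; rewrite !expr1.
have t2 : s * x ^+ 2 <= s ^+ 2 * x ^+ 2 by rewrite ler_wpM2r ?sqr_ge0.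
have t3 : s ^+ 2 * x ^+ 2 <= s ^+ 3 * x ^+ 2 by rewrite ler_wpM2r ?sqr_ge0.
have t4 : s ^+ 3 * x ^+ 2 <= s ^+ 4 * x ^+ 2 by rewrite ler_wpM2r ?sqr_ge0.
have t0 : 0 <= s by [].
by move=> *; lra.
Qed.

Lemma q_weight_real D m0 dg (s : R) : (0 < dg)%N -> m0%:R <= s -> 1 <= s -> s <= D%:R ->
  m0%:R * D%:R ^+ 3 / (6 * dg%:R) - 6 * s ^+ 2 * D%:R ^+ 2 <= (q_weight m0 dg D)%:R :> R.
Proof.
move=> dg0 ms s1 sD; set x : R := D%:R; set t : R := m0%:R.
have mD : (m0 <= D)%N by rewrite -(ler_nat R) (le_trans ms).
have := q_weight_lower dg0 mD; rewrite -(ler_nat R) natrD [(m0 * _)%:R]natrM natrX !natrM natrB; last exact: leqW.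
rewrite -[D.+2%:R]natr1 -[D.+1%:R]natr1 -/x -/t; set w : R := (q_weight m0 dg D)%:R; set d : R := dg%:R => h.
have d1 : 1 <= d by rewrite ler1n.
have x1 : 1 <= x by exact: le_trans sD.
have x0 : 0 <= x by exact: le_trans x1.
have t0 : 0 <= t by exact: ler0n.
have tx : t <= x by exact: le_trans sD.
have h1 : x ^+ 3 - 3 * t * x ^+ 2 <= (x + 1 - t) ^+ 3.
  have : 0 <= t ^+ 2 * (x - t) by rewrite mulr_ge0 ?sqr_ge0 // subr_ge0.
  have : 0 <= (x - t) ^+ 2 by exact: sqr_ge0.
  have : 0 <= t ^+ 2 * x by rewrite mulr_ge0 ?sqr_ge0.
  by move=> *; lra.
have h2 : (x + 1) * (x + 1 + 1) <= 6 * x ^+ 2.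
  have : x <= x ^+ 2 by rewrite expr2 ler_peMl.
  by move=> *; lra.
have h3 : t * x ^+ 3 - 3 * t ^+ 2 * x ^+ 2 <= t * (x + 1 - t) ^+ 3.
  by have := ler_wpM2l t0 h1; move=> *; lra.
have h4 : 3 * d * t * ((x + 1) * (x + 1 + 1)) <= 18 * d * t * x ^+ 2.
  have dt : 0 <= 3 * d * t by rewrite !mulr_ge0 // (le_trans ler01).
  by have := ler_wpM2l dt h2; move=> *; lra.
have d0 : 0 < 6 * d by rewrite mulr_gt0 // (lt_le_trans ltr01).
rewrite lerBlDr ler_pdivrMr //.
have h5 : t ^+ 2 * x ^+ 2 <= d * (s ^+ 2 * x ^+ 2).
  rewrite -[leLHS]mul1r ler_pM ?mulr_ge0 ?sqr_ge0 //.
  by rewrite ler_wpM2r ?sqr_ge0 // lerXn2r ?nnegrE // (le_trans ler01).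
have h6 : d * t * x ^+ 2 <= d * (s ^+ 2 * x ^+ 2).
  rewrite -mulrA ler_wpM2l ?(le_trans ler01) // ler_wpM2r ?sqr_ge0 // (le_trans ms) //.
  by rewrite expr2 ler_peMl // (le_trans ler01).
have h7 : 0 <= d * (s ^+ 2 * x ^+ 2) by rewrite !mulr_ge0 ?sqr_ge0 // (le_trans ler01).
lra.
Qed.

(* [L / p = sqrt s * D / p] is the number of usable terms of the local expansion
   modulo [p]; the estimate also serves with [p = n = 1] for the chosen prime. *)
Lemma prime_exponent_lower (D N b n : nat) (L s p delta : R) :
  1 <= s -> L ^+ 2 = s * D%:R ^+ 2 -> 0 <= L -> L <= s * D%:R -> 1 <= p -> p <= L -> (b <= N)%N ->
  s * D%:R ^+ 2 / 2 - 6 * s ^+ 3 * D%:R <= N%:R -> N%:R <= 7 * s ^+ 3 * D%:R ^+ 2 ->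
  0 <= delta <= 1 -> n%:R <= (1 + delta) * p ^+ 2 ->
  forall r, r = Num.truncn (L / p) ->
  (L ^+ 3 / 3) * (1 - delta / 2) / p - 16 * s ^+ 4 * D%:R ^+ 2 - L * (b%:R / p) <=
  (r * (N - b) - n * tri r)%:R.
Proof.
move=> s1 L2 L0 Ls p1 pL bN Nlo Nhi /andP[d0 d1] np r rE.
set x : R := D%:R in L2 Ls Nlo Nhi *; set NN : R := N%:R in Nlo Nhi *; set bb : R := b%:R.
have p0 : 0 < p by exact: lt_le_trans p1.
set th := L / p in rE *; have thp : th * p = L by rewrite divfK // gt_eqF.
have th1 : 1 <= th by rewrite ler_pdivlMr // mul1r.
have th0 : 0 <= th by exact: le_trans th1.
have /andP[r1 r2] := truncn_itv th0; rewrite -rE -[r.+1%:R]natr1 in r1 r2.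
set rr : R := r%:R in r1 r2.
have rr0 : 0 <= rr by exact: ler0n.
have x0 : 0 <= x by exact: ler0n.
have bb0 : 0 <= bb by exact: ler0n.
have NN0 : 0 <= NN by exact: ler0n.
have bNN : bb <= NN by rewrite ler_nat.
have e1 : (r * (N - b))%:R - (n * tri r)%:R <= (r * (N - b) - n * tri r)%:R :> R.
  case: (leqP (n * tri r) (r * (N - b))) => [h|/ltnW h]; first by rewrite natrB.
  by rewrite (_ : r * (N - b) - n * tri r = 0)%N ?subr_le0 ?ler_nat //; apply/eqP; rewrite subn_eq0.
apply: le_trans e1; rewrite !natrM natrB // -/rr -/NN -/bb.
have e2 : th * NN - NN - th * bb <= rr * (NN - bb).
  have : (th - 1) * (NN - bb) <= rr * (NN - bb) by rewrite ler_wpM2r ?subr_ge0 //; lra.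
  by move=> *; lra.
have t6 : 6 * (tri r)%:R <= th ^+ 3 + 5 * th ^+ 2.
  rewrite tri_real -/rr.
  have : rr * (rr + 1) * (rr + 2) <= th * (th + 1) * (th + 2).
    by rewrite !ler_pM ?mulr_ge0 ?addr_ge0 ?lerD.
  have : th <= th ^+ 2 by rewrite expr2 ler_peMl.
  by move=> *; lra.
have e3 : n%:R * (tri r)%:R <= (1 + delta) * p ^+ 2 * ((th ^+ 3 + 5 * th ^+ 2) / 6).
  by rewrite ler_pM ?ler0n // ler_pdivlMr // mulrC.
have thE : th = L / p by [].
clearbody th.
have e4 : p ^+ 2 * th ^+ 2 = L ^+ 2 by rewrite -thp; ring.
have e5 : p ^+ 2 * th ^+ 3 = L ^+ 3 / p by rewrite -thp; field; rewrite gt_eqF.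
have e6 : (1 + delta) * p ^+ 2 * ((th ^+ 3 + 5 * th ^+ 2) / 6) =
    (1 + delta) * (L ^+ 3 / p) / 6 + (1 + delta) * 5 * L ^+ 2 / 6.
  by rewrite -e4 -e5; ring.
rewrite e6 in e3.
have e7 : L ^+ 3 / p / 2 - 6 * s ^+ 3 * (x * th) <= th * NN.
  have : th * (s * x ^+ 2 / 2 - 6 * s ^+ 3 * x) <= th * NN by rewrite ler_wpM2l.
  rewrite -L2; have -> : L ^+ 3 / p = th * L ^+ 2 by rewrite thE exprS; ring.
  by move=> *; lra.
have e8 : th <= s * x.
  by apply: le_trans Ls; rewrite thE ler_pdivrMr // ler_peMr.
have e9 : s ^+ 3 * (x * th) <= s ^+ 4 * x ^+ 2.
  have -> : s ^+ 4 * x ^+ 2 = s ^+ 3 * (x * (s * x)) by ring.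
  by rewrite ler_wpM2l ?exprn_ge0 ?(le_trans ler01) // ler_wpM2l.
have f1 : s ^+ 3 * x ^+ 2 <= s ^+ 4 * x ^+ 2.
  by rewrite ler_wpM2r ?sqr_ge0 // [X in _ <= X]exprS ler_peMl ?exprn_ge0 // (le_trans ler01).
have f2 : s * x ^+ 2 <= s ^+ 4 * x ^+ 2.
  by rewrite ler_wpM2r ?sqr_ge0 // exprS ler_peMr ?exprn_ege1 // (le_trans ler01).
have f3 : (1 + delta) * L ^+ 2 <= 2 * (s ^+ 4 * x ^+ 2).
  by rewrite ler_pM ?sqr_ge0 ?addr_ge0 // ?L2 //; lra.
have -> : L * (bb / p) = th * bb by rewrite thE; ring.
have -> : L ^+ 3 / 3 * (1 - delta / 2) / p = L ^+ 3 / p / 2 - (1 + delta) * (L ^+ 3 / p) / 6 by field; rewrite gt_eqF.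
lra.
Qed.

End MasterInequality.

Section MasterInequality.

Variable R : realType.

Lemma ln_fact_upper n : ln (n`!)%:R <= n%:R * ln n%:R :> R.
Proof.
have [->|n0] := posnP n; first by rewrite ln1 mul0r.
have h : (n`! <= n ^ n)%N.
  elim: n {n0} => // n IH; rewrite factS expnS leq_mul2l (leq_trans IH) ?orbT //.
  by case: n {IH} => // n; rewrite leq_exp2r.
have : ln (n`!)%:R <= ln (n ^ n)%:R :> R by rewrite ler_ln ?posrE ?ltr0n ?fact_gt0 ?expn_gt0 ?n0 // ler_nat.
by rewrite natrX lnXn ?ltr0n // mulr_natl.
Qed.

(** The letters stand for [c = s], [x = D], [w = 1 - 1 / (2 * Dd)], [t = T] and [xl = X * ln X]; [k]
    is the main term of [q_weight], and [v = (lam * D) ^ 3 / 3] that of the exponent for one residue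
    class. *)
Lemma master_arith (c x k v w s1 s2 t lq il lB xl Alq El SS lnN Wl ls3 : R) :
  1 <= c -> 0 <= x -> 0 <= lq -> 0 <= il -> 0 <= lB -> 0 <= xl -> 0 <= t ->
  Alq + El + SS <= lnN + Wl -> (k - 6 * c ^+ 2 * x ^+ 2) * lq <= Alq ->
  (v - 16 * c ^+ 4 * x ^+ 2) * il <= El -> v * w * s1 - 16 * c ^+ 4 * x ^+ 2 * s2 - ls3 <= SS ->
  ls3 <= 7 * c ^+ 4 * x ^+ 3 * t -> s2 <= 2 * xl -> lnN <= 98 * c ^+ 6 * x ^+ 3 ->
  Wl <= (c * x ^+ 3 / 3 + 20 * c ^+ 4 * x ^+ 2) * lB ->
  k * lq + v * il + v * w * s1 - c * x ^+ 3 / 3 * lB <=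
  100 * (c ^+ 6 * x ^+ 2 * lq + c ^+ 6 * x ^+ 2 * il + c ^+ 6 * x ^+ 2 * lB + c ^+ 6 * x ^+ 2 * xl +
    c ^+ 6 * x ^+ 3 * t + c ^+ 6 * x ^+ 3 * 1).
Proof.
move=> c1 x0 lq0 il0 lB0 xl0 t0 main t1 t2 t3 h3 h2 hN hW.
have c0 : 0 <= c by exact: le_trans c1.
have c26 : c ^+ 2 <= c ^+ 6 by rewrite ler_weXn2l.
have c46 : c ^+ 4 <= c ^+ 6 by rewrite ler_weXn2l.
have c60 : 0 <= c ^+ 6 by rewrite exprn_ge0.
have P (j n : nat) (a : R) : 0 <= a -> c ^+ j <= c ^+ 6 -> c ^+ j * x ^+ n * a <= c ^+ 6 * x ^+ n * a.
  by move=> a0 cj; rewrite ler_wpM2r // ler_wpM2r // exprn_ge0.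
have Q n a : 0 <= a -> 0 <= c ^+ 6 * x ^+ n * a by move=> a0; rewrite !mulr_ge0 // exprn_ge0.
have := P 2%N 2%N _ lq0 c26; have := P 4%N 2%N _ il0 c46; have := P 4%N 2%N _ lB0 c46.
have := P 4%N 2%N _ xl0 c46; have := P 4%N 3%N _ t0 c46.
have := Q 2%N _ lq0; have := Q 2%N _ il0; have := Q 2%N _ lB0; have := Q 2%N _ xl0.
have := Q 3%N _ t0; have := Q 3%N _ ler01.
have : c ^+ 4 * x ^+ 2 * s2 <= c ^+ 4 * x ^+ 2 * (2 * xl).
  by rewrite ler_wpM2l // mulr_ge0 ?sqr_ge0 // exprn_ge0.
lra.
Qed.

Variables (s : nat) (s0 : (0 < s)%N).
Let S : R := s%:R.
Let lam : R := Num.sqrt S.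

Variables (D : nat) (m : 'X_{1..3}) (mS : mdeg m = s) (sD : (s <= D)%N).
Let N := #|off_multiples D m|.
Variables (u : 'I_N -> 'I_3 -> int) (Bn : nat).
Hypotheses (uB : forall j i, (`|u j i| <= Bn)%N) (B0 : (0 < Bn)%N).
Hypothesis det0 : \det (off_matrix u) != 0.
Variables (q dg : nat) (g : {mpoly int[3]}).
Let o1 : 'I_3 := lift ord0 ord0.
Let o2 : 'I_3 := lift ord0 (lift ord0 ord0).
Hypotheses (q0 : (0 < q)%N) (dg0 : (0 < dg)%N).
Hypothesis (gsupp : forall e', e' \in msupp g -> e' ord0 = 0%N /\ (mdeg e' <= dg)%N).
Hypothesis (qg : forall j, (q%:Z %| g.@[u j])%Z).
Hypothesis (cop : gcdz (gcdz (gcdz q%:Z g@_0) g@_(U_(o1) *+ dg)%MM) g@_(U_(o2) *+ dg)%MM = 1).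
Variables (i0 i1 i2 : 'I_3) (f : {poly {poly {poly int}}}).
Hypothesis u3 : uniq [:: i0; i1; i2].
Hypothesis uf : forall j, ev3 idfun (u j i0) (u j i1) (u j i2) f = 0.
Variables (p0 i : nat) (xt yt zt : int).
Hypothesis (pp0 : prime p0).
Hypothesis (class0 : (0 < i)%N -> [/\ ~~ (p0 %| q)%N, ~~ (p0%:Z %| ev3 idfun xt yt zt f^`())%Z &
  forall j, [/\ p0%:Z %| u j i0 - xt, p0%:Z ^+ i %| u j i1 - yt & p0%:Z ^+ i %| u j i2 - zt]%Z]).
Variables (X : nat) (Gd : pred nat) (Dd : nat) (T : R).
Hypothesis (GdP : forall p, Gd p -> p != p0 /\ ~~ (p %| q)%N).
Hypotheses (Dd0 : (0 < Dd)%N) (XD : (X <= D)%N) (T0 : 0 <= T).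
Hypothesis (Gsm : forall p, prime p -> Gd p -> (#|smooth_points p f| * Dd <= Dd.+1 * p ^ 2)%N).
Hypothesis (Tj : forall j, \sum_(p < X.+1 | prime p && (p%:Z %| ev3 idfun (u j i0) (u j i1) (u j i2) f^`())%Z)
  ln p%:R / p%:R <= T).

Let bad p := #|[set j | (p%:Z %| ev3 idfun (u j i0) (u j i1) (u j i2) f^`())%Z]|.

(** Exchange of summations: a given point is bad only at the primes dividing the derivative there,
    and [Tj] bounds the sum over these. *)
Lemma sum_bad : \sum_(p < X.+1 | prime p && Gd p) (bad p)%:R / p%:R * ln p%:R <= N%:R * T :> R.
Proof.
pose F (p : nat) (j : 'I_N) : R := if prime p && (p%:Z %| ev3 idfun (u j i0) (u j i1) (u j i2) f^`())%Z
  then ln p%:R / p%:R else 0.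
have F0 p j : 0 <= F p j by rewrite /F; case: ifP => // _; rewrite divr_ge0 ?ln_nat_ge0.
apply: (@le_trans _ _ (\sum_(p < X.+1) \sum_j F p j)).
  rewrite [X in X <= _]big_mkcond; apply: ler_sum => p _; case: ifP => [/andP[pp _]|_]; last exact: sumr_ge0.
  rewrite /bad -sum1_card natr_sum !mulr_suml [leLHS]big_mkcond; apply: ler_sum => j _.
  by rewrite inE /F pp /=; case: ifP => // _; rewrite mul1r mulrC.
rewrite exchange_big /= mulr_natl -[in X in _ <= X](card_ord N) -sumr_const; apply: ler_sum => j _.
by rewrite -big_mkcond /=; exact: Tj.
Qed.

(** This is [log_det_bound] divided by [(lam * D) ^ 3 / 3]. The weight of [q], about
    [m_1 * D ^ 3 / (6 * dg)], becomes the coefficient of [ln q], and the total degree, about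
    [s * D ^ 3 / 3], becomes [1 / lam]; terms with only [D ^ 2] become the error over [D]. *)
Lemma master_inequality :
  (m ord0)%:R / (2 * lam ^+ 3 * dg%:R) * ln q%:R + i%:R * ln p0%:R +
  (1 - Dd%:R^-1 / 2) * \sum_(p < X.+1 | prime p && Gd p) ln p%:R / p%:R <=
  ln Bn%:R / lam + 300 * S ^+ 6 *
    ((ln q%:R + i%:R * ln p0%:R + ln Bn%:R + X%:R * ln X%:R) / D%:R + T + 1).
Proof.
pose x : R := D%:R; pose delta : R := Dd%:R^-1; pose L := lam * x.
have S1 : 1 <= S by rewrite ler1n.
have S0 : 0 < S by exact: lt_le_trans S1.
have sx : S <= x by rewrite ler_nat.
have x1 : 1 <= x by exact: le_trans sx.
have x0 : 0 < x by exact: lt_le_trans x1.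
have lam2 : lam ^+ 2 = S by rewrite sqr_sqrtr // ltW.
have lam0 : 0 < lam by rewrite sqrtr_gt0.
have lam1 : 1 <= lam by rewrite -sqrtr1 ler_sqrt.
have lamS : lam <= S by rewrite -lam2 expr2 ler_peMl // ltW.
have L2 : L ^+ 2 = S * x ^+ 2 by rewrite exprMn lam2.
have L0 : 0 <= L by rewrite mulr_ge0 // ltW.
have LS : L <= S * x by rewrite ler_wpM2r // ltW.
have xL : x <= L by rewrite ler_peMl // ltW.
have d01 : 0 <= delta <= 1 by rewrite invr_ge0 ler0n /= invf_le1 ?ltr0n // ler1n.
have mSR : (mdeg m)%:R = S by rewrite mS.
have /andP[Nlo Nhi] := card_off_real mSR S1 sx; rewrite -/x -/N in Nlo Nhi.
have mle : (m ord0 <= s)%N by rewrite -mS mdegE (bigD1 ord0) //= leq_addr.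
have mD : (m ord0 <= D)%N by exact: leq_trans sD.
have main := @log_det_bound D m R u Bn uB B0 det0 q dg g q0 mD gsupp qg cop i0 i1 i2 f u3 uf p0 i
  (Num.truncn (L / 1)) xt yt zt pp0 class0 X Gd (fun p => Num.truncn (L / p%:R)) GdP.
rewrite -/N in main.
have qlow := q_weight_real dg0 (_ : (m ord0)%:R <= S) S1 sx; rewrite ler_nat in qlow.
have {}qlow := qlow mle; rewrite -/x in qlow.
have Wup := sum_mdeg_real mSR S1 sx; rewrite -/x in Wup.
set lq := ln q%:R in main *; set l0 := ln p0%:R in main *; set lB := ln Bn%:R in main *.
have lq0 : 0 <= lq by exact: ln_nat_ge0.
have l00 : 0 <= l0 by exact: ln_nat_ge0.
have lB0 : 0 <= lB by exact: ln_nat_ge0.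
have t1 : ((m ord0)%:R * x ^+ 3 / (6 * dg%:R) - 6 * S ^+ 2 * x ^+ 2) * lq <= (q_weight (m ord0) dg D)%:R * lq.
  by rewrite ler_wpM2r.
have e0low : L ^+ 3 / 3 - 16 * S ^+ 4 * x ^+ 2 <= (Num.truncn (L / 1) * N - tri (Num.truncn (L / 1)))%:R.
  have h := @prime_exponent_lower R D N 0 1 L S 1 0 S1 L2 L0 LS (lexx 1) (le_trans x1 xL) (leq0n _) Nlo Nhi.
  have d0 : 0 <= (0 : R) <= 1 by rewrite lexx ler01.
  have n1 : 1%N%:R <= (1 + 0) * 1 ^+ 2 :> R by rewrite addr0 mul1r expr1n.
  have := h d0 n1 _ erefl; rewrite subn0 mul1n; apply: le_trans.
  by rewrite -/x le_eqVlt; apply/orP; left; apply/eqP; field.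
have t2 : (L ^+ 3 / 3 - 16 * S ^+ 4 * x ^+ 2) * (i%:R * l0) <=
    (i * (Num.truncn (L / 1) * N - tri (Num.truncn (L / 1))))%:R * l0.
  rewrite natrM [X in _ <= X]mulrAC [X in _ <= X]mulrC.
  by apply: ler_wpM2r; rewrite ?mulr_ge0.
set S1' := \sum_(p < X.+1 | prime p && Gd p) ln p%:R / p%:R.
have S10 : 0 <= S1' by apply: sumr_ge0 => p _; rewrite divr_ge0 ?ln_nat_ge0.
pose S2 : R := \sum_(p < X.+1 | prime p && Gd p) ln p%:R.
pose S3 : R := \sum_(p < X.+1 | prime p && Gd p) (bad p)%:R / p%:R * ln p%:R.
have t3 : L ^+ 3 / 3 * (1 - delta / 2) * S1' - 16 * S ^+ 4 * x ^+ 2 * S2 - L * S3 <=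
   \sum_(p < X.+1 | prime p && Gd p) (Num.truncn (L / p%:R) * (N - bad p) -
      #|smooth_points p f| * tri (Num.truncn (L / p%:R)))%:R * ln p%:R.
  rewrite /S1' /S2 /S3 !mulr_sumr -!sumrB; apply: ler_sum => p /andP[pp Gp].
  have p1 : 1 <= p%:R :> R by rewrite ler1n prime_gt0.
  have pL : p%:R <= L by apply: le_trans xL; rewrite ler_nat (leq_trans _ XD) // -ltnS.
  have bN : (bad p <= N)%N by rewrite -[X in (_ <= X)%N]card_ord max_card.
  have np : (#|smooth_points p f|)%:R <= (1 + delta) * p%:R ^+ 2.
    have := Gsm pp Gp; rewrite -mulnn -(ler_nat R) !natrM -[Dd.+1%:R]natr1 => h.
    have Dp : 0 < Dd%:R :> R by rewrite ltr0n.
    rewrite -(ler_pM2r Dp) (le_trans h) // /delta.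
    by rewrite le_eqVlt; apply/orP; left; apply/eqP; field; rewrite gt_eqF.
  have h := @prime_exponent_lower R D N (bad p) _ L S _ delta S1 L2 L0 LS p1 pL bN Nlo Nhi d01 np _ erefl.
  have := ler_wpM2r (ln_nat_ge0 R p) h; apply: le_trans; rewrite -/x le_eqVlt; apply/orP; left; apply/eqP; ring.
have S3le : L * S3 <= 7 * S ^+ 4 * x ^+ 3 * T.
  have h1 : S3 <= 7 * S ^+ 3 * x ^+ 2 * T by apply: le_trans sum_bad _; rewrite ler_wpM2r.
  have S30 : 0 <= S3 by apply: sumr_ge0 => p _; rewrite !mulr_ge0 ?ln_nat_ge0 // invr_ge0.
  have -> : 7 * S ^+ 4 * x ^+ 3 * T = (S * x) * (7 * S ^+ 3 * x ^+ 2 * T) by ring.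
  by rewrite ler_pM.
set lX := ln X%:R.
have lX0 : 0 <= lX by exact: ln_nat_ge0.
have S2le : S2 <= 2 * (X%:R * lX).
  have [X0|X0] := posnP X.
    rewrite /S2 big1 ?X0 ?mul0r ?mulr0 // => p /andP[pp _].
    by move: (ltn_ord p) (prime_gt0 pp); rewrite ltnS leqn0 => /eqP->.
  apply: (@le_trans _ _ (\sum_(p < X.+1) lX)).
    rewrite /S2 big_mkcond; apply: ler_sum => p _; case: ifP => // /andP[pp _].
    have pX : (p <= X)%N by rewrite -ltnS.
    have p0' : 0 < p%:R :> R by rewrite ltr0n prime_gt0.
    by rewrite /lX ler_ln ?ler_nat ?posrE ?ltr0n // prime_gt0.
  rewrite sumr_const card_ord -[leLHS]mulr_natl mulrA ler_wpM2r // -natrM ler_nat.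
  by move: X0; clear; lia.
have N1up : ln (N`!)%:R <= 98 * S ^+ 6 * x ^+ 3.
  apply: le_trans (ln_fact_upper N) _.
  have h : ln N%:R <= 14 * S ^+ 3 * x.
    have [->|Np] := posnP N; first by rewrite ln0 // !mulr_ge0 // ?exprn_ge0 // ltW.
    have y0 : 0 < 7 * S ^+ 3 * x by rewrite !mulr_gt0 // exprn_gt0.
    have : ln N%:R <= ln ((7 * S ^+ 3 * x) ^+ 2).
      rewrite ler_ln ?posrE ?ltr0n ?exprn_gt0 // (le_trans Nhi) // exprMn ler_wpM2r ?sqr_ge0 //.
      by rewrite expr2 ler_peMl ?mulr_ge0 ?exprn_ge0 ?(ltW S0) // mulr_ege1 ?exprn_ege1 // ler1n.
    rewrite lnXn // => /le_trans; apply; rewrite mulr2n.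
    have h := ltW (ln_sublinear y0); apply: le_trans (lerD h h) _.
    by rewrite le_eqVlt; apply/orP; left; apply/eqP; ring.
  have -> : 98 * S ^+ 6 * x ^+ 3 = (7 * S ^+ 3 * x ^+ 2) * (14 * S ^+ 3 * x) by ring.
  by rewrite ler_pM ?ln_nat_ge0.
have t5 : (\sum_(e in off_multiples D m) mdeg e)%:R * lB <= (S * x ^+ 3 / 3 + 20 * S ^+ 4 * x ^+ 2) * lB.
  by rewrite ler_wpM2r.
set W := (\sum_(e in off_multiples D m) mdeg e)%:R in main t5.
set A := (q_weight _ _ _)%:R in main t1.
set E0 := (i * _)%:R in main t2; set SS := \sum_(p < X.+1 | _) _ in main t3.
pose V := L ^+ 3 / 3.
have VE : V = lam ^+ 3 * x ^+ 3 / 3 by rewrite /V /L exprMn.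
have V0 : x ^+ 3 / 3 <= V.
  by rewrite VE ler_pM2r ?invr_gt0 // ler_peMl ?exprn_ge0 ?(ltW x0) // exprn_ege1.
have lam3 : lam ^+ 3 = S * lam by rewrite exprSr lam2.
pose M := (m ord0)%:R / (2 * lam ^+ 3 * dg%:R) * lq + i%:R * l0 + (1 - delta / 2) * S1' - lB / lam.
have dgR : 0 < dg%:R :> R by rewrite ltr0n.
have VM : V * M = (m ord0)%:R * x ^+ 3 / (6 * dg%:R) * lq + V * (i%:R * l0) + V * (1 - delta / 2) * S1' -
    S * x ^+ 3 / 3 * lB.
  rewrite /M !mulrDr mulrN; congr (_ + _ + _ - _).
  - by rewrite VE; field; rewrite !gt_eqF.
  - by ring.
  - by rewrite VE lam3; field; rewrite gt_eqF.
pose Err := (lq + i%:R * l0 + lB + X%:R * lX) / x + T + 1.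
have Xl : 0 <= X%:R * lX by rewrite mulr_ge0.
have il : 0 <= i%:R * l0 by rewrite mulr_ge0.
have bound : V * M <= x ^+ 3 / 3 * (300 * S ^+ 6 * Err).
  have -> : x ^+ 3 / 3 * (300 * S ^+ 6 * Err) = 100 * (S ^+ 6 * x ^+ 2 * lq + S ^+ 6 * x ^+ 2 * (i%:R * l0)
     + S ^+ 6 * x ^+ 2 * lB + S ^+ 6 * x ^+ 2 * (X%:R * lX) + S ^+ 6 * x ^+ 3 * T + S ^+ 6 * x ^+ 3 * 1).
    by rewrite /Err; field; rewrite gt_eqF.
  rewrite VM; rewrite -/V in t2 t3.
  exact: master_arith S1 (ltW x0) lq0 il lB0 Xl T0 main t1 t2 t3 S3le S2le N1up t5.
rewrite -[leLHS](subrK (lB / lam)) -/M addrC lerD2l -/Err.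
have x3 : 0 < x ^+ 3 / 3 by rewrite divr_gt0 // exprn_gt0.
have Err0 : 0 <= Err.
  by rewrite /Err !addr_ge0 // mulr_ge0 ?invr_ge0 ?(ltW x0) // !addr_ge0.
have [M0|/ltW M0] := leP M 0; first by apply: le_trans M0 _; rewrite !mulr_ge0.
by rewrite -(ler_pM2l x3) (le_trans _ bound) // ler_wpM2r.
Qed.

End MasterInequality.

(** * Divisibility by [f] and the height of [f] *)

Section LeadingExponent.

Variables (n : nat) (lt : rel 'X_{1..n}).
Hypotheses (lt_irr : irreflexive lt) (lt_trans : transitive lt).
Hypothesis lt_total : forall a b, a != b -> lt a b || lt b a.
Hypothesis lt_add : forall a b c d, lt a b -> lt c d -> lt (a + c)%MM (b + d)%MM.

Lemma max_exponent (s : seq 'X_{1..n}) : s != [::] ->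
  exists2 e, e \in s & forall e', e' \in s -> e' != e -> lt e' e.
Proof.
elim: s => // x [|y s] IH _; first by exists x => [|e']; rewrite ?mem_head // inE => /eqP-> /eqP.
have [//|e es eP] := IH; have [xe|xe] := eqVneq x e.
  exists e; first by rewrite inE es orbT.
  by move=> e'; rewrite inE => /orP[/eqP->|/eP//]; rewrite xe eqxx.
have [xlt|xlt] := boolP (lt x e).
  exists e; first by rewrite inE es orbT.
  by move=> e'; rewrite inE => /orP[/eqP-> //|]; exact: eP.
have ex : lt e x by have := lt_total xe; rewrite (negPf xlt).
exists x; first exact: mem_head.
move=> e'; rewrite inE => /orP[/eqP->|e's _]; first by rewrite eqxx.
by have [->//|ne] := eqVneq e' e; apply: lt_trans ex; exact: eP.
Qed.

(** [lt_add] needs both comparisons strict, so a pair sharing one entry with [(m, e)] is excluded by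
    cancellation, while any other pair has a smaller sum. *)
Lemma mul_max_exponent (A : idomainType) (f h : {mpoly A[n]}) m e :
  m \in msupp f -> (forall m', m' \in msupp f -> m' != m -> lt m' m) ->
  e \in msupp h -> (forall e', e' \in msupp h -> e' != e -> lt e' e) ->
  (m + e)%MM \in msupp (f * h).
Proof.
move=> mf mP eh eP; rewrite mcoeff_msupp mcoeffM.
have dm : (mdeg m < (mdeg (m + e)%MM).+1)%N by rewrite ltnS mdegD leq_addr.
have de : (mdeg e < (mdeg (m + e)%MM).+1)%N by rewrite ltnS mdegD leq_addl.
rewrite (bigD1 (BMultinom dm, BMultinom de)) //= big1 ?addr0 => [|[k1 k2] /=].
  by rewrite mulf_neq0 // -mcoeff_msupp.
move=> /andP[/eqP E ne].
have [k1f|/memN_msupp_eq0->] := boolP ((k1 : 'X_{1..n}) \in msupp f); last by rewrite mul0r.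
have [k2h|/memN_msupp_eq0->] := boolP ((k2 : 'X_{1..n}) \in msupp h); last by rewrite mulr0.
have E' : (k1 + k2 = m + e)%MM := esym E.
have [k1m|k1m] := eqVneq (k1 : 'X_{1..n}) m.
  have k2e : (k2 : 'X_{1..n}) = e.
    by rewrite -[LHS](addmK k1) -[RHS](addmK m) addmC E' k1m addmC.
  by case/negP: ne; apply/eqP; congr pair; apply: val_inj.
have [k2e|k2e] := eqVneq (k2 : 'X_{1..n}) e.
  by case/eqP: k1m; rewrite -[LHS](addmK k2) E' k2e addmK.
by have := lt_add (mP _ k1f k1m) (eP _ k2h k2e); rewrite E' lt_irr.
Qed.

Lemma max_exponent_not_dvd (A B : idomainType) (h : {rmorphism A -> B}) (f G : {mpoly A[n]}) m :
  injective h -> m \in msupp f -> (forall m', m' \in msupp f -> m' != m -> lt m' m) ->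
  G != 0 -> (forall e, e \in msupp G -> ~~ (m <= e)%MM) ->
  ~ ring_dvd (map_mpoly h f) (map_mpoly h G).
Proof.
move=> hI mf mP G0 GP [c E].
have supE (p : {mpoly A[n]}) e : (e \in msupp (map_mpoly h p)) = (e \in msupp p).
  exact: (perm_mem (msupp_map_mpoly p hI)).
have c0 : msupp c != [::].
  rewrite msupp_eq0; apply/eqP => c0; move: G0; rewrite -msupp_eq0.
  have E0 : map_mpoly h G = 0 by rewrite E c0 mulr0.
  case sG : (msupp G) => [|e t] // _.
  have : e \in msupp (map_mpoly h G) by rewrite supE sG mem_head.
  by rewrite E0 msupp0.
have [e ec eP] := max_exponent c0.
have : (m + e)%MM \in msupp (map_mpoly h f * c).
  by apply: mul_max_exponent => //; rewrite ?supE // => m'; rewrite supE; exact: mP.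
by rewrite -E supE => /GP/negP; apply; exact: lem_addr.
Qed.

End LeadingExponent.

Lemma unit_rearrange (A : comUnitRingType) (x y z w : A) :
  y \is a GRing.unit -> z * (x * w) = x * y * (y^-1 * w * z).
Proof.
move=> yU; transitivity (y * y^-1 * (z * (x * w))); first by rewrite divrr // mul1r.
by move: (y^-1) => v; ring.
Qed.

Section PrimitivePart.

Variable n : nat.

Lemma primitive_part (P : {mpoly int[n]}) : P != 0 -> exists (c : int) (P' : {mpoly int[n]}),
  [/\ c != 0, P = c *: P' & forall d : int, (forall e, (d %| P'@_e)%Z) -> d \is a GRing.unit].
Proof.
move=> P0; pose c := \big[gcdz/0]_(e <- msupp P) P@_e.
have cd e : (c %| P@_e)%Z.
  have [eP|/memN_msupp_eq0->] := boolP (e \in msupp P); last exact: dvdz0.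
  rewrite /c; elim: (msupp P) eP => // x t IH; rewrite inE big_cons => /orP[/eqP->|/IH]; first exact: dvdz_gcdl.
  by apply: dvdz_trans; exact: dvdz_gcdr.
have cg (d : int) : (forall e, (d %| P@_e)%Z) -> (d %| c)%Z.
  by move=> h; rewrite /c; elim: (msupp P) => [|x t IH]; rewrite ?big_nil ?dvdz0 // big_cons dvdz_gcd h.
have c0 : c != 0.
  apply: contraNneq P0 => c0; apply/eqP/mpolyP => e; rewrite mcoeff0.
  by have := cd e; rewrite c0 dvd0z => /eqP.
pose P' := \sum_(e <- msupp P) (P@_e %/ c)%Z *: 'X_[e] : {mpoly int[n]}.
have PE : P = c *: P'.
  rewrite {1}[P]mpolyE /P' scaler_sumr; apply: eq_bigr => e _.
  by rewrite scalerA mulrC divzK.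
exists c, P'; split=> // d hd.
have := cg (c * d) _; rewrite -[X in (_ %| X)%Z]mulr1 dvdz_mul2l // => h.
have this : (d %| 1)%Z by apply: h => e; rewrite PE mcoeffZ dvdz_mul2l.
by case/dvdzP: this => x xd; apply/unitrP; exists x; rewrite -xd [d * x]mulrC -xd.
Qed.

(** A common divisor either is constant over [algC], and then divides the content of the primitive
    [P'], or has a constant cofactor in [f], so that [f] would divide [P] over [algC]. Passing to
    the primitive part disposes of the integer divisors. *)
Lemma primitive_coprime (f P : {mpoly int[n]}) :
  ring_irreducible (map_mpoly intr f : {mpoly algC[n]}) ->
  ~ ring_dvd (map_mpoly intr f) (map_mpoly intr P : {mpoly algC[n]}) ->
  exists P' : {mpoly int[n]}, [/\ ring_coprime P' f, msize P' = msize P &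
     forall u : 'I_n -> int, P.@[u] = 0 -> P'.@[u] = 0].
Proof.
move=> [f0 fU fI] ndvd.
have P0 : P != 0.
  by apply/eqP => P0; apply: ndvd; exists 0; rewrite P0 rmorph0 mulr0.
have [c [P' [c0 PE Pp]]] := primitive_part P0; exists P'; split.
- move=> d [a Pd] [e fd].
  have [|dU|eU] := fI (map_mpoly intr d) (map_mpoly intr e); first by rewrite fd rmorphM.
    have : (map_mpoly intr d : {mpoly algC[n]}) = ((d@_0)%:~R)%:MP.
      move: dU; rewrite [_ \is a _]/= => /andP[/eqP E _]; rewrite {1}E mcoeff_map_mpoly //.
    move=> dE; have {}dE : d = (d@_0)%:MP.
      apply/mpolyP => k; have := congr1 (fun p : {mpoly algC[n]} => p@_k) dE.
      by rewrite /= mcoeff_map_mpoly !mcoeffC; case: eqP => _; rewrite ?mulr1 ?mulr0 => hk; apply: (@intr_inj algC); rewrite hk.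
    move: dE; move: d@_0 => d0 dE; have : d0 \is a GRing.unit.
      by apply: Pp => k; rewrite Pd dE mcoeffCM; exact: dvdz_mulr.
    by rewrite dE; exact: rmorph_unit.
  case: ndvd; exists ((map_mpoly intr e)^-1 * map_mpoly intr a * c%:~R%:MP).
  rewrite PE Pd fd -mul_mpolyC !rmorphM /= map_mpolyC.
  exact: unit_rearrange.
- by rewrite PE !mmeasureE; apply: perm_big; rewrite perm_sym; apply: msuppZ.
- by move=> u; rewrite PE mevalZ => /eqP; rewrite mulf_eq0 (negPf c0) => /eqP.
Qed.

End PrimitivePart.

Section NestDegrees.

Variables (i0 i1 i2 : 'I_3) (u3 : uniq [:: i0; i1; i2]).

Lemma nest_filtration (A : comNzRingType) (P : nat -> {poly {poly {poly A}}} -> Prop) d (p : {mpoly A[3]}) :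
  filtration P -> (forall l m x, (l <= m)%N -> P l x -> P m x) ->
  (forall c, P 0%N c%:P%:P%:P) -> (forall i, P 1%N (nest_var i0 i1 A i)) -> (msize p <= d.+1)%N ->
  P d (nest i0 i1 p).
Proof.
move=> fP mono hC hv sp; rewrite /nest /mmap big_seq; apply: (filtration_sum fP) => e ep.
have [_ _ _ _ PM] := fP; rewrite -[d]add0n; apply: PM; first exact: hC.
apply: (mono (mdeg e)); first by rewrite -ltnS (leq_trans _ sp) // msize_mdeg_lt.
rewrite mdegE /mmap1; apply: (filtration_prod fP) => i.
by have := @filtration_exp _ P 1%N _ (e i) fP (hv i); rewrite muln1.
Qed.

Lemma nest_degrees (A : comNzRingType) d (p : {mpoly A[3]}) :
  (msize p <= d.+1)%N -> degrees3 d (nest i0 i1 p).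
Proof.
move=> sp; split.
- apply: (@nest_filtration A (fun k (f : {poly {poly {poly A}}}) => size f <= k.+1)%N) => //.
  + exact: size_filtration.
  + by move=> l m x lm h; apply: leq_trans h _; rewrite ltnS.
  + by move=> c; exact: size_polyC_leq1.
  + move=> i; rewrite /nest_var; case: ifP => _; first by rewrite size_polyX.
    by case: ifP => _; rewrite (leq_trans (size_polyC_leq1 _)).
- apply: (@nest_filtration A (fun k (f : {poly {poly {poly A}}}) => forall i, size (f`_i)%R <= k.+1)%N) => //.
  + exact: (coef_filtration (size_filtration _)).
  + by move=> l m x lm h i; apply: leq_trans (h i) _; rewrite ltnS.
  + by move=> c i; rewrite coefC; case: eqP; rewrite ?size_poly0 // size_polyC_leq1.
  + move=> i j; rewrite /nest_var; case: ifP => _.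
      by rewrite coefX; case: eqP => _; rewrite ?size_poly1 ?size_poly0.
    rewrite -[if _ then _ else _](_ : (if i == i1 then 'X else 'X%:P)%:P = _); last by case: ifP.
    rewrite coefC; case: eqP => _; rewrite ?size_poly0 //.
    by case: ifP => _; rewrite ?size_polyX // (leq_trans (size_polyC_leq1 _)).
- apply: (@nest_filtration A (fun k (f : {poly {poly {poly A}}}) => forall i j, size (f`_i`_j)%R <= k.+1)%N) => //.
  + exact: (coef_filtration (coef_filtration (size_filtration _))).
  + by move=> l m x lm h i j; apply: leq_trans (h i j) _; rewrite ltnS.
  + move=> c i j; rewrite coefC; case: eqP => _; rewrite ?coef0 ?size_poly0 //.
    by rewrite coefC; case: eqP => _; rewrite ?size_poly0 // size_polyC_leq1.
  + move=> i j k; rewrite /nest_var; case: ifP => _.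
      by rewrite coefX; case: eqP => _; rewrite ?coef0 ?size_poly0 // coef1; case: eqP => _; rewrite ?size_poly0 // size_poly1.
    case: ifP => _; rewrite coefC; case: eqP => _; rewrite ?coef0 ?size_poly0 //.
      by rewrite coefX; case: eqP => _; rewrite ?size_poly0 // size_poly1.
    by rewrite coefC; case: eqP => _; rewrite ?size_poly0 // size_polyX.
Qed.

Lemma nest_norm (p : {mpoly int[3]}) : (norm3 (nest i0 i1 p) <= \sum_(e <- msupp p) `|p@_e|)%N.
Proof.
have [N0 N1 ND _ NM] := norm3P.
rewrite /nest /mmap; elim/big_ind2: _ => [|x a y b xa yb|e _]; first by rewrite N0.
  by apply: leq_trans (ND _ _) _; rewrite leq_add.
apply: leq_trans (NM _ _) _.
rewrite /= {1}/norm3 (poly_normC norm2P) /norm2 (poly_normC norm1P) /norm1 (poly_normC int_norm).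
rewrite -[X in (_ <= X)%N]muln1 leq_mul2l; apply/orP; right.
rewrite /mmap1; elim/big_ind: _ => // [x y x1 y1|i _].
  by apply: leq_trans (NM _ _) _; rewrite -[1%N]muln1 leq_mul.
apply: leq_trans (norm_exp norm3P _ _) _.
have v1 : (norm3 (nest_var i0 i1 int i) <= 1)%N.
  rewrite /nest_var; case: ifP => _; first exact: (poly_normX norm2P).
  case: ifP => _; rewrite /norm3 (poly_normC norm2P); first exact: (poly_normX norm1P).
  by rewrite /norm2 (poly_normC norm1P); exact: (poly_normX int_norm).
by elim: (e i) => // k IH; rewrite expnS -[1%N]muln1 leq_mul.
Qed.

Lemma nest_irreducible (F : fieldType) (p : {mpoly F[3]}) :
  ring_irreducible p -> ring_prime (nest i0 i1 p).
Proof.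
move=> [p0 pU pI]; apply: poly_irreducible_prime.
  by apply: poly_factorial; apply: poly_factorial; exact: field_factorial.
have nK := nestK u3 (A := F); have fK := flatten3K u3 (A := F).
have fU a : a \is a GRing.unit -> flatten3 i0 i1 i2 a \is a GRing.unit.
  move=> /unitrPr[b ab]; apply/unitrPr; exists (flatten3 i0 i1 i2 b).
  by rewrite -rmorphM ab rmorph1.
have nU a : a \is a GRing.unit -> nest i0 i1 a \is a GRing.unit.
  move=> /unitrPr[b ab]; apply/unitrPr; exists (nest i0 i1 b).
  by rewrite -rmorphM ab rmorph1.
split.
- by apply: contraNneq p0 => h; rewrite -(nK p) h rmorph0.
- by apply: contraNN pU => h; rewrite -(nK p); exact: fU.
- move=> a b E; have [|aU|bU] := pI (flatten3 i0 i1 i2 a) (flatten3 i0 i1 i2 b).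
  + by rewrite -[LHS]nK E rmorphM.
  + by left; rewrite -(fK a); exact: nU.
  + by right; rewrite -(fK b); exact: nU.
Qed.

Lemma flatten3_dvd_size (A B : idomainType) (h : {rmorphism A -> B}) (f : {mpoly A[3]})
    (P : {poly {poly {poly A}}}) : injective h -> P != 0 -> (size P < size (nest i0 i1 f))%N ->
  ~ ring_dvd (map_mpoly h f) (map_mpoly h (flatten3 i0 i1 i2 P)).
Proof.
move=> hI P0 sP [c E].
have h3I : injective (map_poly (map_poly h)) by do 2![apply: map_inj_poly; last exact: rmorph0].
have := congr1 (@nest i0 i1 B) E; rewrite rmorphM /= !(nest_map u3) (flatten3K u3) => {}E.
have : ~ ring_dvd (map_poly (map_poly (map_poly h)) (nest i0 i1 f)) (map_poly (map_poly (map_poly h)) P).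
  apply: size_lt_not_dvd.
    by rewrite -(rmorph0 (map_poly (map_poly (map_poly h)))) (inj_eq (map_inj_poly h3I (rmorph0 _))).
  by rewrite !size_map_inj_poly ?rmorph0.
by apply; exists (nest i0 i1 c).
Qed.

Lemma flatten3C_msize (A : idomainType) dy dz (c : {poly {poly A}}) :
  (size c <= dy.+1)%N -> (forall i, size (c`_i)%R <= dz.+1)%N ->
  (msize (flatten3 i0 i1 i2 c%:P) <= (dy + dz).+1)%N.
Proof.
move=> sc sc'; rewrite /flatten3 ev3C.
have := @filtration_ev2 _ _ (@mpolyC 3 A) (fun k (p : {mpoly A[3]}) => msize p <= k.+1)%N 'X_i1 'X_i2 1 1 dy dz c.
rewrite !muln1 addnC; apply=> //.
- split=> [|k|k a b ha hb|k a ha|k l a b ha hb]; rewrite ?msize1 ?msize0 //.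
  + by apply: leq_trans (mmeasureD_le _ _ _) _; rewrite geq_max ha.
  + by rewrite mmeasureN.
  + have [->|a0] := eqVneq a 0; first by rewrite mul0r msize0.
    have [->|b0] := eqVneq b 0; first by rewrite mulr0 msize0.
    by rewrite msizeM //; move: ha hb; clear; lia.
- by move=> l m x lm h; apply: leq_trans h _; rewrite ltnS.
- by move=> x; rewrite /= msizeC; case: eqP.
- by rewrite msizeX mdeg1.
- by rewrite msizeX mdeg1.
Qed.

End NestDegrees.

(** After division by the gcd of [a] and [b], what remains of [a] is prime to what remains of [b],
    hence divides every [F i] and is a unit. *)
Lemma dvdz_primitive (I : Type) (F : I -> int) (a b : int) : a != 0 ->
  (forall d : int, (forall i, (d %| F i)%Z) -> d \is a GRing.unit) ->
  (forall i, (a %| F i * b)%Z) -> (a %| b)%Z.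
Proof.
move=> a0 prim h; pose g := gcdz a b.
have g0 : g != 0 by rewrite gcdz_eq0 negb_and a0.
have [a' aE] := dvdzP (dvdz_gcdl a b); have [b' bE] := dvdzP (dvdz_gcdr a b).
rewrite -/g in aE bE.
have cop : coprimez a' b'.
  have := mulz_gcdl a' b' g; rewrite -aE -bE (_ : `|g|%:Z = g) // -/g -[X in _ = X]mul1r => /(mulIf g0).
  by rewrite /coprimez => ->.
have a'U : a' \is a GRing.unit.
  apply: prim => i; have := h i; rewrite aE bE mulrA dvdz_mul2r // => hi.
  by rewrite -(Gauss_dvdzl _ cop).
rewrite aE bE; have /unitrPr[c ac] := a'U; apply/dvdzP; exists (c * b').
transitivity (a' * c * (b' * g)); first by rewrite ac mul1r.
by ring.
Qed.

(** A multiple of no larger degree is a scalar multiple, and a nonzero one has the same support as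
    [f]. *)
Lemma small_multiple_not_dvd (n : nat) (A B : idomainType) (h : {rmorphism A -> B})
    (f P : {mpoly A[n]}) e :
  injective h -> P != 0 -> (msize P <= msize f)%N -> e \in msupp f -> P@_e = 0 ->
  ~ ring_dvd (map_mpoly h f) (map_mpoly h P).
Proof.
move=> hI P0 sP ef Pe [c E].
have sE (p : {mpoly A[n]}) : msize (map_mpoly h p) = msize p.
  by rewrite !mmeasureE; apply: perm_big; exact: msupp_map_mpoly.
have f0 : f != 0 by apply: contraTneq ef => ->; rewrite msupp0.
have hf0 : map_mpoly h f != 0 by rewrite -msize_poly_eq0 sE msize_poly_eq0.
have hP0 : map_mpoly h P != 0 by rewrite -msize_poly_eq0 sE msize_poly_eq0.
have c0 : c != 0 by apply: contraNneq hP0 => c0; rewrite E c0 mulr0.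
have sc : (msize c <= 1)%N.
  have := sE P; rewrite E msizeM // sE => sPE; move: sP; rewrite -sPE.
  have : (0 < msize f)%N by rewrite lt0n msize_poly_eq0.
  by move: (msize f) (msize c); clear; lia.
have cE := msize1_polyC sc.
have := congr1 (fun p : {mpoly B[n]} => p@_e) E.
have hP : (map_mpoly h P)@_e = 0 by rewrite mcoeff_map_mpoly Pe; exact: rmorph0.
rewrite /= hP cE mulrC mcoeffCM mcoeff_map_mpoly => /esym/eqP.
rewrite mulf_eq0 => /orP[/eqP c00|/eqP h0]; last first.
  by move: ef; rewrite mcoeff_msupp => /eqP; apply; apply: hI; rewrite h0; exact/esym/rmorph0.
by move: c0; rewrite cE c00 mpolyC0 eqxx.
Qed.

Section HeightReduction.

Variables (d Bn : nat) (f : {mpoly int[3]}) (pts : nat -> 'I_3 -> int).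
Hypotheses (sf : (msize f <= d.+1)%N) (B0 : (0 < Bn)%N).
Hypothesis prim : forall a : int, (forall e, (a %| f@_e)%Z) -> a \is a GRing.unit.
Hypothesis pf : forall k, f.@[pts k] = 0.
Hypothesis pB : forall k i, (`|pts k i| <= Bn)%N.

Let M0 := #|{: 'X_{1..3 < d.+1}}|.

(* If the points impose independent conditions on the monomials other than [e0], Cramer's rule shows
   that the coefficient at [e0] of the primitive [f] divides a nonzero minor. *)
Lemma coefficient_bound e0 : e0 \in msupp f ->
  (exists P : {mpoly int[3]}, [/\ P != 0, (msize P <= d.+1)%N, P@_e0 = 0 & forall k, P.@[pts k] = 0]) \/
  (`|f@_e0| <= M0`! * Bn ^ (M0 * d))%N.
Proof.
move=> e0f; have e0d : (mdeg e0 < d.+1)%N by rewrite (leq_trans _ sf) // msize_mdeg_lt.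
pose A := [set e : 'X_{1..3 < d.+1} | (e : 'X_{1..3}) != e0].
pose mon (k : 'I_#|A|) : 'X_{1..3} := bmnm (enum_val k).
have monI : injective mon by move=> k k' /val_inj/enum_val_inj.
have mon0 k : mon k != e0 by have := enum_valP k; rewrite inE.
have [[a ha]|[c [b cb] hc]] := kernel_or_det (fun n (k : 'I_#|A|) => ('X_[mon k] : {mpoly int[3]}).@[pts n]); last first.
  left; pose P : {mpoly int[3]} := \sum_k c k *: 'X_[mon k].
  have Pc k : P@_(mon k) = c k.
    rewrite /P raddf_sum /= (bigD1 k) //= mcoeffZ mcoeffX eqxx mulr1 big1 ?addr0 // => k' kk.
    by rewrite mcoeffZ mcoeffX (inj_eq monI) (negPf kk) mulr0.
  exists P; split.
  - by apply: contraNneq cb => P0; rewrite -Pc P0 mcoeff0.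
  - apply: leq_trans (mmeasure_sum _ _ _ _) _; apply/bigmax_leqP => k _.
    by rewrite (leq_trans (mmeasureZ_le _ _ _)) // msizeX bmdeg.
  - rewrite /P raddf_sum /=; apply: big1 => k _; rewrite mcoeffZ mcoeffX.
    by rewrite (negPf (mon0 k)) mulr0.
  - move=> n; rewrite /P raddf_sum /= -[RHS](hc n); apply: eq_bigr => k _.
    by rewrite mevalZ.
right; set Dl := \det _ in ha; pose MM := \matrix_(i, b) ('X_[mon b] : {mpoly int[3]}).@[pts (a i)].
have f00 : f@_e0 != 0 by rewrite -mcoeff_msupp.
have expand n : f.@[pts n] = f@_e0 * ('X_[e0] : {mpoly int[3]}).@[pts n] +
    \sum_k f@_(mon k) * ('X_[mon k] : {mpoly int[3]}).@[pts n].
  rewrite {1}[f](mpolywE sf) raddf_sum /= (bigD1 (BMultinom e0d)) //= mevalZ; congr (_ + _).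
  transitivity (\sum_(e in A) f@_e * ('X_[e] : {mpoly int[3]}).@[pts n]); last by rewrite big_enum_val.
  by apply: eq_big => [e|e _]; [rewrite inE | rewrite mevalZ].
have key k : (f@_e0 %| f@_(mon k) * Dl)%Z.
  pose v : 'cV[int]_(#|A|) := \col_k f@_(mon k).
  have Mv n : (MM *m v) n 0 = - f@_e0 * ('X_[e0] : {mpoly int[3]}).@[pts (a n)].
    have := pf (a n); rewrite expand mxE => /eqP; rewrite addrC addr_eq0 => /eqP h.
    by rewrite mulNr -h; apply: eq_bigr => l _; rewrite !mxE mulrC.
  have := congr1 (fun C : 'M_#|A| => (C *m v) k 0) (mul_adj_mx MM).
  rewrite /= -mulmxA mul_scalar_mx [in X in _ = X]mxE [v k 0]mxE mulrC -/Dl => <-.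
  rewrite mxE; apply: rpred_sum => n _; rewrite Mv mulNr mulrN rpredN.
  by rewrite dvdz_mull // dvdz_mulr.
have f0D : (f@_e0 %| Dl)%Z.
  apply: (dvdz_primitive f00 prim) => e.
  have [->|ne] := eqVneq e e0; first exact: dvdz_mulr.
  have [ef|/memN_msupp_eq0->] := boolP (e \in msupp f); last by rewrite mul0r dvdz0.
  have ed : (mdeg e < d.+1)%N by rewrite (leq_trans _ sf) // msize_mdeg_lt.
  have eA : BMultinom ed \in A by rewrite inE.
  by have := key (enum_rank_in eA (BMultinom ed)); rewrite /mon enum_rankK_in.
apply: (@leq_trans `|Dl|%N); first by rewrite dvdn_leq // absz_gt0.
have AM : (#|A| <= M0)%N by exact: max_card.
apply: (@leq_trans (#|A| `! * \prod_(k < #|A|) Bn ^ mdeg (mon k))%N).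
  apply: absz_det_le => j k; rewrite mxE mevalX mdegE expn_sum.
  rewrite (big_morph absz abszM (erefl _)); apply: leq_prod => i _.
  by rewrite abszX; case: (mon k i) => // n; rewrite leq_exp2r.
rewrite leq_mul ?leq_fact // -expn_sum leq_pexp2l //.
apply: (@leq_trans (\sum_(k < #|A|) d)%N); last by rewrite sum_nat_const card_ord leq_mul2r AM orbT.
by apply: leq_sum => k _; rewrite -ltnS bmdeg.
Qed.

End HeightReduction.

Lemma eliminant (n D : nat) (f G : {poly {poly {poly int}}}) :
  (1 < size f)%N -> degrees3 n f -> degrees3 D G ->
  ring_prime (map_poly (map_poly (map_poly intr)) f : {poly {poly {poly algC}}}) ->
  ~ ring_dvd (map_poly (map_poly (map_poly intr)) f : {poly {poly {poly algC}}}) (map_poly (map_poly (map_poly intr)) G) ->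
  exists H : {poly {poly int}}, [/\ H != 0, exists a b, H%:P = a * f + b * G,
    (size H <= (2 * n * D + D).+1)%N & forall i, (size (H`_i)%R <= (2 * n * D + D).+1)%N].
Proof.
move=> f1 [sf cf ccf] [sG cG ccG] fP ndvd.
have h2I : injective (map_poly (map_poly (intr : {rmorphism int -> algC}))).
  by do 2![apply: map_inj_poly; last exact: rmorph0]; exact: intr_inj.
have [r [a [b [r0 rE rR]]]] := elimination f1 (prime_no_syzygy h2I fP ndvd).
have mono k l : ((size G).-1 * k + (size f).-1 * l <= D * k + n * l)%N.
  have g1 : ((size G).-1 <= D)%N by move: sG; clear; case: (size G).
  have f1' : ((size f).-1 <= n)%N by move: sf; clear; case: (size f).
  by rewrite leq_add // leq_mul2r ?g1 ?f1' orbT.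
have arith : (D * n + n * D <= 2 * n * D + D)%N by clear; nia.
exists r; split=> //; first by exists a, b.
  case: rR => ->; last by rewrite (leq_trans (cG 0%N)) // ltnS leq_addl.
  apply: leq_trans (filtration_resultant (size_filtration _) cf cG) _.
  by rewrite ltnS (leq_trans (mono _ _)).
move=> i; case: rR => ->; last by rewrite (leq_trans (ccG 0%N i)) // ltnS leq_addl.
have := @filtration_resultant _ _ (coef_filtration (size_filtration int)) n D f G ccf ccG i.
by move/leq_trans; apply; rewrite ltnS (leq_trans (mono _ _)).
Qed.

(** * Covering by plane curves *)

Notation P2 := {poly {poly int}}.

(** The sum of the two partial degrees is additive on products and, for nonzero polynomials, zero
    only on constants, which is what counting factors requires. *)
Definition bideg (h : P2) : nat := ((size h).-1 + (size (swapXY h)).-1)%N.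

Lemma bideg_size (h : P2) : (size h <= (bideg h).+1)%N.
Proof. by rewrite /bideg; case: (size h) => // n; rewrite ltnS leq_addr. Qed.

Lemma bideg_coef (h : P2) i : (size (h`_i)%R <= (bideg h).+1)%N.
Proof.
apply: leq_trans (max_size_coefXY h i) _; rewrite sizeYE /bideg.
by case: (size (swapXY h)) => // n; rewrite ltnS leq_addl.
Qed.

Lemma bidegP (h : P2) d : (size h <= d.+1)%N -> (forall i, size (h`_i)%R <= d.+1)%N -> (bideg h <= 2 * d)%N.
Proof.
move=> sh sc; have : (size (swapXY h) <= d.+1)%N.
  by rewrite -sizeYE /sizeY; apply/bigmax_leqP => i _; exact: sc.
by rewrite /bideg; move: sh; move: (size _) (size _); clear; lia.
Qed.

Lemma bidegM (p q : P2) : p != 0 -> q != 0 -> bideg (p * q) = (bideg p + bideg q)%N.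
Proof.
move=> p0 q0; have p0' : swapXY p != 0 by rewrite swapXY_eq0.
have q0' : swapXY q != 0 by rewrite swapXY_eq0.
rewrite /bideg rmorphM !size_mul //; move: p0 q0 p0' q0'; rewrite -!size_poly_gt0.
by move: (size p) (size q) (size (swapXY p)) (size (swapXY q)); clear; lia.
Qed.

Lemma bideg_prod (s : seq P2) : (forall p, p \in s -> p != 0) ->
  bideg (\prod_(p <- s) p) = (\sum_(p <- s) bideg p)%N.
Proof.
elim: s => [|p s IH] h; first by rewrite !big_nil /bideg rmorph1 !size_poly1.
have hs q : q \in s -> q != 0 by move=> qs; apply: h; rewrite inE qs orbT.
rewrite !big_cons bidegM; [by rewrite IH | by apply: h; rewrite mem_head |].
by rewrite prodf_seq_neq0; apply/allP => q /hs.
Qed.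

Lemma bideg0 (h : P2) : bideg h = 0%N -> h = ((h`_0)`_0)%:P%:P.
Proof.
move/eqP; rewrite addn_eq0 => /andP[/eqP h1 /eqP h2].
have s1 : (size h <= 1)%N by move: h1; case: (size h) => [|[]].
rewrite {1}(size1_polyC s1); congr _%:P; apply: size1_polyC.
apply: leq_trans (max_size_coefXY h 0) _; rewrite sizeYE.
by move: h2; case: (size _) => [|[]].
Qed.

Lemma unit_bideg (u : P2) : u \is a GRing.unit -> bideg u = 0%N.
Proof.
move=> /unitrPr[v uv]; have := congr1 bideg uv.
have u0 : u != 0 by apply: contra_eq_neq uv => ->; rewrite mul0r eq_sym oner_eq0.
have v0 : v != 0 by apply: contra_eq_neq uv => ->; rewrite mulr0 eq_sym oner_eq0.
by rewrite bidegM // {3}/bideg rmorph1 !size_poly1 => /eqP; rewrite addn_eq0 => /andP[/eqP].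
Qed.

(** Prime factors of [bideg] 0 are integers, which vanish nowhere, so only the others are kept, with
    multiplicity. *)
Lemma plane_factors (H : P2) : H != 0 -> exists hs : seq P2,
  [/\ forall h, h \in hs -> [/\ ring_prime h, (0 < bideg h)%N & ring_dvd h H],
      (\sum_(h <- hs) bideg h <= bideg H)%N,
      forall h, ring_prime h -> ring_dvd h H -> (0 < bideg h)%N -> exists2 g, g \in hs & ring_dvd h g &
      forall y z, ev2 idfun y z H = 0 -> exists2 h, h \in hs & ev2 idfun y z h = 0].
Proof.
move=> H0; have [u [s [uU sP HE]]] := poly_factorial (poly_factorial int_factorial) H0.
have s0 p : p \in s -> p != 0 by case/sP.
have u0 : u != 0 by apply: contraTneq uU => ->; rewrite unitr0.
have pr0 : \prod_(p <- s) p != 0 by rewrite prodf_seq_neq0; apply/allP => q /s0.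
exists [seq h <- s | (0 < bideg h)%N]; split.
- move=> h; rewrite mem_filter => /andP[h1 hs]; split=> //; first exact: sP.
  by rewrite HE (big_rem h) //=; exists (u * \prod_(y <- rem h s) y); rewrite mulrCA.
- rewrite HE bidegM // bideg_prod // unit_bideg // add0n big_filter [X in (_ <= X)%N](bigID (fun h => 0 < bideg h)%N) /=.
  exact: leq_addr.
- move=> h hP hH hb; have [h0 hU hM] := hP; move: hH; rewrite HE => /hM[/ring_dvd_unit/(_ uU)|].
    by rewrite (negPf hU).
  move/(ring_prime_prod hP) => [g gs [k gE]]; exists g; last by exists k.
  have g0 := s0 g gs; rewrite mem_filter gs andbT gE bidegM //; first by rewrite addn_gt0 hb.
  by apply: contraNneq g0 => k0; rewrite gE k0 mulr0.
- move=> y z; rewrite HE rmorphM => /eqP; rewrite mulf_eq0.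
have cn0 h : h != 0 -> bideg h = 0%N -> ev2 idfun y z h != 0.
  move=> h0 /bideg0 hE; rewrite hE ev2CC /=; apply: contraNneq h0 => c0.
  by rewrite hE c0 !polyC0.
rewrite (negPf (cn0 _ u0 (unit_bideg uU))) /= rmorph_prod prodf_seq_eq0 => /hasP[h hs /= /eqP hz].
exists h => //; rewrite mem_filter hs andbT lt0n; apply/eqP => b0.
by have := cn0 h (s0 h hs) b0; rewrite hz eqxx.
Qed.

Lemma prime_size_no_syzygy (A : idomainType) (p g : {poly A}) :
  ring_prime p -> ~ ring_dvd p g -> no_syzygy p g.
Proof.
move=> [p0 _ pP] ng w a E sw; have [|[c wc]|//] := pP w g; first by exists a; rewrite E mulrC.
apply/eqP/negPn/negP => w0; move: sw; rewrite wc size_mul //; last first.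
  by apply: contraNneq w0 => c0; rewrite wc c0 mulr0.
have c0 : c != 0 by apply: contraNneq w0 => c0; rewrite wc c0 mulr0.
by move: p0 c0; rewrite -!size_poly_gt0; move: (size p) (size c); clear; lia.
Qed.

Section Shear.

Variable c : int.
Let CC : {rmorphism int -> P2} := (polyC \o polyC)%FUN.

(** The new coordinates are [z] (outer) and [y + c * z] (inner), so that eliminating the outer one
    projects along a direction chosen by [c]. *)
Definition shear : P2 -> P2 := ev2 CC ('X%:P - c%:P%:P * 'X) 'X.
Definition unshear : P2 -> P2 := ev2 CC 'X%:P ('X + c%:P%:P * 'X%:P).

HB.instance Definition _ := GRing.RMorphism.copy shear (ev2 CC ('X%:P - c%:P%:P * 'X) 'X).
HB.instance Definition _ := GRing.RMorphism.copy unshear (ev2 CC 'X%:P ('X + c%:P%:P * 'X%:P)).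

Lemma shearK : cancel shear unshear.
Proof.
move=> p; move: p; apply: (@ev2_unique _ _ (unshear \o shear)%FUN idfun) => [k||] /=.
- by rewrite {1}/shear ev2CC /unshear ev2CC.
- rewrite {1}/shear ev2X rmorphB rmorphM /= /unshear ev2CX ev2X ev2CC /=.
  by rewrite addrK.
- by rewrite {1}/shear ev2CX /unshear ev2X.
Qed.

Lemma unshearK : cancel unshear shear.
Proof.
move=> p; move: p; apply: (@ev2_unique _ _ (shear \o unshear)%FUN idfun) => [k||] /=.
- by rewrite {1}/unshear ev2CC /shear ev2CC.
- by rewrite {1}/unshear ev2X /shear ev2CX.
- rewrite {1}/unshear ev2CX rmorphD rmorphM /= /shear ev2CX ev2X ev2CC /=.
  by rewrite subrK.
Qed.

Lemma shear_eval y z p : ev2 idfun z (y + c * z) (shear p) = ev2 idfun y z p.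
Proof.
have e1 : ev2 idfun z (y + c * z) ('X%:P - c%:P%:P * 'X) = y by rewrite ev2_subCM ev2CX ev2X addrK.
have e2 : ev2 idfun z (y + c * z) 'X = z by exact: ev2X.
rewrite /shear (ev2_comp CC (ev2 idfun z (y + c * z))) [X in ev2 _ X _ _]e1 [X in ev2 _ _ X _]e2.
set h : {rmorphism int -> int} := (ev2 idfun z _ \o CC)%FUN.
have hE k : h k = k by rewrite /h /= ev2CC.
move: h hE => h hE; move: p; apply: (@ev2_unique _ _ (ev2 h y z) (ev2 idfun y z)) => [k||] /=.
- by rewrite !ev2CC hE.
- by rewrite !ev2X.
- by rewrite !ev2CX.
Qed.

Lemma shear_dvd p q : ring_dvd (shear p) (shear q) -> ring_dvd p q.
Proof.
by move=> [k E]; exists (unshear k); rewrite -[LHS]shearK E rmorphM /= shearK.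
Qed.

Lemma shear_prime p : ring_prime p -> ring_prime (shear p).
Proof.
move=> [p0 pU pP]; split.
- by apply: contraNneq p0 => h; rewrite -(shearK p) h rmorph0.
- apply: contraNN pU => /unitrPr[b ab]; apply/unitrPr; exists (unshear b).
  by rewrite -[p](shearK) -rmorphM ab rmorph1.
- move=> a b; rewrite -[a](unshearK) -[b](unshearK) -rmorphM => /shear_dvd/pP[] [k ->].
    by left; exists (shear k); rewrite rmorphM.
  by right; exists (shear k); rewrite rmorphM.
Qed.

Lemma shear_size p : (size (shear p) <= (bideg p).+1)%N.
Proof.
pose dy := (size p).-1; pose dz := (size (swapXY p)).-1.
have sy : (size p <= dy.+1)%N by rewrite /dy; case: (size p).
have sz i : (size (p`_i)%R <= dz.+1)%N.
  by apply: leq_trans (max_size_coefXY p i) _; rewrite sizeYE /dz; case: (size _).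
have := @filtration_ev2 _ _ CC (fun k (q : P2) => size q <= k.+1)%N ('X%:P - c%:P%:P * 'X) 'X 1 1 dy dz p.
rewrite !muln1 [(dz + dy)%N]addnC; apply=> //.
- exact: size_filtration.
- by move=> l m x lm h; apply: leq_trans h _; rewrite ltnS.
- by move=> x; rewrite /= size_polyC_leq1.
- rewrite (leq_trans (size_polyD _ _)) // geq_max size_polyN (leq_trans (size_polyC_leq1 _)) //=.
  by rewrite mul_polyC (leq_trans (size_scale_leq _ _)) // size_polyX.
- by rewrite size_polyX.
Qed.

Lemma shear_coef p i : (size ((shear p)`_i)%R <= (bideg p).+1)%N.
Proof.
pose dy := (size p).-1; pose dz := (size (swapXY p)).-1.
have sy : (size p <= dy.+1)%N by rewrite /dy; case: (size p).
have sz j : (size (p`_j)%R <= dz.+1)%N.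
  by apply: leq_trans (max_size_coefXY p j) _; rewrite sizeYE /dz; case: (size _).
have h : forall i, (size ((shear p)`_i)%R <= (dz * 0 + dy * 1).+1)%N.
  apply: (@filtration_ev2 _ _ CC (fun k (q : P2) => forall i, size (q`_i)%R <= k.+1)%N ('X%:P - c%:P%:P * 'X) 'X 1 0 dy dz p) => //.
  - exact: (coef_filtration (size_filtration _)).
  - by move=> l m x lm hx j; apply: leq_trans (hx j) _; rewrite ltnS.
  - by move=> x j; rewrite /= coefC; case: eqP; rewrite ?size_poly0 // size_polyC_leq1.
  - move=> j; rewrite coefB coefC coefCM coefX (leq_trans (size_polyD _ _)) // geq_max size_polyN.
    apply/andP; split; first by case: eqP; rewrite ?size_poly0 // size_polyX.
    by case: eqP => _; rewrite ?mulr0 ?size_poly0 // mulr1 (leq_trans (size_polyC_leq1 _)).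
  - by move=> j; rewrite coefX; case: eqP => _; rewrite ?size_poly0 // size_poly1.
by apply: leq_trans (h i) _; rewrite muln0 muln1 add0n ltnS leq_addr.
Qed.

End Shear.

(** [c] avoids the finitely many directions of lines through two points of [S]. *)
Lemma separating_shear (S : seq (int * int)) : uniq S ->
  exists c : int, {in S &, injective (fun P : int * int => P.1 + c * P.2)}.
Proof.
move=> uS; pose L P Q : {poly int} := (P.1 - Q.1)%:P + (P.2 - Q.2)%:P * 'X.
pose pi := \prod_(P <- S) \prod_(Q <- S | P != Q) L P Q.
have L0 P Q : P != Q -> L P Q != 0.
  apply: contraNneq => E; have := congr1 (fun p : {poly int} => p`_0) E; have := congr1 (fun p : {poly int} => p`_1) E.
  rewrite /L !coefD !coefC !coefCM !coefX /= !mulr0 !mulr1 addr0 add0r => /eqP; rewrite subr_eq0 => /eqP e2 /eqP.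
  by rewrite subr_eq0 => /eqP e1; apply/eqP; case: P Q {E} e1 e2 => a b [a' b'] /= -> ->.
have pi0 : pi != 0.
  rewrite /pi prodf_seq_neq0; apply/allP => P _ /=; rewrite prodf_seq_neq0; apply/allP => Q _.
  by apply/implyP; exact: L0.
have char0 k : k.+1%:R != 0 :> int by rewrite pnatr_eq0.
have [a _ pa] := exists_nat_nonroot char0 pi0.
exists a%:R => P Q PS QS E; apply/eqP/negPn/negP => PQ; case/negP: pa.
rewrite /pi (big_rem P) //= hornerM mulf_eq0; apply/orP; left.
rewrite (big_rem Q) //= PQ hornerM mulf_eq0; apply/orP; left.
rewrite /L hornerD hornerM !hornerC hornerX.
have -> : P.1 - Q.1 + (P.2 - Q.2) * a%:R = (P.1 + a%:R * P.2) - (Q.1 + a%:R * Q.2) by ring.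
by rewrite E subrr.
Qed.

Lemma ev2_polyC (c : {poly int}) (a b : int) : ev2 idfun a b c%:P = c.[b].
Proof. by rewrite /ev2 map_polyC hornerC /= map_poly_id. Qed.

(** After a separating shear the inner coordinates of the points are distinct roots of the eliminant
    of the outer variable, whose degree the Sylvester determinant bounds. If the sheared [h] does
    not involve the outer variable, its own roots suffice. *)
Lemma plane_bezout (h H : P2) (S : seq (int * int)) : ring_prime h -> ~ ring_dvd h H -> uniq S ->
  (forall P, P \in S -> ev2 idfun P.1 P.2 h = 0 /\ ev2 idfun P.1 P.2 H = 0) ->
  (size S <= 2 * bideg h * bideg H + bideg h + bideg H)%N.
Proof.
move=> hP ndvd uS SZ; have [c cI] := separating_shear uS.
pose p := shear c h; pose g := shear c H.
have pP : ring_prime p by exact: shear_prime.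
have npg : ~ ring_dvd p g by move/shear_dvd.
pose ws := [seq P.1 + c * P.2 | P <- S].
have uw : uniq ws by rewrite map_inj_in_uniq.
have sw : size ws = size S by rewrite size_map.
have zw w : w \in ws -> exists z, ev2 idfun z w p = 0 /\ ev2 idfun z w g = 0.
  by case/mapP => P /SZ[e1 e2] ->; exists P.2; rewrite /p /g !shear_eval.
have roots (r : {poly int}) B : r != 0 -> (size r <= B.+1)%N -> (forall w, w \in ws -> root r w) -> (size S <= B)%N.
  move=> r0 rB rw; rewrite -sw -ltnS; apply: leq_trans rB; apply: max_poly_roots => //.
  by apply/allP => w /rw.
have [p1|p1] := leqP (size p) 1.
  have pE := size1_polyC p1; apply: (@leq_trans (bideg h)); last by rewrite -addnA addnCA leq_addr.
  apply: (roots p`_0).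
  - by case: pP => p0 _ _; apply: contraNneq p0 => c0; rewrite pE c0.
  - exact: shear_coef.
  - by move=> w /zw[z [e1 _]]; move: e1; rewrite {1}pE ev2_polyC => /eqP.
have [r [a [b [r0 rE rR]]]] := elimination p1 (prime_size_no_syzygy pP npg).
apply: (roots r) => //.
  case: rR => ->; last by rewrite (leq_trans (shear_coef _ _ _)) // ltnS leq_addl.
  apply: leq_trans (filtration_resultant (size_filtration _) (shear_coef c h) (shear_coef c H)) _.
  have h1 : ((size p).-1 <= bideg h)%N by have := shear_size c h; rewrite -/p; case: (size p).
  have h2 : ((size g).-1 <= bideg H)%N by have := shear_size c H; rewrite -/g; case: (size g).
  rewrite ltnS -addnA (leq_trans _ (leq_addr _ _)) //.
  by apply: leq_trans (leq_add (leq_mul h2 (leqnn _)) (leq_mul h1 (leqnn _))) _; apply: eq_leq; ring.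
move=> w /zw[z [e1 e2]]; have := congr1 (ev2 idfun z w) rE.
rewrite rmorphD !rmorphM /= e1 e2 !mulr0 addr0 ev2_polyC.
by move/eqP.
Qed.

Lemma size_le_cover (T I : eqType) (Z : seq T) (K : seq I) (F : I -> seq T) : uniq Z ->
  (forall u, u \in Z -> exists2 k, k \in K & u \in F k) -> (size Z <= \sum_(k <- K) size (F k))%N.
Proof.
move=> uZ h; apply: (@leq_trans (size (flatten [seq F k | k <- K]))).
  apply: uniq_leq_size => // u /h[k kK uF]; apply/flattenP; exists (F k) => //.
  exact: map_f.
by rewrite size_flatten /shape -map_comp sumnE big_map.
Qed.

(* The main coordinate comes first. *)
Notation pt := (int * (int * int))%type.

Section TreeCover.

Variables (n Cd P0 E0 : nat) (f : {poly {poly {poly int}}}) (S : seq pt).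
Variables (pr : pt -> nat) (t : nat -> nat) (E : nat -> nat -> nat).
Variables (node : nat -> nat -> nat * (nat * nat) -> {poly {poly int}}) (H0 : {poly {poly int}}).

(** The main coordinate is recorded only modulo [p]: where the derivative is prime to [p], Hensel's
    lemma determines it from the other two. *)
Definition label (p i : nat) (u : pt) : nat * (nat * nat) :=
  (`|(u.1 %% p)%Z|%N, (`|(u.2.1 %% (p ^ i)%N)%Z|%N, `|(u.2.2 %% (p ^ i)%N)%Z|%N)).

Let parent (p i : nat) (l : nat * (nat * nat)) := (l.1, (l.2.1 %% p ^ i, l.2.2 %% p ^ i)%N).

Hypotheses (uS : uniq S) (sf : (size f <= n.+1)%N).
Hypothesis fS : forall u, u \in S -> ev3 idfun u.1 u.2.1 u.2.2 f = 0 /\ ev3 idfun u.1 u.2.1 u.2.2 f^`() != 0.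
Hypothesis prS : forall u, u \in S -> (0 < pr u < P0)%N.
Hypothesis node0 : forall p l, node p 0%N l = H0.
Hypothesis nodeS : forall u i, u \in S -> (i <= t (pr u))%N -> let H := node (pr u) i (label (pr u) i u) in
  [/\ H != 0, ev2 idfun u.2.1 u.2.2 H = 0 & (bideg H <= E (pr u) i)%N].
Hypothesis leafS : forall u, u \in S -> (E (pr u) (t (pr u)) <= Cd)%N.
Hypotheses (H00 : H0 != 0) (HE0 : (bideg H0 <= E0)%N).

Let labelS p i u : (0 < p)%N -> parent p i (label p i.+1 u) = label p i u.
Proof.
move=> p0; have pi0 k : (0 < p ^ k)%N by rewrite expn_gt0 p0.
have h (a : int) : (`|(a %% (p ^ i.+1)%N)%Z| %% p ^ i)%N = `|(a %% (p ^ i)%N)%Z|%N.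
  have e (b : int) k : (`|(b %% (p ^ k)%N)%Z|%N)%:Z = (b %% (p ^ k)%N)%Z.
    by rewrite gez0_abs // modz_ge0 // -lt0n.
  apply/eqP; rewrite -eqz_nat -modz_nat e e; apply/eqP.
  apply/eqP; rewrite eqz_mod_dvd {2}(divz_eq a (p ^ i.+1)%N) opprD addrCA subrr addr0 rpredN dvdz_mull //.
  by rewrite dvdzE /= dvdn_exp2l.
by rewrite /parent /label /= !h.
Qed.

Let labels (p i : nat) : seq (nat * (nat * nat)) :=
  [seq (a, bc) | a <- iota 0 p, bc <- [seq (b, c) | b <- iota 0 (p ^ i), c <- iota 0 (p ^ i)]].

Let size_labels p i : size (labels p i) = (p ^ (2 * i + 1))%N.
Proof.
rewrite !size_allpairs !size_iota -expnD addnn -mul2n addn1 expnS //.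
Qed.

Let label_in p i u : (0 < p)%N -> label p i u \in labels p i.
Proof.
move=> p0; have pi0 k : (0 < p ^ k)%N by rewrite expn_gt0 p0.
have e (b : int) q : (0 < q)%N -> `|(b %% q)%Z|%N \in iota 0 q.
  move=> q0; rewrite mem_iota /= add0n -ltz_nat gez0_abs ?modz_ge0 -?lt0n //.
  by rewrite ltz_pmod.
by apply: allpairs_f; [exact: e | apply: allpairs_f; apply: e].
Qed.

(** The derivative is nonzero at a point of [S], so [f] does not vanish identically on the line over
    [(y, z)]. *)
Lemma fiber_bound (y z : int) (xs : seq int) : uniq xs ->
  (forall x, x \in xs -> (x, (y, z)) \in S) -> (size xs <= n)%N.
Proof.
move=> ux hx; case: xs ux hx => // x0 xs ux hx.
pose g : {poly int} := map_poly (ev2 idfun y z) f.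
have [_ fx] := fS (hx x0 (mem_head _ _)).
have g0 : g != 0.
  by apply: contraNneq fx; rewrite /ev3 -deriv_map -/g => ->; rewrite deriv0 horner0.
rewrite -ltnS; apply: leq_trans (_ : size g <= n.+1)%N; last exact: leq_trans (size_poly _ _) sf.
apply: max_poly_roots => //; apply/allP => x /hx/fS[/= fx0 _].
by apply/eqP.
Qed.

(* A prime factor [h] of [H0] with [bideg h > Cd] divides no leaf; so every point on it that [hs] misses
   lies on a factor of some node which does not divide the next one, and Bezout applies there. *)
Lemma tree_cover : exists (hs : seq {poly {poly int}}) (Z : seq pt),
  [/\ forall h, h \in hs -> h != 0 /\ (bideg h <= Cd)%N, (size hs <= E0)%N,
      {subset Z <= S} /\ uniq Z,
      (size Z <= \sum_(p < P0) \sum_(i < t p) p ^ (2 * i + 3) * (n * (3 * (E p i * E p i.+1) + E p i)))%N &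
      forall u, u \in S -> u \notin Z -> exists2 h, h \in hs & ev2 idfun u.2.1 u.2.2 h = 0].
Proof.
have /choice[fac facP] : forall H : {poly {poly int}}, exists hs : seq {poly {poly int}}, H != 0 ->
   [/\ forall h, h \in hs -> [/\ ring_prime h, (0 < bideg h)%N & ring_dvd h H],
      (\sum_(h <- hs) bideg h <= bideg H)%N,
      forall h, ring_prime h -> ring_dvd h H -> (0 < bideg h)%N -> exists2 g, g \in hs & ring_dvd h g &
      forall y z, ev2 idfun y z H = 0 -> exists2 h, h \in hs & ev2 idfun y z h = 0].
  move=> H; have [->|Hn] := eqVneq H 0; first by exists [::].
  by have [hs hsP] := plane_factors Hn; exists hs.
have facs H : H != 0 -> (size (fac H) <= bideg H)%N.
  move=> Hn; have [h1 h2 _ _] := facP H Hn; apply: leq_trans h2.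
  by rewrite -sum1_size big_seq [X in (_ <= X)%N]big_seq; apply: leq_sum => h /h1[].
pose hs := [seq h <- fac H0 | (bideg h <= Cd)%N].
pose Z := [seq u <- S | ~~ has (fun h => ev2 idfun u.2.1 u.2.2 h == 0) hs].
exists hs, Z; split.
- move=> h; rewrite mem_filter => /andP[hC hF]; split=> //.
  by have [h1 _ _ _] := facP H0 H00; have [[]] := h1 h hF.
- by rewrite size_filter (leq_trans (count_size _ _)) // (leq_trans (facs _ H00)).
- by split; [move=> u; rewrite mem_filter => /andP[] | exact: filter_uniq].
- have uZ : uniq Z by exact: filter_uniq.
  have ZS u : u \in Z -> u \in S by rewrite mem_filter => /andP[].
  pose Fg p i (l : nat * (nat * nat)) (g : {poly {poly int}}) : seq pt := [seq u <- S |
     [&& pr u == p, (i < t p)%N, label p i.+1 u == l, ev2 idfun u.2.1 u.2.2 g == 0 &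
         ~~ `[< ring_dvd g (node p i.+1 l) >]]].
  have exi u : u \in Z -> exists i, [/\ (i < t (pr u))%N & exists2 g, g \in fac (node (pr u) i (label (pr u) i u)) &
      ev2 idfun u.2.1 u.2.2 g = 0 /\ ~ ring_dvd g (node (pr u) i.+1 (label (pr u) i.+1 u))].
    rewrite mem_filter => /andP[/hasPn nh uS']; set p := pr u.
    have [h1 h2 _ h4] := facP H0 H00.
    have [h hF hu] : exists2 h, h \in fac H0 & ev2 idfun u.2.1 u.2.2 h = 0.
      apply: h4; have [_ + _] := nodeS uS' (leq0n (t p)).
      by rewrite node0.
    have [hP hb hH0] := h1 h hF.
    have hC : (Cd < bideg h)%N.
      by rewrite ltnNge; apply/negP => le; have := nh h; rewrite mem_filter le hF hu eqxx => /(_ isT).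
    have ntop : ~ ring_dvd h (node p (t p) (label p (t p) u)).
      case=> k kE; have [Hn _ HE] := nodeS uS' (leqnn (t p)).
      have k0 : k != 0 by apply: contraNneq Hn => k0; rewrite -/p kE k0 mulr0.
      have [h0 _ _] := hP; have := leq_trans HE (leafS uS').
      by rewrite -/p kE bidegM // => /(leq_trans (leq_addr _ _)); rewrite leqNgt hC.
    (* [Q] fails at the root and holds at the leaf, whose degree is at most [Cd < bideg h]. Just
       before its first success the node has a factor [g] divisible by [h], and [g] cannot divide
       the next node. *)
    pose Q i := `[< ~ ring_dvd h (node p i (label p i u)) >].
    have exQ : exists i, Q i by exists (t p); apply/asboolP.
    have := ex_minnP exQ; case=> i /asboolP ndi mini.
    have it : (i <= t p)%N by apply: mini; apply/asboolP.
    case: i ndi mini it => [|i] ndi mini it.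
      by case: ndi; rewrite node0.
    exists i; split=> //.
    have hdi : ring_dvd h (node p i (label p i u)).
      apply: contrapT => nd; have : (i.+1 <= i)%N by apply: mini; apply/asboolP.
      by rewrite ltnn.
    have [Hn _ _] := nodeS uS' (ltnW it).
    have [_ _ h3 _] := facP _ Hn; have [g gF [k gE]] := h3 h hP hdi hb.
    exists g => //; split; first by rewrite gE rmorphM /= hu mul0r.
    by case=> k' k'E; apply: ndi; exists (k * k'); rewrite k'E gE mulrA.
  have FgP p i l g u : u \in Fg p i l g -> [/\ u \in S, pr u = p, (i < t p)%N, label p i.+1 u = l &
      ev2 idfun u.2.1 u.2.2 g = 0 /\ ~ ring_dvd g (node p i.+1 l)].
    by rewrite mem_filter => /andP[/and5P[/eqP-> -> /eqP-> /eqP-> /asboolPn]].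
  have p0 u : u \in S -> (0 < pr u)%N by case/prS/andP.
  have FgB p i l g u0 : u0 \in S -> pr u0 = p -> (i < t p)%N -> label p i.+1 u0 = l ->
      g \in fac (node p i (parent p i l)) ->
      (size (Fg p i l g) <= n * (2 * bideg g * E p i.+1 + bideg g + E p i.+1))%N.
    move=> u0S u0p ip u0l gF.
    case FE: (Fg p i l g) => [|u1 s1] //; rewrite -FE.
    have [_ _ _ _ [_ nd]] : [/\ u1 \in S, pr u1 = p, (i < t p)%N, label p i.+1 u1 = l &
        ev2 idfun u1.2.1 u1.2.2 g = 0 /\ ~ ring_dvd g (node p i.+1 l)].
      by apply: FgP; rewrite FE mem_head.
    have gP : ring_prime g.
      move: gF; rewrite -u0l labelS -?u0p ?p0 // => gF.
      have [Hn _ _] : let H := node (pr u0) i (label (pr u0) i u0) in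
        [/\ H != 0, ev2 idfun u0.2.1 u0.2.2 H = 0 & (bideg H <= E (pr u0) i)%N].
        by apply: nodeS => //; rewrite u0p ltnW.
      by have [h1 _ _ _] := facP _ Hn; case: (h1 g gF).
    have HB : (bideg (node p i.+1 l) <= E p i.+1)%N.
      have le : (i.+1 <= t (pr u0))%N by rewrite u0p.
      by rewrite -u0l -u0p; have [] := nodeS u0S le.
    pose yz := undup [seq u.2 | u <- Fg p i l g].
    have szyz : (size yz <= 2 * bideg g * E p i.+1 + bideg g + E p i.+1)%N.
      apply: leq_trans (plane_bezout gP nd (undup_uniq _) _) _.
        move=> P; rewrite mem_undup => /mapP[u /FgP[uS' pu _ lu [gu _]] ->]; split=> //.
        have le : (i.+1 <= t (pr u))%N by rewrite pu.
        by rewrite -lu -pu; have [_ ->] := nodeS uS' le.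
      by rewrite leq_add // leq_add2r leq_mul2l HB orbT.
    apply: leq_trans (_ : \sum_(w <- yz) n <= _)%N; last first.
      by rewrite big_const_seq count_predT iter_addn_0 leq_mul2l szyz orbT.
    have uF : uniq (Fg p i l g) by exact: filter_uniq.
    apply: leq_trans (@size_le_cover _ _ _ yz (fun w => [seq u <- Fg p i l g | u.2 == w]) uF _) _.
      by move=> u uF'; exists u.2; rewrite ?mem_undup ?map_f // mem_filter eqxx.
    apply: leq_sum => -[y z] _.
    rewrite -(size_map (fun u => u.1)); apply: (@fiber_bound y z).
      rewrite map_inj_in_uniq ?filter_uniq // => -[x1 w1] [x2 w2].
      by rewrite !mem_filter /= => /andP[/eqP-> _] /andP[/eqP-> _] ->.
    move=> x /mapP[[x' w]]; rewrite mem_filter /= => /andP[/eqP-> /FgP[xS _ _ _ _]] ->.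
    exact: xS.
  apply: leq_trans (@size_le_cover _ _ Z (iota 0 P0) (fun p => [seq u <- Z | pr u == p]) uZ _) _.
    move=> u uZ'; exists (pr u); last by rewrite mem_filter eqxx.
    by rewrite mem_iota /=; have /andP[_ ->] := prS (ZS u uZ').
  have -> : iota 0 P0 = index_iota 0 P0 by rewrite /index_iota subn0.
  rewrite big_mkord; apply: leq_sum => p _.
  set Zp := [seq u <- Z | _]; have uZp : uniq Zp by exact: filter_uniq.
  pose FF i := flatten [seq flatten [seq Fg p i l g | g <- fac (node p i (parent p i l))] | l <- labels p i.+1].
  apply: leq_trans (@size_le_cover _ _ Zp (iota 0 (t p)) FF uZp _) _.
    move=> u; rewrite mem_filter => /andP[/eqP pu uZ']; have uS' := ZS u uZ'.
    have [i [it [g gF [gu gnd]]]] := exi u uZ'; rewrite pu in it gF gnd.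
    have pp0 : (0 < p)%N by rewrite -pu p0.
    exists i; first by rewrite mem_iota.
    apply/flattenP; eexists; first by apply: map_f; exact: (@label_in p i.+1 u pp0).
    apply/flattenP; exists (Fg p i (label p i.+1 u) g).
      by apply: map_f; rewrite labelS.
    by rewrite mem_filter uS' andbT pu eqxx it gu !eqxx /=; apply/asboolPn.
  have -> : iota 0 (t p) = index_iota 0 (t p) by rewrite /index_iota subn0.
  rewrite big_mkord; apply: leq_sum => i _.
  have -> : (p ^ (2 * i + 3) = size (labels p i.+1))%N.
    by rewrite size_labels; congr (_ ^ _)%N; clear; lia.
  rewrite size_flatten /shape -map_comp sumnE big_map -sum1_size big_distrl /=.
  apply: leq_sum => l _; rewrite mul1n size_flatten /shape -map_comp sumnE big_map.
  have [/hasP[u0 u0S /and3P[/eqP u0p ip /eqP u0l]]|/hasPn none] :=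
    boolP (has (fun u => [&& pr u == p, (i < t p)%N & label p i.+1 u == l]) S); last first.
    rewrite big1_seq // => g _ /=; apply/eqP; rewrite size_eq0 -[_ == _]negbK -has_filter.
    apply/hasPn => u uS'; have := none u uS'; apply: contraNN => /and5P[-> -> -> _ _].
    by [].
  have [Hn _ HE] : let H := node (pr u0) i (label (pr u0) i u0) in
      [/\ H != 0, ev2 idfun u0.2.1 u0.2.2 H = 0 & (bideg H <= E (pr u0) i)%N].
    by apply: nodeS => //; rewrite u0p ltnW.
  have lE : parent p i l = label (pr u0) i u0 by rewrite -u0l u0p labelS // -u0p p0.
  have [_ sb _ _] := facP _ Hn; have sf' := facs _ Hn; rewrite -lE u0p in HE sb sf'.
  have sb' := leq_trans sb HE; have sf'' := leq_trans sf' HE.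
  apply: (@leq_trans (\sum_(g <- fac (node p i (parent p i l))) n * (2 * bideg g * E p i.+1 + bideg g + E p i.+1)))%N.
    rewrite big_seq [X in (_ <= X)%N]big_seq; apply: leq_sum => g gF.
    exact: (FgB p i l g u0).
  rewrite -big_distrr leq_mul2l /=; apply/orP; right.
  (* Both the number of factors and the sum of their degrees are at most [E p i], so Bezout's bounds
     add up to [3 * E p i * E p i.+1 + E p i]. *)
  have -> : (\sum_(g <- fac (node p i (parent p i l))) (2 * bideg g * E p i.+1 + bideg g + E p i.+1) =
     2 * (\sum_(g <- fac (node p i (parent p i l))) bideg g) * E p i.+1 +
     \sum_(g <- fac (node p i (parent p i l))) bideg g + size (fac (node p i (parent p i l))) * E p i.+1)%N.
    elim: (fac _) => [|g gs IH]; first by rewrite !big_nil.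
    by rewrite !big_cons IH /=; ring.
  move: sb' sf''; set a := (\sum_(_ <- _) _)%N; set b := size _; set e := E p i; set e' := E p i.+1.
  clearbody a b e e'; clear=> ha hb.
  have := leq_mul ha (leqnn e'); have := leq_mul hb (leqnn e'); rewrite -!mulnA.
  by move: (a * e')%N (b * e')%N (e * e')%N ha; clear; lia.
- move=> u uS'; rewrite mem_filter uS' andbT negbK => /hasP[h hh /eqP hu].
  by exists h.
Qed.

End TreeCover.

(** * Auxiliary polynomials *)

Lemma horner_absz (p : {poly int}) (x : int) (b M d : nat) : (0 < b)%N -> (`|x| <= b)%N ->
  (size p <= d.+1)%N -> (\sum_(i < size p) `|(p`_i)%R| <= M)%N -> (`|(p.[x])%R| <= M * b ^ d)%N.
Proof.
move=> b0 xb sp pM; rewrite horner_coef; have [_ _ ND _ _] := int_norm.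
apply: (@leq_trans (\sum_(i < size p) `|(p`_i)%R| * b ^ d)%N); last by rewrite -big_distrl leq_mul2r pM orbT.
apply: (big_ind2 (fun (u : int) (a : nat) => `|u|%N <= a)%N) => // [u a v c ua vc|i _].
  by apply: leq_trans (ND _ _) _; rewrite leq_add.
rewrite abszM leq_mul2l abszX; apply/orP; right.
have id : (i <= d)%N by rewrite -ltnS (leq_trans (ltn_ord i)).
by apply: (@leq_trans (b ^ i)); [case: (i : nat) => // k; rewrite leq_exp2r | rewrite leq_pexp2l].
Qed.

Lemma ev3_absz (f : {poly {poly {poly int}}}) (x y z : int) (b d : nat) : (0 < b)%N ->
  (`|x| <= b)%N -> (`|y| <= b)%N -> (`|z| <= b)%N -> degrees3 d f ->
  (`|ev3 idfun x y z f| <= norm3 f * b ^ (3 * d))%N.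
Proof.
move=> b0 xb yb zb [s1 s2 s3].
have e1 (c : {poly int}) : (size c <= d.+1)%N -> (`|(c.[z])%R| <= norm1 c * b ^ d)%N.
  by move=> sc; apply: horner_absz.
have shrink (A B : nzRingType) (h : A -> B) (N : A -> nat) (N' : B -> nat) (p : {poly A}) (e : nat) :
    h 0 = 0 -> N' 0 = 0%N -> (forall i : nat, N' (h p`_i)%R <= N (p`_i)%R * e)%N ->
    (\sum_(i < size (map_poly h p)) N' ((map_poly h p)`_i)%R <= (\sum_(i < size p) N (p`_i)%R) * e)%N.
  move=> h0 N'0 hN; have le : (size (map_poly h p) <= size p)%N by exact: size_poly.
  rewrite (big_ord_widen _ (fun i => N' ((map_poly h p)`_i)%R) le) big_distrl /= big_mkcond.
  apply: leq_sum => i _; case: ifP => // _; rewrite coef_map_id0 //.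
have e2 (c : {poly {poly int}}) : (size c <= d.+1)%N -> (forall i, size (c`_i)%R <= d.+1)%N ->
    (`|ev2 idfun y z c| <= norm2 c * b ^ d * b ^ d)%N.
  move=> sc sc'; apply: horner_absz => //; first exact: leq_trans (size_poly _ _) sc.
  apply: (shrink _ _ _ norm1 (fun k : int => `|k|%N)); [exact: rmorph0 | by [] |].
  by move=> i /=; rewrite map_poly_id // /horner_eval; exact: e1.
have -> : (norm3 f * b ^ (3 * d) = norm3 f * (b ^ d * b ^ d) * b ^ d)%N.
  by rewrite -mulnA -!expnD; congr (_ * _ ^ _)%N; lia.
apply: horner_absz => //; first exact: leq_trans (size_poly _ _) s1.
apply: (shrink _ _ _ norm2 (fun k : int => `|k|%N)); [exact: rmorph0 | by [] |].
by move=> i; rewrite mulnA; exact: e2.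
Qed.

Lemma degrees3_deriv (A : comNzRingType) (f : {poly {poly {poly A}}}) (d : nat) : degrees3 d f -> degrees3 d f^`().
Proof.
move=> [d1 d2 d3]; split.
- by rewrite (leq_trans (size_poly _ _)) // (leq_trans (leq_pred _)).
- by move=> k; rewrite coef_deriv; apply: (filtration_natmul _ (size_filtration _)); exact: d2.
- by move=> k k'; rewrite coef_deriv coefMn; apply: (filtration_natmul _ (size_filtration _)); exact: d3.
Qed.

Lemma deriv_ev3_absz (f : {poly {poly {poly int}}}) (x y z : int) (b d n H : nat) : (0 < b)%N ->
  (`|x| <= b)%N -> (`|y| <= b)%N -> (`|z| <= b)%N -> degrees3 d f -> (size f <= n.+1)%N -> (norm3 f <= H)%N ->
  (`|ev3 idfun x y z f^`()| <= n.+1 * H * b ^ (3 * d))%N.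
Proof.
move=> b0 xb yb zb [d1 d2 d3] sf fH.
have df' := degrees3_deriv (And3 d1 d2 d3).
apply: leq_trans (ev3_absz b0 xb yb zb df') _.
rewrite leq_mul2r; apply/orP; right; apply: leq_trans (poly_norm_deriv norm2P f) _.
exact: leq_mul.
Qed.

Section AuxiliaryPolynomial.

Variable R : realType.

Variables (s dg : nat).
Hypotheses (s0 : (0 < s)%N) (dg0 : (0 < dg)%N).
Let S : R := s%:R.
Let lam : R := Num.sqrt S.
Let o1 : 'I_3 := lift ord0 ord0.
Let o2 : 'I_3 := lift ord0 (lift ord0 ord0).

(** The gcd condition for [g] viewed in three variables: its value at the origin and the values of
    its top part at [(1, 0)] and [(0, 1)] are the coefficients of [1], [x_2 ^ dg] and [x_3 ^ dg]. *)
Definition coprime_form (q : nat) (g : {mpoly int[3]}) : Prop :=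
  (forall e', e' \in msupp g -> e' ord0 = 0%N /\ (mdeg e' <= dg)%N) /\
  gcdz (gcdz (gcdz q%:Z g@_0) g@_(U_(o1) *+ dg)%MM) g@_(U_(o2) *+ dg)%MM = 1.

Definition aux_poly (D : nat) (m : 'X_{1..3}) (pts : nat -> 'I_3 -> int) : Prop :=
  exists G : {mpoly int[3]}, [/\ G != 0,
     forall e, e \in msupp G -> (mdeg e <= D)%N /\ ~~ (m <= e)%MM & forall k, G.@[pts k] = 0].

(* [K = B `^ (1 / lam) * q `^ (- kappa m)]. *)
Definition kappa (m : 'X_{1..3}) : R := (m ord0)%:R / (2 * lam ^+ 3 * dg%:R).

Lemma aux_poly_global (D : nat) (m : 'X_{1..3}) (pts : nat -> 'I_3 -> int) (Bn q : nat) (g : {mpoly int[3]})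
    (i0 i1 i2 : 'I_3) (f : {poly {poly {poly int}}}) :
  mdeg m = s -> (s <= D)%N -> (0 < Bn)%N -> (forall k i, (`|pts k i| <= Bn)%N) ->
  (0 < q)%N -> coprime_form q g -> (forall k, (q%:Z %| g.@[pts k])%Z) ->
  uniq [:: i0; i1; i2] -> (forall k, ev3 idfun (pts k i0) (pts k i1) (pts k i2) f = 0) ->
  ln Bn%:R / lam + 300 * S ^+ 6 * ((ln q%:R + ln Bn%:R) / D%:R + 1) < kappa m * ln q%:R ->
  aux_poly D m pts.
Proof.
move=> mS sD B0 pB q0 [gs cop] qg u3 pf lt.
have [[a ha]|//] := vanishing_or_det D m pts.
(* With [i = 0], [X = 0] and an empty set [Gd], the only gain comes from [q]. *)
have := @master_inequality R s s0 D m mS sD _ Bn (fun j => pB (a j)) B0 ha q dg g q0 dg0 gs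
  (fun j => qg (a j)) cop i0 i1 i2 f u3 (fun j => pf (a j)) 2 0 0 0 0 isT (fun h => False_ind _ (notF h))
  0 pred0 1 0 (fun p h => False_ind _ (notF h)) isT (leq0n _) (lexx 0) (fun p _ h => False_ind _ (notF h)).
have E0 : \sum_(p < 1 | prime p && pred0 p) ln p%:R / p%:R = 0 :> R by rewrite big1 // => p; rewrite andbF.
rewrite E0 !mul0r mulr0 !addr0 -/S -/lam => /(_ _)/le_lt_trans/(_ lt).
rewrite -/(kappa m) ltxx => H; exfalso; apply/notF/H => j.
by rewrite big1 // => p /andP[pp _]; move: pp; rewrite (ord1 p).
Qed.

Lemma exists_large_nat (x : R) : exists k : nat, (0 < k)%N /\ x <= k%:R.
Proof.
exists (Num.truncn x).+1; split=> //; apply: ltW; exact: truncnS_gt.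
Qed.

Lemma aux_arith (c e1 eta l l1 a1 a2 lQ S1 dl lX lD XX E1 lcf lq e0 AH Aq d3 A2 Ce CC0 lC t2 ln1 b : R) :
  0 < e1 -> 0 <= e1 * l -> b = CC0 + (eta * lcf + Ce) + 1 + (eta * lq + Ce) ->
  l1 + lQ + (1 - dl / 2) * S1 <= a1 + (c * E1 + c * XX + c * (eta * (ln1 + (AH + d3) * l) + Ce) + c) ->
  c * E1 <= e1 / 8 * l -> (1 - dl / 2) * (lX - 3 - b) <= (1 - dl / 2) * S1 ->
  dl / 2 * lX <= e1 / 16 * l -> 0 <= dl / 2 * (3 + b) -> a1 <= a2 -> c * XX <= c * A2 ->
  eta * lcf <= eta * (e0 * (lC + (t2 + AH * l))) -> eta * lq <= eta * (Aq * l) ->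
  eta * (2 + e0 * AH + Aq + c * (AH + d3)) * l = e1 / 8 * l ->
  lD - 2 * eta * l - t2 <= lX -> a2 - l1 + e1 * l - lQ <= lD ->
  2 * (t2 + 3 + CC0 + 1 + 2 * Ce + eta * (e0 * (lC + t2)) + c * (A2 + eta * ln1 + Ce + 1)) + e1 <= e1 * l ->
  False.
Proof.
move=> h1 h2 bE M h3 h4 h5 h6 h7 h8 h9 h10 h11 h12 h13 h14.
have {}M : l1 + lQ + (1 - dl / 2) * (lX - 3 - b) <=
    a1 + (c * E1 + c * XX + c * (eta * (ln1 + (AH + d3) * l) + Ce) + c).
  by apply: le_trans M; rewrite lerD2l.
have {h4}M : l1 + lQ + lX - e1 / 16 * l - 3 - b <= a2 + (e1 / 8 * l + c * A2 + c * (eta * (ln1 + (AH + d3) * l) + Ce) + c).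
  by clear -M h3 h5 h6 h7 h8; lra.
have {h3 h5 h6 h7 h8}M : a2 + e1 * l - 2 * eta * l - t2 - e1 / 16 * l - 3 - b <=
    a2 + (e1 / 8 * l + c * A2 + c * (eta * (ln1 + (AH + d3) * l) + Ce) + c).
  by clear -M h12 h13; lra.
have hb : b <= CC0 + (eta * (e0 * (lC + (t2 + AH * l))) + Ce) + 1 + (eta * (Aq * l) + Ce).
  by rewrite bE; clear -h9 h10; lra.
clear -M hb h11 h14 h1 h2; lra.
Qed.

(* [ln D >= ln B / lam - kappa ln q + e1 ln B - ln (p0 ^ i)] says [D >= K B^e1 / p0^i]. *)
Lemma aux_poly_class (e1 Aq AH AQ AD : R) (n d : nat) :
  0 < e1 -> 0 <= Aq -> 0 <= AH -> 0 <= AQ -> 0 <= AD -> (0 < n)%N ->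
  exists (Dc : nat) (l0 : R), (s <= Dc)%N /\ 
  forall (D : nat) (m : 'X_{1..3}) (pts : nat -> 'I_3 -> int) (B : R) (Bn q H : nat) (g : {mpoly int[3]})
    (i0 i1 i2 : 'I_3) (f : {poly {poly {poly int}}}) (p0 i : nat) (xt yt zt : int),
  mdeg m = s -> (Dc <= D)%N -> (0 < Bn)%N -> Bn%:R <= B -> l0 <= ln B ->
  (forall k i, (`|pts k i| <= Bn)%N) ->
  (0 < q)%N -> coprime_form q g -> (forall k, (q%:Z %| g.@[pts k])%Z) ->
  uniq [:: i0; i1; i2] -> size f = n.+1 -> degrees3 d f ->
  ring_prime (map_poly (map_poly (map_poly intr)) f : {poly {poly {poly algC}}}) ->
  (norm3 f <= H)%N -> (0 < H)%N ->
  (forall k, ev3 idfun (pts k i0) (pts k i1) (pts k i2) f = 0 /\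
     ev3 idfun (pts k i0) (pts k i1) (pts k i2) f^`() != 0) ->
  prime p0 ->
  ((0 < i)%N -> [/\ ~~ (p0 %| q)%N, ~~ (p0%:Z %| ev3 idfun xt yt zt f^`())%Z &
    forall k, [/\ p0%:Z %| pts k i0 - xt, p0%:Z ^+ i %| pts k i1 - yt & p0%:Z ^+ i %| pts k i2 - zt]%Z]) ->
  ln q%:R <= Aq * ln B -> ln H%:R <= AH * ln B -> i%:R * ln p0%:R <= AQ * ln B -> ln D%:R <= AD * ln B ->
  ln B / lam - kappa m * ln q%:R + e1 * ln B - i%:R * ln p0%:R <= ln D%:R ->
  aux_poly D m pts.
Proof.
move=> e10 Aq0 AH0 AQ0 AD0 n0; pose c : R := 300 * S ^+ 6.
have c0 : 0 <= c by rewrite mulr_ge0 // exprn_ge0.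
(* [Dd] makes the loss [ln X / (2 * Dd)], due to the surplus of smooth classes, at most
   [e1 * ln B / 16]. *)
have [Dd [Dd0 DdE]] := exists_large_nat (8 * AD / e1).
have [C0 [e0 CE]] := @smooth_points_bound n d Dd n0 Dd0.
(* [den] collects the losses proportional to [eta * ln B]: 2 for the cut-off [X], [e0 * AH] for the
   exceptional primes of [f], [Aq] for those dividing [q], and the last term for those dividing
   derivative values. The choice of [eta] makes the total [e1 * ln B / 8]. *)
pose den : R := 2 + e0%:R * AH + Aq + c * (AH + (3 * d)%:R).
have den0 : 0 < den.
  by rewrite !ltr_wpDr ?mulr_ge0 // ?addr_ge0 // ?ler0n.
pose eta : R := e1 / 8 / den.
have eta0 : 0 < eta by rewrite !divr_gt0.
have etaE : eta * den = e1 / 8 by rewrite divfK // gt_eqF.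
have [Ce [Ce0 CeP]] := sum_ln_div_dvd eta0.
(* [Dc] keeps [c] times [(ln q + i * ln p0 + ln Bn) / D] below [e1 * ln B / 8]. *)
have [Dc [Dc0 DcE]] := exists_large_nat (8 * (c * (Aq + AQ + 1)) / e1).
pose CC0 : R := \sum_(p < C0) ln p%:R.
have CC00 : 0 <= CC0 by apply: sumr_ge0 => p _; exact: ln_nat_ge0.
pose CT : R := ln 2 + 3 + CC0 + 1 + 2 * Ce + eta * (e0%:R * (ln C0.+1%:R + ln 2)) +
  c * (AD / (2 * eta) + eta * ln n.+1%:R + Ce + 1).
exists (maxn s Dc), (Num.max 1 (2 * CT / e1 + 1)); split; first exact: leq_maxl.
move=> D m pts B Bn q H g i0 i1 i2 f p0 i xt yt zt mS; rewrite geq_max => /andP[sD DcD] Bn0 BnB.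
rewrite ge_max => /andP[l1 lCT] pB q0 [gs cop] qg u3 sf df fP fH H0 pf pp0 cl lqA lHA lQA lDA lDlow.
have [[a ha]|//] := vanishing_or_det D m pts; exfalso.
set l := ln B in l1 lCT lqA lHA lQA lDA lDlow.
have B1 : 1 <= B by apply: le_trans BnB; rewrite ler1n.
have B0 : 0 < B by exact: lt_le_trans B1.
have lB : ln Bn%:R <= l by rewrite ler_ln ?posrE // ltr0n.
have [cf [cf0 cfH cfP]] := CE f H sf df fP fH.
have l0 : 0 <= l by exact: le_trans l1.
have D0 : (0 < D)%N by exact: leq_trans DcD.
have Dp : 0 < D%:R :> R by rewrite ltr0n.
pose b2 : R := B `^ (2 * eta).
have b20 : 0 < b2 by exact: powR_gt0.
have lb2 : ln b2 = 2 * eta * l by rewrite ln_powR.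
have b21 : 1 <= b2.
  by rewrite -(powRr0 B); apply: ler_powR => //; rewrite mulr_ge0 // ltW.
(* Stopping the primes at [D / B ^ (2 * eta)] instead of [D] keeps [X * ln X / D] bounded and costs
   [2 * eta * ln B]. *)
pose y : R := D%:R / b2.
have y0 : 0 < y by rewrite divr_gt0.
have yD : y <= D%:R by rewrite ler_pdivrMr // ler_peMr // ltW.
have ly : ln y = ln D%:R - 2 * eta * l by rewrite ln_div ?posrE // lb2.
pose X := maxn 1 (Num.truncn y).
have X0 : (0 < X)%N by rewrite leq_max.
have Xp : 0 < X%:R :> R by rewrite ltr0n.
have XD : (X <= D)%N.
  rewrite geq_max D0 -(ler_nat R); apply: le_trans yD.
  by have /andP[] := truncn_itv (ltW y0).
have y2X : y <= 2 * X%:R.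
  have /andP[_ h] := truncn_itv (ltW y0); apply: (le_trans (ltW h)).
  by rewrite -natrM ler_nat /X; clear; lia.
have lX0 : 0 <= ln X%:R :> R by exact: ln_nat_ge0.
have lXlow : ln D%:R - 2 * eta * l - ln 2 <= ln X%:R :> R.
  have : ln y <= ln (2 * X%:R) by rewrite ler_ln ?posrE // mulr_gt0.
  by rewrite lnM ?posrE // ly; clear -R s dg s0 dg0 S lam o1 o2; lra.
have lXup : ln X%:R <= AD * l :> R.
  by apply: le_trans lDA; rewrite ler_ln ?posrE // ler_nat.
have XX : X%:R * ln X%:R / D%:R <= AD / (2 * eta) :> R.
  have [y1|y1] := leP 1 y; last first.
    have -> : X = 1%N by rewrite /X; have : (Num.truncn y < 1)%N; [rewrite truncn_lt_nat // ltW | clear; lia].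
    by rewrite ln1 mulr0 mul0r divr_ge0 // mulr_ge0 // ltW.
  have Xy : X%:R <= y.
    have /andP[h _] := truncn_itv (ltW y0); apply: le_trans h; rewrite ler_nat /X.
    by have : (0 < Num.truncn y)%N; [rewrite truncn_gt0 | clear; lia].
  have h1 : X%:R / D%:R <= b2^-1 :> R by rewrite ler_pdivrMr // mulrC.
  have h2 : l / b2 <= (2 * eta)^-1.
    have e20 : 0 < 2 * eta by rewrite mulr_gt0.
    rewrite ler_pdivrMr // mulrC ler_pdivlMr // [l * _]mulrC -lb2; exact/ltW/ln_sublinear.
  have -> : X%:R * ln X%:R / D%:R = X%:R / D%:R * ln X%:R :> R by rewrite mulrAC.
  apply: le_trans (_ : b2^-1 * (AD * l) <= _); first by rewrite ler_pM // divr_ge0.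
  by rewrite mulrCA [b2^-1 * l]mulrC ler_wpM2l.
(* The derivative at a point is at most [n.+1 * H * Bn ^ (3 * d)], which bounds the sum of
   [ln p / p] over the primes dividing it. *)
pose T : R := eta * (ln n.+1%:R + (AH + (3 * d)%:R) * l) + Ce.
have T0 : 0 <= T by rewrite addr_ge0 // mulr_ge0 ?(ltW eta0) // addr_ge0 ?ln_nat_ge0 // mulr_ge0 // addr_ge0.
have Tj j : \sum_(p < X.+1 | prime p && (p%:Z %| ev3 idfun (pts (a j) i0) (pts (a j) i1) (pts (a j) i2) f^`())%Z)
    ln p%:R / p%:R <= T.
  have [_ fx] := pf (a j); set v := ev3 _ _ _ _ _ in fx *.
  have v0 : (0 < `|v|)%N by rewrite absz_gt0.
  have := CeP `|v|%N X.+1 v0; rewrite (eq_bigl (fun p : 'I_X.+1 => prime p && (p%:Z %| v)%Z)) => [|p]; last first.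
    by rewrite dvdzE.
  move/le_trans; apply; rewrite /T lerD2r ler_wpM2l ?(ltW eta0) //.
  have vle : (`|v| <= n.+1 * H * Bn ^ (3 * d))%N.
    by apply: deriv_ev3_absz => //; rewrite sf.
  have : ln `|v|%:R <= ln (n.+1 * H * Bn ^ (3 * d))%:R :> R.
    by rewrite ler_ln ?posrE ?ltr0n ?muln_gt0 ?H0 ?expn_gt0 ?Bn0 // ler_nat.
  rewrite !natrM natrX !lnM ?posrE ?mulr_gt0 ?exprn_gt0 ?ltr0n // lnXn ?ltr0n // -mulr_natl => h.
  have h2 : (3 * d)%:R * ln Bn%:R <= (3 * d)%:R * l :> R by rewrite ler_wpM2l.
  by rewrite natrM in h h2 *; clear -R s dg s0 dg0 S lam o1 o2 h h2 lHA; lra.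
pose Gd p := [&& (C0 <= p)%N, ~~ (p %| cf)%N, p != p0 & ~~ (p %| q)%N].
have GdP p : Gd p -> p != p0 /\ ~~ (p %| q)%N by case/and4P.
have Gsm p : prime p -> Gd p -> (#|smooth_points p f| * Dd <= Dd.+1 * p ^ 2)%N.
  by move=> pp /and4P[pC pc _ _]; exact: cfP.
have M := @master_inequality R s s0 D m mS sD (pts \o a) Bn (fun j => pB (a j)) Bn0 ha q dg g q0 dg0 gs
  (fun j => qg (a j)) cop i0 i1 i2 f u3 (fun j => (pf (a j)).1) p0 i xt yt zt pp0
  (fun i_gt0 => let: And3 h1 h2 h3 := cl i_gt0 in And3 h1 h2 (fun j => h3 (a j))) X Gd Dd T GdP Dd0 XD T0 Gsm Tj.
rewrite -/S -/lam -/(kappa m) in M.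
set S1 := \sum_(p < X.+1 | prime p && Gd p) _ in M.
set lq := ln q%:R in M lqA lDlow; set lQ := i%:R * ln p0%:R in M lQA lDlow.
have lq0 : 0 <= lq by exact: ln_nat_ge0.
have lQ0 : 0 <= lQ by rewrite mulr_ge0 ?ln_nat_ge0.
(* What the excluded primes take away from Mertens' sum: those below [C0], the divisors of [cf], the
   prime [p0] (at most 1), and the divisors of [q]. *)
pose bad := CC0 + (eta * ln cf%:R + Ce) + 1 + (eta * lq + Ce).
have S1low : ln X%:R - 3 <= S1 + bad.
  apply: le_trans (mertens_lower R X0) _; rewrite (bigID (fun p : 'I_X.+1 => Gd p)) /= lerD2l.
  apply: (@le_trans _ _ (\sum_(p < X.+1) ((if (p < C0)%N then ln p%:R else 0) +
     (if prime p && (p %| cf)%N then ln p%:R / p%:R else 0) + (if p == p0 :> nat then 1 else 0) +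
     (if prime p && (p %| q)%N then ln p%:R / p%:R else 0)))).
    rewrite big_mkcond; apply: ler_sum => p _.
    have t0 : 0 <= ln p%:R / p%:R :> R by rewrite divr_ge0 ?ln_nat_ge0.
    have z1 : 0 <= (if (p < C0)%N then ln p%:R else 0) :> R by case: ifP; rewrite ?ln_nat_ge0.
    have z2 : 0 <= (if prime p && (p %| cf)%N then ln p%:R / p%:R else 0) :> R by case: ifP.
    have z3 : 0 <= (if p == p0 :> nat then 1 else 0) :> R by case: ifP.
    have z4 : 0 <= (if prime p && (p %| q)%N then ln p%:R / p%:R else 0) :> R by case: ifP.
    case: ifP => [/andP[pp]|_]; last by rewrite !addr_ge0.
    have p0' : 0 < p%:R :> R by rewrite ltr0n prime_gt0.
    rewrite !negb_and !negbK -ltnNge => /or4P[h|h|h|h]; move: z1 z2 z3 z4; rewrite h ?pp /=.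
    - have : ln p%:R / p%:R <= ln p%:R :> R by rewrite ler_pdivrMr // ler_peMr ?ln_nat_ge0 // ler1n prime_gt0.
      by clear -R s dg s0 dg0 S lam o1 o2; lra.
    - by clear -R s dg s0 dg0 S lam o1 o2; lra.
    - have : ln p%:R / p%:R <= 1 :> R by rewrite ler_pdivrMr // mul1r; exact/ltW/ln_sublinear.
      by clear -R s dg s0 dg0 S lam o1 o2; lra.
    - by move=> *; rewrite ler_wpDl // !addr_ge0.
  rewrite !big_split /=; apply: lerD; last by rewrite -big_mkcond; exact: CeP.
  apply: lerD; last first.
    have [lt|le] := ltnP p0 X.+1.
      rewrite (bigD1 (Ordinal lt)) //= eqxx big1 ?addr0 // => p pne.
      by rewrite (_ : (p == p0 :> nat) = false) //; apply: negPf.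
    rewrite big1 ?ler01 // => p _; rewrite (_ : (p == p0 :> nat) = false) //.
    by apply/negP => /eqP pE; move: (ltn_ord p); rewrite pE ltnNge le.
  apply: lerD; last by rewrite -big_mkcond; exact: CeP.
  pose Y := maxn X.+1 C0.
  rewrite -big_mkcond /= (big_ord_widen_cond Y (fun p => p < C0)%N (fun p => ln p%:R : R)) ?leq_maxl //.
  rewrite /CC0 (big_ord_widen Y (fun p => ln p%:R : R)) ?leq_maxr //.
  rewrite big_mkcond [leRHS]big_mkcond; apply: ler_sum => p _.
  by case: ifP => [/andP[-> _]|_] //; case: ifP => _ //; exact: ln_nat_ge0.
have lcf : ln cf%:R <= e0%:R * (ln C0.+1%:R + (ln 2 + AH * l)).
  have cfH' : (cf <= (C0.+1 * H.+1) ^ e0)%N.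
    apply: leq_trans cfH _; case: (e0) => // k; rewrite leq_exp2r // leq_mul2r leqnSn orbT //.
  have : ln cf%:R <= ln ((C0.+1 * H.+1) ^ e0)%:R :> R.
    by rewrite ler_ln ?posrE ?ltr0n ?expn_gt0 ?muln_gt0 // ler_nat.
  rewrite natrX lnXn ?ltr0n ?muln_gt0 // -[X in _ <= X -> _]mulr_natl natrM lnM ?posrE ?ltr0n // => /le_trans; apply.
  rewrite ler_wpM2l // lerD2l; have : ln H.+1%:R <= ln (2 * H%:R) :> R.
    by rewrite ler_ln ?posrE ?mulr_gt0 ?ltr0n // -natrM ler_nat; move: H0; clear; lia.
  by rewrite lnM ?posrE ?ltr0n //; move: lHA; clear -R s dg s0 dg0 S lam o1 o2; lra.
have Ddp : 0 < Dd%:R :> R by rewrite ltr0n.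
have Dcp : 0 < Dc%:R :> R by rewrite ltr0n.
pose delta : R := Dd%:R^-1.
have delta0 : 0 <= delta by rewrite invr_ge0 ltW.
have deltaAD : delta * AD <= e1 / 8.
  rewrite /delta ler_pdivrMl //; move: DdE; rewrite ler_pdivrMr //; clear -R s dg s0 dg0 S lam o1 o2; lra.
have h3 : c * ((lq + lQ + ln Bn%:R) / D%:R) <= e1 / 8 * l.
  have t1 : (lq + lQ + ln Bn%:R) / D%:R <= (Aq + AQ + 1) * l / Dc%:R.
    rewrite ler_pM ?addr_ge0 ?ln_nat_ge0 ?invr_ge0 ?(ltW Dp) //; first by clear -R s dg s0 dg0 S lam o1 o2 lqA lQA lB; lra.
    by rewrite lef_pV2 ?posrE // ler_nat.
  have t2 : c * (Aq + AQ + 1) / Dc%:R <= e1 / 8.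
    by rewrite ler_pdivrMr //; move: DcE; rewrite ler_pdivrMr //; clear -R s dg s0 dg0 S lam o1 o2; lra.
  apply: (le_trans (ler_wpM2l c0 t1)).
  have -> : c * ((Aq + AQ + 1) * l / Dc%:R) = c * (Aq + AQ + 1) / Dc%:R * l by ring.
  by rewrite ler_wpM2r.
have h4 : (1 - delta / 2) * (ln X%:R - 3 - bad) <= (1 - delta / 2) * S1.
  rewrite ler_wpM2l //; last by clear -R s dg s0 dg0 S lam o1 o2 S1low; lra.
  have : delta <= 1 by rewrite invf_le1 // ler1n.
  by clear -R s dg s0 dg0 S lam o1 o2; lra.
have bad0 : 0 <= bad by rewrite !addr_ge0 // ?addr_ge0 // mulr_ge0 ?ln_nat_ge0 // ltW.
have h5 : delta / 2 * ln X%:R <= e1 / 16 * l.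
  have : delta * ln X%:R <= delta * (AD * l) by rewrite ler_wpM2l.
  have : delta * AD * l <= e1 / 8 * l by rewrite ler_wpM2r.
  by clear -R s dg s0 dg0 S lam o1 o2; lra.
have h6 : 0 <= delta / 2 * (3 + bad) by rewrite mulr_ge0 ?divr_ge0 // addr_ge0.
have h7 : ln Bn%:R / lam <= l / lam.
  by rewrite ler_wpM2r // invr_ge0 sqrtr_ge0.
have h8 : c * (X%:R * ln X%:R / D%:R) <= c * (AD / (2 * eta)) by rewrite ler_wpM2l.
have h9 : eta * ln cf%:R <= eta * (e0%:R * (ln C0.+1%:R + (ln 2 + AH * l))) by rewrite ler_wpM2l // ltW.
have h10 : eta * lq <= eta * (Aq * l) by rewrite ler_wpM2l // ltW.
have MM : c * ((lq + lQ + ln Bn%:R + X%:R * ln X%:R) / D%:R + T + 1) =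
   c * ((lq + lQ + ln Bn%:R) / D%:R) + c * (X%:R * ln X%:R / D%:R) + c * T + c by rewrite /c; field; rewrite gt_eqF.
rewrite -/c MM -/delta in M.
have h11 : eta * den * l = e1 / 8 * l by rewrite etaE.
have h12 : 2 * CT + e1 <= e1 * l.
  move: lCT; rewrite -(ler_pM2l e10) mulrDr mulr1 => h; apply: le_trans h.
  by rewrite lerD2r [X in _ <= X]mulrC divfK // gt_eqF.
apply: (@aux_arith c e1 eta l _ _ _ lQ S1 delta (ln X%:R) (ln D%:R) _ _ (ln cf%:R) lq e0%:R AH Aq _ _ Ce CC0
  (ln C0.+1%:R) (ln 2) (ln n.+1%:R) bad e10 _ erefl M h3 h4 h5 h6 h7 h8 h9 h10 h11 lXlow lDlow h12).
by rewrite mulr_ge0 // ltW.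
Qed.

End AuxiliaryPolynomial.

(** * The covering *)

(** Otherwise every prime up to [B ^ e] divides [N]. By Mertens the sum of [ln p / p] over them is
    at least [e * ln B] up to a constant, but [sum_ln_div_dvd] bounds it by half of that. *)
Lemma small_prime (R : realType) (e A : R) : 0 < e -> 0 <= A -> exists l0 : R,
  forall (B : R) (N : nat), l0 <= ln B -> 1 <= B -> (0 < N)%N -> ln N%:R <= A * ln B ->
  exists p, [/\ prime p, p%:R <= B `^ e & ~~ (p %| N)%N].
Proof.
move=> e0 A0; have A10 : 0 < A + 1 by apply: ltr_wpDl.
pose eta := e / 2 / (A + 1).
have eta0 : 0 < eta by rewrite !divr_gt0.
have etaA : eta * A <= e / 2.
  have -> : e / 2 = eta * (A + 1) by rewrite divfK // gt_eqF.
  by apply: ler_wpM2l; [exact: ltW | rewrite lerDl].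
have [C [C0 CP]] := sum_ln_div_dvd eta0.
exists (2 * (C + 4 + ln 2) / e) => B N; rewrite ler_pdivrMr // => lB B1 N0 lN.
have l0 : 0 <= ln B by exact: ln_ge0.
have b0 : 0 < B `^ e by apply: powR_gt0; exact: lt_le_trans B1.
pose P := Num.truncn (B `^ e).
have /andP[Ple Plt] := truncn_itv (ltW b0).
have P0 : (0 < P)%N by rewrite truncn_gt0 -(powRr0 B); apply: ler_powR => //; exact: ltW.
have Pp : 0 < P%:R :> R by rewrite ltr0n.
apply: contrapT => H.
have all p : prime p -> (p < P.+1)%N -> (p %| N)%N.
  move=> pp; rewrite ltnS => pP; apply/negPn/negP => npN; apply: H; exists p; split=> //.
  by apply: le_trans Ple; rewrite ler_nat.
have := mertens_lower R P0; rewrite (eq_bigl (fun p : 'I_P.+1 => prime p && (p %| N)%N)) => [h1|p]; last first.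
  by case: (boolP (prime p)) => // pp; rewrite all.
have {h1}h1 := le_trans h1 (CP N P.+1 N0).
have : ln (B `^ e) <= ln (2 * P%:R).
  rewrite ler_ln ?posrE ?mulr_gt0 //; apply: (le_trans (ltW Plt)).
  by rewrite -natrM ler_nat; move: P0; rewrite -/P; clear; lia.
rewrite ln_powR lnM ?posrE // => h2.
have h3 : eta * ln N%:R <= e / 2 * ln B.
  apply: (le_trans (ler_wpM2l (ltW eta0) lN)).
  by rewrite mulrA; apply: ler_wpM2r.
move: h1 h2 h3 lB; clear -R e C; lra.
Qed.

Definition pt3 (i0 i1 : 'I_3) (u : pt) : 'I_3 -> int :=
  fun i => if i == i0 then u.1 else if i == i1 then u.2.1 else u.2.2.

Lemma nest_pt3 (i0 i1 i2 : 'I_3) (u : pt) (G : {mpoly int[3]}) : uniq [:: i0; i1; i2] ->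
  ev3 idfun u.1 u.2.1 u.2.2 (nest i0 i1 G) = G.@[pt3 i0 i1 u].
Proof.
move=> u3; rewrite -(nest_meval u3) /pt3 eqxx.
move: u3; rewrite /= !inE negb_or andbT eq_sym [i0 == i2]eq_sym => /andP[/andP[/negPf-> /negPf->]].
by rewrite eq_sym => /negPf->; rewrite eqxx.
Qed.

Lemma pt3_coords (i0 i1 i2 : 'I_3) (u : pt) : uniq [:: i0; i1; i2] ->
  [/\ pt3 i0 i1 u i0 = u.1, pt3 i0 i1 u i1 = u.2.1 & pt3 i0 i1 u i2 = u.2.2].
Proof.
rewrite /= !inE negb_or andbT /pt3 => /andP[/andP[h1 h2] h3]; split.
- by rewrite eqxx.
- by rewrite eq_sym (negPf h1) eqxx.
- by rewrite eq_sym (negPf h2) eq_sym (negPf h3).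
Qed.

Lemma plane_eliminant (D d n : nat) (f : {poly {poly {poly int}}}) (i0 i1 i2 : 'I_3) (m : 'X_{1..3}) (T : seq pt) :
  uniq [:: i0; i1; i2] -> (0 < n)%N -> size f = n.+1 -> degrees3 d f ->
  ring_prime (map_poly (map_poly (map_poly intr)) f : {poly {poly {poly algC}}}) ->
  (forall G : {mpoly int[3]}, G != 0 -> (forall e, e \in msupp G -> ~~ (m <= e)%MM) ->
     ~ ring_dvd (map_poly (map_poly (map_poly intr)) f : {poly {poly {poly algC}}})
        (map_poly (map_poly (map_poly intr)) (nest i0 i1 G))) ->
  (forall u0, u0 \in T -> aux_poly D m (fun k => pt3 i0 i1 (nth u0 T k))) ->
  exists H : {poly {poly int}}, [/\ H != 0, (bideg H <= 2 * (2 * d * D + D))%N &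
    forall u, u \in T -> ev3 idfun u.1 u.2.1 u.2.2 f = 0 -> ev2 idfun u.2.1 u.2.2 H = 0].
Proof.
move=> u3 n0 sf df fP nd; case: T => [|u0 T] aux.
  exists 1; split=> //; first exact: oner_neq0.
  by rewrite /bideg rmorph1 !size_poly1.
have [G [G0 GP Gv]] := aux u0 (mem_head _ _).
have dG : degrees3 D (nest i0 i1 G).
  apply: nest_degrees; rewrite mmeasureE; apply/bigmax_leqP_seq => e /GP[eD _] _.
  by rewrite ltnS.
have f1 : (1 < size f)%N by rewrite sf.
have [H [H0 [a [b HE]] s1 s2]] := eliminant f1 df dG fP (nd G G0 (fun e h => (GP e h).2)).
exists H; split=> //; first exact: bidegP.
move=> u uT fu; have := congr1 (ev3 idfun u.1 u.2.1 u.2.2) HE.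
rewrite ev3C rmorphD !rmorphM /= fu mulr0 add0r => ->.
rewrite (@nest_pt3 i0 i1 i2) //; have := Gv (index u (u0 :: T)).
by rewrite nth_index // => ->; rewrite mulr0.
Qed.

Lemma label_congr (p i : nat) (u v : pt) : (0 < p)%N -> label p i u = label p i v ->
  [/\ p%:Z %| u.1 - v.1, p%:Z ^+ i %| u.2.1 - v.2.1 & p%:Z ^+ i %| u.2.2 - v.2.2]%Z.
Proof.
move=> p0 [h1 h2 h3].
have key (k : nat) (x y : int) : (0 < k)%N -> `|(x %% k)%Z|%N = `|(y %% k)%Z|%N -> (k%:Z %| x - y)%Z.
  move=> k0 h; rewrite -eqz_mod_dvd; apply/eqP.
  have kz : k%:Z != 0 by case: (k) k0.
  by rewrite -[LHS]gez0_abs ?modz_ge0 // -[RHS]gez0_abs ?modz_ge0 // h.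
have pi0 : (0 < p ^ i)%N by rewrite expn_gt0 p0.
have E : p%:Z ^+ i = (p ^ i)%N%:Z by rewrite -[p%:Z]natz -natrX natz.
by rewrite E; split; exact: key.
Qed.

Section TreePoints.

Variable R : realType.

(** [up_log p (Num.truncn U).+1] is the first level [i] with [p ^ i > U]; before it the degree scale
    [U / p ^ i] is still at least 1. *)
Lemma up_log_le (U : R) p i : 1 <= U -> (1 < p)%N -> (i < up_log p (Num.truncn U).+1)%N -> (p ^ i)%:R <= U.
Proof.
move=> U1 p1 it; have U0 : 0 <= U by exact: le_trans U1.
have /andP[h _] := truncn_itv U0; apply: le_trans h; rewrite ler_nat -ltnS.
have t1 : (1 < (Num.truncn U).+1)%N by rewrite ltnS truncn_gt0.
have /andP[h _] := up_log_bounds p1 t1; apply: leq_ltn_trans h.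
by rewrite leq_exp2l // -ltnS (leq_trans it) // leqSpred.
Qed.

Lemma lt_up_log (U : R) p : (1 < p)%N -> U < (p ^ up_log p (Num.truncn U).+1)%:R.
Proof.
move=> p1; apply: lt_le_trans (truncnS_gt U) _; rewrite ler_nat; exact: up_logP.
Qed.

Lemma up_log_pow (U : R) p i : 1 <= U -> (1 < p)%N -> (i <= up_log p (Num.truncn U).+1)%N -> (p ^ i)%:R <= p%:R * U.
Proof.
move=> U1 p1; case: i => [_|i it].
  by rewrite expn0 -[1%:R]mulr1 ler_pM // ler_nat ltnW.
by rewrite expnS natrM ler_wpM2l // up_log_le.
Qed.

(** The number of classes, about [p ^ (2 * i + 3)], cancels the decay of the squared degrees
    [(U / p ^ i) ^ 2], so each level costs [O(p ^ 3 * U ^ 2)]. Here [L] bounds the number of levels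
    and [Y] the number and size of the primes. *)
Lemma tree_sum (U a Y L : R) (n P0 : nat) (E : nat -> nat -> nat) :
  1 <= U -> 1 <= a -> P0%:R <= Y -> 0 <= L ->
  (forall p i, (1 < p < P0)%N -> (i < up_log p (Num.truncn U).+1)%N ->
    [/\ (up_log p (Num.truncn U).+1)%:R <= L, (E p i)%:R <= a * (U / (p ^ i)%:R) & (E p i.+1)%:R <= a * (U / (p ^ i)%:R)]) ->
  (\sum_(p < P0) \sum_(i < up_log p (Num.truncn U).+1)
     p ^ (2 * i + 3) * (n * (3 * (E p i * E p i.+1) + E p i)))%:R <= Y ^+ 4 * L * (4 * n%:R * a ^+ 2 * U ^+ 2).
Proof.
move=> U1 a1 PY L0 h; have Y0 : 0 <= Y by apply: le_trans PY.
have a0 : 0 <= a by exact: le_trans a1.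
have U0 : 0 <= U by exact: le_trans U1.
pose M : R := 4 * n%:R * a ^+ 2 * U ^+ 2.
have M0 : 0 <= M by rewrite !mulr_ge0 // exprn_ge0.
have term p i : (1 < p < P0)%N -> (i < up_log p (Num.truncn U).+1)%N ->
    (p ^ (2 * i + 3) * (n * (3 * (E p i * E p i.+1) + E p i)))%:R <= Y ^+ 3 * M.
  move=> /[dup] pP /andP[p1 pP0] it; have [_ h1 h2] := h p i pP it.
  have q0 : 0 < (p ^ i)%:R :> R by rewrite ltr0n expn_gt0 ltnW.
  set w := U / (p ^ i)%:R in h1 h2.
  have wU : U = w * (p ^ i)%:R by rewrite /w divfK // gt_eqF.
  have aw1 : 1 <= a * w.
    rewrite -[1]mulr1 ler_pM // /w ler_pdivlMr // mul1r; exact: up_log_le.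
  have hE : (3 * (E p i * E p i.+1) + E p i)%:R <= 4 * (a * w) ^+ 2.
    rewrite natrD !natrM; apply: (@le_trans _ _ (3 * (a * w * (a * w)) + a * w * (a * w))); last by rewrite expr2; move: (a * w * _); clear => x; lra.
    apply: lerD; first by rewrite ler_wpM2l // ler_pM.
    by apply: (le_trans h1); rewrite ler_peMl // (le_trans _ aw1).
  rewrite natrM [(n * _)%:R]natrM expnD [(2 * _)%N]mulnC expnM natrM !natrX mulrC.
  have pY : p%:R <= Y by apply: le_trans PY; rewrite ler_nat ltnW.
  apply: (@le_trans _ _ (((n%:R * (4 * (a * w) ^+ 2)) * (((p%:R ^+ i) ^+ 2) * Y ^+ 3)))).
    rewrite ler_pM ?mulr_ge0 ?exprn_ge0 // ?ler_wpM2l ?exprn_ge0 //.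
    by rewrite lerXn2r ?nnegrE.
  by rewrite /M wU natrX le_eqVlt; apply/orP; left; apply/eqP; ring.
rewrite natr_sum; apply: (@le_trans _ _ (\sum_(p < P0) Y ^+ 3 * L * M)); last first.
  rewrite sumr_const card_ord -[leLHS]mulr_natl.
  have -> : Y ^+ 4 * L * (4 * n%:R * a ^+ 2 * U ^+ 2) = Y * (Y ^+ 3 * L * M) by rewrite /M; ring.
  by rewrite ler_wpM2r // !mulr_ge0 // exprn_ge0.
apply: ler_sum => p _; have [p1|p1] := leqP p 1.
  rewrite (_ : up_log p _ = 0%N) ?big_ord0 ?mulr_ge0 // ?exprn_ge0 //.
  by rewrite /up_log leqNgt ltnNge p1.
have pP : (1 < p < P0)%N by rewrite p1 ltn_ord.
set k := up_log p _; rewrite natr_sum; apply: (@le_trans _ _ (\sum_(i < k) Y ^+ 3 * M)).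
  by apply: ler_sum => i _; apply: term => //; exact: ltn_ord.
rewrite sumr_const card_ord -[leLHS]mulr_natl.
have -> : Y ^+ 3 * L * M = L * (Y ^+ 3 * M) by ring.
have [k0|k0] := posnP k; first by rewrite k0 mul0r !mulr_ge0 // exprn_ge0.
have [kL _ _] := h p 0%N pP k0.
by rewrite ler_wpM2r // mulr_ge0 // exprn_ge0.
Qed.

End TreePoints.

(** As the prime may divide neither [q] nor the derivative at the point, each point [u] gets its own
    small prime [pr u], and nodes are attached to a prime, a level and a residue class. All trees
    share the root, where no congruence is imposed. A branch ends at the first level with
    [p ^ i > U]. *)
Lemma tree_points (R : realType) (s dg : nat) (e Aq AH : R) (n d : nat) :
  (0 < s)%N -> (0 < dg)%N -> 0 < e -> 0 <= Aq -> 0 <= AH -> (0 < n)%N ->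
  exists (Cd : nat) (C l0 : R), 0 <= C /\
  forall (m : 'X_{1..3}) (B V : R) (Bn q H : nat) (g : {mpoly int[3]}) (i0 i1 i2 : 'I_3)
    (f : {poly {poly {poly int}}}) (T : seq pt),
  mdeg m = s -> (0 < Bn)%N -> Bn%:R <= B -> l0 <= ln B -> (0 < q)%N -> coprime_form dg q g ->
  uniq [:: i0; i1; i2] -> size f = n.+1 -> degrees3 d f ->
  ring_prime (map_poly (map_poly (map_poly intr)) f : {poly {poly {poly algC}}}) ->
  (norm3 f <= H)%N -> (0 < H)%N -> ln q%:R <= Aq * ln B -> ln H%:R <= AH * ln B ->
  (forall G : {mpoly int[3]}, G != 0 -> (forall e', e' \in msupp G -> ~~ (m <= e')%MM) ->
     ~ ring_dvd (map_poly (map_poly (map_poly intr)) f : {poly {poly {poly algC}}})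
        (map_poly (map_poly (map_poly intr)) (nest i0 i1 G))) ->
  uniq T ->
  (forall u, u \in T -> [/\ forall i, (`|pt3 i0 i1 u i| <= Bn)%N, (q%:Z %| g.@[pt3 i0 i1 u])%Z,
     ev3 idfun u.1 u.2.1 u.2.2 f = 0 & ev3 idfun u.1 u.2.1 u.2.2 f^`() != 0]) ->
  0 <= ln B / Num.sqrt s%:R - kappa R s dg m * ln q%:R + e * ln B ->
  0 < V -> ln V = ln B / Num.sqrt s%:R - kappa R s dg m * ln q%:R + 2 * e * ln B ->
  exists (hs : seq {poly {poly int}}) (Z : seq pt),
  [/\ forall h, h \in hs -> h != 0 /\ (bideg h <= Cd)%N, (size hs)%:R <= C * V,
      {subset Z <= T} /\ uniq Z, (size Z)%:R <= C * V ^+ 2 &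
      forall u, u \in T -> u \notin Z -> exists2 h, h \in hs & ev2 idfun u.2.1 u.2.2 h = 0].
Proof.
move=> s0 dg0 e0 Aq0 AH0 n0; pose lam : R := Num.sqrt s%:R.
have lam0 : 0 < lam by rewrite sqrtr_gt0 ltr0n.
pose c := 1 / lam + e.
have c0 : 0 < c by rewrite addr_gt0 // divr_gt0.
(* The primes contribute four powers of [B ^ e2] (their cube and their number) and the levels one;
   five of them make up [(B ^ e) ^ 2]. *)
pose e2 := 2 * e / 5.
have e20 : 0 < e2 by rewrite /e2 divr_gt0 // mulr_gt0.
have AQ0 : 0 <= c + e2 by rewrite addr_ge0 // ltW.
have AD0 : 0 <= c + 1 by rewrite addr_ge0 // ltW.
have [Dc [l1 [sDc auxP]]] := aux_poly_class s0 dg0 d e0 Aq0 AH0 AQ0 AD0 n0.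
have Dc0 : (0 < Dc)%N by exact: leq_trans sDc.
have AN0 : 0 <= Aq + (1 + AH + (3 * d)%:R) by rewrite !addr_ge0.
have [l2 primeP] := small_prime e20 AN0.
pose Cd := (2 * (2 * d * Dc + Dc))%N.
have Cd0 : (0 < Cd)%N by rewrite muln_gt0 addn_gt0 Dc0 orbT.
pose a : R := (2 * Cd)%:R.
have a1 : 1 <= a by rewrite ler1n muln_gt0.
have a0 : 0 <= a by exact: le_trans a1.
have ln20 : 0 < ln 2 :> R by rewrite ln_gt0 // ltr1n.
pose cL : R := 1 + c / (ln 2 * e2).
have cL0 : 0 <= cL by apply: addr_ge0 => //; apply/ltW/divr_gt0 => //; exact: mulr_gt0.
pose C : R := a + 2 ^+ 4 * cL * (4 * n%:R * a ^+ 2).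
have Cs0 : 0 <= 2 ^+ 4 * cL * (4 * n%:R * a ^+ 2) by rewrite !mulr_ge0 ?exprn_ge0.
exists Cd, C, (Num.max l1 (Num.max l2 (Num.max (ln n.+1%:R) (ln (2 * Dc%:R))))); split; first by rewrite addr_ge0.
move=> m B V Bn q H g i0 i1 i2 f T mS Bn0 BnB; rewrite !ge_max => /and4P[lB1 lB2 lB3 lB4] q0 cop u3 sf df fP fH H0 lq lH nd uT TP E0 V0 lV.
have B1 : 1 <= B by apply: le_trans BnB; rewrite ler1n.
have Bp : 0 < B by exact: lt_le_trans B1.
have l0 : 0 <= ln B by exact: ln_ge0.
(* [U = K * B ^ e] is the degree scale of the nodes; the spare factor [B ^ e] in [V] pays for the
   size of the primes and the number of levels. *)
pose U := V / B `^ e; have be0 : 0 < B `^ e by exact: powR_gt0.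
have U0 : 0 < U by rewrite divr_gt0.
have VU : V = U * B `^ e by rewrite /U divfK // gt_eqF.
have lU : ln U = ln B / lam - kappa R s dg m * ln q%:R + e * ln B.
  by rewrite ln_div ?posrE // ln_powR lV -/lam; move: (ln B / lam) (kappa _ _ _ _ * _) => x y; clear; lra.
have U1 : 1 <= U by rewrite -ler_ln ?posrE // ln1 lU.
clearbody U.
have kap0 : 0 <= kappa R s dg m * ln q%:R.
  by rewrite mulr_ge0 ?ln_nat_ge0 // divr_ge0 // mulr_ge0 // mulr_ge0 // exprn_ge0 // ltW.
have lUc : ln U <= c * ln B.
  by rewrite lU /c mulrDl div1r [lam^-1 * _]mulrC lerD2r lerBlDr lerDl.
have b20 : 0 < B `^ e2 by exact: powR_gt0.
have b21 : 1 <= B `^ e2 by rewrite -(powRr0 B); apply: ler_powR => //; exact: ltW.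
pose tt p := up_log p (Num.truncn U).+1.
(* This is [Dc] as soon as [p ^ i > U], so the leaves have bounded degree. *)
pose Dl p i := (Dc * (Num.truncn (U / (p ^ i)%:R)).+1)%N.
pose El p i := (2 * (2 * d * Dl p i + Dl p i))%N.
have wp p i : (0 < p)%N -> 0 < U / (p ^ i)%:R by move=> p0; rewrite divr_gt0 // ltr0n expn_gt0 p0.
have aux p i (T' : seq pt) u0 : prime p -> (i <= tt p)%N -> ((0 < i)%N -> p%:R <= B `^ e2) ->
    {subset T' <= T} -> u0 \in T' ->
    ((0 < i)%N -> [/\ ~~ (p %| q)%N, ~~ (p%:Z %| ev3 idfun u0.1 u0.2.1 u0.2.2 f^`())%Z &
       forall u, u \in T' -> label p i u = label p i u0]) ->
    aux_poly (Dl p i) m (fun k => pt3 i0 i1 (nth u0 T' k)).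
  move=> pp it pB sT u0T cl; have p0 := prime_gt0 pp; have p1 := prime_gt1 pp.
  have nT k : nth u0 T' k \in T' by have [lt|le] := ltnP k (size T'); [exact: mem_nth | rewrite nth_default].
  have nTT k := TP _ (sT _ (nT k)).
  have w0 := wp p i p0; have /andP[w1 w2] := truncn_itv (ltW w0).
  have q0' : 0 < (p ^ i)%:R :> R by rewrite ltr0n expn_gt0 p0.
  apply: (auxP (Dl p i) m _ B Bn q H g i0 i1 i2 f p i u0.1 u0.2.1 u0.2.2) => //.
  - by rewrite leq_pmulr.
  - by move=> k j; have [] := nTT k.
  - by move=> k; have [] := nTT k.
  - move=> k; have [-> -> ->] := pt3_coords (nth u0 T' k) u3.
    by have [_ _ h1 h2] := nTT k.
  - move=> i_gt0; have [h1 h2 h3] := cl i_gt0; split=> // k.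
    have [-> -> ->] := pt3_coords (nth u0 T' k) u3; exact: label_congr p0 (h3 _ (nT k)).
  - case: (posnP i) => [->|i_gt0]; first by rewrite mul0r mulr_ge0.
    have pU : (p ^ i)%:R <= p%:R * U by exact: up_log_pow.
    have : ln (p ^ i)%:R <= ln (p%:R * U) by rewrite ler_ln ?posrE // mulr_gt0 // ltr0n.
    rewrite natrX lnXn ?ltr0n // lnM ?posrE ?ltr0n // -[_ *+ i]mulr_natl => h.
    have : ln p%:R <= ln (B `^ e2) by rewrite ler_ln ?posrE ?ltr0n // pB.
    by rewrite ln_powR [(c + e2) * _]mulrDl; move: h lUc; move: (c * _) (e2 * _) => x y; clear -R; lra.
  - have : ln (Dl p i)%:R <= ln (2 * Dc%:R * U).
      rewrite ler_ln ?posrE ?ltr0n ?muln_gt0 ?Dc0 // ?mulr_gt0 ?ltr0n //.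
      rewrite /Dl natrM [2 * _]mulrC -mulrA ler_wpM2l // -addn1 natrD mulr_natl mulr2n lerD //.
      by apply: (le_trans w1); rewrite ler_pdivrMr // ler_peMr ?(ltW U0) // ler1n expn_gt0 p0.
    rewrite lnM ?posrE ?mulr_gt0 ?ltr0n // [(c + 1) * _]mulrDl mul1r; move: lB4 lUc; move: (c * _) => x; clear -R; lra.
  - have : ln (U / (p ^ i)%:R) <= ln (Dl p i)%:R.
      rewrite ler_ln ?posrE ?ltr0n ?muln_gt0 ?Dc0 //; apply: (le_trans (ltW w2)).
      by rewrite ler_nat leq_pmull.
    rewrite ln_div ?posrE // lU natrX lnXn ?ltr0n // -[_ *+ i]mulr_natl //.
have /choice[pr prP] : forall u : pt, exists p, u \in T ->
    [/\ prime p, p%:R <= B `^ e2, ~~ (p %| q)%N & ~~ (p%:Z %| ev3 idfun u.1 u.2.1 u.2.2 f^`())%Z].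
  move=> u; have [uT'|] := boolP (u \in T); last by exists 0%N.
  have [h1 _ _ h4] := TP u uT'; set v := ev3 _ _ _ _ _ in h4 *.
  have [c1 c2 c3] := pt3_coords u u3.
  have vle : (`|v| <= n.+1 * H * Bn ^ (3 * d))%N.
    by apply: deriv_ev3_absz; rewrite ?sf // -?c1 -?c2 -?c3.
  have N0 : (0 < q * `|v|)%N by rewrite muln_gt0 q0 absz_gt0.
  have [|p [pp pB pN]] := primeP B (q * `|v|)%N lB2 B1 N0.
    rewrite natrM lnM ?posrE ?ltr0n ?absz_gt0 // mulrDl; apply: lerD => //.
    have : ln `|v|%:R <= ln (n.+1 * H * Bn ^ (3 * d))%:R :> R.
      by rewrite ler_ln ?posrE ?ltr0n ?absz_gt0 ?muln_gt0 ?H0 ?expn_gt0 ?Bn0 // ler_nat.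
    move/le_trans; apply; rewrite natrM [(n.+1 * H)%:R]natrM natrX !lnM ?posrE ?mulr_gt0 ?exprn_gt0 ?ltr0n //.
    rewrite lnXn ?ltr0n // !mulrDl mul1r -[_ *+ (3 * d)]mulr_natl; apply: lerD; first exact: lerD.
    by rewrite ler_wpM2l // ler_ln ?posrE ?ltr0n.
  exists p => _; split=> //; apply: contra pN; first exact: dvdn_mulr.
  by rewrite dvdzE; exact: dvdn_mull.
have elim p i (T' : seq pt) : {subset T' <= T} -> (forall u0, u0 \in T' -> aux_poly (Dl p i) m (fun k => pt3 i0 i1 (nth u0 T' k))) ->
    exists H' : {poly {poly int}}, [/\ H' != 0, (bideg H' <= El p i)%N &
      forall u, u \in T' -> ev2 idfun u.2.1 u.2.2 H' = 0].
  move=> sT ax; have [H' [h1 h2 h3]] := plane_eliminant u3 n0 sf df fP nd ax.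
  by exists H'; split=> // u uT'; apply: h3 => //; have [] := TP u (sT u uT').
(* At level 0 no congruence is used; 2 serves as a sample prime. *)
have [Hr [Hr0 Hrb Hrv]] : exists H' : {poly {poly int}}, [/\ H' != 0, (bideg H' <= El 2 0)%N &
      forall u, u \in T -> ev2 idfun u.2.1 u.2.2 H' = 0].
  by apply: elim => // u0 uT'; apply: aux.
have El0 p : El p 0 = El 2 0 by rewrite /El /Dl !expn0.
have /choice[nd1 nd1P] : forall x : nat * (nat * (nat * (nat * nat))), exists H' : {poly {poly int}},
    (0 < x.2.1 <= tt x.1)%N -> [/\ H' != 0, (bideg H' <= El x.1 x.2.1)%N &
    forall u, u \in T -> pr u = x.1 -> label x.1 x.2.1 u = x.2.2 -> ev2 idfun u.2.1 u.2.2 H' = 0].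
  case=> p [i l] /=; have [/andP[i_gt0 it]|_] := boolP (0 < i <= tt p)%N; last by exists 0.
  have [||H' [h1 h2 h3]] := elim p i [seq u <- T | (pr u == p) && (label p i u == l)].
  - by move=> u; rewrite mem_filter => /andP[].
  - move=> u0; rewrite mem_filter => /andP[/andP[/eqP pu /eqP lu] uT0]; have [pp pB pq pf] := prP u0 uT0.
    rewrite pu in pp pB pq pf; apply: aux => //.
    + by move=> u; rewrite mem_filter => /andP[].
    + by rewrite mem_filter pu lu !eqxx.
    + by move=> _; split=> // u; rewrite mem_filter lu => /andP[/andP[_ /eqP]].
  exists H' => _; split=> // u uT' pu lu; apply: h3; by rewrite mem_filter pu lu !eqxx.
pose node p i l := if i == 0%N then Hr else nd1 (p, (i, l)).
pose P0 := (Num.truncn (B `^ e2)).+1.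
have prlt u : u \in T -> (0 < pr u < P0)%N.
  by move=> /prP[pp pB _ _]; rewrite prime_gt0 //= ltnS truncn_ge_nat // ltW.
have leaf u : u \in T -> (El (pr u) (tt (pr u)) <= Cd)%N.
  move=> /prP[pp _ _ _]; rewrite /El /Dl (_ : Num.truncn _ = 0%N) ?muln1 //.
  apply/eqP; rewrite -leqn0 -ltnS truncn_lt_nat ?(ltW (wp _ _ _)) ?prime_gt0 //.
  by rewrite ltr_pdivrMr ?ltr0n ?expn_gt0 ?prime_gt0 // mul1r lt_up_log // prime_gt1.
have nodeP u i : u \in T -> (i <= tt (pr u))%N -> forall H', H' = node (pr u) i (label (pr u) i u) ->
    [/\ H' != 0, ev2 idfun u.2.1 u.2.2 H' = 0 & (bideg H' <= El (pr u) i)%N].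
  move=> uT' it H' ->; rewrite /node; have [->|i_n0] := eqVneq i 0%N; first by rewrite El0; split=> //; exact: Hrv.
  by have [|h1 h2 h3] := nd1P (pr u, (i, label (pr u) i u)); rewrite /= ?lt0n ?i_n0 //; split=> //; exact: h3.
have [hs [Z [Z1 Z2 Z3 Z4 Z5]]] := @tree_cover n Cd P0 (El 2 0) f T pr tt El node Hr uT (eq_leq sf)
  (fun u uT' => let: And4 _ _ h3 h4 := TP u uT' in conj h3 h4) prlt (fun p l => erefl)
  (fun u i h1 h2 => nodeP u i h1 h2 _ erefl) leaf Hr0 Hrb.
have Elle p i w : U / (p ^ i)%:R <= w -> 0 <= U / (p ^ i)%:R -> 1 <= w -> (El p i)%:R <= a * w.
  move=> h h0 h1; have /andP[t1 _] := truncn_itv h0.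
  have -> : El p i = (Cd * (Num.truncn (U / (p ^ i)%:R)).+1)%N by rewrite /El /Dl /Cd; clear; ring.
  rewrite natrM /a natrM [2%:R * _]mulrC -mulrA ler_wpM2l // -addn1 natrD mulr_natl mulr2n lerD //.
  exact: le_trans h.
exists hs, Z; split=> //.
- apply: le_trans (_ : (El 2 0)%:R <= _); first by rewrite ler_nat.
  have V1 : U <= V by rewrite VU ler_peMr ?(ltW U0) // -(powRr0 B); apply: ler_powR => //; exact: ltW.
  apply: le_trans (_ : a * V <= _); last by rewrite ler_wpM2r ?(ltW V0) // /C lerDl.
  by apply: Elle; rewrite ?expn0 ?divr1 ?(ltW U0) // (le_trans U1).
- apply: le_trans (_ : (2 * B `^ e2) ^+ 4 * (cL * B `^ e2) * (4 * n%:R * a ^+ 2 * U ^+ 2) <= _).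
    move: Z4; rewrite -(ler_nat R) => /le_trans; apply; apply: tree_sum => //.
    + rewrite -[P0]addn1 natrD mulr_natl mulr2n lerD //.
      by have /andP[] := truncn_itv (ltW b20).
    + by rewrite mulr_ge0 // ltW.
    + move=> p i /andP[p1 _] it; have p0 := ltnW p1.
      have q0' : 0 < (p ^ i)%:R :> R by rewrite ltr0n expn_gt0 p0.
      have w1 : 1 <= U / (p ^ i)%:R by rewrite ler_pdivlMr // mul1r up_log_le.
      have El1 : (El p i)%:R <= a * (U / (p ^ i)%:R) by apply: Elle => //; apply: ltW; exact: wp.
      have El2 : (El p i.+1)%:R <= a * (U / (p ^ i)%:R).
        apply: Elle => //; last by apply: ltW; exact: wp.
        by rewrite ler_wpM2l ?(ltW U0) // lef_pV2 ?posrE ?ltr0n ?expn_gt0 ?p0 // ler_nat leq_exp2l.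
      split=> //; rewrite -/(tt p); have tp : (0 < tt p)%N by exact: leq_ltn_trans it.
      have : ln (2 ^ (tt p).-1)%:R <= ln U.
        rewrite ler_ln ?posrE ?ltr0n ?expn_gt0 //; apply: le_trans (_ : (p ^ (tt p).-1)%:R <= _).
          by rewrite ler_nat; case: (tt p).-1 => // k; rewrite leq_exp2r.
        by rewrite up_log_le // -/(tt p) prednK.
      rewrite natrX lnXn ?ltr0n // -[_ *+ _]mulr_natl => /le_trans/(_ lUc) h.
      have lb : ln B <= B `^ e2 / e2.
        by rewrite ler_pdivlMr // mulrC -ln_powR; exact/ltW/ln_sublinear.
      rewrite -(prednK tp) -addn1 natrD addrC /cL mulrDl mul1r; apply: lerD => //.
      rewrite -(ler_pM2r ln20); apply: (le_trans h); apply: (le_trans (ler_wpM2l (ltW c0) lb)).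
      rewrite le_eqVlt; apply/orP; left; apply/eqP.
      by clear -ln20 e20; clearbody e2; field; rewrite !gt_eqF.
  have -> : (2 * B `^ e2) ^+ 4 * (cL * B `^ e2) * (4 * n%:R * a ^+ 2 * U ^+ 2) =
      2 ^+ 4 * cL * (4 * n%:R * a ^+ 2) * ((B `^ e2) ^+ 5 * U ^+ 2) by clear; clearbody cL a e2; ring.
  have -> : (B `^ e2) ^+ 5 = (B `^ e) ^+ 2.
    rewrite -!powR_mulrn ?powR_ge0 // -!powRrM; congr (_ `^ _); rewrite /e2; by field.
  have -> : (B `^ e) ^+ 2 * U ^+ 2 = V ^+ 2 by rewrite VU exprMn mulrC.
  by rewrite ler_wpM2r ?exprn_ge0 ?(ltW V0) // /C lerDr.
Qed.

(** * Return to multivariate polynomials and conclusion *)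

Lemma msize_filtration (A : idomainType) (n : nat) :
  filtration (fun k (p : {mpoly A[n]}) => msize p <= k.+1)%N.
Proof.
split=> [|k|k a b ha hb|k a ha|k l a b ha hb]; rewrite ?msize1 ?msize0 //.
- by apply: leq_trans (mmeasureD_le _ _ _) _; rewrite geq_max ha.
- by rewrite mmeasureN.
- have [->|a0] := eqVneq a 0; first by rewrite mul0r msize0.
  have [->|b0] := eqVneq b 0; first by rewrite mulr0 msize0.
  by rewrite msizeM //; move: ha hb; clear; lia.
Qed.

Lemma flatten3_msize (A : idomainType) (i0 i1 i2 : 'I_3) d (P : {poly {poly {poly A}}}) :
  degrees3 d P -> (msize (flatten3 i0 i1 i2 P) <= (3 * d).+1)%N.
Proof.
move=> [d1 d2 d3]; rewrite -[P]coefK poly_def rmorph_sum.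
apply: (filtration_sum (msize_filtration A 3)) => i _.
rewrite -mul_polyC rmorphM rmorphXn /=.
have [_ _ _ _ FM] := msize_filtration A 3.
have -> : (3 * d = (d + d) + d)%N by clear; lia.
apply: FM; first exact: flatten3C_msize.
have id : (i <= d)%N by rewrite -ltnS (leq_trans (ltn_ord i)).
have -> : flatten3 i0 i1 i2 'X = 'X_i0 :> {mpoly A[3]} by rewrite /flatten3 ev3X.
have := @filtration_exp _ _ 1%N ('X_i0 : {mpoly A[3]}) i (msize_filtration A 3).
rewrite muln1 msizeX mdeg1 => /(_ isT) h; apply: leq_trans h _; by rewrite ltnS.
Qed.

(** A polynomial constant in the main variable has no exponent involving [x_i0]. This guarantees
    positive degree in the main variable once that variable occurs in the maximal monomial. *)
Lemma nest_size_gt (A : idomainType) (i0 i1 i2 : 'I_3) (p : {mpoly A[3]}) (e : 'X_{1..3}) :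
  uniq [:: i0; i1; i2] -> e \in msupp p -> (0 < e i0)%N -> (1 < size (nest i0 i1 p))%N.
Proof.
move=> u3 ep e0; rewrite ltnNge; apply/negP => /size1_polyC pE.
have fF : filtration (fun k (p : {mpoly A[3]}) => forall e : 'X_{1..3}, e \in msupp p -> (e i0 <= k)%N).
  split=> [e'|k e'|k a b ha hb e'|k a ha e'|k l a b ha hb e'].
  - by rewrite msupp1 inE => /eqP->; rewrite mnmE.
  - by rewrite msupp0.
  - by move/(msuppD_le); rewrite mem_cat => /orP[/ha|/hb].
  - by rewrite (perm_mem (msuppN a)); exact: ha.
  - move/(msuppM_le)/allpairsP => [[x y] /= [/ha hx /hb hy ->]].
    by rewrite mnmDE leq_add.
pose c : {poly {poly A}} := (nest i0 i1 p)`_0; rewrite -/c in pE.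
have := @filtration_ev2 _ _ (@mpolyC 3 A) _ 'X_i1 'X_i2 0 0 (size c) (\max_(i < size c) size (c`_i)%R) c fF.
rewrite -(ev3C _ 'X_i0) -pE -/(flatten3 i0 i1 i2 _) (nestK u3) !muln0 addn0.
have hX i : i != i0 -> forall e' : 'X_{1..3}, e' \in msupp ('X_i : {mpoly A[3]}) -> (e' i0 <= 0)%N.
  by move=> ii e'; rewrite msuppX inE => /eqP->; rewrite mnm1E (negPf ii).
move=> H; suff : (e i0 <= 0)%N by rewrite leqNgt e0.
apply: H ep => //.
- by move=> l k x lk h e' /h/leq_trans; apply.
- by move=> x e'; rewrite /= msuppC; case: eqP; rewrite ?inE // => _ /eqP->; rewrite mnmE.
- by apply: hX; move: u3; rewrite /= !inE eq_sym negb_or => /andP[/andP[]].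
- by apply: hX; move: u3; rewrite /= !inE negb_or => /andP[/andP[_]]; rewrite eq_sym.
- move=> i; have [lt|le] := ltnP i (size c); last by rewrite nth_default // size_poly0.
  by apply: leqW; exact: (@leq_bigmax _ (fun i : 'I__ => size (c`_i)%R) (Ordinal lt)).
Qed.

Lemma uniq_lift3 (i0 : 'I_3) : uniq [:: i0; lift i0 ord0; lift i0 ord_max].
Proof. by rewrite /= !inE !negb_or !neq_lift (inj_eq lift_inj). Qed.

Lemma ln_Kbound (R : realType) (B : R) (q dg : nat) (m : 'X_{1..3}) : (0 < mdeg m)%N -> (0 < dg)%N -> 0 < B -> (0 < q)%N ->
  0 < Kbound B q m dg /\
  ln (Kbound B q m dg) = ln B / Num.sqrt (mdeg m)%:R - kappa R (mdeg m) dg m * ln q%:R.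
Proof.
move=> m0 d0 B0 q0; have q0' : 0 < q%:R :> R by rewrite ltr0n.
rewrite /Kbound; split; first by rewrite mulr_gt0 ?powR_gt0.
rewrite lnM ?posrE ?powR_gt0 // !ln_powR div1r mulrC mulNr; congr (_ - _ * _).
rewrite /kappa; congr (_ / (_ * _ * _)).
rewrite -powR12_sqrt // [3 / 2]mulrC powRrM (powR_mulrn 3) ?powR_ge0 //.
Qed.

Definition lift_mnm (e : 'X_{1..2}) : 'X_{1..3} :=
  [multinom (if unlift ord0 i is Some j then e j else 0%N) | i < 3].

Lemma lift_mnmE (e : 'X_{1..2}) j : lift_mnm e (lift ord0 j) = e j.
Proof. by rewrite mnmE liftK. Qed.

Lemma lift_mnm0 (e : 'X_{1..2}) : lift_mnm e ord0 = 0%N.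
Proof. by rewrite mnmE unlift_none. Qed.

Lemma lift_mnm_inj : injective lift_mnm.
Proof. by move=> e e' E; apply/mnmP => j; rewrite -!lift_mnmE E. Qed.

Definition lift_mpoly (g : {mpoly int[2]}) : {mpoly int[3]} :=
  \sum_(e <- msupp g) g@_e *: 'X_[lift_mnm e].

Lemma mcoeff_sum (n : nat) (A : nzRingType) (g : {mpoly A[n]}) e :
  \sum_(e' <- msupp g) g@_e' * (e' == e)%:R = g@_e.
Proof. by rewrite {3}(mpolyE g) raddf_sum /=; apply: eq_bigr => e' _; rewrite mcoeffZ mcoeffX. Qed.

Lemma lift_mpoly_coef g e : (lift_mpoly g)@_(lift_mnm e) = g@_e.
Proof.
rewrite /lift_mpoly raddf_sum /= -[RHS]mcoeff_sum; apply: eq_bigr => e' _.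
by rewrite mcoeffZ mcoeffX (inj_eq lift_mnm_inj).
Qed.

Lemma lift_mpoly_supp g x : x \in msupp (lift_mpoly g) -> exists2 e, e \in msupp g & x = lift_mnm e.
Proof.
rewrite mcoeff_msupp => h; apply: contrapT => H; case/eqP: h.
rewrite /lift_mpoly raddf_sum /= big1_seq // => e /andP[_ eg].
rewrite mcoeffZ mcoeffX; case: eqP => [E|_]; last by rewrite mulr0.
by case: H; exists e.
Qed.

Lemma lift_mpoly_eval g (x : point3) : eval23 g x = (lift_mpoly g).@[x].
Proof.
rewrite /eval23 mevalE /lift_mpoly raddf_sum /=; apply: eq_bigr => e _.
rewrite mevalZ mevalX; congr (_ * _); rewrite [RHS]big_ord_recl lift_mnm0 expr0 mul1r.
by apply: eq_bigr => j _; rewrite lift_mnmE.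
Qed.

Lemma eval2E (g : {mpoly int[2]}) a b :
  eval2 g a b = \sum_(e <- msupp g) g@_e * (a ^+ e ord0 * b ^+ e ord_max).
Proof.
rewrite /eval2 mevalE; apply: eq_bigr => e _; congr (_ * _).
by rewrite big_ord_recl big_ord1 (_ : lift ord0 ord0 = ord_max) //; apply: val_inj.
Qed.

Lemma coprime_form_lift q g : gcd_condition q g -> coprime_form (tdeg g) q (lift_mpoly g).
Proof.
have m2 (e e' : 'X_{1..2}) : (e == e') = (e ord0 == e' ord0) && (e ord_max == e' ord_max).
  apply/eqP/andP => [->//|[/eqP h1 /eqP h2]]; apply/mnmP => i.
  by case: i => [[|[|//]] hi]; [rewrite (_ : Ordinal hi = ord0) | rewrite (_ : Ordinal hi = ord_max)] => //; exact: val_inj.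
have d2 (e : 'X_{1..2}) : mdeg e = (e ord0 + e ord_max)%N.
  by rewrite mdegE big_ord_recl big_ord1 (_ : lift ord0 ord0 = ord_max) //; apply: val_inj.
have e00 : eval2 g 0 0 = g@_0.
  rewrite eval2E -[RHS]mcoeff_sum; apply: eq_bigr => e _; congr (_ * _).
  rewrite m2 !mnmE; case: (e ord0) => [|k]; last by rewrite exprS !mul0r.
  by case: (e ord_max) => [|k]; rewrite ?exprS ?mul0r ?mulr0.
have topc x : mdeg x = tdeg g -> (top_part g)@_x = g@_x.
  move=> xd; rewrite /top_part pihomogE raddf_sum /= -[RHS]mcoeff_sum big_mkcond /=.
  apply: eq_bigr => e _; rewrite -xd; case: eqP => [_|ne]; first by rewrite mcoeffZ mcoeffX.
  by case: eqP => [E|]; [rewrite E in ne | rewrite mulr0].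
have tops e : e \in msupp (top_part g) -> mdeg e = tdeg g.
  rewrite mcoeff_msupp /top_part pihomogE raddf_sum /= => h; apply/eqP; apply: contraNT h => ne.
  rewrite big1 // => e' /eqP e'd; rewrite mcoeffZ mcoeffX; case: eqP => [E|_]; last by rewrite mulr0.
  by move: ne; rewrite -E e'd eqxx.
have e10 : eval2 (top_part g) 1 0 = g@_(U_(ord0) *+ tdeg g).
  rewrite -topc ?mdegMn ?mdeg1 ?mul1n // eval2E -[RHS]mcoeff_sum; apply: eq_big_seq => e /tops ed; congr (_ * _).
  rewrite m2 !mulmnE !mnm1E eqxx mul1n mul0n expr1n mul1r -ed d2.
  by case: (e ord_max) => [|k]; rewrite ?addn0 ?eqxx // exprS mul0r andbF.
have e01 : eval2 (top_part g) 0 1 = g@_(U_(ord_max) *+ tdeg g).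
  rewrite -topc ?mdegMn ?mdeg1 ?mul1n // eval2E -[RHS]mcoeff_sum; apply: eq_big_seq => e /tops ed; congr (_ * _).
  rewrite m2 !mulmnE !mnm1E eqxx mul1n mul0n expr1n mulr1 -ed d2.
  by case: (e ord0) => [|k]; rewrite ?add0n ?eqxx // exprS mul0r.
rewrite /gcd_condition e00 e10 e01 => cop; split.
  move=> e' /lift_mpoly_supp[e eg ->]; split; first exact: lift_mnm0.
  have -> : mdeg (lift_mnm e) = mdeg e.
    by rewrite !mdegE [LHS]big_ord_recl lift_mnm0 add0n; apply: eq_bigr => j _; rewrite lift_mnmE.
  by have := msize_mdeg_lt eg; rewrite /tdeg; case: (msize g).
have lift3 j k : lift_mnm (U_(j) *+ k)%MM = (U_(lift ord0 j) *+ k)%MM.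
  apply/mnmP => i; case: (unliftP ord0 i) => [i'|] ->.
    by rewrite lift_mnmE !mulmnE !mnm1E (inj_eq lift_inj).
  by rewrite lift_mnm0 mulmnE mnm1E eq_sym -(negbK (_ == _)) neq_lift.
have lift0 : lift_mnm 0%MM = 0%MM.
  by apply/mnmP => i; case: (unliftP ord0 i) => [i'|] ->; rewrite ?lift_mnmE ?lift_mnm0 !mnmE.
rewrite -lift0 -!lift3 !lift_mpoly_coef.
by rewrite (_ : lift ord0 ord0 = ord_max :> 'I_2) //; apply: val_inj.
Qed.

Lemma coprime_form1 (dg q : nat) g : coprime_form dg q g -> coprime_form dg 1 g.
Proof. by case=> h _; split=> //; rewrite !gcd1z. Qed.

Lemma assemble (f : {mpoly int[3]}) (Ps : seq {mpoly int[3]}) (Zs : seq point3) (dd : nat) (Q : point3 -> Prop) :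
  ring_irreducible (map_mpoly intr f : {mpoly algC[3]}) ->
  (forall P, P \in Ps -> ~ ring_dvd (map_mpoly intr f) (map_mpoly intr P : {mpoly algC[3]}) /\ (msize P <= dd.+1)%N) ->
  (forall x, Q x -> f.@[x] = 0) -> (forall x, x \in Zs -> f.@[x] = 0) ->
  (forall x, Q x -> x \notin Zs -> exists2 P, P \in Ps & P.@[x] = 0) ->
  exists (fs : 'I_(size Ps) -> {mpoly int[3]}) (Z : {fset point3}),
  [/\ forall x, x \in Z -> f.@[x] = 0, forall j, ring_coprime (fs j) f /\ (tdeg (fs j) <= dd)%N,
      (#|` Z| <= size Zs)%N &
      forall x, Q x -> x \notin Z -> exists j, f.@[x] = 0 /\ (fs j).@[x] = 0].
Proof.
move=> fI PsP Qf Zf cov.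
have /choice[r rP] : forall j : 'I_(size Ps), exists P' : {mpoly int[3]}, [/\ ring_coprime P' f, msize P' = msize Ps`_j &
     forall u : 'I_3 -> int, (Ps`_j).@[u] = 0 -> P'.@[u] = 0].
  by move=> j; apply: primitive_coprime => //; have [] := PsP Ps`_j (mem_nth _ (ltn_ord j)).
exists r, [fset x in Zs]%fset; split.
- by move=> x; rewrite finmap.inE => /Zf.
- move=> j; have [h1 h2 _] := rP j; split=> //.
  by have [_] := PsP Ps`_j (mem_nth _ (ltn_ord j)); rewrite /tdeg h2; case: (msize _).
- by rewrite card_fseq size_undup.
- move=> x Qx; rewrite finmap.inE => xZ; have [P PP Px] := cov x Qx xZ.
  have lt : (index P Ps < size Ps)%N by rewrite index_mem.
  exists (Ordinal lt); split; first exact: Qf.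
  by have [_ _] := rP (Ordinal lt); apply; rewrite /= nth_index.
Qed.

Definition box (N : nat) : seq point3 :=
  [seq [ffun i => (phi i)%:Z - N%:Z] | phi : {ffun 'I_3 -> 'I_(2 * N).+1}].

Lemma box_size N : size (box N) = ((2 * N).+1 ^ 3)%N.
Proof. by rewrite size_map -cardE card_ffun !card_ord. Qed.

Lemma mem_box N (x : point3) : (forall i, (`|x i| <= N)%N) -> x \in box N.
Proof.
move=> xN; have h i : (absz (x i + N%:Z)%R < (2 * N).+1)%N by move: (xN i); clear; lia.
apply/mapP; exists [ffun i => Ordinal (h i)]; first by rewrite mem_enum.
apply/ffunP => i; rewrite !ffunE /=; move: (xN i); move: (x i : int) => v vN.
by rewrite gez0_abs ?addrK //; move: vN; clear; lia.
Qed.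

Lemma int_le_truncn (R : realType) (B : R) (x : int) : 0 <= B ->
  `|x|%:~R <= B -> (`|x| <= Num.truncn B)%N.
Proof.
move=> B0 h; rewrite truncn_ge_nat //; apply: le_trans h.
Qed.

Lemma scale_irreducible (n : nat) (f f' : {mpoly int[n]}) (c : int) : c != 0 -> f = c *: f' ->
  ring_irreducible (map_mpoly intr f : {mpoly algC[n]}) ->
  ring_irreducible (map_mpoly intr f' : {mpoly algC[n]}).
Proof.
move=> c0 fE; set F := map_mpoly intr f; set F' := map_mpoly intr f'.
have cu : (c%:~R : algC) != 0 by rewrite intr_eq0.
have E : F = (c%:~R : algC)%:MP * F'.
  by rewrite /F fE -mul_mpolyC rmorphM /= map_mpolyC.
have U : ((c%:~R : algC)%:MP : {mpoly algC[n]}) \is a GRing.unit.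
  by apply: rmorph_unit; rewrite unitfE.
move=> [h1 h2 h3]; split.
- by apply: contraNneq h1 => h; rewrite E h mulr0.
- by apply: contraNN h2 => h; rewrite E unitrM U.
- move=> a b ab; have [||] := h3 ((c%:~R : algC)%:MP * a) b; first by rewrite E ab mulrA.
    by rewrite unitrM U /=; left.
  by right.
Qed.

(** Here [y = ln B / lam], [x = kappa * ln q] and [r = lam * e]. Since [ln q <= x / k1], a large [D]
    makes the error over [D] a small fraction of [x], and the gap [r * y] absorbs it together with
    [c]. *)
Lemma global_arith (R : realType) (lam r c k1 y lB x lq D : R) :
  0 < lam -> 0 < r -> 0 <= c -> 0 < k1 -> 0 <= y -> lB = lam * y -> 0 < lq -> k1 * lq <= x -> y * (1 + r) < x -> 2 * c / r <= y ->
  2 * (c * (k1^-1 + lam)) * (1 + r) / r <= D -> 0 < D ->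
  y + c * ((lq + lB) / D + 1) < x.
Proof.
move=> l0 r0 c0 k0 y0 -> q0 h1 h2 h3 h4 D0.
have x0 : 0 < x by apply: lt_le_trans h1; exact: mulr_gt0.
have r1 : 0 < 1 + r by apply: ltr_pwDl => //; exact: ltW.
have lqx : lq <= x / k1 by rewrite ler_pdivlMr // mulrC.
have yx : y <= x by apply: le_trans (ltW h2); rewrite ler_peMr // lerDl ltW.
have t1 : (lq + lam * y) / D <= (k1^-1 + lam) * x / D.
  rewrite ler_wpM2r ?invr_ge0 ?(ltW D0) // mulrDl [k1^-1 * x]mulrC lerD //.
  by rewrite ler_wpM2l // ltW.
have t2 : c * ((k1^-1 + lam) * x / D) <= x * r / (1 + r) / 2.
  have : 2 * (c * (k1^-1 + lam)) * (1 + r) / r * x <= D * x by rewrite ler_wpM2r // ltW.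
  rewrite mulrAC ler_pdivrMr // => h.
  have -> : c * ((k1^-1 + lam) * x / D) = 2 * (c * (k1^-1 + lam)) * (1 + r) * x / (2 * (1 + r) * D).
    by field; rewrite ?gt_eqF.
  have -> : x * r / (1 + r) / 2 = D * x * r / (2 * (1 + r) * D) by field; rewrite ?gt_eqF.
  by rewrite ler_wpM2r // invr_ge0 !mulr_ge0 // ltW.
have t3 : c <= y * r / 2 by move: h3; rewrite ler_pdivrMr // ler_pdivlMr // mulrC.
have t4 : c * ((lq + lam * y) / D) <= x * r / (1 + r) / 2 by apply: le_trans t2; rewrite ler_wpM2l.
have t5 : y < x / (1 + r) by rewrite ltr_pdivlMr.
have t6 : y * r < x / (1 + r) * r by rewrite ltr_pM2r.
have t7 : x / (1 + r) + x * r / (1 + r) = x by field; rewrite gt_eqF.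
rewrite [x * r / _]mulrAC in t4 t7.
rewrite mulrDr mulr1; move: t3 t4 t5 t6 t7; move: (x / (1 + r)) (c * _) => u v; clear; move=> *; lra.
Qed.

(** The assumption forces [m_1 > 0], so [kappa >= k1] and [ln q] is [O(kappa * ln q)]. A fixed large
    [D] then makes the error in [aux_poly_global] a small part of the main term, and the surplus
    [e * ln B] absorbs it. *)
Lemma aux_poly_large_modulus (R : realType) (s dg : nat) (e : R) : (0 < s)%N -> (0 < dg)%N -> 0 < e ->
  exists (D : nat) (l0 : R), forall (q : nat) (m : 'X_{1..3}) (B : R) (Bn : nat) (f g : {mpoly int[3]}) (pts : nat -> 'I_3 -> int),
  mdeg m = s -> (0 < Bn)%N -> Bn%:R <= B -> l0 <= ln B -> (0 < q)%N -> coprime_form dg q g ->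
  (forall k i, (`|pts k i| <= Bn)%N) -> (forall k, (q%:Z %| g.@[pts k])%Z) -> (forall k, f.@[pts k] = 0) ->
  ln B / Num.sqrt s%:R + e * ln B < kappa R s dg m * ln q%:R -> aux_poly D m pts.
Proof.
move=> s0 dg0 e0; pose lam : R := Num.sqrt s%:R.
have lam0 : 0 < lam by rewrite sqrtr_gt0 ltr0n.
pose k1 : R := (2 * lam ^+ 3 * dg%:R)^-1.
have k10 : 0 < k1 by rewrite invr_gt0 !mulr_gt0 ?exprn_gt0 // ltr0n.
pose c : R := 300 * s%:R ^+ 6; have c0 : 0 <= c by rewrite mulr_ge0 // exprn_ge0.
pose r := lam * e; have r0 : 0 < r by exact: mulr_gt0.
have [D [D0 DE]] := exists_large_nat (2 * (c * (k1^-1 + lam)) * (1 + r) / r).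
exists (maxn s D), (lam * (2 * c / r)) => q m B Bn f g pts mS Bn0 BnB lB q0 cop pB qg pf h.
have B1 : 1 <= B by apply: le_trans BnB; rewrite ler1n.
have Bp : 0 < B by exact: lt_le_trans B1.
have l0 : 0 <= ln B by exact: ln_ge0.
have lBn : ln Bn%:R <= ln B by rewrite ler_ln ?posrE // ltr0n.
have kq0 : 0 < kappa R s dg m * ln q%:R.
  by apply: le_lt_trans h; rewrite addr_ge0 ?divr_ge0 ?mulr_ge0 // ltW.
have lq0 : 0 < ln q%:R :> R.
  rewrite lt_neqAle ln_nat_ge0 andbT eq_sym; apply: contraTneq kq0 => ->; by rewrite mulr0 ltxx.
have kE : kappa R s dg m = (m ord0)%:R * k1 by [].
have m0 : (0 < m ord0)%N.
  by rewrite lt0n; apply: contraTneq kq0 => m0; rewrite kE m0 !mul0r ltxx.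
have D0' : (0 < maxn s D)%N by rewrite leq_max s0.
have DD : D%:R <= (maxn s D)%:R :> R by rewrite ler_nat leq_maxr.
apply: (@aux_poly_global R s dg s0 dg0 _ m pts Bn q g ord0 (lift ord0 ord0) (lift ord0 ord_max) (nest ord0 (lift ord0 ord0) f)) => //.
- exact: leq_maxl.
- by move=> k; rewrite (nest_meval (uniq_lift3 ord0)).
have := @global_arith R lam r c k1 (ln B / lam) (ln B) (kappa R s dg m * ln q%:R) (ln q%:R) (maxn s D)%:R lam0 r0 c0 k10.
rewrite -/lam -/c.
have y0 : 0 <= ln B / lam by rewrite divr_ge0 // ltW.
have yE : ln B = lam * (ln B / lam) by rewrite mulrC divfK // gt_eqF.
have h1 : k1 * ln q%:R <= kappa R s dg m * ln q%:R.
  by rewrite ler_wpM2r ?(ltW lq0) // kE ler_peMl ?(ltW k10) // ler1n.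
have h2 : ln B / lam * (1 + r) < kappa R s dg m * ln q%:R.
  have -> : ln B / lam * (1 + r) = ln B / lam + e * ln B.
    by rewrite mulrDr mulr1 /r mulrA divfK ?gt_eqF // [e * _]mulrC.
  exact: h.
have h3 : 2 * c / r <= ln B / lam by rewrite ler_pdivlMr // mulrC.
have h4 := le_trans DE DD; have h5 : 0 < (maxn s D)%:R :> R by rewrite ltr0n.
move=> /(_ y0 yE lq0 h1 h2 h3 h4 h5); apply: le_lt_trans.
apply: lerD; first by rewrite ler_wpM2r // invr_ge0 ltW.
by rewrite ler_wpM2l // lerD2r ler_wpM2r ?invr_ge0 // lerD2l.
Qed.

Lemma flatten3_meval (A : comNzRingType) (i0 i1 i2 : 'I_3) (u : 'I_3 -> A) (P : {poly {poly {poly A}}}) :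
  uniq [:: i0; i1; i2] -> (flatten3 i0 i1 i2 P).@[u] = ev3 idfun (u i0) (u i1) (u i2) P.
Proof. by move=> u3; rewrite -(nest_meval u3) flatten3K. Qed.

Lemma pt3_pack (i0 i1 i2 : 'I_3) (x : point3) : uniq [:: i0; i1; i2] ->
  pt3 i0 i1 (x i0, (x i1, x i2)) = (x : 'I_3 -> int).
Proof.
move=> u3; apply/funext => i; have [h0 h1 h2] := pt3_coords (x i0, (x i1, x i2)) u3.
by case: (ord3_cases u3 i) => ->.
Qed.

Lemma nest_not_dvd (lt : rel 'X_{1..3}) (i0 i1 i2 : 'I_3) (f : {mpoly int[3]}) m : uniq [:: i0; i1; i2] ->
  linear_total_order lt -> is_max_exponent lt f m ->
  forall G : {mpoly int[3]}, G != 0 -> (forall e, e \in msupp G -> ~~ (m <= e)%MM) ->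
  ~ ring_dvd (map_mpoly intr f) (map_mpoly intr G : {mpoly algC[3]}) /\
  ~ ring_dvd (map_poly (map_poly (map_poly intr)) (nest i0 i1 f) : {poly {poly {poly algC}}})
     (map_poly (map_poly (map_poly intr)) (nest i0 i1 G)).
Proof.
move=> u3 [irr tr tot add] [mf mP] G G0 GP.
have nd : ~ ring_dvd (map_mpoly intr f) (map_mpoly intr G : {mpoly algC[3]}).
  exact: (@max_exponent_not_dvd 3 lt irr tr tot add _ _ intr f G m (@intr_inj _) mf mP G0 GP).
split=> // -[c E]; apply: nd; exists (flatten3 i0 i1 i2 c).
have := congr1 (@flatten3 i0 i1 i2 algC) E; rewrite rmorphM /= -!(nest_map u3).
by rewrite !(nestK u3).
Qed.

Lemma deriv_int_neq0 (F : {poly {poly {poly int}}}) (n : nat) : (0 < n)%N -> size F = n.+1 -> F^`() != 0.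
Proof.
move=> n0 sF; have c0 : lead_coef (lead_coef (lead_coef F)) != 0.
  by rewrite !lead_coef_eq0 -size_poly_gt0 sF.
set c := lead_coef F in c0; set c1 := lead_coef c in c0.
apply: contraNneq c0 => F0.
have := congr1 (fun p : {poly {poly {poly int}}} => (p`_n.-1)`_(size c).-1`_(size c1).-1) F0.
rewrite /= coef_deriv !coefMn !coef0 prednK //.
have -> : F`_n = c by rewrite /c lead_coefE sF.
rewrite -lead_coefE -/c1 -lead_coefE => /eqP.
by rewrite mulrn_eq0 eqn0Ngt n0.
Qed.

(* [W] is [K * B `^ eps]. *)
Definition covering_bound (R : realType) (s dg df n : nat) (eps : R) (dd : nat) (C l0 : R) : Prop :=
  forall (lt : rel 'X_{1..3}) (q : nat) (f g : {mpoly int[3]}) (m : 'X_{1..3}) (B W : R) (i0 : 'I_3),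
  linear_total_order lt -> (0 < q)%N -> ring_irreducible (map_mpoly intr f : {mpoly algC[3]}) ->
  (forall a : int, (forall e, (a %| f@_e)%Z) -> a \is a GRing.unit) ->
  msize f = df.+1 -> coprime_form dg q g -> is_max_exponent lt f m -> mdeg m = s ->
  size (nest i0 (lift i0 ord0) f) = n.+1 -> 1 <= B -> l0 <= ln B -> 0 < W ->
  ln W = ln B / Num.sqrt s%:R - kappa R s dg m * ln q%:R + eps * ln B ->
  exists (Ps : seq {mpoly int[3]}) (Zs : seq point3),
  [/\ forall P, P \in Ps -> ~ ring_dvd (map_mpoly intr f) (map_mpoly intr P : {mpoly algC[3]}) /\ (msize P <= dd.+1)%N,
      (size Ps)%:R <= C * Num.max 1 W, (size Zs)%:R <= C * Num.max 1 W ^+ 2,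
      forall x, x \in Zs -> f.@[x] = 0 &
      forall x : point3, (forall i, `|x i|%:~R <= B) -> f.@[x] = 0 -> (q%:Z %| g.@[x])%Z -> x \notin Zs ->
        exists2 P, P \in Ps & P.@[x] = 0].

(** Three situations: [q] is so large that one polynomial of bounded degree vanishes at all points;
    the points lie on a second surface of degree at most [df]; or [ln q] and the logarithm of the
    height of [f] are [O(ln B)], and the tree of residue classes applies. *)
Lemma core_covering (R : realType) (s dg df n : nat) (eps : R) :
  (0 < s)%N -> (0 < dg)%N -> (0 < n)%N -> 0 < eps ->
  exists (dd : nat) (C l0 : R), 0 <= C /\
  covering_bound s dg df n eps dd C l0.
Proof.
move=> s0 dg0 n0 eps0; pose lam : R := Num.sqrt s%:R.
have lam0 : 0 < lam by rewrite sqrtr_gt0 ltr0n.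
pose e := eps / 2; have e0 : 0 < e by exact: divr_gt0.
pose k1 : R := (2 * lam ^+ 3 * dg%:R)^-1.
have k10 : 0 < k1 by rewrite invr_gt0 !mulr_gt0 ?exprn_gt0 // ltr0n.
have [DA [lA auxA]] := aux_poly_large_modulus s0 dg0 e0.
pose Aq := (1 / lam + e) / k1.
have Aq0 : 0 <= Aq by rewrite divr_ge0 ?addr_ge0 ?divr_ge0 // ltW.
pose M0 := #|{: 'X_{1..3 < df.+1}}|.
pose AH : R := 1 + (M0 * df)%:R; have AH0 : 0 <= AH by rewrite addr_ge0.
have [Cd [Ct [lt0 [Ct0 treeP]]]] := tree_points df s0 dg0 e0 Aq0 AH0 n0.
exists (DA + df + 3 * df + 3 * Cd)%N, (Ct + 1), (Num.max lA (Num.max lt0 (ln (M0 * M0`!)%:R))).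
split=> [|lt q f g m B W i0]; first by rewrite addr_ge0.
move=> lto q0 fI prim sf cop mmax mS sn B1; rewrite !ge_max => /and3P[lB1 lB2 lB3] W0 lW.
set i1 := lift i0 ord0 in sn; pose i2 := lift i0 ord_max.
have u3 : uniq [:: i0; i1; i2] by exact: uniq_lift3.
have Bp : 0 < B by exact: lt_le_trans B1.
have l0 : 0 <= ln B by exact: ln_ge0.
pose Bn := Num.truncn B.
have Bn0 : (0 < Bn)%N by rewrite truncn_gt0.
have BnB : Bn%:R <= B by have /andP[] := truncn_itv (ltW Bp).
pose S := [seq x : point3 <- box Bn | [&& [forall i, (absz (x i) <= Bn)%N], f.@[x] == 0 & (q%:Z %| g.@[x])%Z]].
have SP (x : point3) : x \in S -> [/\ forall i, (absz (x i) <= Bn)%N, f.@[x] = 0 & (q%:Z %| g.@[x])%Z].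
  by rewrite mem_filter => /andP[/and3P[/forallP h1 /eqP h2 h3] _].
have inS (x : point3) : (forall i, `|x i|%:~R <= B) -> f.@[x] = 0 -> (q%:Z %| g.@[x])%Z -> x \in S.
  move=> xB fx gx; have h i : (absz (x i) <= Bn)%N by apply: int_le_truncn => //; exact: ltW.
  by rewrite mem_filter fx eqxx gx mem_box // !andbT; apply/forallP.
have max1 : 1 <= Num.max 1 W by rewrite le_max lexx.
have max2 : 1 <= Num.max 1 W ^+ 2 by rewrite exprn_ege1.
have C1 : 1 <= Ct + 1 by rewrite lerDr.
have C0 : 0 <= Ct + 1 by exact: le_trans C1.
have single P : ~ ring_dvd (map_mpoly intr f) (map_mpoly intr P : {mpoly algC[3]}) -> (msize P <= (DA + df).+1)%N ->
    (forall x, x \in S -> P.@[x] = 0) ->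
    exists (Ps : seq {mpoly int[3]}) (Zs : seq point3),
    [/\ forall P, P \in Ps -> ~ ring_dvd (map_mpoly intr f) (map_mpoly intr P : {mpoly algC[3]}) /\
          (msize P <= (DA + df + 3 * df + 3 * Cd).+1)%N,
      (size Ps)%:R <= (Ct + 1) * Num.max 1 W, (size Zs)%:R <= (Ct + 1) * Num.max 1 W ^+ 2,
      forall x, x \in Zs -> f.@[x] = 0 &
      forall x : point3, (forall i, `|x i|%:~R <= B) -> f.@[x] = 0 -> (q%:Z %| g.@[x])%Z -> x \notin Zs ->
        exists2 P, P \in Ps & P.@[x] = 0].
  move=> nd sP Pv; exists [:: P], [::]; split=> //.
  - move=> P'; rewrite inE => /eqP->; split=> //; apply: leq_trans sP _; rewrite ltnS; clear; lia.
  - by rewrite -[(size [:: P])%:R]mulr1 ler_pM.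
  - by rewrite mulr_ge0 // (le_trans _ max2).
  - by move=> x xB fx gx _; exists P; [exact: mem_head | apply: Pv; exact: inS].
case SE : S => [|x0 S'].
  exists [::], [::]; split=> //.
  - by rewrite mulr_ge0 // (le_trans _ max1).
  - by rewrite mulr_ge0 // (le_trans _ max2).
  - by move=> x xB fx gx; have := inS x xB fx gx; rewrite SE.
have x0S : x0 \in S by rewrite SE mem_head.
pose pts k : 'I_3 -> int := nth x0 S k.
have pS k : nth x0 S k \in S by have [lt1|le] := ltnP k (size S); [exact: mem_nth | rewrite nth_default].
have ptsP k : [/\ forall i, (absz (pts k i) <= Bn)%N, f.@[pts k] = 0 & (q%:Z %| g.@[pts k])%Z] := SP _ (pS k).
have ptsV P : (forall k, P.@[pts k] = 0) -> forall x, x \in S -> P.@[x] = 0.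
  by move=> h x xS; have := h (index x S); rewrite /pts nth_index.
have [hA|hB] := ltP (ln B / lam + e * ln B) (kappa R s dg m * ln q%:R).
  have [|||G [G0 GP Gv]] := auxA q m B Bn f g pts mS Bn0 BnB lB1 q0 cop _ _ _ hA; try by move=> k; have [] := ptsP k.
  apply: (single G); last exact: ptsV.
    by have [] := nest_not_dvd u3 lto mmax G0 (fun e' h => (GP e' h).2).
  by rewrite mmeasureE; apply/bigmax_leqP_seq => e' /GP[h _] _; rewrite ltnS (leq_trans h) // leq_addr.
have [[e0' [ef [P [P0 sP Pe Pv]]]]|nH] := pselect (exists e0, e0 \in msupp f /\ exists P : {mpoly int[3]},
   [/\ P != 0, (msize P <= df.+1)%N, P@_e0 = 0 & forall k, P.@[pts k] = 0]).
  apply: (single P); last exact: ptsV.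
    by apply: (small_multiple_not_dvd (@intr_inj _) P0 _ ef Pe); rewrite sf.
  by apply: leq_trans sP _; rewrite ltnS leq_addl.
pose H := (M0 * M0`! * Bn ^ (M0 * df))%N.
have M00 : (0 < M0)%N.
  have h0 : (mdeg (0%MM : 'X_{1..3}) < df.+1)%N by rewrite mdeg0.
  by apply/card_gt0P; exists (BMultinom h0).
have H0 : (0 < H)%N by rewrite !muln_gt0 M00 fact_gt0 expn_gt0 Bn0.
have normH : (norm3 (nest i0 i1 f) <= H)%N.
  apply: leq_trans (nest_norm i0 i1 f) _; rewrite /H -mulnA.
  apply: (@leq_trans (\sum_(e' <- msupp f) M0`! * Bn ^ (M0 * df))%N).
    rewrite big_seq [X in (_ <= X)%N]big_seq; apply: leq_sum => e' ef.
    have [h|//] := coefficient_bound (eq_leq sf) Bn0 prim (fun k => let: And3 _ h _ := ptsP k in h)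
       (fun k => let: And3 h _ _ := ptsP k in h) ef.
    by case: nH; exists e'; split.
  rewrite big_const_seq count_predT iter_addn_0 mulnC leq_mul2r; apply/orP; right.
  rewrite /M0 cardE -(size_map (@bmnm 3 df.+1)); apply: uniq_leq_size; first exact: msupp_uniq.
  move=> e' ef; have h : (mdeg e' < df.+1)%N by rewrite (leq_trans _ (eq_leq sf)) // msize_mdeg_lt.
  by apply/mapP; exists (BMultinom h); rewrite ?mem_enum.
have lH : ln H%:R <= AH * ln B.
  rewrite /H natrM natrX lnM ?posrE ?exprn_gt0 ?ltr0n ?muln_gt0 ?M00 ?fact_gt0 // lnXn ?ltr0n // mulrDl mul1r lerD //.
  by rewrite -[_ *+ _]mulr_natl ler_wpM2l // ler_ln ?posrE ?ltr0n.
(* If [m_1 = 0], then [q] is absent from [K] and not controlled by [B], and the congruence is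
   weakened to modulus 1. Otherwise [hB] makes [ln q] at most a multiple of [ln B]. *)
pose q' := if m ord0 == 0%N then 1%N else q.
have q'0 : (0 < q')%N by rewrite /q'; case: ifP.
have cop' : coprime_form dg q' g by rewrite /q'; case: ifP => // _; exact: coprime_form1 cop.
have kE : kappa R s dg m = (m ord0)%:R * k1 by [].
have kq : kappa R s dg m * ln q'%:R = kappa R s dg m * ln q%:R.
  by rewrite /q'; case: eqP => // m0; rewrite kE m0 !mul0r.
have lq' : ln q'%:R <= Aq * ln B.
  rewrite /q'; case: eqP => [_|/eqP m0]; first by rewrite ln1 mulr_ge0.
  rewrite /Aq mulrAC ler_pdivlMr // mulrC; apply: (@le_trans _ _ (kappa R s dg m * ln q%:R)).
    by rewrite ler_wpM2r ?ln_nat_ge0 // kE ler_peMl ?(ltW k10) // ler1n lt0n.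
  by apply: (le_trans hB); rewrite mulrDl div1r [lam^-1 * _]mulrC.
pose F := nest i0 i1 f.
pose pack (x : point3) : pt := (x i0, (x i1, x i2)).
(* Only the points where the derivative of [F] is nonzero enter the tree; the derivative itself
   joins the list of polynomials and covers the others. *)
pose T := undup [seq pack x | x : point3 <- S & ev3 idfun (x i0) (x i1) (x i2) F^`() != 0].
have TP u : u \in T -> exists2 x, x \in S & u = pack x /\ ev3 idfun (x i0) (x i1) (x i2) F^`() != 0.
  by rewrite mem_undup => /mapP[x]; rewrite mem_filter => /andP[h1 h2] ->; exists x.
have dF : degrees3 df F by apply: nest_degrees; rewrite sf.
have pF : ring_prime (map_poly (map_poly (map_poly intr)) F : {poly {poly {poly algC}}}).
  by have := nest_irreducible u3 fI; rewrite (nest_map u3).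
have := treeP m B W Bn q' H g i0 i1 i2 F T mS Bn0 BnB lB2 q'0 cop' u3 sn dF pF normH H0 lq' lH.
have nd G : G != 0 -> (forall e', e' \in msupp G -> ~~ (m <= e')%MM) ->
    ~ ring_dvd (map_poly (map_poly (map_poly intr)) F : {poly {poly {poly algC}}})
       (map_poly (map_poly (map_poly intr)) (nest i0 i1 G)).
  by move=> G0 GP; have [] := nest_not_dvd u3 lto mmax G0 GP.
move=> /(_ nd (undup_uniq _)) {treeP}.
have TP' u : u \in T -> [/\ forall i, (absz (pt3 i0 i1 u i) <= Bn)%N, (q'%:Z %| g.@[pt3 i0 i1 u])%Z,
     ev3 idfun u.1 u.2.1 u.2.2 F = 0 & ev3 idfun u.1 u.2.1 u.2.2 F^`() != 0].
  move=> /TP[x xS [-> fx]]; have [h1 h2 h3] := SP x xS.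
  rewrite (pt3_pack x u3); split=> //.
    by rewrite /q'; case: ifP => // _; exact: dvd1z.
  by rewrite /= (nest_meval u3 x).
have lW' : ln W = ln B / Num.sqrt s%:R - kappa R s dg m * ln q'%:R + 2 * e * ln B.
  have -> : 2 * e = eps by rewrite /e mulrC divfK // pnatr_eq0.
  by rewrite kq.
have hB' : 0 <= ln B / Num.sqrt s%:R - kappa R s dg m * ln q'%:R + e * ln B.
  by rewrite kq -/lam addrAC subr_ge0.
move=> /(_ TP' hB' W0 lW')[hs [Z [Z1 Z2 [Z3 Z4] Z5 Z6]]].
have WM : W <= Num.max 1 W by rewrite le_max lexx orbT.
exists (flatten3 i0 i1 i2 F^`() :: [seq flatten3 i0 i1 i2 h%:P | h <- hs]), [seq ([ffun i => pt3 i0 i1 u i] : point3) | u <- Z].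
have sF : (0 < size F)%N by rewrite sn.
split.
- move=> P; rewrite inE => /orP[/eqP->|/mapP[h hin ->]].
    split.
      apply: (flatten3_dvd_size u3 (@intr_inj _)); last by rewrite -/F lt_size_deriv // -size_poly_gt0.
      exact: deriv_int_neq0 n0 sn.
    apply: leq_trans (@flatten3_msize _ i0 i1 i2 df _ _) _; last by rewrite ltnS; clear; lia.
    exact: degrees3_deriv.
  have [h0 hd] := Z1 h hin; split.
    apply: (flatten3_dvd_size u3 (@intr_inj _)); first by rewrite polyC_eq0.
    by rewrite -/F sn size_polyC h0 ltnS.
  apply: leq_trans (@flatten3_msize _ i0 i1 i2 Cd _ _) _; last by rewrite ltnS; clear; lia.
  split.
  + by rewrite size_polyC h0.
  + by move=> i; rewrite coefC; case: eqP => _; rewrite ?size_poly0 //; exact: leq_trans (bideg_size h) _.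
  + move=> i j; rewrite coefC; case: eqP => _; rewrite ?coef0 ?size_poly0 //; exact: leq_trans (bideg_coef h j) _.
- rewrite /= size_map -addn1 natrD mulrDl mul1r lerD //; apply: (le_trans Z2); exact: ler_wpM2l.
- rewrite size_map; apply: (le_trans Z5); apply: ler_pM => //; first by rewrite exprn_ge0 // ltW.
    by rewrite lerDl.
  by rewrite lerXn2r ?nnegrE // ?(ltW W0) // (le_trans _ max1).
- move=> x /mapP[u /Z3 uT ->]; have [y yS [uy _]] := TP u uT; have [_ fy _] := SP y yS.
  rewrite -[RHS]fy; congr (_.@[_]); apply/funext => i; rewrite ffunE uy; exact: (congr1 (fun v : 'I_3 -> int => v i) (pt3_pack y u3)).
- move=> x xB fx gx xZ; have xS := inS x xB fx gx.
  have [fx0|fx0] := eqVneq (ev3 idfun (x i0) (x i1) (x i2) F^`()) 0.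
    by exists (flatten3 i0 i1 i2 F^`()); [exact: mem_head | rewrite flatten3_meval].
  have uT : pack x \in T by rewrite mem_undup; apply/mapP; exists x => //; rewrite mem_filter fx0.
  have uZ : pack x \notin Z.
    apply: contra xZ => h; apply/mapP; exists (pack x) => //; apply/ffunP => i.
    by rewrite ffunE (pt3_pack x u3).
  have [h hin hv] := Z6 _ uT uZ.
  exists (flatten3 i0 i1 i2 h%:P); first by rewrite inE; apply/orP; right; apply/mapP; exists h.
  by rewrite flatten3_meval // ev3C.
Qed.

Theorem theorem1p2 (R : realType) (eps : R) (heps : 0 < eps) (df dg : nat) :
  exists CJ Cdeg CZ : R,
  forall (lt : rel 'X_{1..3}) (q : nat)
    (f : {mpoly int[3]}) (g : {mpoly int[2]}) (m : 'X_{1..3}) (B : R),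
    linear_total_order lt ->
    (0 < q)%N ->
    absolutely_irreducible f ->
    tdeg f = df ->
    tdeg g = dg ->
    (0 < tdeg g)%N ->
    gcd_condition q g ->
    is_max_exponent lt f m ->
    m != 0%MM ->
    2 <= B ->
    let K := Kbound B q m (tdeg g) in
    exists (J : nat) (fs : 'I_J -> {mpoly int[3]}) (Z : {fset point3}),
      [/\ forall x, x \in Z -> f.@[x] = 0,
          J%:R <= CJ * Num.max 1 (K * B `^ eps),
          forall j, ring_coprime (fs j) f /\ (tdeg (fs j))%:R <= Cdeg,
          (#|` Z|)%:R <= CZ * Num.max 1 (K * B `^ eps) ^+ 2
        & forall x, in_S q f g B x -> x \notin Z ->
            exists j, f.@[x] = 0 /\ (fs j).@[x] = 0].
Proof.
(* The constants of [core_covering] depend on the degree of the maximal monomial and on the degree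
   in the main variable. Both are at most [df], so sums over this finite grid make them uniform. *)
pose Ip := ('I_df.+1 * 'I_df.+1)%type.
have /choice[cst cstP] : forall p : Ip, exists t : nat * R * R, 0 <= t.1.2 /\
    ((0 < p.1)%N -> (0 < dg)%N -> (0 < p.2)%N -> covering_bound p.1 dg df p.2 eps t.1.1 t.1.2 t.2).
  move=> [s n] /=; have [|h] := boolP [&& 0 < s, 0 < dg & 0 < n]%N; last first.
    by exists (0%N, 0, 0); split=> // h1 h2 h3; rewrite h1 h2 h3 in h.
  move=> /and3P[s0 dg0 n0]; have [dd [C [l0 [C0 H]]]] := core_covering df s0 dg0 n0 heps.
  by exists (dd, C, l0).
have sub (F : Ip -> R) p : (forall p, 0 <= F p) -> F p <= \sum_p F p.
  by move=> F0; rewrite (bigD1 p) //= lerDl sumr_ge0.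
pose CC : R := \sum_p (cst p).1.2.
pose L : R := \sum_p Num.max 0 (cst p).2.
pose DD : R := \sum_p ((cst p).1.1)%:R.
have CC0 : 0 <= CC by apply: sumr_ge0 => p _; have [] := cstP p.
have ln20 : 0 < ln 2 :> R by rewrite ln_gt0 // ltr1n.
pose B0 : R := 2 `^ (L / ln 2).
have B00 : 0 < B0 by exact: powR_gt0.
pose N0 := ((2 * Num.truncn B0).+1 ^ 3)%N.
exists CC, DD, (CC + N0%:R) => lt q f g m B lto q0 fI fd gd g0 cop mmax m0 B2 K.
have B1 : 1 <= B by apply: le_trans B2; rewrite ler1n.
have Bp : 0 < B by exact: lt_le_trans B1.
have max1 : 1 <= Num.max 1 (K * B `^ eps) by rewrite le_max lexx.
have max2 : 1 <= Num.max 1 (K * B `^ eps) ^+ 2 by rewrite exprn_ege1.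
have [mf _] := mmax.
have f0 : f != 0 by apply: contraTneq mf => ->; rewrite msupp0.
have sf : msize f = df.+1 by rewrite -fd /tdeg prednK // lt0n msize_poly_eq0.
(* For [B] below the threshold [B0], whose logarithm is [L], all zeros in the box go into [Z]; [N0]
   bounds their number. *)
have [sB|lB] := ltP (ln B) L.
  have BN : (Num.truncn B <= Num.truncn B0)%N.
    apply: le_truncn; apply: ltW; rewrite -ltr_ln ?posrE // ln_powR divfK // gt_eqF //.
  have [|x xQ|x|x xQ xZ|fs [Z [h1 h2 h3 h4]]] := @assemble f [::] [seq x : point3 <- box (Num.truncn B) | f.@[x] == 0] 0
     (in_S q f g B) fI.
  - by [].
  - by have [] := xQ.
  - by rewrite mem_filter => /andP[/eqP].
  - case: xQ => xB fx _; move: xZ; rewrite mem_filter fx eqxx /= => /negP[].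
    by apply: mem_box => i; apply: int_le_truncn => //; exact: ltW.
  exists 0%N, fs, Z; split=> //.
  - by rewrite mulr_ge0 // (le_trans _ max1).
  - by case.
  - apply: (@le_trans _ _ N0%:R).
      rewrite ler_nat (leq_trans h3) // size_filter (leq_trans (count_size _ _)) // box_size /N0.
      by rewrite leq_exp2r // ltnS leq_mul2l.
    by rewrite -[leLHS]mulr1 ler_pM // lerDr.
(* Dividing by the content changes neither the zeros nor the exponents, and the height bound
   requires a primitive polynomial. *)
have [c [f' [c0 fE prim]]] := primitive_part f0.
have fI' := scale_irreducible c0 fE fI.
have sup : msupp f' =i msupp f by move=> e; rewrite fE; apply/esym/perm_mem/msuppZ.
have sf' : msize f' = df.+1.
  by rewrite -sf fE !mmeasureE; apply: perm_big; rewrite perm_sym; exact: msuppZ.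
have mmax' : is_max_exponent lt f' m by case: mmax => h1 h2; split=> [|m']; rewrite sup //; exact: h2.
have mf' : m \in msupp f' by case: mmax'.
(* Any variable of the maximal monomial can be the main one, since [f] has positive degree in it. *)
have [i0 mi] : exists i0, (0 < m i0)%N.
  apply: contrapT => h; case/eqP: m0; apply/mnmP => i; rewrite mnmE; apply/eqP; rewrite -leqn0 leqNgt.
  by apply/negP => h'; apply: h; exists i.
have u3 := uniq_lift3 i0.
have sn := nest_size_gt u3 mf' mi.
pose n := (size (nest i0 (lift i0 ord0) f')).-1.
have nE : size (nest i0 (lift i0 ord0) f') = n.+1 by rewrite prednK // ltnW.
have n0 : (0 < n)%N by rewrite -ltnS -nE.
have ndf : (n < df.+1)%N.
  by rewrite -nE; have [] := nest_degrees i0 (lift i0 ord0) (eq_leq sf').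
have s0 : (0 < mdeg m)%N by rewrite lt0n mdeg_eq0.
have sdf : (mdeg m < df.+1)%N by rewrite -sf; exact: msize_mdeg_lt.
pose p : Ip := (Ordinal sdf, Ordinal ndf).
have dg0 : (0 < dg)%N by rewrite -gd.
have [Cp0 /(_ s0 dg0 n0) cb] := cstP p.
have [K0 lK] := ln_Kbound s0 g0 Bp q0.
have W0 : 0 < K * B `^ eps by rewrite mulr_gt0 // powR_gt0.
have lW : ln (K * B `^ eps) = ln B / Num.sqrt (mdeg m)%:R - kappa R (mdeg m) dg m * ln q%:R + eps * ln B.
  by rewrite lnM ?posrE ?powR_gt0 // ln_powR lK gd.
have cop' := coprime_form_lift cop; rewrite gd in cop'.
have lBp : (cst p).2 <= ln B.
  apply: le_trans lB; apply: (@le_trans _ _ (Num.max 0 (cst p).2)); first by rewrite le_max lexx orbT.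
  by apply: (sub (fun p => Num.max 0 (cst p).2)) => p'; rewrite le_max lexx.
have [Ps [Zs [P1 P2 P3 P4 P5]]] := cb lt q f' (lift_mpoly g) m B _ i0 lto q0 fI' prim sf' cop' mmax' erefl nE B1 lBp W0 lW.
have zer (x : point3) : f.@[x] = 0 <-> f'.@[x] = 0.
  rewrite fE mevalZ; split=> [/eqP|->]; last by rewrite mulr0.
  by rewrite mulf_eq0 (negPf c0) => /eqP.
have CpC : (cst p).1.2 <= CC by apply: (sub (fun p => (cst p).1.2)) => p'; have [] := cstP p'.
have [P hP|x xQ|x xZ|x xQ xZ|fs [Z [h1 h2 h3 h4]]] := @assemble f Ps Zs (cst p).1.1 (in_S q f g B) fI.
- have [nd sP] := P1 P hP; split=> // -[d E]; apply: nd; exists (c%:~R%:MP * d).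
  by rewrite E fE -mul_mpolyC rmorphM /= map_mpolyC mulrCA mulrA.
- by case: xQ.
- by apply/zer/P4.
- case: xQ => xB fx gx; apply: P5 => //; first exact/zer.
  by rewrite -lift_mpoly_eval.
exists (size Ps), fs, Z; split=> //.
- by apply: (le_trans P2); rewrite ler_wpM2r // (le_trans _ max1).
- move=> j; have [hc hd] := h2 j; split=> //; apply: (@le_trans _ _ ((cst p).1.1)%:R); first by rewrite ler_nat.
  exact: (sub (fun p => ((cst p).1.1)%:R)).
- apply: (@le_trans _ _ (size Zs)%:R); first by rewrite ler_nat.
  apply: (le_trans P3); rewrite ler_wpM2r // ?(le_trans _ max2) //.
  by apply: (le_trans CpC); rewrite lerDl.
Qed.
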